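(* Let $\rho : G \to \mathrm{O}(V)$ be a polar representation of a compact Lie group $G$ on a real finite dimensional Euclidean vector space $V$. Let $\Sigma \subseteq V$ be a section, $W(\Sigma)=N_G(\Sigma)/Z_G(\Sigma)$ its generalized Weyl group, and $\rho_\Sigma : W(\Sigma) \to \mathrm{O}(\Sigma)$ the induced representation. Let $d=d(\rho_\Sigma)$ and $k=k(\rho_\Sigma)$. Consider a curve $c : \mathbb{R} \to V/G = \sigma(V) \subseteq \mathbb{R}^n$ in the orbit space of $\rho$. Then: (i) If $c$ is of class $C^k$, then there exists a global orthogonal $C^1$-lift $\bar c : \mathbb{R} \to V$ of $c$. (ii) If $c$ is of class $C^{k+d}$, then there exists a global orthogonal twice differentiable lift $\bar c : \mathbb{R} \to V$ of $c$.
   Context: Let $\sigma_1,\ldots,\sigma_n$ be a minimal system of homogeneous generators (of positive degree) of the algebra $\mathbb{R}[V]^G$ of $G$-invariant polynomials on $V$, and let $\sigma = (\sigma_1,\ldots,\sigma_n) : V \to \mathbb{R}^n$. The map $\sigma$ induces a homeomorphism between the orbit space $V/G$ and the image $\sigma(V)$, and $V/G$ is identified with $\sigma(V) \subseteq \mathbb{R}^n$ in this way. A curve $c : \mathbb{R} \to \sigma(V)$ is said to be of class $C^m$ if it is of class $C^m$ as a curve in $\mathbb{R}^n$. Lift: a curve $\bar c : \mathbb{R} \to V$ is a lift of $c$ if $\sigma \circ \bar c = c$. ''Global'' means defined on all of $\mathbb{R}$. ''Twice differentiable'' means that the first and second derivatives exist at every point, with no continuity of the second derivative required. A differentiable lift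 $\bar c$ is orthogonal if it is orthogonal to each orbit it meets, i.e. $\bar c'(t) \perp T_{\bar c(t)}(G.\bar c(t))$ for all $t \in \mathbb{R}$. Polar representation: $\rho$ is polar if there exists a linear subspace $\Sigma \subseteq V$, called a section, which meets every $G$-orbit and meets orbits orthogonally, i.e. $\Sigma \perp T_x(G.x)$ for every $x \in \Sigma$. Here $N_G(\Sigma) = \{g \in G : \rho(g)(\Sigma) = \Sigma\}$ and $Z_G(\Sigma) = \{g \in G : \rho(g)(s) = s \text{ for all } s \in \Sigma\}$. The generalized Weyl group $W(\Sigma) = N_G(\Sigma)/Z_G(\Sigma)$ is a finite group acting orthogonally on $\Sigma$; this action is $\rho_\Sigma$. The numbers $d$ and $k$ of a finite group representation: let $\tau : H \to \mathrm{O}(E)$ be a representation of a finite group $H$ on a real finite dimensional Euclidean vector space $E$. Then $d(\tau)$ is the maximal degree of the elements of a minimal system of homogeneous generators of $\mathbb{R}[E]^H$ (independent of the choice of the system). Write $E = E_1 \oplus \cdots \oplus E_l$ as an orthogonal direct sum of irreducible subspaces, and for each $i$ choose $v_i \in E_i \setminus \{0\}$ such that the cardinality of the isotropy group $H_{v_i} = \{h \in H : h.v_i = v_i\}$ is maximal (among nonzero vectors of $E_i$). Put $k(\tau) := \max\{d(\tau), |H|/|H_{v_i}| : 1 \le i \le l\}$. These are applied to $\tau = \rho_\Sigma$, $H = W(\Sigma)$, $E = \Sigma$. *)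

(* Defs.v *)
From HB Require Import structures.
From mathcomp Require Import all_boot all_order all_algebra.
From mathcomp Require Import finmap.
From mathcomp Require Import all_classical all_reals all_analysis.
(* The notations of [mpoly] clash with those of the analysis library. *)
From mathcomp Require Import (canonicals, coercions) mpoly.

Set Implicit Arguments.
Unset Strict Implicit.
Unset Printing Implicit Defensive.

Import Order.TTheory GRing.Theory Num.Theory.
Import numFieldNormedType.Exports.

Local Open Scope ring_scope.
Local Open Scope classical_set_scope.

(** * Euclidean vector spaces *)

(* Finite dimensional real vector spaces with an inner product.  Carrying no
   topology, this structure is inherited by subspaces. *)
HB.mixin Record hasInnerProduct (R : realType) E of Vector R E := {
  dot : E -> E -> R ;
  dotC : forall u v, dot u v = dot v u ;
  dot_linearl : forall a u v w, dot (a *: u + v) w = a * dot u w + dot v w ;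
  dot_gt0 : forall u, u != 0 -> 0 < dot u u
}.

#[short(type="innerVectType")]
HB.structure Definition InnerVector (R : realType) :=
  {E of Vector R E & hasInnerProduct R E}.

(* The norm (hence the topology and the derivatives) is the one of the inner
   product. *)
HB.mixin Record InnerVector_isEuclidean (R : realType) V
    of InnerVector R V & NormedModule R V := {
  norm_dot : forall u : V, `|u| = Num.sqrt (dot u u)
}.

#[short(type="euclideanType")]
HB.structure Definition Euclidean (R : realType) :=
  {V of InnerVector R V & NormedModule R V & InnerVector_isEuclidean R V}.

Section SubInnerVector.
Variables (R : realType) (E : innerVectType R) (U : {vspace E}).

Let sdot (u v : subvs_of U) : R := dot (vsval u) (vsval v).

Fact sdotC u v : sdot u v = sdot v u.
Proof. exact: dotC. Qed.

Fact sdot_linearl a u v w : sdot (a *: u + v) w = a * sdot u w + sdot v w.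
Proof. by rewrite /sdot linearP dot_linearl. Qed.

Fact sdot_gt0 u : u != 0 -> 0 < sdot u u.
Proof. by move=> u0; apply/dot_gt0/(contra_neq _ u0) => u0E; exact: val_inj. Qed.

HB.instance Definition _ :=
  hasInnerProduct.Build R (subvs_of U) sdotC sdot_linearl sdot_gt0.
End SubInnerVector.

(** * Differentiability classes *)

Definition curve_Ck (R : realType) (W : normedModType R) (m : nat)
    (c : R -> W) : Prop :=
  (forall i, (i < m)%N -> forall t, derivable (c^`(i)) t 1) /\
  continuous (c^`(m)).

Definition curve_smooth (R : realType) (W : normedModType R)
    (c : R -> W) : Prop :=
  forall m, curve_Ck m c.

Definition twice_differentiable (R : realType) (W : normedModType R)
    (c : R -> W) : Prop :=
  (forall t, derivable c t 1) /\ (forall t, derivable (c^`()) t 1).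

(* Meaningful for [A] open and [U] finite dimensional: all iterated directional
   derivatives up to order [m] exist and are continuous on [A]. *)
Fixpoint Ck_on (R : realType) (U W : normedModType R) (m : nat) (A : set U)
    (f : U -> W) : Prop :=
  match m with
  | 0 => forall x, A x -> {for x, continuous f}
  | m'.+1 => (forall x v, A x -> derivable f x v) /\
             (forall v, Ck_on m' A ('D_v f))
  end.

Definition smooth_on (R : realType) (U W : normedModType R) (A : set U)
    (f : U -> W) : Prop :=
  forall m, Ck_on m A f.

(** * Lie groups *)

(* The group and the topology only; their compatibility is part of
   [is_lie_group]. *)
#[short(type="topologicalGroupType")]
HB.structure Definition TopologicalGroup := {G of Topological G & Group G}.

Record chart (R : realType) (T : Type) (m : nat) := Chart {
  chart_dom : set T ;
  chart_map : T -> 'rV[R]_m ;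
  chart_inv : 'rV[R]_m -> T
}.

Definition chart_cod (R : realType) (T : Type) (m : nat) (a : chart R T m) :
    set 'rV[R]_m :=
  chart_map a @` chart_dom a.

Definition is_chart (R : realType) (T : topologicalType) (m : nat)
    (a : chart R T m) : Prop :=
  [/\ open (chart_dom a),
      open (chart_cod a),
      forall x, chart_dom a x -> chart_inv a (chart_map a x) = x,
      forall x, chart_dom a x -> {for x, continuous (chart_map a)} &
      forall y, chart_cod a y -> {for y, continuous (chart_inv a)}].

Definition is_smooth_atlas (R : realType) (T : topologicalType) (m : nat)
    (A : set (chart R T m)) : Prop :=
  [/\ forall a, A a -> is_chart a,
      forall x, exists2 a, A a & chart_dom a x &
      forall a b, A a -> A b ->
        smooth_on (chart_map a @` (chart_dom a `&` chart_dom b))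
                  (fun y => chart_map b (chart_inv a y))].

Section LieGroup.
Variables (R : realType) (G : topologicalGroupType).

Definition smooth_mul (m : nat) (A : set (chart R G m)) : Prop :=
  forall a b e, A a -> A b -> A e ->
    smooth_on
      [set y : 'rV[R]_m * 'rV[R]_m |
        [/\ chart_cod a y.1, chart_cod b y.2 &
            chart_dom e (chart_inv a y.1 * chart_inv b y.2)%g]]
      (fun y : 'rV[R]_m * 'rV[R]_m =>
         chart_map e (chart_inv a y.1 * chart_inv b y.2)%g).

Definition smooth_inv (m : nat) (A : set (chart R G m)) : Prop :=
  forall a b, A a -> A b ->
    smooth_on
      [set y | chart_cod a y /\ chart_dom b (chart_inv a y)^-1%g]
      (fun y => chart_map b (chart_inv a y)^-1%g).

Definition is_lie_group : Prop :=
  [/\ hausdorff_space G,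
      second_countable (T := G),
      continuous (fun p : G * G => (p.1 * p.2)%g),
      continuous (fun g : G => g^-1%g) &
      exists (m : nat) (A : set (chart R G m)),
        [/\ is_smooth_atlas A, smooth_mul A & smooth_inv A]].

End LieGroup.

(** * Orthogonal representations *)

Record orthRep (R : realType) (G : groupType) (E : innerVectType R) := OrthRep {
  rep_fun :> G -> 'End(E) ;
  rep1 : forall v, rep_fun 1%g v = v ;
  repM : forall g h v, rep_fun (g * h)%g v = rep_fun g (rep_fun h v) ;
  rep_dot : forall g u v, dot (rep_fun g u) (rep_fun g v) = dot u v
}.

Definition orbit_of (R : realType) (G : groupType) (E : innerVectType R)
    (rho : orthRep G E) (x : E) : set E :=
  range (fun g => rho g x).

(* Velocities of the smooth curves of [V] which stay in [M]; for [M] an embedded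
   submanifold, such as an orbit of a compact Lie group, this is [T_x M]. *)
Definition tangent_space (R : realType) (V : normedModType R) (M : set V)
    (x : V) : set V :=
  [set w | exists gamma : R -> V,
    [/\ curve_smooth gamma, forall t, M (gamma t), gamma 0 = x &
        gamma^`() 0 = w]].

(* A representation is polar when it has a section. *)
Definition is_section (R : realType) (G : groupType) (V : euclideanType R)
    (rho : orthRep G V) (Sigma : {vspace V}) : Prop :=
  (forall x, exists2 y, orbit_of rho x y & y \in Sigma) /\
  (forall x s w, x \in Sigma -> s \in Sigma ->
     tangent_space (orbit_of rho x) x w -> dot s w = 0).

(** * The generalized Weyl group *)

Section WeylGroup.
Variables (R : realType) (G : groupType) (E : innerVectType R).
Variables (rho : orthRep G E) (Sigma : {vspace E}).

Definition normalizer : {pred G} := [pred g | (rho g @: Sigma == Sigma)%VS].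

Definition centralizer : {pred G} :=
  [pred g | `[< forall s, s \in Sigma -> rho g s = s >]].

Lemma centralizerP g :
  reflect (forall s, s \in Sigma -> rho g s = s) (g \in centralizer).
Proof. exact: asboolP. Qed.

Lemma repK g v : rho g^-1%g (rho g v) = v.
Proof. by rewrite -repM mulVg rep1. Qed.

Lemma repVK g v : rho g (rho g^-1%g v) = v.
Proof. by rewrite -repM mulgV rep1. Qed.

Lemma normalizer_mem g s : g \in normalizer -> s \in Sigma -> rho g s \in Sigma.
Proof. by move=> /eqP gS sS; rewrite -gS memv_img. Qed.

Fact normalizer_group_closed : group_closed normalizer.
Proof.
have limgM g h : (rho (g * h)%g @: Sigma = rho g @: (rho h @: Sigma))%VS.
  rewrite -limg_comp; congr (_ @: _)%VS; apply/lfunP => v.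
  by rewrite comp_lfunE repM.
have limg1 : (rho 1%g @: Sigma = Sigma)%VS.
  rewrite -[RHS]lim1g; congr (_ @: _)%VS; apply/lfunP => v.
  by rewrite id_lfunE rep1.
split=> [|g h]; rewrite !inE ?limg1 // => /eqP gS /eqP hS.
by rewrite limgM -{1}hS -limgM mulVg limg1 gS.
Qed.

Definition normalizer_type := {g : G | g \in normalizer}.
HB.instance Definition _ := SubChoice.on normalizer_type.
HB.instance Definition _ :=
  SubChoice_isSubGroup.Build G (fun g => g \in normalizer) normalizer_type
    normalizer_group_closed.

Definition weyl_rel : rel normalizer_type :=
  fun g h => val (g^-1 * h)%g \in centralizer.

Fact weyl_relE g h :
  weyl_rel g h <-> forall s, s \in Sigma -> rho (val g) s = rho (val h) s.
Proof.
rewrite /weyl_rel; split.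
  move=> /centralizerP gh s sS; rewrite -{1}(gh s sS) gmulfM gmulfV repM.
  by rewrite repVK.
by move=> gh; apply/centralizerP => s sS; rewrite gmulfM gmulfV repM -gh ?repK.
Qed.

Fact weyl_rel_refl : reflexive weyl_rel.
Proof. by move=> g; apply/weyl_relE. Qed.

Fact weyl_rel_sym : symmetric weyl_rel.
Proof.
by move=> g h; apply/idP/idP => /weyl_relE gh; apply/weyl_relE => s /gh.
Qed.

Fact weyl_rel_trans : transitive weyl_rel.
Proof.
move=> h g k /weyl_relE gh /weyl_relE hk; apply/weyl_relE => s sS.
by rewrite gh ?hk.
Qed.

Canonical weyl_equiv := EquivRel weyl_rel weyl_rel_refl weyl_rel_sym
  weyl_rel_trans.

(* [W(Sigma) = N_G(Sigma) / Z_G(Sigma)] *)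
Definition weyl_group := {eq_quot weyl_equiv}%qT.
HB.instance Definition _ := Choice.on weyl_group.
HB.instance Definition _ := EqQuotient.on weyl_group.

Definition weyl_class (g : normalizer_type) : weyl_group :=
  (\pi_(weyl_group) g)%qT.

Definition weyl_repr (w : weyl_group) : normalizer_type := repr w.

Lemma weyl_reprK w : weyl_class (weyl_repr w) = w.
Proof. exact: reprK. Qed.

Lemma weyl_classP g h :
  weyl_class g = weyl_class h <->
  forall s, s \in Sigma -> rho (val g) s = rho (val h) s.
Proof.
rewrite -weyl_relE; split=> [/(@eqmodP _ weyl_equiv)//|gh].
exact/(@eqmodP _ weyl_equiv).
Qed.

Lemma weyl_repr_class g s :
  s \in Sigma -> rho (val (weyl_repr (weyl_class g))) s = rho (val g) s.
Proof. by move: s; apply/weyl_classP; rewrite weyl_reprK. Qed.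

Definition weyl_one : weyl_group := weyl_class 1%g.
Definition weyl_mul (v w : weyl_group) : weyl_group :=
  weyl_class (weyl_repr v * weyl_repr w)%g.
Definition weyl_inv (w : weyl_group) : weyl_group :=
  weyl_class (weyl_repr w)^-1%g.

Lemma weyl_mul_class g h :
  weyl_mul (weyl_class g) (weyl_class h) = weyl_class (g * h)%g.
Proof.
apply/weyl_classP => s sS; rewrite !gmulfM !repM !weyl_repr_class //.
exact: (normalizer_mem (valP h)).
Qed.

Fact weyl_mulA : associative weyl_mul.
Proof.
move=> u v w; rewrite -(weyl_reprK u) -(weyl_reprK v) -(weyl_reprK w).
by rewrite !weyl_mul_class mulgA.
Qed.

Fact weyl_mul1 : left_id weyl_one weyl_mul.
Proof. by move=> w; rewrite -(weyl_reprK w) weyl_mul_class mul1g. Qed.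

Fact weyl_1mul : right_id weyl_one weyl_mul.
Proof. by move=> w; rewrite -(weyl_reprK w) weyl_mul_class mulg1. Qed.

Fact weyl_mulV : left_inverse weyl_one weyl_inv weyl_mul.
Proof.
by move=> w; rewrite -[X in weyl_mul _ X]weyl_reprK weyl_mul_class mulVg.
Qed.

Fact weyl_Vmul : right_inverse weyl_one weyl_inv weyl_mul.
Proof.
by move=> w; rewrite -[X in weyl_mul X _]weyl_reprK weyl_mul_class mulgV.
Qed.

HB.instance Definition _ :=
  isGroup.Build weyl_group weyl_mulA weyl_mul1 weyl_1mul weyl_mulV weyl_Vmul.

(* The representation of [W(Sigma)] on [Sigma] induced by [rho]. *)
Definition weyl_act (w : weyl_group) : 'End(subvs_of Sigma) :=
  linfun (vsproj Sigma \o rho (val (weyl_repr w)) \o vsval).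

Lemma weyl_actE w s : vsval (weyl_act w s) = rho (val (weyl_repr w)) (vsval s).
Proof.
rewrite lfunE /= vsprojK //.
exact: (normalizer_mem (valP (weyl_repr w))) (subvsP s).
Qed.

Lemma weyl_act_class g s :
  vsval (weyl_act (weyl_class g) s) = rho (val g) (vsval s).
Proof. by rewrite weyl_actE weyl_repr_class // subvsP. Qed.

Fact weyl_act1 s : weyl_act 1%g s = s.
Proof. by apply: val_inj; rewrite /= weyl_act_class rep1. Qed.

Fact weyl_actM v w s : weyl_act (v * w)%g s = weyl_act v (weyl_act w s).
Proof.
apply: val_inj; rewrite /= -(weyl_reprK v) -(weyl_reprK w).
rewrite [(_ * _)%g]weyl_mul_class !weyl_act_class.
exact: repM.
Qed.

Fact weyl_act_dot w s t : dot (weyl_act w s) (weyl_act w t) = dot s t.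
Proof. by rewrite /dot /= !weyl_actE rep_dot. Qed.

Definition weyl_rep : orthRep weyl_group (subvs_of Sigma) :=
  OrthRep weyl_act1 weyl_actM weyl_act_dot.

End WeylGroup.

(** * Invariant polynomials *)

Section Invariants.
Variables (R : realType) (G : groupType) (E : innerVectType R).
Variable rho : orthRep G E.

(* As [R] is infinite, polynomials on [E] are identified with polynomial
   functions, written in the coordinates of some basis of [E]. *)
Definition poly_eval (p : mpoly.mpoly (\dim {:E}) R) (x : E) : R :=
  mpoly.meval (fun i => coord (vbasis {:E}) i x) p.

Definition is_poly_fun (f : E -> R) : Prop :=
  exists p, f =1 poly_eval p.

Definition is_homog_fun (d : nat) (f : E -> R) : Prop :=
  exists2 p, p \is mpoly.ishomog1 d mpoly.mdeg & f =1 poly_eval p.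

Definition is_invariant (f : E -> R) : Prop :=
  forall g x, f (rho g x) = f x.

Definition generates_invariants (n : nat) (sigma : 'I_n -> E -> R) : Prop :=
  forall f, is_poly_fun f -> is_invariant f ->
    exists P : mpoly.mpoly n R,
      forall x, f x = mpoly.meval (fun i => sigma i x) P.

Record minimal_generators (n : nat) (sigma : 'I_n -> E -> R)
    (deg : 'I_n -> nat) : Prop := {
  mingen_homog : forall i, is_homog_fun (deg i) (sigma i) ;
  mingen_deg_gt0 : forall i, (0 < deg i)%N ;
  mingen_invariant : forall i, is_invariant (sigma i) ;
  mingen_generates : generates_invariants sigma ;
  mingen_minimal :
    forall i, ~ generates_invariants (fun j : 'I_n.-1 => sigma (lift i j))
}.

(* [d] is the number [d(rho)]; it does not depend on the system chosen. *)
Definition is_d_number (d : nat) : Prop :=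
  exists (n : nat) (sigma : 'I_n -> E -> R) (deg : 'I_n -> nat),
    minimal_generators sigma deg /\ d = (\max_(i < n) deg i)%N.

Definition is_irreducible (U : {vspace E}) : Prop :=
  [/\ U != 0%VS,
      forall g, (rho g @: U <= U)%VS &
      forall U' : {vspace E}, (U' <= U)%VS ->
        (forall g, (rho g @: U' <= U')%VS) -> U' = 0%VS \/ U' = U].

Definition isotropy (v : E) : set G := [set g | rho g v = v].

Definition is_orthogonal_irreducible_decomposition (l : nat)
    (U : 'I_l -> {vspace E}) : Prop :=
  [/\ forall i, is_irreducible (U i),
      (\sum_(i < l) U i)%VS = fullv &
      forall i j u v, i != j -> u \in U i -> v \in U j -> dot u v = 0].

(* [k] is the number [k(rho)] of the representation [rho] of the finite group
   [G]; it does not depend on the choices made. *)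
Definition is_k_number (k : nat) : Prop :=
  finite_set [set: G] /\
  exists (d l : nat) (U : 'I_l -> {vspace E}) (v : 'I_l -> E),
    [/\ is_d_number d,
        is_orthogonal_irreducible_decomposition U,
        forall i, v i \in U i /\ v i != 0,
        forall i u, u \in U i -> u != 0 ->
          (#|` fset_set (isotropy u)| <= #|` fset_set (isotropy (v i))|)%N &
        k = maxn d (\max_(i < l) (#|` fset_set [set: G]| %/
                                  #|` fset_set (isotropy (v i))|))].

End Invariants.

(** * Lifts *)

Section Lifts.
Variables (R : realType) (G : groupType) (V : euclideanType R).
Variable rho : orthRep G V.
Variables (n : nat) (sigma : 'I_n -> V -> R).

(* The orbit space [V/G] is identified with the image of this map. *)
Definition orbit_map (x : V) : 'rV[R]_n := \row_(i < n) sigma i x.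

Definition is_lift (c : R -> 'rV[R]_n) (cbar : R -> V) : Prop :=
  forall t, orbit_map (cbar t) = c t.

Definition is_orthogonal_curve (cbar : R -> V) : Prop :=
  forall t w, tangent_space (orbit_of rho (cbar t)) (cbar t) w ->
    dot (cbar^`() t) w = 0.

End Lifts.

(* Main.v *)
Require Import Defs.
From HB Require Import structures.
From mathcomp Require Import all_boot all_order all_algebra.
From mathcomp Require Import all_classical all_reals all_analysis.
From mathcomp Require Import (canonicals, coercions) mpoly.
From mathcomp Require Import zify ring lra.

Set Implicit Arguments.
Unset Strict Implicit.
Unset Printing Implicit Defensive.

Import Order.TTheory GRing.Theory Num.Theory.
Import numFieldNormedType.Exports.

Local Open Scope ring_scope.
Local Open Scope classical_set_scope.

(** The curve is first moved into the section, [c t = sigma (v t)] with [v t] in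
    [Sigma].  Restriction to [Sigma] maps the [G]-invariant polynomials on [V] onto
    the [W]-invariant polynomials on [Sigma], so that [f (v t)] is as regular as [c]
    for every [W]-invariant [f]: it suffices to lift [c] for the finite group [W].
    The lift stays in [Sigma], hence is orthogonal to the orbits.

    Surjectivity of the restriction.  A homogeneous [W]-invariant [v] on [Sigma]
    extends to a continuous [K]-invariant function [U] on [V], [K] being the image
    of [G].  The Laplacian of [V] acts on restrictions of [K]-invariant polynomials
    by its radial part [L], a singular operator on [Sigma] whose singularities lie
    on the mirrors of reflections of [W], so that [L] preserves the [W]-invariant
    polynomials.  By induction on the degree one may subtract from [v] a restriction
    and assume [L v = 0].  Then [U] is a locally uniform limit of harmonic
    [K]-invariant polynomials: approximate [U] by a [K]-invariant polynomial on the
    unit sphere, replace it by the harmonic polynomial with the same boundary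
    values, and compare on [Sigma] by the maximum principle for [L].  A homogeneous
    limit of harmonic polynomials is a polynomial.

    Finite groups.  Where the curve is not fixed by the group, the slice theorem
    reduces to an isotropy group.  At a fixed point [v] the blow-up
    [z t = (x t - v) / t] has again regular invariants, with a loss of [d]
    derivatives; this gives one-sided Taylor expansions of continuous lifts, which
    can be matched by group elements and glued.  That the derivative is continuous
    follows from a Lipschitz estimate, uniform over the lifts of curves with bounded
    invariants, applied to rescalings of [z]; the second derivative is
    obtained by applying this to [z] itself.

    Limits are taken along ultrafilters instead of subsequences. *)

(** * Polynomial functions *)

Section PolyFun.
Variables (R : realType).

(** The exponents come from one count. If [f] is an invariant form of degree [m <= d] and
    [z = (x - v) / t], then [f (x - v) = t ^ m * f z], so [f z] keeps all but [m] of the derivatives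
    of [f (x - v)]. A blow-up thus costs at most [d] derivatives: one expansion step needs [d <= k]
    of them, two steps need [2 d <= k + d]. For the count to survive the passage to isotropy groups,
    the generators are forgotten and only their degree bound [gen d H] is kept. The obstacle is that
    the invariants see a lift only up to a group element depending on time. Expansions on the two
    sides of a point need not match, and a differentiable lift may a priori have an oscillating
    derivative; compactness arguments replace explicit estimates there. They require the slice
    theorem for germs, for limits under blow-up and for bounded families alike, and [calculus]
    isolates what its proof uses. For the restriction theorem no integration over the group is made:
    invariant polynomials come from vectors of least norm, and the Lie algebra is extracted from
    group elements close to the identity. *)

Lemma poly_inj_horner (p q : {poly R}) : (forall s, p.[s] = q.[s]) -> p = q.
Proof.
move=> pq; apply/eqP; rewrite -subr_eq0; apply/eqP.
apply: (@roots_geq_poly_eq0 _ _ [seq (i%:R : R) | i <- iota 0 (size (p - q))]).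
- by apply/allP => s _; rewrite /root hornerD hornerN pq subrr.
- rewrite map_inj_uniq ?iota_uniq // => i j /eqP.
  by rewrite eqr_nat => /eqP.
- by rewrite size_map size_iota.
Qed.

Section Fixed.
Variable n : nat.
Notation E := 'cV[R]_n.
Implicit Types (f g : E -> R) (x y z : E).

(** An inductive predicate rather than an expansion in monomials: restrictions to lines,
    derivatives, limits and bounds are all obtained by induction on how the function is built. *)
Inductive polyf : (E -> R) -> Prop :=
| polyf_cst c : polyf (fun=> c)
| polyf_coord i : polyf (fun x => x i 0)
| polyf_add f g : polyf f -> polyf g -> polyf (fun x => f x + g x)
| polyf_mul f g : polyf f -> polyf g -> polyf (fun x => f x * g x).

Lemma polyf_ext f g : f =1 g -> polyf f -> polyf g.
Proof. by move=> /funext ->. Qed.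

Lemma polyf_opp f : polyf f -> polyf (fun x => - f x).
Proof.
move=> pf; apply: (@polyf_ext (fun x => -1 * f x)) => [x|].
  by rewrite mulN1r.
exact: polyf_mul (polyf_cst _) pf.
Qed.

Lemma polyf_sub f g : polyf f -> polyf g -> polyf (fun x => f x - g x).
Proof. by move=> pf pg; apply: polyf_add => //; apply: polyf_opp. Qed.

Lemma polyf_sum (I : Type) (r : seq I) (P : pred I) (F : I -> E -> R) :
  (forall i, polyf (F i)) -> polyf (fun x => \sum_(i <- r | P i) F i x).
Proof.
move=> pF; elim: r => [|i r IH].
  by apply: (polyf_ext _ (polyf_cst 0)) => x; rewrite big_nil.
case Pi: (P i).
  by apply: (polyf_ext _ (polyf_add (pF i) IH)) => x; rewrite big_cons Pi.
by apply: (polyf_ext _ IH) => x; rewrite big_cons Pi.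
Qed.

Lemma polyf_prod (I : Type) (r : seq I) (P : pred I) (F : I -> E -> R) :
  (forall i, polyf (F i)) -> polyf (fun x => \prod_(i <- r | P i) F i x).
Proof.
move=> pF; elim: r => [|i r IH].
  by apply: (polyf_ext _ (polyf_cst 1)) => x; rewrite big_nil.
case Pi: (P i).
  by apply: (polyf_ext _ (polyf_mul (pF i) IH)) => x; rewrite big_cons Pi.
by apply: (polyf_ext _ IH) => x; rewrite big_cons Pi.
Qed.

Lemma polyf_exp f k : polyf f -> polyf (fun x => f x ^+ k).
Proof.
move=> pf; elim: k => [|k IH].
  by apply: (polyf_ext _ (polyf_cst 1)) => x; rewrite expr0.
by apply: (polyf_ext _ (polyf_mul pf IH)) => x; rewrite exprS.
Qed.

(** [0] when [s |-> f (x + s y)] is not a polynomial function. *)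
Definition line f x y : {poly R} :=
  xget 0 [set p : {poly R} | forall s, p.[s] = f (x + s *: y)].

Lemma line_uniq f x y p : (forall s, p.[s] = f (x + s *: y)) -> line f x y = p.
Proof.
move=> pE; rewrite /line; case: xgetP => [q _ qE|/(_ p)[]//].
by apply: poly_inj_horner => s; rewrite qE pE.
Qed.

Lemma lineE f x y s : polyf f -> (line f x y).[s] = f (x + s *: y).
Proof.
move=> pf; suff [p pE] : exists p : {poly R}, forall s, p.[s] = f (x + s *: y).
  by rewrite (line_uniq pE) pE.
elim: pf => [c|i|{}f g _ [p pE] _ [q qE]|{}f g _ [p pE] _ [q qE]].
- by exists c%:P => t; rewrite hornerC.
- by exists ((x i 0)%:P + (y i 0) *: 'X) => t; rewrite !hornerE !mxE mulrC.
- by exists (p + q) => t; rewrite hornerD pE qE.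
- by exists (p * q) => t; rewrite hornerM pE qE.
Qed.

Lemma line_cst c x y : line (fun=> c) x y = c%:P.
Proof. by apply: line_uniq => s; rewrite hornerC. Qed.

Lemma line_coord i x y : line (fun z => z i 0) x y = (x i 0)%:P + (y i 0) *: 'X.
Proof. by apply: line_uniq => s; rewrite !hornerE !mxE mulrC. Qed.

Lemma lineD f g x y : polyf f -> polyf g ->
  line (fun z => f z + g z) x y = line f x y + line g x y.
Proof. by move=> pf pg; apply: line_uniq => s; rewrite hornerD !lineE. Qed.

Lemma lineM f g x y : polyf f -> polyf g ->
  line (fun z => f z * g z) x y = line f x y * line g x y.
Proof. by move=> pf pg; apply: line_uniq => s; rewrite hornerM !lineE. Qed.

Lemma lineZ c f x y : polyf f -> line (fun z => c * f z) x y = c *: line f x y.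
Proof. by move=> pf; apply: line_uniq => s; rewrite hornerZ !lineE. Qed.

Lemma line_coef0 f x y : polyf f -> (line f x y)`_0 = f x.
Proof. by move=> pf; rewrite -horner_coef0 lineE // scale0r addr0. Qed.

Lemma size_line f : polyf f -> exists N, forall x y, (size (line f x y) <= N)%N.
Proof.
elim=> [c|i|{}f g pf [N1 h1] pg [N2 h2]|{}f g pf [N1 h1] pg [N2 h2]].
- by exists 1%N => x y; rewrite line_cst size_polyC; case: (c != 0).
- exists 2 => x y; rewrite line_coord (leq_trans (size_polyD _ _))// geq_max.
  rewrite size_polyC (leq_trans (leq_b1 _))//=.
  by rewrite (leq_trans (size_scale_leq _ _))// size_polyX.
- exists (maxn N1 N2) => x y; rewrite lineD // (leq_trans (size_polyD _ _))//.
  by rewrite geq_max !leq_max h1 h2 orbT.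
- exists (N1 + N2)%N => x y; rewrite lineM //.
  by rewrite (leq_trans (size_polyMleq _ _))// (leq_trans (leq_pred _))// leq_add.
Qed.

Lemma polyf_line_l f y j : polyf f -> polyf (fun x => (line f x y)`_j).
Proof.
move=> pf; elim: pf j => [c|i|{}f g pf IHf pg IHg|{}f g pf IHf pg IHg] j.
- by apply: (polyf_ext _ (polyf_cst (c%:P)`_j)) => x; rewrite line_cst.
- apply: (@polyf_ext (fun x => (x i 0) * (1 : {poly R})`_j + (y i 0 *: 'X)`_j)).
    by move=> x; rewrite line_coord coefD -alg_polyC [in RHS]coefZ.
  apply: polyf_add (polyf_mul (polyf_coord _) (polyf_cst _)) (polyf_cst _).
- by apply: (polyf_ext _ (polyf_add (IHf j) (IHg j))) => x; rewrite lineD ?coefD.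
- apply: (@polyf_ext (fun x => \sum_(i < j.+1)
      (line f x y)`_i * (line g x y)`_(j - i))).
    by move=> x; rewrite lineM // coefM.
  by apply: polyf_sum => i; apply: polyf_mul.
Qed.

Lemma polyf_line_r f x j : polyf f -> polyf (fun y => (line f x y)`_j).
Proof.
move=> pf; elim: pf j => [c|i|{}f g pf IHf pg IHg|{}f g pf IHf pg IHg] j.
- by apply: (polyf_ext _ (polyf_cst (c%:P)`_j)) => y; rewrite line_cst.
- apply: (@polyf_ext (fun y => ((x i 0)%:P)`_j + (y i 0) * ('X : {poly R})`_j)).
    by move=> y; rewrite line_coord coefD coefZ.
  exact: polyf_add (polyf_cst _) (polyf_mul (polyf_coord _) (polyf_cst _)).
- by apply: (polyf_ext _ (polyf_add (IHf j) (IHg j))) => y; rewrite lineD ?coefD.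
- apply: (@polyf_ext (fun y => \sum_(i < j.+1)
      (line f x y)`_i * (line g x y)`_(j - i))).
    by move=> y; rewrite lineM // coefM.
  by apply: polyf_sum => i; apply: polyf_mul.
Qed.

Lemma line_scale f x y s j : polyf f ->
  (line f x (s *: y))`_j = s ^+ j * (line f x y)`_j.
Proof.
move=> pf.
suff -> : line f x (s *: y) = line f x y \Po (s *: 'X).
  rewrite coef_comp_poly; case: (ltnP j (size (line f x y))) => [jl|jl].
    rewrite (bigD1 (Ordinal jl)) //= exprZn coefZ coefXn eqxx mulr1 big1 ?addr0.
      exact: mulrC.
    move=> i /eqP ij; rewrite exprZn coefZ coefXn.
    case: eqP => [ji|]; last by rewrite !mulr0.
    by case: ij; apply: val_inj.
  rewrite [X in _ = _ * X]nth_default // mulr0 big1 // => i _.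
  rewrite exprZn coefZ coefXn; case: eqP => [ji|]; last by rewrite !mulr0.
  by move: (ltn_ord i); rewrite -ji ltnNge jl.
apply: line_uniq => t.
by rewrite horner_comp !hornerE lineE // scalerA mulrC.
Qed.

(** The directional derivative of [f] at [x] along [y], read off algebraically on the line, so that
    no differentiability has to be proved. *)
Definition dd y f x : R := (line f x y)`_1.

Lemma polyf_dd y f : polyf f -> polyf (dd y f).
Proof. exact: polyf_line_l. Qed.

Lemma dd_cst y c : dd y (fun=> c) = fun=> 0.
Proof. by apply: funext => x; rewrite /dd line_cst coefC. Qed.

Lemma dd_coord y i x : dd y (fun z => z i 0) x = y i 0.
Proof. by rewrite /dd line_coord coefD coefC coefZ coefX mulr1 add0r. Qed.

Lemma ddD y f g x : polyf f -> polyf g ->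
  dd y (fun z => f z + g z) x = dd y f x + dd y g x.
Proof. by move=> pf pg; rewrite /dd lineD // coefD. Qed.

Lemma ddZ y c f x : polyf f -> dd y (fun z => c * f z) x = c * dd y f x.
Proof. by move=> pf; rewrite /dd lineZ // coefZ. Qed.

Lemma ddM y f g x : polyf f -> polyf g ->
  dd y (fun z => f z * g z) x = dd y f x * g x + f x * dd y g x.
Proof.
move=> pf pg; rewrite /dd lineM // coefM !big_ord_recr big_ord0 /= add0r.
by rewrite !line_coef0 // addrC.
Qed.

Lemma dd_sum y (I : Type) (r : seq I) (P : pred I) (F : I -> E -> R) x :
  (forall i, polyf (F i)) ->
  dd y (fun z => \sum_(i <- r | P i) F i z) x = \sum_(i <- r | P i) dd y (F i) x.
Proof.
move=> pF; elim: r => [|i r IH].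
  rewrite big_nil (_ : (fun z => _) = fun=> 0) ?dd_cst //.
  by apply: funext => z; rewrite big_nil.
rewrite big_cons -IH; case: ifP => Pi.
  rewrite -ddD //; last exact: polyf_sum.
  by congr (dd y _ x); apply: funext => z; rewrite big_cons Pi.
by congr (dd y _ x); apply: funext => z; rewrite big_cons Pi.
Qed.

Lemma dd_linear f x : polyf f ->
  forall a y z, dd (a *: y + z) f x = a * dd y f x + dd z f x.
Proof.
move=> pf a y z.
elim: pf => [c|i|{}f g pf IHf pg IHg|{}f g pf IHf pg IHg].
- by rewrite !dd_cst mulr0 addr0.
- by rewrite !dd_coord !mxE.
- by rewrite !ddD // IHf IHg; ring.
- by rewrite !ddM // IHf IHg; ring.
Qed.

Lemma dd0 f x : polyf f -> dd 0 f x = 0.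
Proof.
by move=> pf; have := line_scale x 0 0 1 pf; rewrite scale0r expr1 mul0r.
Qed.

Definition pd (i : 'I_n) f := dd (delta_mx i 0) f.

Lemma polyf_pd i f : polyf f -> polyf (pd i f).
Proof. exact: polyf_dd. Qed.

Lemma dd_pd y f x : polyf f -> dd y f x = \sum_i y i 0 * pd i f x.
Proof.
move=> pf; have -> : y = \sum_i y i 0 *: (delta_mx i 0 : E).
  rewrite {1}(matrix_sum_delta y); apply: eq_bigr => i _.
  by rewrite big_ord1.
under [RHS]eq_bigr => i _.
  rewrite summxE (bigD1 i) //= big1 ?addr0 => [|j /negbTE ji]; last first.
    by rewrite !mxE eq_sym ji mulr0.
  rewrite !mxE !eqxx mulr1.
  over.
elim: (index_enum _) => [|i r IH]; first by rewrite !big_nil dd0.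
by rewrite !big_cons dd_linear // IH.
Qed.

Lemma dd_comm y z f : polyf f -> dd y (dd z f) = dd z (dd y f).
Proof.
elim=> [c|i|{}f g pf IHf pg IHg|{}f g pf IHf pg IHg].
- by rewrite !dd_cst.
- have dE w : dd w (fun x => x i 0) = fun=> w i 0.
    by apply: funext => x; rewrite dd_coord.
  by rewrite !dE !dd_cst.
- have dE w : dd w (fun x => f x + g x) = fun x => dd w f x + dd w g x.
    by apply: funext => x; rewrite ddD.
  apply: funext => x; rewrite !dE !ddD ?IHf ?IHg //; exact: polyf_dd.
- have dE w : dd w (fun x => f x * g x) =
              fun x => dd w f x * g x + f x * dd w g x.
    by apply: funext => x; rewrite ddM.
  have pdw := polyf_dd _ pf; have pgw := polyf_dd _ pg.
  apply: funext => x; rewrite !dE !ddD ?ddM ?IHf ?IHg //.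
  + by ring.
  + exact: polyf_mul.
  + exact: polyf_mul.
  + exact: polyf_mul.
  + exact: polyf_mul.
Qed.

Definition homog (m : nat) f := forall s x, f (s *: x) = s ^+ m * f x.

Definition hcomp (j : nat) f x := (line f 0 x)`_j.

Lemma polyf_hcomp j f : polyf f -> polyf (hcomp j f).
Proof. exact: polyf_line_r. Qed.

Lemma homog_hcomp j f : polyf f -> homog j (hcomp j f).
Proof. by move=> pf s x; rewrite /hcomp line_scale. Qed.

Lemma hcomp_sum f : polyf f ->
  exists N, forall M, (N <= M)%N -> forall x, f x = \sum_(j < M) hcomp j f x.
Proof.
move=> pf; have [N hN] := size_line pf; exists N => M NM x.
have := lineE 0 x 1 pf; rewrite scale1r add0r => <-.
rewrite (@horner_coef_wide _ M) ?(leq_trans _ NM) ?hN //.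
by apply: eq_bigr => j _; rewrite expr1n mulr1.
Qed.

Lemma hcomp_homog m f x : polyf f -> homog m f ->
  forall j, hcomp j f x = if j == m then f x else 0.
Proof.
move=> pf hf j; rewrite /hcomp (@line_uniq f 0 x (f x *: 'X^m)).
  by rewrite coefZ coefXn; case: eqP => _; rewrite (mulr1, mulr0).
by move=> s; rewrite hornerZ hornerXn add0r hf mulrC.
Qed.

Lemma homogM m1 m2 f g : homog m1 f -> homog m2 g ->
  homog (m1 + m2) (fun x => f x * g x).
Proof. by move=> hf hg s x; rewrite hf hg exprD mulrACA. Qed.

Lemma homog_mul_cst m c f : homog m f -> homog m (fun x => c * f x).
Proof. by move=> hf s x; rewrite hf mulrCA. Qed.

Definition cvc (T : Type) (F : set_system T) (u : T -> E) (x : E) :=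
  forall i, u t i 0 @[t --> F] --> x i 0.

Lemma polyf_cvc (T : Type) (F : set_system T) {FF : Filter F} f u x :
  polyf f -> cvc F u x -> f (u t) @[t --> F] --> f x.
Proof.
move=> pf ux; elim: pf => [c|i|{}f g pf IHf pg IHg|{}f g pf IHf pg IHg].
- exact: cvg_cst.
- exact: ux.
- exact: cvgD.
- exact: cvgM.
Qed.

Lemma polyf_bound f (M : R) : polyf f ->
  exists C, 0 <= C /\ forall x, (forall i, `|x i 0| <= M) -> `|f x| <= C.
Proof.
elim=> [c|i|{}f g pf [C1 [C10 h1]] pg [C2 [C20 h2]]|
        {}f g pf [C1 [C10 h1]] pg [C2 [C20 h2]]].
- by exists `|c|; split.
- by exists `|M|; split=> // x /(_ i) /le_trans; apply; rewrite ler_norm.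
- exists (C1 + C2); split=> [|x hx]; first exact: addr_ge0.
  by rewrite (le_trans (ler_normD _ _)) // lerD ?h1 ?h2.
- exists (C1 * C2); split=> [|x hx]; first exact: mulr_ge0.
  by rewrite normrM ler_pM ?h1 ?h2.
Qed.

End Fixed.

Lemma polyf_comp_affine (n p : nat) (A : 'M[R]_(n, p)) (v : 'cV[R]_n) f :
  polyf f -> polyf (fun x : 'cV[R]_p => f (A *m x + v)).
Proof.
elim=> [c|i|{}f g pf IHf pg IHg|{}f g pf IHf pg IHg].
- exact: polyf_cst.
- apply: (@polyf_ext _ (fun x : 'cV[R]_p => \sum_j A i j * x j 0 + v i 0)).
    by move=> x; rewrite !mxE.
  apply: polyf_add (polyf_cst _ _); apply: polyf_sum => j.
  exact: polyf_mul (polyf_cst _ _) (polyf_coord _).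
- exact: polyf_add.
- exact: polyf_mul.
Qed.

Lemma polyf_comp_lin (n p : nat) (A : 'M[R]_(n, p)) f :
  polyf f -> polyf (fun x : 'cV[R]_p => f (A *m x)).
Proof.
move=> pf; apply: (polyf_ext _ (polyf_comp_affine A 0 pf)) => x.
by rewrite addr0.
Qed.

Lemma polyf_shift (n : nat) (v : 'cV[R]_n) f :
  polyf f -> polyf (fun x : 'cV[R]_n => f (x + v)).
Proof.
move=> pf; apply: (polyf_ext _ (polyf_comp_affine 1%:M v pf)) => x.
by rewrite mul1mx.
Qed.

Lemma line_comp_lin (n p : nat) (A : 'M[R]_(n, p)) f x y : polyf f ->
  line (fun z => f (A *m z)) x y = line f (A *m x) (A *m y).
Proof. by move=> pf; apply: line_uniq => s; rewrite lineE // mulmxDr -scalemxAr. Qed.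

Lemma dd_comp_lin (n p : nat) (A : 'M[R]_(n, p)) f x y : polyf f ->
  dd y (fun z => f (A *m z)) x = dd (A *m y) f (A *m x).
Proof. by move=> pf; rewrite /dd line_comp_lin. Qed.

End PolyFun.

(** * Derivation classes *)

Section RealDerive.
Variable R : realType.
Implicit Types (f g : R -> R) (t a b : R).

Lemma cvg_bsum (T J : Type) (F : set_system T) {FF : Filter F} (r : seq J)
  (P : pred J) (f : J -> T -> R) (l : J -> R) :
  (forall j, P j -> f j s @[s --> F] --> l j) ->
  \sum_(j <- r | P j) f j s @[s --> F] --> \sum_(j <- r | P j) l j.
Proof.
move=> fl; elim: r => [|j r IH].
  rewrite big_nil (_ : (fun s => _) = fun=> 0); first exact: cvg_cst.
  by apply/funext => s; rewrite big_nil.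
rewrite big_cons (_ : (fun s => _) = fun s => if P j
    then f j s + \sum_(j <- r | P j) f j s else \sum_(j <- r | P j) f j s).
  by case: ifP => // Pj; apply: cvgD => //; apply: fl.
by apply/funext => s; rewrite big_cons.
Qed.

Lemma cvg_expn (T : Type) (F : set_system T) {FF : Filter F} (f : T -> R) (l : R) n :
  f s @[s --> F] --> l -> f s ^+ n @[s --> F] --> l ^+ n.
Proof.
move=> fl; elim: n => [|n IH].
  by rewrite expr0 (_ : (fun s => _) = fun=> 1) //; first exact: cvg_cst.
rewrite exprS (_ : (fun s => _) = fun s => f s * f s ^+ n); first exact: cvgM.
by apply/funext => s; rewrite exprS.
Qed.

Lemma isdD f g t a b : is_derive t 1 f a -> is_derive t 1 g b ->
  is_derive t 1 (fun x => f x + g x) (a + b).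
Proof. by move=> df dg; apply: is_deriveD. Qed.

Lemma isdM f g t a b : is_derive t 1 f a -> is_derive t 1 g b ->
  is_derive t 1 (fun x => f x * g x) (a * g t + f t * b).
Proof.
move=> df dg; apply: is_derive_eq.
by rewrite /GRing.scale /= addrC mulrC.
Qed.

Lemma isdV f t a : f t != 0 -> is_derive t 1 f a ->
  is_derive t 1 (fun x => (f x)^-1) (- (f t)^-1 ^+ 2 * a).
Proof. by move=> f0 df; rewrite exprVn; apply: is_deriveV. Qed.

Lemma isd_cst c t : is_derive t 1 (fun=> c : R) 0.
Proof. exact: is_derive_cst. Qed.

Lemma isd_eq f t a b : is_derive t 1 f a -> a = b -> is_derive t 1 f b.
Proof. by move=> df <-. Qed.

Lemma isd_uniq f t a b : is_derive t 1 f a -> is_derive t 1 f b -> a = b.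
Proof. by move=> [_ <-] [_ <-]. Qed.

Lemma isd_cont f t a : is_derive t 1 f a -> {for t, continuous f}.
Proof. by case=> df _; apply/differentiable_continuous/derivable1_diffP. Qed.

Lemma isd_sum (I : Type) (r : seq I) (f : I -> R -> R) (a : I -> R) t :
  (forall i, is_derive t 1 (f i) (a i)) ->
  is_derive t 1 (fun x => \sum_(i <- r) f i x) (\sum_(i <- r) a i).
Proof.
move=> df; elim: r => [|i r IH].
  rewrite big_nil (_ : (fun x => _) = fun=> 0); first exact: isd_cst.
  by apply/funext => x; rewrite big_nil.
rewrite big_cons (_ : (fun x => _) = fun x => f i x + \sum_(j <- r) f j x).
  exact: isdD.
by apply/funext => x; rewrite big_cons.
Qed.

Lemma isd_horner (p : {poly R}) t : is_derive t 1 (horner p) (p^`()).[t].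
Proof. exact: is_derive_poly. Qed.

(** The implicit function theorem for a simple root already known to be continuous. Subtracting the
    value at [e t] leaves [(e s - e t) * S s] with [S] continuous and [S t] the derivative of the
    polynomial at its root, so the difference quotient of [e] is a quotient of continuous
    functions. *)
Lemma isd_root N (a a' : nat -> R -> R) (e : R -> R) t :
  (forall j, is_derive t 1 (a j) (a' j t)) ->
  {for t, continuous e} ->
  (\forall s \near t, \sum_(j < N) a j s * e s ^+ j = 0) ->
  \sum_(j < N) a j t * (e t ^+ j.-1 *+ j) != 0 ->
  is_derive t 1 e (- (\sum_(j < N) a' j t * e t ^+ j)
                   / (\sum_(j < N) a j t * (e t ^+ j.-1 *+ j))).
Proof.
move=> da ce ae0 dn0.
pose S s := \sum_(j < N) a j s * \sum_(k < j) e s ^+ (j.-1 - k) * e t ^+ k.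
have SE s : \sum_(j < N) a j s * e s ^+ j - \sum_(j < N) a j s * e t ^+ j
    = (e s - e t) * S s.
  rewrite -sumrB mulr_sumr; apply: eq_bigr => j _.
  rewrite -mulrBr mulrCA; congr (_ * _).
  case: (nat_of_ord j) => [|k]; first by rewrite big_ord0 mulr0 !expr0 subrr.
  by rewrite subrXX /=; congr (_ * _); apply: eq_bigr => i _; rewrite subSS.
have St : S t = \sum_(j < N) a j t * (e t ^+ j.-1 *+ j).
  apply: eq_bigr => j _; congr (_ * _).
  rewrite (eq_bigr (fun=> e t ^+ j.-1)); last first.
    by move=> k _; rewrite -exprD subnK // -ltnS; case: (nat_of_ord j) k => [[]|].
  by rewrite sumr_const card_ord.
pose A s := \sum_(j < N) a j s * e t ^+ j.
have dA : is_derive t 1 A (\sum_(j < N) a' j t * e t ^+ j).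
  apply: isd_sum => j.
  by apply: isd_eq (isdM (da j) (isd_cst (e t ^+ j) t)) _; rewrite mulr0 addr0.
have cS : {for t, continuous S}.
  apply: cvg_bsum => j _; apply: cvgM; first exact: isd_cont (da j).
  apply: cvg_bsum => k _; apply: cvgM; last exact: cvg_cst.
  exact: cvg_expn.
have [gA [gAE cgA gAt]] := (is_derive1_caratheodory _ _ _).1 dA.
have Sn0 : \forall s \near t, S s != 0.
  by apply: (cvgr_neq0 _ cS); rewrite St.
pose g s := if s == t then - gA t / S t else (e s - e t) / (s - t).
have gt : g t = - gA t / S t by rewrite /g eqxx.
have cg : {for t, continuous g}.
  rewrite /prop_for /continuous_at gt.
  have : - gA s / S s @[s --> t] --> - gA t / S t.
    apply: cvgM; first exact: cvgN.
    by apply: cvgV => //; rewrite St.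
  apply: cvg_trans; apply: near_eq_cvg.
  near=> s; rewrite /g; case: (s =P t) => [->//|/eqP st].
  have Ss : S s != 0 by near: s.
  have := SE s; have -> : \sum_(j < N) a j s * e s ^+ j = 0 by near: s.
  rewrite sub0r -/(A s) => AE.
  have A0 : A t = 0 by apply: (nbhs_singleton ae0).
  have := gAE s; rewrite A0 subr0 => AE2.
  rewrite -subr_eq0 in st.
  apply: (mulIf st); rewrite divfK //; apply: (mulIf Ss).
  by rewrite -AE AE2 -mulrA [_ * S s]mulrC mulrA divfK // mulNr.
apply/is_derive1_caratheodory; exists g; split=> //; last by rewrite gt gAt St mulNr.
move=> s; rewrite /g; case: (s =P t) => [->|/eqP st]; first by rewrite !subrr mulr0.
by rewrite divfK // subr_eq0.
Unshelve. all: by end_near. Qed.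

End RealDerive.

Section Classes.
Variables (R : realType) (I : Type) (F : set_system (I * R)).
Variable b : (I * R -> R) -> Prop.
Implicit Types f g : I * R -> R.

(** A point of [I * R] is a parameter together with a time.  The classes used are
    the germs of class C^m, the functions with a limit along a blow-up, and the
    functions bounded along an ultrafilter. *)
Record calculus : Prop := {
  ca_filter : Filter F ;
  ca_open : forall P : set (I * R), F P ->
    F [set p | \forall s \near p.2, P (p.1, s)] ;
  ca_ext : forall f g, (\forall p \near F, f p = g p) -> b f -> b g ;
  ca_cst : forall c, b (fun=> c) ;
  ca_add : forall f g, b f -> b g -> b (fun p => f p + g p) ;
  ca_mul : forall f g, b f -> b g -> b (fun p => f p * g p) ;
  ca_inv : forall f k, 0 < k -> (\forall p \near F, k <= `|f p|) -> b f ->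
    b (fun p => (f p)^-1)
}.

Hypothesis C : calculus.
Let FF : Filter F := ca_filter C.
#[local] Existing Instance FF.
Let Fopen := ca_open C.

Definition dtau f f' :=
  \forall p \near F, is_derive p.2 (1 : R) (fun s => f (p.1, s)) (f' p).

(** Class C^m over the base class [b]. The derivatives are asked for on a set of the filter only,
    and the parameter is never differentiated. *)
Fixpoint cl (m : nat) f : Prop :=
  b f /\ match m with
  | 0 => True
  | m'.+1 => exists f', dtau f f' /\ cl m' f'
  end.

Lemma cl_b m f : cl m f -> b f.
Proof. by case: m => [|m] []. Qed.

Lemma cl_ext m f g : (\forall p \near F, f p = g p) -> cl m f -> cl m g.
Proof.
move=> fg; case: m => [[bf _]|m [bf [f' [df cf]]]].
  by split=> //; apply: (ca_ext C fg).
split; first exact: (ca_ext C fg).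
exists f'; split=> //; rewrite /dtau; apply: filterS2 (Fopen fg) df.
by move=> [i s] /= fgs; apply: near_eq_is_derive.
Qed.

Lemma cl_ext' m f g : f =1 g -> cl m f -> cl m g.
Proof. by move=> fg; apply: cl_ext; apply: nearW. Qed.

Lemma clS m f : cl m.+1 f -> cl m f.
Proof.
elim: m f => [|m IH] f [bf [f' [df cf]]]; first by split.
by split=> //; exists f'; split=> //; apply: IH.
Qed.

Lemma cl_le m k f : (m <= k)%N -> cl k f -> cl m f.
Proof.
move=> mk; rewrite -(subnK mk); elim: (k - m)%N => // l IH.
by rewrite addSn => /clS /IH.
Qed.

Lemma cl_cst m c : cl m (fun=> c).
Proof.
elim: m c => [|m IH] c; first by split=> //; apply: ca_cst.
split; first exact: ca_cst.
exists (fun=> 0); split=> //; apply: nearW => p; exact: isd_cst.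
Qed.

Lemma cl_add m f g : cl m f -> cl m g -> cl m (fun p => f p + g p).
Proof.
elim: m f g => [|m IH] f g; first by move=> [bf _] [bg _]; split=> //; apply: ca_add.
move=> [bf [f' [df cf]]] [bg [g' [dg cg]]]; split; first exact: ca_add.
exists (fun p => f' p + g' p); split; last exact: IH.
by apply: filterS2 df dg => p; apply: isdD.
Qed.

Lemma cl_mul m f g : cl m f -> cl m g -> cl m (fun p => f p * g p).
Proof.
elim: m f g => [|m IH] f g; first by move=> [bf _] [bg _]; split=> //; apply: ca_mul.
move=> cf0 cg0; move: (cf0) (cg0) => [bf [f' [df cf]]] [bg [g' [dg cg]]].
split; first exact: ca_mul.
exists (fun p => f' p * g p + f p * g' p); split; last first.
  by apply: cl_add; apply: IH => //; apply: clS.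
apply: filterS2 df dg => -[i s] /= df dg.
exact: (isdM df dg).
Qed.

Lemma cl_opp m f : cl m f -> cl m (fun p => - f p).
Proof.
move=> cf; apply: (@cl_ext' _ (fun p => -1 * f p)) => [p|]; first by rewrite mulN1r.
exact: cl_mul (cl_cst _ _) cf.
Qed.

Lemma cl_exp m f k : cl m f -> cl m (fun p => f p ^+ k).
Proof.
move=> cf; elim: k => [|k IH].
  by apply: cl_ext' (cl_cst m 1) => p; rewrite expr0.
by apply: cl_ext' (cl_mul cf IH) => p; rewrite exprS.
Qed.

Lemma cl_sum m (J : Type) (r : seq J) (P : pred J) (f : J -> I * R -> R) :
  (forall j, P j -> cl m (f j)) -> cl m (fun p => \sum_(j <- r | P j) f j p).
Proof.
move=> cf; elim: r => [|j r IH].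
  by apply: cl_ext' (cl_cst m 0) => p; rewrite big_nil.
case Pj: (P j).
  by apply: cl_ext' (cl_add (cf _ Pj) IH) => p; rewrite big_cons Pj.
by apply: cl_ext' IH => p; rewrite big_cons Pj.
Qed.

Lemma cl_inv m f k : 0 < k -> (\forall p \near F, k <= `|f p|) ->
  cl m f -> cl m (fun p => (f p)^-1).
Proof.
move=> k0 kf; elim: m => [|m IH].
  by move=> [bf _]; split=> //; apply: (ca_inv C k0 kf).
move=> cf0; move: (cf0) => [bf [f' [df cf]]].
split; first exact: (ca_inv C k0 kf).
exists (fun p => - (f p)^-1 ^+ 2 * f' p); split; last first.
  by apply: cl_mul => //; apply: cl_opp; apply: cl_exp; apply: IH; apply: clS.
apply: filterS2 kf df => -[i s] /= kf df; apply: (isdV _ df).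
by rewrite -normr_gt0 (lt_le_trans k0).
Qed.

Lemma cl_polyf m n (f : 'cV[R]_n -> R) (x : I * R -> 'cV[R]_n) :
  polyf f -> (forall i, cl m (fun p => x p i 0)) -> cl m (fun p => f (x p)).
Proof.
move=> pf cx; elim: pf => [c|i|{}f g pf IHf pg IHg|{}f g pf IHf pg IHg].
- exact: cl_cst.
- exact: cx.
- exact: cl_add.
- exact: cl_mul.
Qed.

(** Bootstrapping: the derivative of the root is a rational expression in [e], the [a j] and their
    derivatives. If [e] is of class C^m so is its derivative, and [e] gains one order. *)
Lemma cl_root m N (a : nat -> I * R -> R) (e : I * R -> R) k :
  (forall j, cl m (a j)) -> b e ->
  (\forall p \near F, {for p.2, continuous (fun s => e (p.1, s))}) ->
  (\forall p \near F, \sum_(j < N) a j p * e p ^+ j = 0) -> 0 < k ->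
  (\forall p \near F, k <= `|\sum_(j < N) a j p * (e p ^+ j.-1 *+ j)|) ->
  cl m e.
Proof.
move=> ca be ce ae0 k0 ka; elim: m ca => [|m IH] ca; first by [].
have ce' : cl m e by apply: IH => j; apply: clS.
have /choice[a' ha'] : forall j, exists a', dtau (a j) a' /\ cl m a'.
  by move=> j; have [_ [a' ?]] := ca j; exists a'.
split=> //.
exists (fun p => - (\sum_(j < N) a' j p * e p ^+ j)
                   / (\sum_(j < N) a j p * (e p ^+ j.-1 *+ j))); split.
  have da : \forall p \near F, forall j : 'I_N,
      is_derive p.2 (1 : R) (fun s => a j (p.1, s)) (a' j p).
    by apply: filter_forall => j; case: (ha' j).
  apply: filterS2 (filterI ce da) (filterI ka (Fopen ae0)).
  move=> -[i t] /= [cep dap] [kp ap0].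
  (* [isd_root] wants every coefficient differentiable, while only those of index below [N] are
     known to be so near [p]; the others are set to [0]. *)
  pose A j s := if (j < N)%N then a j (i, s) else 0.
  pose A' j s := if (j < N)%N then a' j (i, s) else 0.
  have dA j : is_derive t (1 : R) (A j) (A' j t).
    rewrite /A /A'; case: (ltnP j N) => jN; last exact: isd_cst.
    exact: (dap (Ordinal jN)).
  have AE (u : nat -> R) s :
      \sum_(j < N) A j s * u j = \sum_(j < N) a j (i, s) * u j.
    by apply: eq_bigr => j _; rewrite /A ltn_ord.
  have A'E (u : nat -> R) s :
      \sum_(j < N) A' j s * u j = \sum_(j < N) a' j (i, s) * u j.
    by apply: eq_bigr => j _; rewrite /A' ltn_ord.
  have := isd_root (N := N) dA cep.
  rewrite (AE (fun j => e (i, t) ^+ j.-1 *+ j)) (A'E (fun j => e (i, t) ^+ j)); apply.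
    by apply: filterS ap0 => s; apply: etrans; apply: (AE (fun j => e (i, s) ^+ j)).
  by rewrite -normr_gt0 (lt_le_trans k0).
apply: cl_mul.
  apply: cl_opp; apply: cl_sum => j _; apply: cl_mul; last exact: cl_exp.
  by case: (ha' j).
apply: cl_inv ka _ => //; apply: cl_sum => j _; apply: cl_mul; first exact: clS.
apply: (@cl_ext' _ (fun p => j%:R * e p ^+ j.-1)) => [p|].
  by rewrite mulr_natl.
by apply: cl_mul; [exact: cl_cst | exact: cl_exp].
Qed.

End Classes.

(** * Finite orthogonal groups *)

Section Euclid.
Variables (R : realType) (n : nat).
Notation E := 'cV[R]_n.
Implicit Types (u v w x y : E) (g h : 'M[R]_n).

Definition dp u v : R := \sum_i u i 0 * v i 0.
(** Distances are squared throughout, so that they are polynomial functions of the point. *)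
Definition nq u : R := dp u u.

Lemma dpC u v : dp u v = dp v u.
Proof. by apply: eq_bigr => i _; rewrite mulrC. Qed.

Lemma dpDl u v w : dp (u + v) w = dp u w + dp v w.
Proof. by rewrite -big_split; apply: eq_bigr => i _; rewrite mxE mulrDl. Qed.

Lemma dpDr u v w : dp w (u + v) = dp w u + dp w v.
Proof. by rewrite dpC dpDl !(dpC w). Qed.

Lemma dpZl a u v : dp (a *: u) v = a * dp u v.
Proof. by rewrite mulr_sumr; apply: eq_bigr => i _; rewrite mxE mulrA. Qed.

Lemma dpZr a u v : dp u (a *: v) = a * dp u v.
Proof. by rewrite dpC dpZl dpC. Qed.

Lemma dpNl u v : dp (- u) v = - dp u v.
Proof. by rewrite -scaleN1r dpZl mulN1r. Qed.

Lemma dpNr u v : dp u (- v) = - dp u v.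
Proof. by rewrite dpC dpNl dpC. Qed.

Lemma dp0l u : dp 0 u = 0.
Proof. by rewrite -(scale0r 0) dpZl mul0r. Qed.

Lemma dp0r u : dp u 0 = 0.
Proof. by rewrite dpC dp0l. Qed.

Lemma dp_suml (I : Type) (r : seq I) (P : pred I) (F : I -> E) v :
  dp (\sum_(i <- r | P i) F i) v = \sum_(i <- r | P i) dp (F i) v.
Proof.
elim/big_ind2: _ => [|_ u _ w <- <-|//]; first exact: dp0l.
exact: dpDl.
Qed.

Lemma dp_sumr (I : Type) (r : seq I) (P : pred I) (F : I -> E) v :
  dp v (\sum_(i <- r | P i) F i) = \sum_(i <- r | P i) dp v (F i).
Proof. by rewrite dpC dp_suml; apply: eq_bigr => i _; rewrite dpC. Qed.

Lemma dp_mulmx (A : 'M[R]_n) u v : dp (A *m u) v = dp u (A^T *m v).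
Proof.
rewrite /dp (eq_bigr (fun i => \sum_j A i j * u j 0 * v i 0)); last first.
  by move=> i _; rewrite mxE mulr_suml.
rewrite exchange_big /=; apply: eq_bigr => j _.
rewrite mxE mulr_sumr; apply: eq_bigr => i _; rewrite mxE.
by rewrite mulrAC mulrC.
Qed.

Lemma dp_delta u i : dp u (delta_mx i 0) = u i 0.
Proof.
rewrite /dp (bigD1 i) //= !mxE !eqxx mulr1 big1 ?addr0 // => j /negbTE ji.
by rewrite !mxE ji mulr0.
Qed.

Lemma nq_ge0 u : 0 <= nq u.
Proof. by apply: sumr_ge0 => i _; rewrite -expr2 sqr_ge0. Qed.

Lemma nq_coord u i : u i 0 ^+ 2 <= nq u.
Proof.
rewrite /nq /dp (bigD1 i) //= -expr2 lerDl; apply: sumr_ge0 => j _.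
by rewrite -expr2 sqr_ge0.
Qed.

Lemma nq_eq0 u : (nq u == 0) = (u == 0).
Proof.
apply/idP/eqP => [/eqP u0|->]; last by rewrite /nq dp0l.
apply/matrixP => i j; rewrite ord1 mxE; apply/eqP; rewrite -sqrf_eq0.
by rewrite eq_le sqr_ge0 andbT -u0 nq_coord.
Qed.

Lemma nq_gt0 u : (0 < nq u) = (u != 0).
Proof. by rewrite lt_neqAle nq_ge0 andbT eq_sym nq_eq0. Qed.

Lemma nqD u v : nq (u + v) = nq u + 2 * dp u v + nq v.
Proof. by rewrite /nq dpDl !dpDr (dpC v u); ring. Qed.

Lemma nqB u v : nq (u - v) = nq u - 2 * dp u v + nq v.
Proof. by rewrite nqD /nq dpNr dpNl dpNr opprK; ring. Qed.

Lemma nqN u : nq (- u) = nq u.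
Proof. by rewrite /nq dpNl dpNr opprK. Qed.

Lemma nqZ a u : nq (a *: u) = a ^+ 2 * nq u.
Proof. by rewrite /nq dpZl dpZr; ring. Qed.

Lemma nq0 : nq 0 = 0.
Proof. exact: dp0l. Qed.

Lemma nqBC u v : nq (u - v) = nq (v - u).
Proof. by rewrite -nqN opprB. Qed.

Lemma nqD_le u v : nq (u + v) <= 2 * nq u + 2 * nq v.
Proof. by have := nq_ge0 (u - v); rewrite nqB nqD; lra. Qed.

Lemma cauchy_schwarz u v : dp u v ^+ 2 <= nq u * nq v.
Proof.
have [->|v0] := eqVneq v 0; first by rewrite dp0r nq0 expr0n mulr0.
have := nq_ge0 (nq v *: u - dp u v *: v).
rewrite nqB !nqZ dpZl dpZr => h.
rewrite -(ler_pM2l (_ : 0 < nq v)) ?nq_gt0 //.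
by move: h; nra.
Qed.

Lemma coord_le_nq u i (M : R) : 0 <= M -> nq u <= M ^+ 2 -> `|u i 0| <= M.
Proof.
move=> M0 uM; rewrite -(@ler_pXn2r _ 2) ?nnegrE // real_normK ?num_real //.
exact: le_trans (nq_coord u i) uM.
Qed.

Lemma polyf_dp v : polyf (fun x => dp x v).
Proof. by apply: polyf_sum => i; apply: polyf_mul (polyf_coord _ _) (polyf_cst _ _). Qed.

Lemma polyf_nqB v : polyf (fun x => nq (x - v)).
Proof.
apply: (@polyf_ext _ _ (fun x => \sum_i (x i 0 - v i 0) * (x i 0 - v i 0))).
  by move=> x; apply: eq_bigr => i _; rewrite !mxE.
by apply: polyf_sum => i; apply: polyf_mul; apply: polyf_sub (polyf_coord _ _) (polyf_cst _ _).
Qed.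

Lemma polyf_nq : polyf nq.
Proof. by apply: (polyf_ext _ (polyf_nqB 0)) => x; rewrite subr0. Qed.

Lemma homog_nq : homog 2 nq.
Proof. by move=> s x; rewrite nqZ. Qed.

Definition orth g := g^T *m g = 1%:M.

Lemma orthT g : orth g -> orth g^T.
Proof. by move=> og; rewrite /orth trmxK; apply: mulmx1C. Qed.

Lemma orthTK g u : orth g -> g^T *m (g *m u) = u.
Proof. by move=> og; rewrite mulmxA og mul1mx. Qed.

Lemma orthKT g u : orth g -> g *m (g^T *m u) = u.
Proof. by move=> /orthT /(orthTK u); rewrite trmxK. Qed.

Lemma dp_orth g u v : orth g -> dp (g *m u) (g *m v) = dp u v.
Proof. by move=> og; rewrite dp_mulmx orthTK. Qed.

Lemma nq_orth g u : orth g -> nq (g *m u) = nq u.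
Proof. exact: dp_orth. Qed.

End Euclid.

Section FiniteGroup.
Variables (R : realType) (n : nat).
Notation E := 'cV[R]_n.
Implicit Types (u v x y : E) (g h w : 'M[R]_n) (H : seq 'M[R]_n).

(** A finite group is a duplicate-free list of matrices, over which averages are plain sums; by
    orthogonality the transpose is the inverse. *)
Record isgrp H : Prop := {
  grp_uniq : uniq H ;
  grp1 : 1%:M \in H ;
  grpM : forall g h, g \in H -> h \in H -> g *m h \in H ;
  grpT : forall g, g \in H -> g^T \in H ;
  grpO : forall g, g \in H -> orth g
}.

Definition inv H (f : E -> R) := forall g x, g \in H -> f (g *m x) = f x.

Definition stab H v := [seq g <- H | g *m v == v].

Lemma stab_sub H v g : g \in stab H v -> g \in H.
Proof. by rewrite mem_filter => /andP[]. Qed.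

Lemma stab_fix H v g : g \in stab H v -> g *m v = v.
Proof. by rewrite mem_filter => /andP[/eqP]. Qed.

Lemma mem_stab H v g : (g \in stab H v) = (g *m v == v) && (g \in H).
Proof. exact: mem_filter. Qed.

Lemma isgrp_stab H v : isgrp H -> isgrp (stab H v).
Proof.
move=> [Hu H1 HM HT HO]; split.
- exact: filter_uniq.
- by rewrite mem_stab mul1mx eqxx.
- move=> g h; rewrite !mem_stab => /andP[/eqP gv gH] /andP[/eqP hv hH].
  by rewrite -mulmxA hv gv eqxx HM.
- move=> g; rewrite !mem_stab => /andP[/eqP gv gH]; rewrite HT // andbT.
  by rewrite -{1}gv orthTK //; apply: HO.
- by move=> g /stab_sub /HO.
Qed.

Definition orb H v := undup [seq g *m v | g <- H].

Lemma mem_orb H v u : reflect (exists2 g, g \in H & u = g *m v) (u \in orb H v).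
Proof. by rewrite mem_undup; apply: mapP. Qed.

Section WithGroup.
Variable H : seq 'M[R]_n.
Hypothesis HG : isgrp H.

Lemma grp_perm g : g \in H -> perm_eq [seq w *m g | w <- H] H.
Proof.
move=> gH.
have injg : injective (fun w : 'M[R]_n => w *m g).
  move=> w1 w2 /(congr1 (fun w => w *m g^T)).
  by rewrite -!mulmxA (mulmx1C (grpO HG gH)) !mulmx1.
have umap : uniq [seq w *m g | w <- H] by rewrite map_inj_uniq ?(grp_uniq HG).
have sub : {subset [seq w *m g | w <- H] <= H}.
  by move=> _ /mapP[w wH ->]; apply: (grpM HG).
have [_ meq] := uniq_min_size umap sub (eq_leq (esym (size_map _ _))).
exact: uniq_perm (grp_uniq HG) meq.
Qed.

Lemma grp_sum (f : 'M[R]_n -> R) g : g \in H ->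
  \sum_(w <- H) f (w *m g) = \sum_(w <- H) f w.
Proof. by move=> gH; rewrite -[RHS](perm_big _ (grp_perm gH)) /= big_map. Qed.

Lemma inv_avg (f : E -> R) : inv H (fun x => \sum_(w <- H) f (w *m x)).
Proof.
move=> g x gH; under eq_bigr do rewrite mulmxA.
exact: (grp_sum (fun w => f (w *m x))).
Qed.

Lemma size_grp_gt0 : (0 < size H)%N.
Proof. by have := grp1 HG; case: (H). Qed.

Lemma size_grp_neq0 : (size H)%:R != 0 :> R.
Proof. by rewrite pnatr_eq0 -lt0n size_grp_gt0. Qed.

Lemma orb_refl v : v \in orb H v.
Proof. by apply/mem_orb; exists 1%:M; rewrite ?mul1mx ?(grp1 HG). Qed.

Lemma orb_mul v u g : g \in H -> u \in orb H v -> g *m u \in orb H v.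
Proof.
move=> gH /mem_orb[h hH ->]; apply/mem_orb; exists (g *m h).
  exact: (grpM HG).
by rewrite mulmxA.
Qed.

Lemma orb_perm v g : g \in H -> perm_eq [seq g *m u | u <- orb H v] (orb H v).
Proof.
move=> gH; have og := grpO HG gH.
have injg : injective (mulmx g : E -> E).
  by move=> z1 z2 /(congr1 (fun z : E => g^T *m z)) /=; rewrite !orthTK.
have umap : uniq [seq g *m u | u <- orb H v] by rewrite map_inj_uniq ?undup_uniq.
have sub : {subset [seq g *m u | u <- orb H v] <= orb H v}.
  by move=> _ /mapP[z zH ->]; apply: orb_mul.
have [_ meq] := uniq_min_size umap sub (eq_leq (esym (size_map _ _))).
exact: uniq_perm (undup_uniq _) meq.
Qed.

Lemma orb_sep v : exists2 k : R, 0 < k &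
  forall u, u \in orb H v -> u != v -> k <= nq (u - v).
Proof.
elim: (orb H v) => [|u s [k k0 hk]]; first by exists 1.
have [->|uv] := eqVneq u v.
  exists k => // u'; rewrite inE => /orP[/eqP->|]; last exact: hk.
  by rewrite eqxx.
exists (Num.min k (nq (u - v))).
  by rewrite lt_min k0 nq_gt0 subr_eq0.
move=> u'; rewrite inE => /orP[/eqP->|us] u'v; rewrite ge_min ?lexx ?orbT //.
by rewrite hk.
Qed.

End WithGroup.
End FiniteGroup.

Lemma prod_ge_expn (R : numDomainType) (T : eqType) (s : seq T) (f : T -> R) k :
  0 <= k -> (forall u, u \in s -> k <= f u) -> k ^+ size s <= \prod_(u <- s) f u.
Proof.
move=> k0; elim: s => [|u s IH] ks; first by rewrite expr0 big_nil.
rewrite exprS big_cons ler_pM ?exprn_ge0 //; first by rewrite ks ?mem_head.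
by apply: IH => v vs; apply: ks; rewrite inE vs orbT.
Qed.

Section Slice.
Variables (R : realType) (n : nat).
Notation E := 'cV[R]_n.
Implicit Types (u v x y : E) (g h w : 'M[R]_n) (H : seq 'M[R]_n).

Definition rootpoly (s : seq E) x : {poly R} :=
  \prod_(u <- s) ('X - (nq (x - u))%:P).

Lemma polyf_rootpoly s j : polyf (fun x => (rootpoly s x)`_j).
Proof.
elim: s j => [|u s IH] j.
  by apply: (polyf_ext _ (polyf_cst _ (1 : {poly R})`_j)) => x; rewrite /rootpoly big_nil.
apply: (@polyf_ext _ _ (fun x => (if j == 0 then 0 else (rootpoly s x)`_j.-1)
     - nq (x - u) * (rootpoly s x)`_j)).
  by move=> x; rewrite /rootpoly big_cons mulrBl coefB coefXM coefCM.
apply: polyf_sub; last exact: polyf_mul (polyf_nqB _) (IH _).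
by case: (j == 0); [exact: polyf_cst | exact: IH].
Qed.

Lemma size_rootpoly s x : size (rootpoly s x) = (size s).+1.
Proof. by rewrite size_prod_XsubC. Qed.

Lemma inv_rootpoly H v j : isgrp H -> inv H (fun x => (rootpoly (orb H v) x)`_j).
Proof.
move=> HG g x gH; congr ((polyseq _)`_ j); rewrite /rootpoly.
rewrite -[LHS](perm_big _ (orb_perm HG v gH)) big_map /=; apply: eq_bigr => u _.
by rewrite -mulmxBr nq_orth //; apply: (grpO HG).
Qed.

Variables (I : Type) (F : set_system (I * R)).
Variable b : (I * R -> R) -> Prop.
Hypothesis C : calculus F b.
Let FF : Filter F := ca_filter C.
#[local] Existing Instance FF.

(** [v] is fixed by [stab H v] and isolated in its orbit, so that [nq (x - v)]
    is a simple root of [rootpoly (orb H v) x] for [x] near [v]. *)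
Lemma cl_slice H v k m (x : I * R -> E) : isgrp H -> 0 < k ->
  (forall u, u \in orb H v -> u != v -> k <= nq (u - v)) ->
  (forall f, polyf f -> inv H f -> cl F b m (fun p => f (x p))) ->
  b (fun p => nq (x p - v)) ->
  (\forall p \near F, {for p.2, continuous (fun s => nq (x (p.1, s) - v))}) ->
  (\forall p \near F, nq (x p - v) <= k / 8) ->
  forall f, polyf f -> inv (stab H v) f -> cl F b m (fun p => f (x p)).
Proof.
move=> HG k0 hk Hcl be ce xk f pf fH.
have SG := isgrp_stab v HG.
set s := orb H v; set s' := [seq u <- s | u != v].
set e := fun p => nq (x p - v) in be ce *.
have sv p : rootpoly s (x p) = ('X - (e p)%:P) * rootpoly s' (x p).
  rewrite /rootpoly (bigD1_seq v) ?orb_refl ?undup_uniq //=.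
  by rewrite big_filter.
(* [k <= nq (u - v) <= 2 nq (x p - u) + 2 e p] and [e p <= k / 8] give [nq (x p - u) - e p >= k / 2
   - 2 e p >= k / 4]. *)
have far : \forall p \near F, forall u, u \in s' -> k / 4 <= nq (x p - u) - e p.
  apply: filterS xk => p xk u; rewrite mem_filter => /andP[uv us].
  have := hk u us uv; have := nqD_le (x p - u) (v - x p).
  rewrite [_ + (v - _)]addrC addrA subrK.
  rewrite [nq (v - u)]nqBC [nq (v - x p)]nqBC -/(e p) => h1 h2.
  by move: xk; rewrite -/(e p); lra.
(* The cofactor of the root [e p]; its value at [e p] is the derivative of [rootpoly] there, bounded
   away from [0] by [far]. *)
pose q p := rootpoly s' (x p).
have qe : \forall p \near F, (k / 4) ^+ size s' <= `|(q p).[e p]|.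
  apply: filterS far => p far; rewrite /q /rootpoly horner_prod.
  rewrite normr_prod; apply: prod_ge_expn => [|u us']; first by rewrite divr_ge0 ?ltW.
  by rewrite hornerXsubC distrC ler_normr far.
have k40 : 0 < (k / 4) ^+ size s' by rewrite exprn_gt0 // divr_gt0.
have clQ j : cl F b m (fun p => (rootpoly s (x p))`_j).
  by apply: (Hcl (fun y => (rootpoly s y)`_j)); [exact: polyf_rootpoly | exact: inv_rootpoly].
have cle : cl F b m e.
  apply: (cl_root C (N := (size s).+1)
           (a := fun j p => (rootpoly s (x p))`_j) (k := (k / 4) ^+ size s')) => //.
  - apply: nearW => p.
    rewrite -(horner_coef_wide _ (eq_leq (size_rootpoly s (x p)))) sv.
    by rewrite hornerM hornerXsubC subrr mul0r.
  - apply: filterS qe => p; congr (_ <= `|_|).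
    rewrite -[LHS]add0r -[LHS]addr0.
    have -> : \sum_(j < (size s).+1) (rootpoly s (x p))`_j * (e p ^+ j.-1 *+ j)
        = ((rootpoly s (x p))^`()).[e p].
      rewrite (@horner_coef_wide _ (size s)); last first.
        by rewrite -ltnS -(size_rootpoly s (x p)) lt_size_deriv // -size_poly_gt0 size_rootpoly.
      rewrite big_ord_recl mulr0n mulr0 add0r; apply: eq_bigr => j _.
      by rewrite coef_deriv /= mulrnAr mulrnAl.
    rewrite sv derivM hornerD !hornerM derivXsubC hornerC mul1r hornerXsubC.
    by rewrite subrr mul0r addr0 add0r addr0.
(* Synthetic division by [X - e p], from the top coefficient downwards: [q_j] is the coefficient of
   index [j + 1] of [rootpoly] plus [e p * q_(j + 1)]. *)
have clq j : cl F b m (fun p => (q p)`_j).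
  suff H0 l : forall j, ((size s).+1 - l <= j)%N -> cl F b m (fun p => (q p)`_j).
    by apply: (H0 (size s).+1); rewrite subnn.
  elim: l => [|l IH] {}j jl.
    apply: (cl_ext' C _ (cl_cst C m 0)) => p; rewrite nth_default //.
    rewrite size_rootpoly (leq_trans _ jl) // subn0 ltnS.
    by rewrite size_filter count_size.
  have [jl'|jl'] := leqP ((size s).+1 - l) j; first exact: IH.
  have jS : ((size s).+1 - l <= j.+1)%N by lia.
  apply: (cl_ext' C _ (cl_add C (clQ j.+1) (cl_mul C cle (IH _ jS)))).
  move=> p; rewrite sv mulrBl coefB coefXM coefCM /=.
  by rewrite subrK.
pose Fj j y := \sum_(w <- H) f (w *m y) * nq (w *m y - v) ^+ j.
have clF j : cl F b m (fun p => Fj j (x p)).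
  apply: (Hcl (Fj j)).
    apply: polyf_sum => w; apply: (polyf_comp_lin w (f := fun y => f y * nq (y - v) ^+ j)).
    by apply: polyf_mul => //; apply: polyf_exp; apply: polyf_nqB.
  exact: (inv_avg HG (fun y => f y * nq (y - v) ^+ j)).
(* In the sum over [w] of [f (w x) * q (nq (w x - v))], the number [nq (w x - v) = nq (x - w^T v)]
   is a root of [q] unless [w] fixes [v]. Only the isotropy group survives, and there neither factor
   depends on [w]. *)
have key p : (size (stab H v))%:R * f (x p) * (q p).[e p]
    = \sum_(j < (size s).+1) (q p)`_j * Fj j (x p).
  rewrite (eq_bigr (fun j : 'I__ => \sum_(w <- H)
      f (w *m x p) * ((q p)`_j * nq (w *m x p - v) ^+ j))); last first.
    by move=> j _; rewrite mulr_sumr; apply: eq_bigr => w _; rewrite mulrCA.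
  rewrite exchange_big /=.
  rewrite (eq_bigr (fun w => f (w *m x p) * (q p).[nq (w *m x p - v)])); last first.
    move=> w _; rewrite -mulr_sumr (@horner_coef_wide _ (size s).+1) //.
    by rewrite size_rootpoly ltnS size_filter count_size.
  rewrite (bigID (fun w => w *m v == v)) /= [X in _ = _ + X]big1_seq ?addr0; last first.
    move=> w /andP[wv wH]; rewrite /q /rootpoly horner_prod.
    have us' : uniq s' by rewrite filter_uniq ?undup_uniq.
    have ws' : w^T *m v \in s'.
      rewrite mem_filter; apply/andP; split; last first.
        by apply/mem_orb; exists w^T => //; apply: (grpT HG).
      by apply: contra_neq wv => wv; rewrite -{1}wv orthKT //; exact: (grpO HG).
    rewrite (bigD1_seq (w^T *m v)) //=.
    rewrite hornerXsubC -(nq_orth (x p - _) (grpO HG wH)) mulmxBr orthKT.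
      by rewrite subrr mul0r mulr0.
    exact: (grpO HG).
  rewrite -big_filter (eq_big_seq (fun=> f (x p) * (q p).[e p])); last first.
    move=> w wS; rewrite fH //; congr (_ * _.[_]).
    rewrite -{1}(stab_fix wS) -mulmxBr nq_orth //.
    by apply: (grpO HG); apply: stab_sub wS.
  by rewrite big_const_seq count_predT iter_addr addr0 -[_ * _ *+ _]mulr_natl mulrA.
have n0 := size_grp_neq0 SG.
apply: (@cl_ext _ _ F b C m (fun p =>
   (\sum_(j < (size s).+1) (q p)`_j * Fj j (x p)) *
   ((size (stab H v))%:R * (q p).[e p])^-1)).
  apply: filterS qe => p qe; rewrite -key invfM [_ * f _]mulrC -!mulrA.
  rewrite (mulrCA (q p).[e p]) mulfV ?mulr1 ?mulfV ?mulr1 //.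
  by rewrite -normr_gt0 (lt_le_trans k40).
apply: (cl_mul C).
  by apply: (cl_sum C) => // j _; apply: (cl_mul C).
apply: (@cl_inv _ _ F b C _ _ ((size (stab H v))%:R * (k / 4) ^+ size s')).
- by rewrite mulr_gt0 // ltr0n size_grp_gt0.
- apply: filterS qe => p qe; rewrite normrM normr_nat ler_pM //.
  exact: ltW.
- apply: (cl_mul C); first exact: (cl_cst C).
  apply: (@cl_ext' _ _ F b C m (fun p => \sum_(j < (size s).+1) (q p)`_j * e p ^+ j)).
    move=> p; rewrite -horner_coef_wide // size_rootpoly ltnS.
    by rewrite size_filter count_size.
  by apply: (cl_sum C) => // j _; apply: (cl_mul C) => //; apply: (cl_exp C).
Qed.

End Slice.

(** * Generation of the invariants in bounded degree *)

Section Generation.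
Variables (R : realType) (n : nat).
Notation E := 'cV[R]_n.
Implicit Types (u v x y : E) (h w : 'M[R]_n) (H : seq 'M[R]_n) (f g : E -> R).

Inductive alg (S : (E -> R) -> Prop) : (E -> R) -> Prop :=
| alg_cst c : alg S (fun=> c)
| alg_base f : S f -> alg S f
| alg_add f g : alg S f -> alg S g -> alg S (fun x => f x + g x)
| alg_mul f g : alg S f -> alg S g -> alg S (fun x => f x * g x).

Lemma alg_ext S f g : f =1 g -> alg S f -> alg S g.
Proof. by move=> /funext ->. Qed.

Lemma alg_sum S (I : Type) (r : seq I) (P : pred I) (F : I -> E -> R) :
  (forall i, alg S (F i)) -> alg S (fun x => \sum_(i <- r | P i) F i x).
Proof.
move=> aF; elim: r => [|i r IH].
  by apply: (alg_ext _ (alg_cst S 0)) => x; rewrite big_nil.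
case Pi: (P i).
  by apply: (alg_ext _ (alg_add (aF i) IH)) => x; rewrite big_cons Pi.
by apply: (alg_ext _ IH) => x; rewrite big_cons Pi.
Qed.

Definition gbase (d : nat) H f : Prop :=
  [/\ polyf f, inv H f & exists m, [/\ (0 < m)%N, (m <= d)%N & homog m f]].

(** Only the degree bound of a generating system is remembered: unlike the generators, it is
    inherited by isotropy groups, see [gen_stab]. *)
Definition gen (d : nat) H : Prop :=
  forall f, polyf f -> inv H f -> alg (gbase d H) f.

Lemma alg_polyf d H f : alg (gbase d H) f -> polyf f.
Proof.
elim=> [c|{}f []//|{}f g _ pf _ pg|{}f g _ pf _ pg].
- exact: polyf_cst.
- exact: polyf_add.
- exact: polyf_mul.
Qed.

Lemma cl_gen (I : Type) (F : set_system (I * R)) b d H m (x : I * R -> E) :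
  calculus F b -> gen d H ->
  (forall f, gbase d H f -> cl F b m (fun p => f (x p))) ->
  forall f, polyf f -> inv H f -> cl F b m (fun p => f (x p)).
Proof.
move=> C genH Hcl f pf fH.
elim: (genH f pf fH) => [c|f0 Sf|f1 f2 _ p1 _ p2|f1 f2 _ p1 _ p2].
- exact: (cl_cst C).
- exact: Hcl.
- exact: (cl_add C).
- exact: (cl_mul C).
Qed.

(** Homogeneity exchanges the two ends of the line: [f (y + t x) = t ^ m * f (x + y / t)], so a term
    of degree above [m] would give the polynomial on the left a pole at [0]. *)
Lemma size_line_homog m f x y : polyf f -> homog m f ->
  (size (line f x y) <= m.+1)%N.
Proof.
move=> pf hf; set P := line f x y; rewrite leqNgt; apply/negP => mP.
have [N PN] : {N | size P = N.+1}.
  by case: (size P) mP => // N _; exists N.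
have mN : (m < N)%N by move: mP; rewrite PN.
pose Q := line f y x.
have QP t : t != 0 -> Q.[t] = t ^+ m * P.[t^-1].
  by move=> t0; rewrite !lineE // -hf scalerDr scalerA mulfV // scale1r addrC.
have key : 'X * ('X^(N - m) * Q) = 'X * \sum_(j < N.+1) P`_j *: 'X^(N - j).
  apply: poly_inj_horner => t; rewrite !hornerM hornerX.
  have [->|t0] := eqVneq t 0; first by rewrite !mul0r.
  congr (_ * _).
  rewrite hornerXn.
  rewrite horner_sum.
  rewrite (QP _ t0).
  rewrite mulrA -exprD.
  rewrite subnK; last exact: ltnW.
  rewrite (@horner_coef_wide _ N.+1) ?PN // mulr_sumr.
  apply: eq_bigr => j _; rewrite hornerZ hornerXn mulrCA; congr (_ * _).
  have jN : (j <= N)%N by rewrite -ltnS.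
  by rewrite -[X in t ^+ X * _](subnK jN) exprD exprVn mulfK ?expf_neq0.
have := congr1 (fun p : {poly R} => p.[0]) (mulfI (negbT (polyX_eq0 _)) key).
rewrite hornerM hornerXn expr0n subn_eq0 leqNgt mN mul0r horner_sum.
rewrite big_ord_recr big1 /= => [|j _]; last first.
  by rewrite hornerZ hornerXn expr0n subn_eq0 leqNgt ltn_ord mulr0.
rewrite subnn hornerZ hornerXn expr0 mulr1 add0r => /esym/eqP.
have -> : P`_N = lead_coef P by rewrite lead_coefE PN.
by rewrite lead_coef_eq0 -size_poly_eq0 PN.
Qed.

(** Multiplying a [stab H v]-invariant form of degree [m] by a high power of
    [\prod_(u in H v, u != v) |x - u|^2] and averaging over [H] gives an
    [H]-invariant polynomial with that form as its part of degree [m] at [v]. *)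
Lemma gen_stab d H v : isgrp H -> gen d H -> gen d (stab H v).
Proof.
move=> HG genH.
have SG := isgrp_stab v HG.
have hom m f : polyf f -> inv (stab H v) f -> homog m f ->
    alg (gbase d (stab H v)) f.
  move=> pf fS hf.
  (* The exponent [m + 1] makes the factor vanish at the other points of the orbit to an order above
     [m], so that averaging does not disturb the coefficient of degree [m] at [v]. *)
  pose Ev x := \prod_(u <- orb H v | u != v) nq (x - u) ^+ m.+1.
  have pE : polyf Ev by apply: polyf_prod => u; apply: polyf_exp; apply: polyf_nqB.
  have Ev0 : Ev v != 0.
    rewrite prodf_seq_neq0; apply/allP => u _; apply/implyP => uv.
    by rewrite expf_neq0 // nq_eq0 subr_eq0 eq_sym.
  have ES (g : 'M[R]_n) x : g \in stab H v -> Ev (g *m x) = Ev x.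
    move=> gS; have gH := stab_sub gS.
    rewrite /Ev -[LHS](perm_big _ (orb_perm HG v gH)) big_map /=.
    apply: eq_big => u.
      congr (~~ _); rewrite -{1}(stab_fix gS); apply/eqP/eqP => [|->//].
      move=> /(congr1 (fun z : E => g^T *m z)) /=; rewrite !orthTK //.
        exact: (grpO HG).
      exact: (grpO HG).
    by move=> _; rewrite -mulmxBr nq_orth //; apply: (grpO HG).
  pose fE x := f (x - v) * Ev x.
  have pfE : polyf fE by apply: polyf_mul => //; apply: (polyf_shift (- v) pf).
  pose F x := \sum_(w <- H) fE (w *m x).
  have pF : polyf F by apply: polyf_sum => w; apply: polyf_comp_lin.
  have FH : inv H F by apply: inv_avg.
  have coefF y : (line F v y)`_m = (size (stab H v))%:R * (f y * Ev v).
    have lS w : w \in stab H v -> (line fE v (w *m y))`_m = f y * Ev v.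
      move=> wS; have -> : line fE v (w *m y) = (f y *: 'X^m) * line Ev v y.
        apply: line_uniq => s; rewrite hornerM hornerZ hornerXn lineE // /fE.
        have -> : v + s *: (w *m y) = w *m (v + s *: y).
          by rewrite mulmxDr (stab_fix wS) scalemxAr.
        rewrite ES // mulmxDr (stab_fix wS) addrAC subrr add0r.
        by rewrite -scalemxAr hf fS //; ring.
      by rewrite -scalerAl coefZ coefXnM ltnn subnn line_coef0.
    have lN w : w \in H -> w *m v != v -> (line fE (w *m v) (w *m y))`_m = 0.
      move=> wH wv.
      pose G x := f (x - v) * \prod_(u <- orb H v | (u != v) && (u != w *m v))
                                 nq (x - u) ^+ m.+1.
      have EvE x : Ev x = nq (x - w *m v) ^+ m.+1 *
          \prod_(u <- orb H v | (u != v) && (u != w *m v)) nq (x - u) ^+ m.+1.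
        have us : uniq [seq u <- orb H v | u != v] by rewrite filter_uniq ?undup_uniq.
        have ws : w *m v \in [seq u <- orb H v | u != v].
          by rewrite mem_filter wv; apply/mem_orb; exists w.
        by rewrite /Ev -big_filter (bigD1_seq _ ws us) /= big_filter_cond.
      have pG : polyf G.
        apply: polyf_mul; first exact: (polyf_shift (- v) pf).
        by apply: polyf_prod => u; apply: polyf_exp; apply: polyf_nqB.
      suff -> : line fE (w *m v) (w *m y)
          = 'X^(m.+1) * ('X^(m.+1) * (nq y ^+ m.+1 *: line G (w *m v) (w *m y))).
        by rewrite coefXnM leqnn.
      apply: line_uniq => s; rewrite !hornerM hornerZ hornerXn lineE //.
      rewrite /fE /G EvE.
      have -> : w *m v + s *: (w *m y) - w *m v = s *: (w *m y).
        by rewrite addrAC subrr add0r.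
      rewrite nqZ nq_orth; last exact: (grpO HG).
      rewrite exprMn -exprM mul2n -addnn exprD.
      by ring.
    have -> : line F v y = \sum_(w <- H) line fE (w *m v) (w *m y).
      apply: line_uniq => s; rewrite horner_sum; apply: eq_bigr => w _.
      by rewrite lineE // scalemxAr -mulmxDr.
    rewrite coef_sum (bigID (fun w => w *m v == v)) /= [X in _ + X]big1_seq ?addr0.
      rewrite -big_filter (eq_big_seq (fun=> f y * Ev v)).
        by rewrite big_const_seq count_predT iter_addr addr0 -[_ * _ *+ _]mulr_natl.
      by move=> w wS; rewrite (stab_fix wS) lS.
    by move=> w /andP[wv wH]; rewrite lN.
  (* The Taylor coefficients at [v] of an [H]-invariant form of degree [k <= d] are a constant and
     [stab H v]-invariant forms of degrees [j <= k]; sums and products carry this to the whole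
     algebra. *)
  have key j : alg (gbase d (stab H v)) (fun y => (line F v y)`_j).
    elim: (genH F pF FH) j => [c|g [pg gH [k [k0 kd hg]]]|g1 g2 a1 IH1 a2 IH2|
                               g1 g2 a1 IH1 a2 IH2] j.
    - by apply: (alg_ext _ (alg_cst _ (c%:P)`_j)) => y; rewrite line_cst.
    - case: j => [|j].
        by apply: (alg_ext _ (alg_cst _ (g v))) => y; rewrite line_coef0.
      have [jk|kj] := leqP j.+1 k; last first.
        apply: (alg_ext _ (alg_cst _ 0)) => y; rewrite nth_default //.
        exact: leq_trans (size_line_homog _ _ pg hg) kj.
      apply: alg_base; split.
      + exact: polyf_line_r.
      + move=> h y hS; congr ((polyseq _)`_ _); apply: line_uniq => s.
        rewrite lineE // -{2}(stab_fix hS) scalemxAr -mulmxDr gH //.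
        exact: stab_sub hS.
      + exists j.+1; split=> //; first exact: leq_trans kd.
        by move=> s y; rewrite line_scale.
    - apply: (alg_ext _ (alg_add (IH1 j) (IH2 j))) => y.
      by rewrite lineD ?coefD //; apply: alg_polyf; eassumption.
    - apply: (@alg_ext _ (fun y => \sum_(i < j.+1)
          (line g1 v y)`_i * (line g2 v y)`_(j - i))).
        by move=> y; rewrite lineM ?coefM //; apply: alg_polyf; eassumption.
      by apply: alg_sum => i; apply: alg_mul.
  apply: (alg_ext _ (alg_mul (alg_cst _ ((size (stab H v))%:R * Ev v)^-1) (key m))).
  move=> y; rewrite coefF.
  have -> : (size (stab H v))%:R * (f y * Ev v) = (size (stab H v))%:R * Ev v * f y.
    by ring.
  by rewrite mulKf // mulf_neq0 // size_grp_neq0.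
move=> f pf fS; have [N hN] := hcomp_sum pf.
apply: (@alg_ext _ (fun x => \sum_(j < N) hcomp j f x)); first by move=> x; rewrite -hN.
apply: alg_sum => j; apply: (hom j); [exact: polyf_hcomp| |exact: homog_hcomp].
move=> g x gS; congr ((polyseq _)`_ _); apply: line_uniq => s.
by rewrite lineE // !add0r scalemxAr fS.
Qed.

(** The product of the squared distances to the points of the orbit of [x] is an invariant
    polynomial that vanishes exactly on that orbit. *)
Lemma inv_separates H x y : isgrp H ->
  (forall f, polyf f -> inv H f -> f y = f x) -> exists2 w, w \in H & y = w *m x.
Proof.
move=> HG fxy; apply/mem_orb.
pose f z := \prod_(u <- orb H x) nq (z - u).
have pf : polyf f by apply: polyf_prod => u; apply: polyf_nqB.
have fH : inv H f.
  move=> g z gH; rewrite /f -[LHS](perm_big _ (orb_perm HG x gH)) big_map /=.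
  by apply: eq_bigr => u _; rewrite -mulmxBr nq_orth //; apply: (grpO HG).
have fx : f x = 0.
  by rewrite /f (bigD1_seq x) ?undup_uniq ?orb_refl //= subrr nq0 mul0r.
have /eqP := fxy f pf fH; rewrite fx prodf_seq_eq0 => /hasP[u uo].
by rewrite /= nq_eq0 subr_eq0 => /eqP ->.
Qed.

Lemma gbase_separates d H x y : isgrp H -> gen d H ->
  (forall f, gbase d H f -> f y = f x) -> exists2 w, w \in H & y = w *m x.
Proof.
move=> HG genH fxy; apply: inv_separates => // f pf fH.
elim: (genH f pf fH) => [c|f0|f1 f2 _ IHf _ IHg|f1 f2 _ IHf _ IHg] //.
- exact: fxy.
- by rewrite IHf IHg.
- by rewrite IHf IHg.
Qed.

Definition fixp H x := forall g : 'M[R]_n, g \in H -> g *m x = x.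

(** The orthogonal projection onto the fixed space, as the average of the group. *)
Definition proj H : 'M[R]_n := (size H)%:R^-1 *: \sum_(w <- H) w.

Lemma projE H x : proj H *m x = (size H)%:R^-1 *: \sum_(w <- H) w *m x.
Proof. by rewrite /proj -scalemxAl mulmx_suml. Qed.

Lemma proj_fix H x : isgrp H -> fixp H (proj H *m x).
Proof.
move=> HG g gH; rewrite projE -scalemxAr; congr (_ *: _).
apply/matrixP => i j; rewrite mulmx_sumr !summxE ord1.
have HG' : isgrp H := HG.
rewrite (eq_bigr (fun w => ((w^T *m g^T)^T *m x) i 0)); last first.
  by move=> w _; rewrite trmx_mul !trmxK mulmxA.
have pT : perm_eq [seq w^T | w <- H] H.
  have uT : uniq [seq w^T | w <- H].
    by rewrite map_inj_uniq ?(grp_uniq HG) //; exact: trmx_inj.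
  have sT : {subset [seq w^T | w <- H] <= H}.
    by move=> _ /mapP[w wH ->]; apply: (grpT HG).
  have [_ meq] := uniq_min_size uT sT (eq_leq (esym (size_map _ _))).
  exact: uniq_perm (grp_uniq HG) meq.
rewrite -(big_map (fun w => w^T) xpredT (fun w => ((w *m g^T)^T *m x) i 0)).
rewrite (perm_big _ pT) /= (grp_sum HG (fun w => (w^T *m x) i 0)); last exact: (grpT HG).
by rewrite -(perm_big _ pT) big_map /=; apply: eq_bigr => w _; rewrite trmxK.
Qed.

Lemma fix_proj H x : isgrp H -> fixp H x -> proj H *m x = x.
Proof.
move=> HG fx; rewrite projE (eq_big_seq (fun=> x)); last by move=> g /fx.
rewrite big_const_seq count_predT iter_addr addr0 -[x *+ _]scaler_nat scalerA mulVf.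
  by rewrite scale1r.
exact: size_grp_neq0.
Qed.

Lemma proj_comm H (g : 'M[R]_n) x : isgrp H -> g \in H -> proj H *m (g *m x) = proj H *m x.
Proof.
move=> HG gH; rewrite !projE; congr (_ *: _).
apply/matrixP => i j; rewrite !summxE ord1.
rewrite -(grp_sum HG (fun w => (w *m x) i 0) gH).
by apply: eq_bigr => w _; rewrite mulmxA.
Qed.

Lemma size_stab H v : isgrp H -> ~ fixp H v -> (size (stab H v) < size H)%N.
Proof.
move=> HG nf; rewrite size_filter; apply: contra_notT nf; rewrite -leqNgt => sH.
move=> g gH; apply/eqP; move: g gH; apply/allP.
by rewrite all_count eqn_leq count_size.
Qed.

End Generation.

(** * Germs of class C^m *)

Section Germ.
Variable R : realType.
Implicit Types (f g : R -> R) (t s : R).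

(** The parameter space is a point: germs in time alone, in the setting of [calculus]. *)
Definition germ_filter t : set_system (unit * R) :=
  [set P | \forall s \near t, P (tt, s)].

Definition germ_base t (f : unit * R -> R) :=
  \forall s \near t, {for s, continuous (fun s => f (tt, s))}.

Lemma near_near (t : R) (P : set R) : (\forall s \near t, P s) ->
  \forall s \near t, \forall s' \near s, P s'.
Proof. exact: nbhs_interior. Qed.

Lemma cont_near_eq f g t : (\forall s \near t, f s = g s) ->
  {for t, continuous f} -> {for t, continuous g}.
Proof.
move=> fg cf; rewrite /prop_for /continuous_at -(nbhs_singleton fg).
by apply: cvg_trans cf; apply: near_eq_cvg; apply: filterS fg => s ->.
Qed.

Lemma germ_calculus t : calculus (germ_filter t) (germ_base t).
Proof.
split.
- split; first exact: (@filterT _ (nbhs t)).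
    by move=> P Q; apply: filterI.
  by move=> P Q PQ; apply: filterS => s; apply: PQ.
- by move=> P /near_near.
- move=> f g fg cf.
  have fg' : \forall s \near t, f (tt, s) = g (tt, s) := fg.
  by apply: filterS2 (near_near fg') cf => s; apply: cont_near_eq.
- by move=> c; rewrite /germ_base; near=> s; exact: cvg_cst.
- by move=> f g cf cg; apply: filterS2 cf cg => s; apply: cvgD.
- by move=> f g cf cg; apply: filterS2 cf cg => s; apply: cvgM.
- move=> f k k0 kf cf.
  have kf' : \forall s \near t, k <= `|f (tt, s)| := kf.
  apply: filterS2 kf' cf => s ks; apply: cvgV.
  by rewrite -normr_gt0 (lt_le_trans k0).
Unshelve. all: by end_near. Qed.

Definition Ck m t f := cl (germ_filter t) (germ_base t) m (fun p => f p.2).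

Lemma Ck0 t f : Ck 0 t f <-> \forall s \near t, {for s, continuous f}.
Proof. by split=> [[]|cf] //; split. Qed.

Lemma CkS m t f : Ck m.+1 t f <->
  exists f', (\forall s \near t, is_derive s (1 : R) f (f' s)) /\ Ck m t f'.
Proof.
split=> [[_ [f' [df cf]]]|[f' [df cf]]].
  exists (fun s => f' (tt, s)); split; first exact: df.
  by apply: cl_ext' cf; [exact: germ_calculus | case=> -[]].
split; last by exists (fun p => f' p.2).
by apply: filterS df => s; apply: isd_cont.
Qed.

Lemma Ck_eq m t f g : (\forall s \near t, f s = g s) -> Ck m t f -> Ck m t g.
Proof. by move=> fg; apply: cl_ext; [exact: germ_calculus | exact: fg]. Qed.

Lemma Ck_cont m t f : Ck m t f -> {for t, continuous f}.
Proof. by move/cl_b => /nbhs_singleton. Qed.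

Lemma Ck_shift m t s f : Ck m (t + s) f -> Ck m s (fun u => f (t + u)).
Proof.
have nS (P : set R) : (\forall u \near t + s, P u) -> \forall u \near s, P (t + u).
  have ct : t + u @[u --> s] --> t + s by apply: cvgD; [exact: cvg_cst|exact: cvg_id].
  by move=> /ct.
elim: m f => [|m IH] f.
  move=> /Ck0 /nS cf; apply/Ck0; apply: filterS cf => u cf.
  apply: (@continuous_comp _ _ _ (fun u => t + u) f) => //.
  by apply: cvgD; [exact: cvg_cst|exact: cvg_id].
move=> /CkS[f' [/nS df cf]]; apply/CkS; exists (fun u => f' (t + u)).
split; last exact: IH.
apply: filterS df => u df.
have du : is_derive u (1 : R) (fun u => t + u) 1.
  have did : is_derive u (1 : R) (fun v : R => v) 1 by exact: is_derive_id.
  by have h := isdD (isd_cst t u) did; apply: (isd_eq h); rewrite add0r.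
by have h := is_derive1_comp df du; apply: (isd_eq h); rewrite mulr1.
Qed.

Lemma Ck_opp m t f : Ck m (- t) f -> Ck m t (fun u => f (- u)).
Proof.
have cN (u : R) : - v @[v --> u] --> - u by apply: cvgN; exact: cvg_id.
have nS (P : set R) : (\forall u \near - t, P u) -> \forall u \near t, P (- u).
  by move=> /cN.
elim: m f => [|m IH] f.
  move=> /Ck0 /nS cf; apply/Ck0; apply: filterS cf => u cf.
  by apply: (@continuous_comp _ _ _ (fun u => - u) f) => //; apply: cN.
move=> /CkS[f' [/nS df cf]]; apply/CkS; exists (fun u => - f' (- u)).
split; last first.
  by apply: cl_opp (germ_calculus t) _ _ _; apply: IH.
apply: filterS df => u df.
have du : is_derive u (1 : R) (fun u => - u) (-1) by apply: is_deriveNid.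
by have h := is_derive1_comp df du; apply: (isd_eq h); rewrite mulrN1.
Qed.

Lemma mvt f f' (a b : R) :
  (forall s, Num.min a b <= s <= Num.max a b -> is_derive s (1 : R) f (f' s)) ->
  exists2 s, Num.min a b <= s <= Num.max a b & f b - f a = f' s * (b - a).
Proof.
wlog ab : a b / a <= b => [H|].
  case/orP: (le_total a b) => [/H//|ba]; rewrite minC maxC => df.
  have [s sab E] := H b a ba df; exists s => //.
  by rewrite -opprB E -mulrN opprB.
rewrite min_l // max_r // => df.
have [s||s sab E] := @MVT_segment _ f f' a b ab.
- by rewrite in_itv /= => /andP[/ltW as_ /ltW sb]; apply: df; rewrite as_.
- by apply: derivable_within_continuous => s; rewrite in_itv /= => /df[].
- by exists s => //; move: sab; rewrite in_itv.
Qed.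

(** At [t] only continuity is known. This is the form needed at a blow-up, where the derivative is
    given away from [t]. *)
Lemma mvt_at f f' t s : s != t -> {for t, continuous f} ->
  (forall c, c != t -> `|c - t| <= `|s - t| -> is_derive c (1 : R) f (f' c)) ->
  exists2 c, c != t /\ `|c - t| <= `|s - t| & f s - f t = f' c * (s - t).
Proof.
move=> st cf df; case: (ltgtP s t) st => // st _.
  have [||c] := @MVT _ f f' s t st.
  - move=> c; rewrite in_itv /= => /andP[sc ct]; apply: df; first by rewrite lt_eqF.
    by rewrite !ltr0_norm ?subr_lt0 // lerN2 lerD2r ltW.
  - apply: (@continuous_in_subspaceT _ _ `[s, t]%classic).
    move=> c; rewrite inE /= in_itv /= => /andP[sc].
    rewrite le_eqVlt => /orP[/eqP->//|ct].
    apply: (@isd_cont _ _ _ (f' c)); apply: df; first by rewrite lt_eqF.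
    by rewrite !ltr0_norm ?subr_lt0 // lerN2 lerD2r.
  - rewrite in_itv /= => /andP[sc ct] E; exists c.
      by rewrite lt_eqF // !ltr0_norm ?subr_lt0 // lerN2 lerD2r ltW.
    by rewrite -opprB E -mulrN opprB.
have [||c] := @MVT _ f f' t s st.
- move=> c; rewrite in_itv /= => /andP[tc cs]; apply: df; first by rewrite gt_eqF.
  by rewrite !gtr0_norm ?subr_gt0 // lerD2r ltW.
- apply: (@continuous_in_subspaceT _ _ `[t, s]%classic).
  move=> c; rewrite inE /= in_itv /= => /andP[tc cs].
  move: tc; rewrite le_eqVlt => /orP[/eqP<-//|tc].
  apply: (@isd_cont _ _ _ (f' c)); apply: df; first by rewrite gt_eqF.
  by rewrite !gtr0_norm ?subr_gt0 // lerD2r.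
- rewrite in_itv /= => /andP[tc cs] E; exists c => //.
  by rewrite gt_eqF // !gtr0_norm ?subr_gt0 // lerD2r ltW.
Qed.

Lemma isd_limit f f' t : {for t, continuous f} ->
  (\forall s \near t, s != t -> is_derive s (1 : R) f (f' s)) ->
  {for t, continuous f'} -> is_derive t (1 : R) f (f' t).
Proof.
move=> cf df cf'; apply/is_derive1_caratheodory.
exists (fun s => if s == t then f' t else (f s - f t) / (s - t)); split; last 2 first.
- rewrite /prop_for /continuous_at eqxx.
  apply/cvgrPdist_le => e e0.
  have /cvgrPdist_le /(_ e e0) fe := cf'.
  move/nbhs_ballP : df => [d1 /= d10 df].
  move/nbhs_ballP : fe => [d2 /= d20 fe].
  apply/nbhs_ballP; exists (Num.min d1 d2); first by rewrite /= lt_min d10.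
  move=> s /=; rewrite /ball /= lt_min => /andP[s1 s2].
  case: (s =P t) => [_|/eqP st]; first by rewrite subrr normr0 ltW.
  have [|c [ct cs] ->] := @mvt_at f f' t s st cf.
    move=> c ct cs; apply: df => //.
    by rewrite /ball /= distrC (le_lt_trans cs) // distrC.
  rewrite mulfK ?subr_eq0 //; apply: fe.
  by rewrite /ball /= distrC (le_lt_trans cs) // distrC.
- by rewrite eqxx.
- move=> s; case: (s =P t) => [->|/eqP st]; first by rewrite !subrr mulr0.
  by rewrite divfK // subr_eq0.
Qed.

End Germ.

(** * Division of germs by powers of the variable *)

Section Division.
Variable R : realType.
Implicit Types (f g h phi : R -> R) (t s : R).

Lemma isd_id t : is_derive t (1 : R) (fun v : R => v) 1.
Proof. exact: is_derive_id. Qed.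

Lemma isd_pow n t : is_derive t (1 : R) (fun v : R => v ^+ n.+1) (n.+1%:R * t ^+ n).
Proof.
elim: n => [|n IH].
  rewrite expr0 mulr1 (_ : (fun v => _) = fun v => v); first exact: isd_id.
  by apply/funext => v; rewrite expr1.
rewrite (_ : (fun v => _) = fun v => v * v ^+ n.+1); last first.
  by apply/funext => v; rewrite exprS.
apply: (isd_eq (isdM (isd_id t) IH)).
by rewrite mul1r mulrCA -exprS -[in RHS]addn1 natrD; ring.
Qed.

(** [h] stands for [t ^ -(j + 1)] times the integral of [s ^ j * phi s] from [0] to [t],
    characterized by its differential equation so that no integral is formed. The mean value theorem
    applies to [s ^ (j + 1) * (h s - a)], whose derivative is [s ^ j * (phi s - phi 0)]. *)
Lemma avg_limit j phi h : {for 0, continuous phi} ->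
  t ^+ j.+1 * h t @[t --> 0^'] --> (0 : R) ->
  (\forall t \near 0^', is_derive t (1 : R) h ((phi t - j.+1%:R * h t) / t)) ->
  h t @[t --> 0^'] --> phi 0 / j.+1%:R.
Proof.
move=> cphi k0 dh; apply/cvgrPdist_le => e e0.
have /cvgrPdist_le /(_ e e0) := cphi.
move=> /nbhs_ballP[d1 /= d10 hphi].
move: dh; rewrite near_withinE => /nbhs_ballP[d2 /= d20 dh].
rewrite near_withinE; apply/nbhs_ballP; exists (Num.min d1 d2).
  by rewrite /= lt_min d10.
move=> t; rewrite /ball /= sub0r normrN lt_min => /andP[t1 t2] tn0.
have j0 : 0 < j.+1%:R :> R by rewrite ltr0n.
pose a := phi 0 / j.+1%:R.
pose k s := if s == 0 then 0 else s ^+ j.+1 * (h s - a).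
have dk s : s != 0 -> `|s| < d2 -> is_derive s (1 : R) k (s ^+ j * (phi s - phi 0)).
  move=> s0 s2.
  have dhs := dh s; rewrite /ball /= sub0r normrN in dhs.
  have h1 := isdM (isd_pow j s) (isdD (dhs s2 s0) (isd_cst (- a) s)).
  apply: (@near_eq_is_derive _ _ _ (fun s => s ^+ j.+1 * (h s - a))).
    near=> u; rewrite /k ifF //; apply/negbTE; near: u.
    by apply: (@cvgr_neq0 _ _ _ _ _ (fun x => x) s) => //; exact: cvg_id.
  apply: (isd_eq h1).
  by rewrite /a exprS; field; rewrite s0 lt0r_neq0.
have ck0 : {for 0, continuous k}.
  apply/continuous_withinNx; rewrite {2}/k eqxx.
  have : s ^+ j.+1 * h s - s ^+ j.+1 * a @[s --> 0^'] --> 0 - 0 ^+ j.+1 * a.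
    apply: cvgB => //; apply: cvgM; last exact: cvg_cst.
    by apply: cvg_expn; apply: cvg_within.
  rewrite expr0n mul0r subr0; apply: cvg_trans; apply: near_eq_cvg.
  near=> s; rewrite /k ifF ?mulrBr //; apply/negbTE; near: s.
  exact: nbhs_dnbhs_neq.
have [|c [c0 ct] E] := @mvt_at _ k (fun s => s ^+ j * (phi s - phi 0)) 0 t tn0 ck0.
  by move=> c c0; rewrite !subr0 => ct; apply: dk => //; apply: le_lt_trans t2.
move: ct E; rewrite !subr0 {1 2}/k eqxx (negbTE tn0) subr0 => ct E.
have {}E : h t - a = (c / t) ^+ j * (phi c - phi 0).
  apply: (mulfI (expf_neq0 j.+1 tn0)); rewrite E exprMn exprVn exprS.
  by field; rewrite expf_neq0.
rewrite distrC E normrM normrX -[leRHS]mul1r ler_pM ?exprn_ge0 //.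
  rewrite exprn_ile1 ?normr_ge0 // normrM normfV ler_pdivrMr ?mul1r //.
  by rewrite normr_gt0.
rewrite distrC; apply: hphi; rewrite /ball /= sub0r normrN.
exact: le_lt_trans ct t1.
Unshelve. all: by end_near. Qed.

(** The family of equations is closed under differentiation: [h'] solves the one for [phi'] and
    [j + 1]. Hence [h] is as regular as [phi]. *)
Lemma avg_Ck m j phi h : Ck m 0 phi -> {for 0, continuous h} ->
  h 0 = phi 0 / j.+1%:R ->
  (\forall t \near 0^', is_derive t (1 : R) h ((phi t - j.+1%:R * h t) / t)) ->
  Ck m 0 h.
Proof.
elim: m j phi h => [|m IH] j phi h cphi ch h0 dh.
  apply/Ck0; move: dh; rewrite near_withinE; apply: filterS => t dh.
  have [->//|t0] := eqVneq t 0; exact: isd_cont (dh t0).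
have j0 : j.+1%:R != 0 :> R by rewrite pnatr_eq0.
have j1 : j.+2%:R != 0 :> R by rewrite pnatr_eq0.
have [phi' [dphi cphi']] := (CkS _ _ _).1 cphi.
pose h1 t := if t == 0 then phi' 0 / j.+2%:R else (phi t - j.+1%:R * h t) / t.
have dphi' : \forall t \near 0^', is_derive t (1 : R) phi (phi' t).
  by rewrite near_withinE; apply: filterS dphi.
have dh1 : \forall t \near 0^', is_derive t (1 : R) h1 ((phi' t - j.+2%:R * h1 t) / t).
  near=> t.
  have t0 : t != 0 by near: t; exact: nbhs_dnbhs_neq.
  have dht : is_derive t (1 : R) h ((phi t - j.+1%:R * h t) / t) by near: t.
  have dpt : is_derive t (1 : R) phi (phi' t) by near: t.
  have d1 := isdD dpt (isdM (isd_cst (- j.+1%:R) t) dht).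
  have d2 := isdM d1 (isdV t0 (isd_id t)).
  apply: (@near_eq_is_derive _ _ _ (fun t => (phi t + - j.+1%:R * h t) / t)).
    near=> u; rewrite /h1 ifF ?mulNr //; apply/negbTE; near: u.
    by apply: (@cvgr_neq0 _ _ _ _ _ (fun x => x) t) => //; exact: cvg_id.
  apply: (isd_eq d2); rewrite /h1 (negbTE t0) -[j.+2%:R]natr1.
  by field.
have ch1 : {for 0, continuous h1}.
  apply/continuous_withinNx; rewrite {2}/h1 eqxx.
  apply: avg_limit dh1; first exact: (Ck_cont cphi').
  have : s ^+ j.+1 * (phi s - j.+1%:R * h s) @[s --> 0^'] -->
      0 ^+ j.+1 * (phi 0 - j.+1%:R * h 0).
    apply: cvgM; first by apply: cvg_expn; apply: cvg_within.
    apply: cvgB; first exact: cvg_within_filter (Ck_cont cphi).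
    by apply: cvgM; [exact: cvg_cst | exact: cvg_within_filter ch].
  rewrite expr0n mul0r; apply: cvg_trans; apply: near_eq_cvg.
  near=> s; have s0 : s != 0 by near: s; exact: nbhs_dnbhs_neq.
  by rewrite /h1 (negbTE s0) [s ^+ j.+2]exprSr -mulrA [s * _]mulrC divfK.
apply/CkS; exists h1; split; last first.
  by apply: (IH j.+1 phi') => //; rewrite /h1 eqxx.
have dh0 : is_derive (0 : R) (1 : R) h (h1 0).
  apply: isd_limit => //; move: dh; rewrite near_withinE; apply: filterS => t dh t0.
  by apply: (isd_eq (dh t0)); rewrite /h1 (negbTE t0).
move: dh; rewrite near_withinE; apply: filterS => t dh.
have [->//|t0] := eqVneq t 0.
by apply: (isd_eq (dh t0)); rewrite /h1 (negbTE t0).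
Unshelve. all: by end_near. Qed.

(** The quotient [g t / t] is the mean of [g'] between [0] and [t], which is the case [j = 0] of
    [avg_Ck]. *)
Lemma Ck_div m g : Ck m.+1 0 g -> g 0 = 0 ->
  exists2 h, Ck m 0 h & forall t, g t = t * h t.
Proof.
move=> /CkS[g' [dg cg]] g0.
pose h t := if t == 0 then g' 0 else g t / t.
exists h; last first.
  move=> t; rewrite /h; case: (t =P 0) => [->|/eqP t0]; first by rewrite mul0r.
  by rewrite mulrC divfK.
apply: (@avg_Ck m 0 g') => //.
- apply/continuous_withinNx; rewrite {2}/h eqxx.
  have [q [qE cq <-]] := (is_derive1_caratheodory _ _ _).1 (nbhs_singleton dg).
  have /continuous_withinNx := cq; apply: cvg_trans; apply: near_eq_cvg.
  near=> s; have s0 : s != 0 by near: s; exact: nbhs_dnbhs_neq.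
  have := qE s; rewrite g0 !subr0 /h (negbTE s0) => ->.
  by rewrite mulfK.
- by rewrite /h eqxx divr1.
- near=> t; have t0 : t != 0 by near: t; exact: nbhs_dnbhs_neq.
  have dgt : is_derive t (1 : R) g (g' t).
    by near: t; rewrite near_withinE; apply: filterS dg.
  apply: (@near_eq_is_derive _ _ _ (fun t => g t / t)).
    near=> u; rewrite /h ifF //; apply/negbTE; near: u.
    by apply: (@cvgr_neq0 _ _ _ _ _ (fun x => x) t) => //; exact: cvg_id.
  have d2 := isdM dgt (isdV t0 (isd_id t)).
  apply: (isd_eq d2); rewrite /h (negbTE t0).
  by field.
Unshelve. all: by end_near. Qed.

Lemma Ck_divn m k g C : Ck (m + k) 0 g ->
  (\forall t \near 0^', `|g t| <= C * `|t| ^+ k) ->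
  exists2 h, Ck m 0 h & forall t, g t = t ^+ k * h t.
Proof.
elim: k g => [|k IH] g cg gC.
  by exists g; [rewrite addn0 in cg | move=> t; rewrite expr0 mul1r].
have g0 : g 0 = 0.
  have cg0 : {for 0, continuous g} := Ck_cont cg.
  apply/eqP; rewrite -normr_le0.
  have c0 : `|g t| @[t --> (0 : R)^'] --> `|g 0|.
    by apply: cvg_norm; apply: cvg_within_filter cg0.
  have c1 : C * `|t| ^+ k.+1 @[t --> (0 : R)^'] --> C * `|0 : R| ^+ k.+1.
    apply: cvgM; first exact: cvg_cst.
    by apply: cvg_expn; apply: cvg_norm; apply: cvg_within.
  rewrite normr0 expr0n mulr0 in c1.
  exact: ler_cvg_to c0 c1 gC.
rewrite addnS in cg; have [h ch gh] := Ck_div cg g0.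
have [|h' ch' hh'] := IH h ch.
  near=> t; have t0 : t != 0 by near: t; exact: nbhs_dnbhs_neq.
  have : `|g t| <= C * `|t| ^+ k.+1 by near: t.
  by rewrite gh normrM exprS mulrCA ler_pM2l ?normr_gt0.
by exists h' => // t; rewrite gh hh' exprS mulrA.
Unshelve. all: by end_near. Qed.

End Division.

(** * Jets of continuous lifts *)

Section Limits.
Variables (R : realType) (n : nat).
Notation E := 'cV[R]_n.

(** The limit is the supremum of the numbers eventually below [g]: along an ultrafilter, not being
    eventually above a level means being eventually below it. *)
Lemma ultra_cvg_real (T : Type) (G : set_system T) (g : T -> R) (M : R) :
  UltraFilter G -> (\forall t \near G, `|g t| <= M) -> cvg (g t @[t --> G]).
Proof.
move=> GU gM; have GP : ProperFilter G := ultra_proper.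
pose S := [set x | \forall t \near G, x <= g t].
have SM x : S x -> x <= M.
  move=> Sx; have [t [xt tM]] : exists t, x <= g t /\ `|g t| <= M.
    by have [t [? ?]] := filter_ex (filterI Sx gM); exists t.
  by rewrite (le_trans xt) // (le_trans (ler_norm _)).
have S0 : S (- M).
  by apply: filterS gM => t; rewrite ler_norml => /andP[].
have hS : has_sup S by split; [exists (- M) | exists M => x; apply: SM].
apply/cvg_ex; exists (sup S); apply/cvgrPdist_le => e e0.
have [x Sx xe] := sup_adherent e0 hS.
have nS : ~ S (sup S + e).
  by move=> /(ub_le_sup hS.2); rewrite gerDl leNgt e0.
have [//|up] := in_ultra_setVsetC [set t | sup S + e <= g t] GU.
have up' : \forall t \near G, g t < sup S + e.
  by apply: filterS up => t /= /negP; rewrite -ltNge.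
apply: filterS2 Sx up' => t xt tu.
by rewrite ler_norml lerBrDr lerBlDr addrC; apply/andP; split; lra.
Qed.

Lemma ultra_cvc (T : Type) (F : set_system T) (u : T -> E) (M : R) :
  ProperFilter F -> (\forall t \near F, forall i, `|u t i 0| <= M) ->
  exists G, [/\ UltraFilter G, F `<=` G & exists a, cvc G u a].
Proof.
move=> FP uM; have [G [GU FG]] := ultraFilterLemma FP; exists G; split=> //.
have GP : ProperFilter G := ultra_proper.
have cu i : cvg (u t i 0 @[t --> G]).
  by apply: (@ultra_cvg_real _ _ _ M); apply: FG; apply: filterS uM => t; apply.
by exists (\col_i lim (u t i 0 @[t --> G])) => i; rewrite mxE; apply: cu.
Qed.

Lemma cvc_nq (T : Type) (F : set_system T) {FF : Filter F} (u : T -> E) a :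
  cvc F u a <-> nq (u t - a) @[t --> F] --> 0.
Proof.
split=> [ua|ua i].
  by have h := polyf_cvc (polyf_nqB a) ua; rewrite subrr nq0 in h; exact: h.
apply/cvgrPdist_le => e e0.
have /cvgrPdist_le /(_ (e ^+ 2)) := ua; rewrite exprn_gt0 // => /(_ isT).
apply: filterS => t; rewrite sub0r normrN ger0_norm ?nq_ge0 // => h.
have := coord_le_nq i (ltW e0) h; by rewrite !mxE distrC.
Qed.

Lemma cvc_mulmx (T : Type) (F : set_system T) {FF : Filter F} (u : T -> E) a
    (g : 'M[R]_n) : cvc F u a -> cvc F (fun t => g *m u t) (g *m a).
Proof.
by move=> ua i; exact: (polyf_cvc (polyf_comp_lin g (polyf_coord R i)) ua).
Qed.

Lemma cvc_uniq (T : Type) (F : set_system T) {FF : ProperFilter F}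
    (u : T -> E) a b : cvc F u a -> cvc F u b -> a = b.
Proof.
move=> ua ub; apply/matrixP => i j; rewrite ord1.
by apply: (cvg_unique _ (ua i) (ub i)).
Qed.

Lemma cvcD (T : Type) (F : set_system T) {FF : Filter F} (u v : T -> E) a b :
  cvc F u a -> cvc F v b -> cvc F (fun t => u t + v t) (a + b).
Proof.
move=> ua vb i; rewrite mxE (_ : (fun t => _) = fun t => u t i 0 + v t i 0).
  exact: cvgD.
by apply/funext => t; rewrite mxE.
Qed.

Lemma cvcZ (T : Type) (F : set_system T) {FF : Filter F} (k : T -> R) (c : R)
    (u : T -> E) a :
  k t @[t --> F] --> c -> cvc F u a -> cvc F (fun t => k t *: u t) (c *: a).
Proof.
move=> kc ua i; rewrite mxE (_ : (fun t => _) = fun t => k t * u t i 0).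
  exact: cvgM.
by apply/funext => t; rewrite mxE.
Qed.

Lemma cvcN (T : Type) (F : set_system T) {FF : Filter F} (u : T -> E) a :
  cvc F u a -> cvc F (fun t => - u t) (- a).
Proof.
move=> ua i; rewrite mxE (_ : (fun t => _) = fun t => - u t i 0).
  exact: cvgN.
by apply/funext => t; rewrite mxE.
Qed.

Lemma cvc_cst (T : Type) (F : set_system T) {FF : Filter F} (a : E) :
  cvc F (fun=> a) a.
Proof. by move=> i; apply: cvg_cst. Qed.

Lemma cvc_eq (T : Type) (F : set_system T) {FF : Filter F} (u v : T -> E) a :
  (\forall t \near F, u t = v t) -> cvc F u a -> cvc F v a.
Proof.
move=> uv ua i; apply: cvg_trans (ua i); apply: near_eq_cvg.
by apply: filterS uv => t ->.
Qed.

End Limits.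

Section Orbits.
Variables (R : realType) (n : nat).
Notation E := 'cV[R]_n.
Implicit Types (O : seq E) (v x : E) (e k : R).

Definition dorb O x := \prod_(u <- O) nq (x - u).

Lemma dorb_lt O e x : 0 < e -> dorb O x < e ^+ size O ->
  exists2 u, u \in O & nq (x - u) < e.
Proof.
move=> e0 h; apply: contrapT => nu; move: h; apply/negP; rewrite -leNgt.
apply: prod_ge_expn => [|u uO]; first exact: ltW.
by rewrite leNgt; apply/negP => h; apply: nu; exists u.
Qed.

(** Two points within [e] and [3 e] of [x] satisfy [nq (u - v) < 2 e + 2 (3 e) = 8 e], which is less
    than the separation of the orbit. *)
Lemma sep_close O v k e x u : (forall u, u \in O -> u != v -> k <= nq (u - v)) ->
  8 * e <= k -> 0 < e -> u \in O -> nq (x - u) < e -> nq (x - v) < 3 * e -> u = v.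
Proof.
move=> sep ek e0 uO xu xv; apply/eqP; apply: contraT => uv.
have := sep u uO uv; have := nqD_le (u - x) (x - v).
by rewrite addrA subrK nqBC; move: xu; rewrite nqBC; lra.
Qed.

(** By the intermediate value theorem, a path leaving the ball passes through squared distance
    exactly [e] from [v]; there the nearby point of [O] can only be [v], which is not that near. *)
Lemma stay O v k e (y : R -> E) s0 s :
  (forall u, u \in O -> u != v -> k <= nq (u - v)) -> 8 * e <= k -> 0 < e ->
  (forall c, Num.min s0 s <= c <= Num.max s0 s ->
     {for c, continuous (fun s => nq (y s - v))} /\ dorb O (y c) < e ^+ size O) ->
  nq (y s0 - v) < e -> nq (y s - v) < e.
Proof.
move=> sep ek e0 hy ys0; rewrite ltNge; apply/negP => ys.
have [c cs yc] : exists2 c, Num.min s0 s <= c <= Num.max s0 s & nq (y c - v) = e.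
  have cy c : Num.min s0 s <= c <= Num.max s0 s ->
      {for c, continuous (fun s => nq (y s - v))} by move=> /hy[].
  have ivt a b : a <= b -> (forall c, a <= c <= b ->
      {for c, continuous (fun s => nq (y s - v))}) ->
      Num.min (nq (y a - v)) (nq (y b - v)) <= e <=
      Num.max (nq (y a - v)) (nq (y b - v)) ->
      exists2 c, a <= c <= b & nq (y c - v) = e.
    move=> ab cab hv.
    have [|c cab' E1] := @IVT _ (fun s => nq (y s - v)) a b e ab _ hv.
      apply: (@continuous_in_subspaceT _ _ `[a, b]%classic) => c.
      by rewrite inE /= in_itv /= => /cab.
    by exists c => //; move: cab'; rewrite in_itv.
  case/orP: (le_total s0 s) => le0.
    rewrite min_l // max_r // in cy *; apply: ivt => //.
    by rewrite ge_min le_max (ltW ys0) ys orbT.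
  rewrite min_r // max_l // in cy *; apply: ivt => //.
  by rewrite ge_min le_max (ltW ys0) ys orbT.
have [_ /(dorb_lt e0)[u uO yu]] := hy c cs.
have uv : u = v.
  by apply: (sep_close sep ek e0 uO yu); rewrite yc; lra.
by move: yu; rewrite uv yc ltxx.
Qed.

Lemma inv_dorb (H : seq 'M[R]_n) v : isgrp H -> inv H (dorb (orb H v)).
Proof.
move=> HG g x gH; rewrite /dorb -[LHS](perm_big _ (orb_perm HG v gH)) big_map /=.
by apply: eq_bigr => u _; rewrite -mulmxBr nq_orth //; apply: (grpO HG).
Qed.

Lemma polyf_dorb O : polyf (dorb O).
Proof. by apply: polyf_prod => u; apply: polyf_nqB. Qed.

Lemma dorb0 O v : v \in O -> dorb O v = 0.
Proof.
move=> vO; apply/eqP; rewrite /dorb prodf_seq_eq0; apply/hasP; exists v => //.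
by rewrite /= subrr nq0.
Qed.

(** A connectedness argument: the possible limits form a finite set. *)
Lemma lift_limit (H : seq 'M[R]_n) (x : R -> E) : isgrp H ->
  (forall f, polyf f -> inv H f -> f (x t) @[t --> 0^'+] --> f (x 0)) ->
  (\forall t \near 0^'+, forall i, {for t, continuous (fun s => x s i 0)}) ->
  exists2 g, g \in H & cvc 0^'+ x (g *m x 0).
Proof.
move=> HG fx cx; set O := orb H (x 0).
have [k k0 sep0] := orb_sep H (x 0).
have sep v : v \in O -> forall u, u \in O -> u != v -> k <= nq (u - v).
  move=> /mem_orb[g gH ->] u uO uv; have og := grpO HG gH.
  have -> : nq (u - g *m x 0) = nq (g^T *m u - x 0).
    by rewrite -(nq_orth (_ - x 0) og) mulmxBr orthKT.
  apply: sep0; first by apply: orb_mul => //; apply: (grpT HG).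
  by apply: contra_neq uv => <-; rewrite orthKT.
have b0 : dorb O (x t) @[t --> 0^'+] --> 0.
  have h := fx _ (polyf_dorb O) (inv_dorb (x 0) HG).
  by rewrite (dorb0 (orb_refl HG (x 0))) in h.
have small e : 0 < e -> \forall t \near 0^'+, dorb O (x t) < e ^+ size O.
  move=> e0; have /cvgr_lt := b0; apply; exact: exprn_gt0.
pose e := k / 8; have e0 : 0 < e by rewrite divr_gt0.
have ek : 8 * e <= k by rewrite /e mulrC divfK.
have [d d0 hd] : exists2 d, 0 < d & forall t, 0 < t < d ->
    (forall i, {for t, continuous (fun s => x s i 0)}) /\
    dorb O (x t) < e ^+ size O.
  have [d /= d0 hd] := filterI cx (small e e0).
  exists d => // t /andP[t0 td]; apply: (hd t) => //.
  by rewrite /ball /= sub0r normrN gtr0_norm.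
have d20 : 0 < d / 2 < d by rewrite divr_gt0 // ltr_pdivrMr // ltr_pMr // ltr1n.
have [v vO xv] := dorb_lt e0 (hd _ d20).2.
have xt t : 0 < t < d -> nq (x t - v) < e.
  move=> td; apply: (stay (sep v vO) ek e0 _ xv) => c ctd.
  have cd : 0 < c < d.
    move: ctd d20 td => /andP[c1 c2] /andP[h1 h2] /andP[h3 h4].
    by rewrite (lt_le_trans _ c1) ?lt_min ?h1 // (le_lt_trans c2) // gt_max h2.
  have [cc dc] := hd c cd; split=> //.
  by have := polyf_cvc (polyf_nqB v) (u := x) (F := nbhs c) (x := x c); apply.
have /mem_orb[g gH vg] := vO; exists g => //; rewrite -vg.
apply/cvc_nq; apply/cvgrPdist_lt => e' e'0.
have e''0 : 0 < Num.min e e' by rewrite lt_min e0.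
apply: filterS2 (small _ e''0) (_ : \forall t \near 0^'+, 0 < t < d).
  move=> t /(dorb_lt e''0)[u uO]; rewrite lt_min => /andP[xu xu'] /xt xtv.
  have -> : v = u.
    by apply/esym; apply: (sep_close (sep v vO) ek e0 uO xu); lra.
  by rewrite sub0r normrN ger0_norm ?nq_ge0.
near=> t; apply/andP; split; first by near: t; exact: nbhs_right_gt.
by near: t; exact: nbhs_right_lt.
Unshelve. all: by end_near. Qed.

End Orbits.

Section Jets.
Variables (R : realType) (n : nat).
Notation E := 'cV[R]_n.
Implicit Types (H : seq 'M[R]_n) (x y z : R -> E) (v : E) (t s : R).

(** Nothing is asked of [x] itself, which may jump within the orbits: any choice of representatives
    of a regular curve in the orbit space is allowed. *)
Definition gcurve m H x t :=
  forall f, polyf f -> inv H f -> Ck m t (fun s => f (x s)).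

Definition ccont x t := forall i, {for t, continuous (fun s => x s i 0)}.

Lemma ccont_polyf x t f : polyf f -> ccont x t -> {for t, continuous (fun s => f (x s))}.
Proof. by move=> pf cx; exact: (polyf_cvc pf (F := nbhs t) (u := x) (x := x t)). Qed.

Lemma ccont_eq x y t : (\forall s \near t, x s = y s) -> ccont x t -> ccont y t.
Proof.
by move=> xy cx i; apply: cont_near_eq (cx i); apply: filterS xy => s ->.
Qed.

Lemma gcurve_slice_at m H x v k t : isgrp H -> 0 < k ->
  (forall u, u \in orb H v -> u != v -> k <= nq (u - v)) ->
  gcurve m H x t ->
  (\forall s \near t, {for s, continuous (fun s => nq (x s - v))}) ->
  (\forall s \near t, nq (x s - v) <= k / 8) ->
  gcurve m (stab H v) x t.
Proof.
move=> HG k0 sep gx cx xk f pf fH.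
exact: (cl_slice (germ_calculus t) (x := fun p => x p.2) HG k0 sep).
Qed.

Lemma gcurve_slice m H x t : isgrp H -> gcurve m H x t ->
  (\forall s \near t, {for s, continuous (fun s => nq (x s - x t))}) ->
  gcurve m (stab H (x t)) x t.
Proof.
move=> HG gx cx; have [k k0 sep] := orb_sep H (x t).
apply: (gcurve_slice_at HG k0 sep gx cx).
have c0 : nq (x s - x t) @[s --> t] --> 0.
  by have := nbhs_singleton cx; rewrite /prop_for /continuous_at subrr nq0.
have : \forall s \near t, nq (x s - x t) < k / 8.
  by have /cvgr_lt := c0; apply; rewrite divr_gt0.
by apply: filterS => s /ltW.
Qed.

Lemma cvg_dnbhs0 (g : R -> R) (l : R) : g t @[t --> 0^'+] --> l ->
  g (- t) @[t --> 0^'+] --> l -> g t @[t --> 0^'] --> l.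
Proof.
move=> /cvgrPdist_lt g1 /cvgrPdist_lt g2; apply/cvgrPdist_lt => e e0.
have [d1 /= d10 h1] := g1 e e0; have [d2 /= d20 h2] := g2 e e0.
rewrite near_withinE; apply/nbhs_ballP; exists (Num.min d1 d2).
  by rewrite /= lt_min d10.
move=> t; rewrite /ball /= lt_min => /andP[t1 t2] t0.
case: (ltgtP t 0) t0 => // t0 _; last exact: h1.
rewrite -[t]opprK; apply: h2; last by rewrite /= oppr_gt0.
by rewrite /ball /= opprK; move: t2; rewrite sub0r normrN add0r.
Qed.

Lemma right_dnbhs (P : R -> Prop) : (\forall t \near (0 : R)^', P t) ->
  \forall t \near 0^'+, P t.
Proof.
move=> [d /= d0 hd]; exists d => // t td /= t0; apply: hd => //.
by rewrite gt_eqF.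
Qed.

Lemma dnbhs_opp (P : R -> Prop) : (\forall t \near (0 : R)^', P t) ->
  \forall t \near (0 : R)^', P (- t).
Proof.
move=> [d /= d0 hd]; exists d => // t td /= t0; apply: hd => //=.
  by move: td; rewrite /ball /= !sub0r opprK normrN.
by rewrite oppr_eq0.
Qed.

(** [0] is a minimum of [p], so the quotient [p t / t] vanishes at [0] as well and [t] can be
    divided out twice. *)
Lemma sq_bound (p : R -> R) : Ck 2 0 p -> (forall t, 0 <= p t) -> p 0 = 0 ->
  exists2 C, 0 <= C & \forall t \near 0, p t <= C * t ^+ 2.
Proof.
move=> cp p0 p00; have [h ch ph] := Ck_div cp p00.
have chh := Ck_cont ch.
have h0 : h 0 = 0.
  apply/eqP; rewrite eq_le; apply/andP; split.
    have c1 : h (- t) @[t --> 0^'+] --> h 0.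
      have : h (- t) @[t --> (0 : R)] --> h (- 0).
        apply: (@continuous_comp _ _ _ (fun t : R => - t) h).
          by apply: cvgN; exact: cvg_id.
        by rewrite oppr0.
      by rewrite oppr0; apply: cvg_within_filter.
    have c2 : (fun=> 0 : R) t @[t --> (0 : R)^'+] --> (0 : R) by exact: cvg_cst.
    apply: (ler_cvg_to c1 c2); near=> t.
    have t0 : 0 < t by near: t; exact: nbhs_right_gt.
    by have := p0 (- t); rewrite ph mulNr oppr_ge0 pmulr_rle0.
  have c1 : h t @[t --> 0^'+] --> h 0 by exact: cvg_within_filter chh.
  have c2 : (fun=> 0 : R) t @[t --> (0 : R)^'+] --> (0 : R) by exact: cvg_cst.
  apply: (ler_cvg_to c2 c1); near=> t.
  have t0 : 0 < t by near: t; exact: nbhs_right_gt.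
  by have := p0 t; rewrite ph pmulr_rge0.
have [g cg hg] := Ck_div ch h0.
exists (`|g 0| + 1); first by rewrite addr_ge0.
have : `|g t| @[t --> 0] --> `|g 0| by apply: cvg_norm; exact: Ck_cont cg.
move=> /cvgr_lt /(_ (`|g 0| + 1)); rewrite ltrDl ltr01 => /(_ isT).
apply: filterS => t gt; rewrite ph hg mulrA -expr2 mulrC ler_wpM2r ?sqr_ge0 //.
by rewrite (le_trans (ler_norm _)) // ltW.
Unshelve. all: by end_near. Qed.

(** A one-sided Taylor expansion of order [r], the factorials being absorbed in the coefficients.
    The left side is reached through [x (- h)], with signs [(-1) ^ j] on the coefficients. *)
Definition jet (F : set_system R) r (a : nat -> E) x :=
  cvc F (fun h => (h ^+ r)^-1 *: (x h - \sum_(j < r.+1) h ^+ j *: a j)) 0.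

Lemma inv_gcurve m H x y t : (forall s f, inv H f -> f (x s) = f (y s)) ->
  gcurve m H x t -> gcurve m H y t.
Proof.
move=> xy gx f pf fH; apply: Ck_eq (gx f pf fH); near=> s; exact: xy.
Unshelve. all: by end_near. Qed.

(** The value of [z] at [0] is chosen so that the invariants of
    [z t = (x t - v) / t] extend to germs of class [C^(r d)]. *)
Lemma lift_blowup r d H x : isgrp H -> gen d H -> (2 <= d)%N ->
  gcurve (r.+1 * d) H x 0 -> (forall h, h \in H -> h *m x 0 = x 0) ->
  (forall i, {for 0, continuous (fun s => x s i 0)}) ->
  exists2 a, gcurve (r * d) H (fun t => if t == 0 then a else t^-1 *: (x t - x 0)) 0 &
    exists G, [/\ UltraFilter G, 0^'+ `<=` G & cvc G (fun t => t^-1 *: (x t - x 0)) a].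
Proof.
move=> HG genH d2 gx xfix cx0.
have invB f : polyf f -> inv H f -> polyf (fun u => f (u - x 0)) /\
    inv H (fun u => f (u - x 0)).
  move=> pf fH; split; first exact: (polyf_shift (- x 0) pf).
  by move=> g u gH; rewrite -{1}(xfix g gH) -mulmxBr fH.
have nqH : inv H (@nq R n) by move=> g u gH; rewrite nq_orth //; apply: (grpO HG).
(* This is where [2 <= d] enters: [(r + 1) * d >= 2], so the squared distance to the fixed point is
   of class C^2 and is [O(t ^ 2)]. *)
have rho2 : Ck 2 0 (fun t => nq (x t - x 0)).
  have [p1 p2] := invB _ (polyf_nq _ _) nqH.
  apply: cl_le (gx _ p1 p2); rewrite mulSn; exact: leq_trans (leq_addr _ _).
have [C C0 hC] : exists2 C, 0 <= C & \forall t \near 0, nq (x t - x 0) <= C * t ^+ 2.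
  by apply: sq_bound rho2 _ _ => [t|]; rewrite ?nq_ge0 // subrr nq0.
pose z t := t^-1 *: (x t - x 0).
have zC : \forall t \near 0^', nq (z t) <= (C + 1) ^+ 2.
  have hC' : \forall t \near (0 : R)^', nq (x t - x 0) <= C * t ^+ 2.
    by apply: filterS hC.
  near=> t; have t0 : t != 0 by near: t; exact: nbhs_dnbhs_neq.
  have : nq (x t - x 0) <= C * t ^+ 2 by near: t.
  rewrite nqZ exprVn ler_pdivrMl ?exprn_even_gt0 // [t ^+ 2 * _]mulrC => /le_trans.
  by apply; rewrite ler_wpM2r ?sqr_ge0 //; nra.
have zM : \forall t \near 0^', forall i, `|z t i 0| <= C + 1.
  by apply: filterS zC => t h i; apply: coord_le_nq h; rewrite addr_ge0.
have [G [GU FG [a za]]] := ultra_cvc (at_right_proper_filter 0) (right_dnbhs zM).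
exists a; last by exists G.
have GP := @ultra_proper _ _ GU.
apply: (cl_gen (germ_calculus 0) genH) => f [pf fH [m [m0 md hf]]].
have [p1 p2] := invB f pf fH.
(* Of the [(r + 1) * d] derivatives, [m] are spent on dividing by [t ^ m] and [d - m] are left
   over. *)
have cphi : Ck (r * d + (d - m) + m) 0 (fun t => f (x t - x 0)).
  by rewrite -addnA subnK // addnC -mulSn; apply: (gx _ p1 p2).
have [D [D0 hD]] := polyf_bound (C + 1) pf.
have fz t : t != 0 -> f (x t - x 0) = t ^+ m * f (z t).
  by move=> t0; rewrite -hf /z scalerA mulfV // scale1r.
have [|h ch fh] := Ck_divn (C := D) cphi.
  near=> t; have t0 : t != 0 by near: t; exact: nbhs_dnbhs_neq.
  rewrite fz // normrM normrX mulrC ler_wpM2r ?exprn_ge0 // hD //.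
  by near: t.
have fzh t : t != 0 -> f (z t) = h t.
  by move=> t0; apply: (mulfI (expf_neq0 m t0)); rewrite -fz // fh.
have fa : f a = h 0.
  have c1 : f (z t) @[t --> G] --> f a by exact: (polyf_cvc pf za).
  have c2 : h t @[t --> G] --> h 0.
    apply: cvg_trans (Ck_cont ch); apply: cvg_app.
    by move=> P [e /= e0 he]; apply: FG; exists e => // t te /= t0; apply: he.
  have c3 : f (z t) @[t --> G] --> h 0.
    apply: cvg_trans c2; apply: near_eq_cvg; apply: FG.
    by near=> t; rewrite fzh // gt_eqF //; near: t; exact: nbhs_right_gt.
  exact: (cvg_unique _ c1 c3).
apply: cl_ext' (cl_le (leq_addr (d - m) _) ch); first exact: germ_calculus.
move=> [[] t] /=; case: (t =P 0) => [->//|/eqP t0]; exact/esym/fzh.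
Unshelve. all: by end_near. Qed.

Lemma lift_limits H x : isgrp H -> gcurve 0 H x 0 ->
  (\forall t \near 0^', ccont x t) ->
  exists gR gL, [/\ gR \in H, gL \in H, cvc 0^'+ x (gR *m x 0) &
    cvc 0^'+ (fun t => x (- t)) (gL *m x 0)].
Proof.
move=> HG gx cx.
have fx f : polyf f -> inv H f -> {for 0, continuous (fun t => f (x t))}.
  by move=> pf fH; exact: Ck_cont (gx f pf fH).
have [gR gRH xR] : exists2 g, g \in H & cvc 0^'+ x (g *m x 0).
  apply: lift_limit => //; last exact: right_dnbhs.
  by move=> f pf fH; exact: cvg_within_filter (fx f pf fH).
have cN (t : R) : - s @[s --> t] --> - t by apply: cvgN; exact: cvg_id.
have [gL gLH xL] : exists2 g, g \in H & cvc 0^'+ (fun t => x (- t)) (g *m x (- 0)).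
  apply: (lift_limit (x := fun t => x (- t))) => // [f pf fH|].
    apply: cvg_within_filter.
    apply: (@continuous_comp _ _ _ (fun t : R => - t) (fun t => f (x t))).
      exact: cN.
    by rewrite oppr0; exact: fx.
  apply: right_dnbhs; apply: filterS (dnbhs_opp cx) => t ct i.
  by apply: (@continuous_comp _ _ _ (fun t : R => - t) (fun s => x s i 0));
    [exact: cN | exact: ct].
by rewrite oppr0 in xL; exists gR, gL.
Qed.

Lemma jet0 (F : set_system R) {FF : Filter F} a x v : cvc F x v -> a 0%N = v ->
  jet F 0 a x.
Proof.
move=> xv av.
apply: (cvc_eq (u := fun h => x h + - v)).
  by apply: nearW => h; rewrite big_ord1 expr0 invr1 !scale1r av.
by rewrite -(subrr v); apply: cvcD => //; exact: cvc_cst.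
Qed.

(** Induction on [r]: the blow-up has regular invariants for the isotropy group of the limit [v],
    and its expansion of order [r] is the one of order [r + 1] shifted by one. The two sides need
    not fit together; [w] records the mismatch between the left expansion and the right one. *)
Theorem lift_jets r d H x : isgrp H -> gen d H -> (2 <= d)%N ->
  gcurve (r * d) H x 0 -> (\forall t \near 0^', ccont x t) ->
  exists a w, [/\ w \in H, exists2 g, g \in H & a 0%N = g *m x 0,
    jet 0^'+ r a x &
    jet 0^'+ r (fun j => (-1) ^+ j *: (w *m a j)) (fun t => x (- t))].
Proof.
elim: r H x => [|r IH] H x HG genH d2 gx cx.
  have [gR [gL [gRH gLH xR xL]]] := lift_limits HG gx cx.
  exists (fun=> gR *m x 0), (gL *m gR^T); split.
  - by apply: (grpM HG) => //; apply: (grpT HG).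
  - by exists gR.
  - exact: jet0 xR _.
  - apply: jet0 xL _; rewrite expr0 scale1r -mulmxA orthTK //; exact: (grpO HG).
have gx0 : gcurve 0 H x 0 by move=> f pf fH; apply: cl_le (gx f pf fH).
have [gR [gL [gRH gLH xR xL]]] := lift_limits HG gx0 cx.
set v := gR *m x 0 in xR.
(* Carries the left limit [gL *m x 0] to the right limit [v]. *)
pose w1 := gR *m gL^T.
have w1H : w1 \in H by apply: (grpM HG) => //; apply: (grpT HG).
pose y t := if t == 0 then v else if 0 < t then x t else w1 *m x t.
have yx t f : inv H f -> f (x t) = f (y t).
  by rewrite /y => fH; case: eqP => [->|_]; [|case: ifP => _]; rewrite ?fH.
have gy : gcurve (r.+1 * d) H y 0 by apply: inv_gcurve gx => t f; apply: yx.
have yR : cvc 0^'+ y v.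
  apply: (cvc_eq _ xR); near=> t; have t0 : 0 < t by near: t; exact: nbhs_right_gt.
  by rewrite /y gt_eqF // t0.
have yL : cvc 0^'+ (fun t => y (- t)) v.
  have -> : v = w1 *m (gL *m x 0).
    by rewrite /w1 -mulmxA orthTK //; exact: (grpO HG).
  have h : cvc 0^'+ (fun t => w1 *m x (- t)) (w1 *m (gL *m x 0)) by exact: cvc_mulmx.
  apply: (cvc_eq _ h); near=> t.
  have t0 : 0 < t by near: t; exact: nbhs_right_gt.
  by rewrite /y lt_eqF ?oppr_lt0 // ltNge oppr_le0 (ltW t0).
have y0 : y 0 = v by rewrite /y eqxx.
have cy0 : ccont y 0.
  move=> i; apply/continuous_withinNx; rewrite y0.
  by apply: cvg_dnbhs0; [exact: yR | exact: yL].
have cy : \forall t \near 0^', ccont y t.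
  have cx' : \forall t \near (0 : R)^', ccont x t := cx.
  near=> t; have t0 : t != 0 by near: t; exact: nbhs_dnbhs_neq.
  have cxt : ccont x t by near: t.
  case: (ltgtP t 0) t0 => // t0 _.
    apply: (@ccont_eq (fun s => w1 *m x s)).
      near=> s; have s0 : s < 0 by near: s; exact: lt_nbhsl.
      by rewrite /y lt_eqF // ltNge ltW.
    by move=> i; exact: (ccont_polyf (polyf_comp_lin w1 (polyf_coord R i)) cxt).
  apply: (@ccont_eq x) => //.
  near=> s; have s0 : 0 < s by near: s; exact: lt_nbhsr.
  by rewrite /y gt_eqF // s0.
have cyn : \forall t \near 0, ccont y t.
  move: cy; rewrite near_withinE; apply: filterS => t ct.
  by have [->|/ct] := eqVneq t 0.
have gS : gcurve (r.+1 * d) (stab H v) y 0.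
  rewrite -y0; apply: gcurve_slice => //; apply: filterS cyn => s cs.
  exact: (ccont_polyf (polyf_nqB (y 0)) cs).
have SG := isgrp_stab v HG.
have [|a ga [G [GU FG Ga]]] := lift_blowup SG (gen_stab (v := v) HG genH) d2 gS _ cy0.
  by rewrite y0 => h /stab_fix.
set z := fun t => _ in ga.
have zE t : t != 0 -> y t = v + t *: z t.
  move=> t0; rewrite /z (negbTE t0) scalerA mulfV // scale1r y0.
  by rewrite addrC subrK.
have cz : \forall t \near 0^', ccont z t.
  near=> t; have t0 : t != 0 by near: t; exact: nbhs_dnbhs_neq.
  have ct : ccont y t by near: t.
  apply: (@ccont_eq (fun s => s^-1 *: (y s - v))).
    near=> s; rewrite /z ifF ?y0 //; apply/negbTE; near: s.
    by apply: (@cvgr_neq0 _ _ _ _ _ (fun u => u) t) => //; exact: cvg_id.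
  apply: cvcZ; first by apply: cvgV => //; exact: cvg_id.
  by apply: cvcD; [exact: ct | exact: cvc_cst].
have [b [w2 [w2S [g2 g2S b0] jR jL]]] := IH _ _ SG (gen_stab (v := v) HG genH) d2 ga cz.
have w2v : w2 *m v = v := stab_fix w2S.
(* The constant term [v] is fixed by [w2], so that the single element [w1^T *m w2] serves for all
   the coefficients. *)
exists (fun j => if j is j'.+1 then b j' else v), (w1^T *m w2); split.
- by apply: (grpM HG); [exact: (grpT HG) | exact: stab_sub w2S].
- by exists gR.
- apply: (cvc_eq _ jR); near=> h.
  have h0 : 0 < h by near: h; exact: nbhs_right_gt.
  have hn0 : h != 0 by rewrite gt_eqF.
  have -> : x h = y h by rewrite /y gt_eqF // h0.
  rewrite zE // [in RHS]big_ord_recl expr0 scale1r opprD addrACA subrr add0r.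
  rewrite [in RHS](eq_bigr (fun j : 'I_r.+1 => h *: (h ^+ j *: b j))); last first.
    by move=> j _; rewrite scalerA -exprS.
  rewrite -scaler_sumr -scalerBr scalerA exprSr invfM -mulrA mulVf ?mulr1 //.
- apply: (cvc_eq (u := fun h => - (w1^T *m ((h ^+ r)^-1 *:
      (z (- h) - \sum_(j < r.+1) h ^+ j *: ((-1) ^+ j *: (w2 *m b j))))))).
    near=> h.
    have h0 : 0 < h by near: h; exact: nbhs_right_gt.
    have hn0 : h != 0 by rewrite gt_eqF.
    have -> : x (- h) = w1^T *m y (- h).
      rewrite /y lt_eqF ?oppr_lt0 // ltNge oppr_le0 (ltW h0) /= orthTK //.
      exact: (grpO HG).
    rewrite zE ?oppr_eq0 // [in RHS]big_ord_recl !expr0 !scale1r -mulmxA w2v.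
    rewrite mulmxDr opprD addrACA subrr add0r.
    rewrite [in RHS](eq_bigr (fun j : 'I_r.+1 => - h *: (w1^T *m
        (h ^+ j *: ((-1) ^+ j *: (w2 *m b j)))))); last first.
      move=> j _; rewrite /= -mulmxA -!scalemxAr !scalerA; congr (_ *: _).
      by rewrite !exprS; ring.
    rewrite -scaler_sumr -mulmx_sumr -!scalemxAr -scalerBr -mulmxBr scalerA.
    rewrite -scaleNr; congr (_ *: _).
    by rewrite exprSr invfM mulrN -mulrA mulVf ?mulr1.
  have FF : Filter (0^'+ : set_system R) by apply: filter_filter.
  have h := @cvc_mulmx R n R 0^'+ FF _ 0 w1^T jL; rewrite mulmx0 in h.
  by have h' := @cvcN R n R 0^'+ FF _ 0 h; rewrite oppr0 in h'.
Unshelve. all: by end_near. Qed.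

End Jets.

(** * Gluing local solutions on the line *)

Section Gluing.
Variables (R : realType) (E : Type) (P : (R -> E) -> R -> Prop).
Implicit Types (y z : R -> E) (t s b : R).

Definition local_prop := forall y z t,
  (\forall s \near t, y s = z s) -> P y t -> P z t.

Definition extends_right b := forall y e, 0 < e ->
  (forall t, b - e < t < b -> P y t) ->
  exists z e', [/\ 0 < e', forall t, t < b -> z t = y t &
    forall t, b <= t < b + e' -> P z t].

(** Zorn's lemma on solutions over intervals starting at [t0], ordered by extension: a maximal one
    reaches every point of [J], since otherwise it could be extended beyond its supremum. *)
Lemma glue_right (J : set R) (t0 : R) (y0 : R -> E) (e0 : R) :
  local_prop -> open J -> (forall a b t, J a -> J b -> a <= t <= b -> J t) ->
  J t0 -> 0 < e0 -> (forall t, t0 < t < t0 + e0 -> P y0 t) ->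
  (forall b, J b -> t0 < b -> extends_right b) ->
  exists y, forall t, J t -> t0 < t -> P y t.
Proof.
move=> loc Jo Jc Jt0 e00 Py0 ext.
have nJ b : J b -> exists2 d, 0 < d & forall t, `|b - t| < d -> J t.
  by move=> Jb; have /nbhs_ballP[d /= d0 hd] := open_nbhs_nbhs (conj Jo Jb); exists d.
(* The intervals are open at [t0] and have no largest element, so that a union of a chain is of the
   same kind and [P], being local, passes to it. *)
pose valid (q : set R * (R -> E)) := [/\ q.1 !=set0,
  forall t, q.1 t -> t0 < t /\ J t,
  forall t, q.1 t -> forall s, t0 < s <= t -> q.1 s,
  forall t, q.1 t -> exists2 t', q.1 t' & t < t' &
  forall t, q.1 t -> P q.2 t].
pose T := {q : set R * (R -> E) | valid q}.
pose le (p q : T) : bool := `[< (sval p).1 `<=` (sval q).1 /\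
  forall t, (sval p).1 t -> (sval p).2 t = (sval q).2 t >].
have [d0 d00 hd0] := nJ t0 Jt0.
have q0P : valid ([set t | t0 < t < t0 + Num.min e0 d0], y0).
  have m0 : 0 < Num.min e0 d0 by rewrite lt_min e00.
  split => /=.
  - by exists (t0 + Num.min e0 d0 / 2); rewrite /= ltrDl ltrD2l ltr_pdivrMr ?ltr_pMr ?ltr1n ?divr_gt0.
  - move=> t /andP[t1 t2]; split=> //; apply: hd0.
    rewrite ltr0_norm ?subr_lt0 // opprB ltrBlDl (lt_le_trans t2) // lerD2l.
    by rewrite ge_min lexx orbT.
  - by move=> t /andP[t1 t2] s /andP[s1 s2]; rewrite s1 (le_lt_trans s2).
  - move=> t /andP[t1 t2]; exists ((t + (t0 + Num.min e0 d0)) / 2); last lra.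
    by apply/andP; split; lra.
  - move=> t /andP[t1 t2]; apply: Py0; rewrite t1 (lt_le_trans t2) // lerD2l.
    by rewrite ge_min lexx.
pose q0 : T := exist _ _ q0P.
have [||A totA|[[K y] Kv] Kmax] := @ZL_preorder T q0 le.
- by move=> q; apply/asboolP; split.
- move=> q1 q2 q3 /asboolP[h1 h2] /asboolP[h3 h4]; apply/asboolP; split.
    exact: subset_trans h1 h3.
  by move=> t qt; rewrite h2 // h4 //; apply: h1.
- have [[q1 Aq1]|nA] := pselect (exists q, A q); last first.
    by exists q0 => s As; case: nA; exists s.
  pose K := [set t | exists2 q, A q & (sval q).1 t].
  pose sel t : T := match pselect (exists2 q, A q & (sval q).1 t) with
    | left h => sval (cid2 h) | right _ => q0 end.
  have selP t : K t -> A (sel t) /\ (sval (sel t)).1 t.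
    by rewrite /sel; case: pselect => // h _; case: cid2.
  pose y t := (sval (sel t)).2 t.
  have yE q t : A q -> (sval q).1 t -> y t = (sval q).2 t.
    move=> Aq qt; have [As st] : A (sel t) /\ (sval (sel t)).1 t by apply: selP; exists q.
    by case: (totA _ _ Aq As) => /asboolP[h1 h2]; rewrite /y h2.
  have Kv : valid (K, y).
    split => /=.
    + by have [[t qt] _ _ _ _] := svalP q1; exists t, q1.
    + by move=> t [q Aq qt]; have [_ h _ _ _] := svalP q; apply: h.
    + move=> t [q Aq qt] s st; exists q => //.
      by have [_ _ h _ _] := svalP q; apply: h st.
    + move=> t [q Aq qt]; have [_ _ _ h _] := svalP q.
      by have [t' qt' tt'] := h t qt; exists t' => //; exists q.
    + move=> t [q Aq qt]; have [_ h1 h2 h3 h4] := svalP q.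
      have [t' qt' tt'] := h3 t qt; have [t0t _] := h1 t qt.
      apply: (loc (sval q).2); last exact: h4.
      near=> s; rewrite (yE q) //; apply: (h2 t' qt').
      apply/andP; split; first by near: s; exact: lt_nbhsr.
      by apply: ltW; near: s; exact: lt_nbhsl.
  exists (exist _ _ Kv) => q Aq; apply/asboolP; split=> /=.
    by move=> t qt; exists q.
  by move=> t qt; rewrite (yE q).
exists y => s Js t0s; apply: contrapT => nPs.
have [[k0 Kk0] K1 K2 K3 K4] := Kv; rewrite /= in k0 Kk0 K1 K2 K3 K4.
have nKs : ~ K s by move=> /K4.
have Ks k : K k -> k < s.
  move=> Kk; rewrite ltNge; apply/negP => sk; apply: nKs.
  by apply: (K2 k) => //; rewrite t0s.
have hK : has_sup K by split; [exists k0 | exists s => k /Ks /ltW].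
pose b := sup K.
have Kb k : K k -> k < b.
  move=> Kk; have [k' Kk' kk'] := K3 k Kk; apply: (lt_le_trans kk').
  by apply: ub_le_sup => //; case: hK.
have t0b : t0 < b by apply: lt_trans (Kb _ Kk0); have [] := K1 _ Kk0.
have bs : b <= s by apply: ge_sup => //; [exists k0 | move=> k /Ks /ltW].
have Jb : J b by apply: (Jc t0 s) => //; rewrite (ltW t0b).
have below t : t0 < t -> t < b -> K t.
  move=> t0t tb; have e' : 0 < b - t by rewrite subr_gt0.
  have [k Kk] := sup_adherent e' hK; rewrite opprB addrCA subrr addr0 => tk.
  by apply: (K2 k Kk); rewrite t0t ltW.
have [||z [e' [e'0 zy Pz]]] := ext b Jb t0b y (b - t0).
- by rewrite subr_gt0.
- by move=> t /andP[]; rewrite opprB addrCA subrr addr0 => t1 t2; apply: K4; apply: below.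
have [d d00' hd] := nJ b Jb.
pose m := Num.min e' d; have m0 : 0 < m by rewrite lt_min e'0.
have zv : valid ([set t | t0 < t < b + m], z).
  split => /=.
  - by exists b; rewrite /= t0b ltrDl.
  - move=> t /andP[t1 t2]; split=> //; case: (ltP t b) => [tb|bt].
      by have [] := K1 t (below t t1 tb).
    apply: hd; rewrite ler0_norm ?subr_le0 // opprB ltrBlDl (lt_le_trans t2) //.
    by rewrite lerD2l ge_min lexx orbT.
  - by move=> t /andP[t1 t2] u /andP[u1 u2]; rewrite u1 (le_lt_trans u2).
  - move=> t /andP[t1 t2]; exists ((t + (b + m)) / 2); last lra.
    by apply/andP; split; lra.
  - move=> t /andP[t1 t2]; case: (ltP t b) => [tb|bt].
      apply: (loc y); last by apply: K4; apply: below.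
      by near=> u; rewrite zy //; near: u; exact: lt_nbhsl.
    by apply: Pz; rewrite bt (lt_le_trans t2) // lerD2l ge_min lexx.
have : le (exist _ _ zv) (exist _ _ Kv).
  apply: Kmax; apply/asboolP; split=> /= [t Kt|t Kt].
    have [t0t _] := K1 t Kt.
    by rewrite /= t0t (lt_trans (Kb _ Kt)) // ltrDl.
  by rewrite zy //; apply: Kb.
move=> /asboolP[/= /(_ b)]; rewrite /= t0b ltrDl => /(_ m0) /Kb.
by rewrite ltxx.
Unshelve. all: by end_near. Qed.

End Gluing.

Section GluingOpen.
Variables (R : realType) (E : Type) (P : (R -> E) -> R -> Prop).
Implicit Types (y z : R -> E) (t s b : R).

(** The adjustment [w] preserves [P]. Both variants are asked for, because solutions are extended to
    the right as well as to the left, and what has been constructed must not be changed. *)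
Definition glues b := forall y1 y2 e, 0 < e ->
  (forall t, b - e < t < b -> P y1 t) -> (forall t, b < t < b + e -> P y2 t) ->
  (exists z w, [/\ forall y t, P y t -> P (w \o y) t, P z b,
     forall t, t < b -> z t = y1 t & forall t, b < t -> z t = w (y2 t)]) /\
  (exists z w, [/\ forall y t, P y t -> P (w \o y) t, P z b,
     forall t, b < t -> z t = y2 t & forall t, t < b -> z t = w (y1 t)]).

Definition sided_sol b := exists y1 y2 e, [/\ 0 < e,
  forall t, b - e < t < b -> P y1 t & forall t, b < t < b + e -> P y2 t].

Definition component (U : set R) t :=
  [set s | forall c, Num.min t s <= c <= Num.max t s -> U c].

Lemma componentP U t a b c : component U t a -> component U t b -> a <= c <= b ->
  component U t c.
Proof.
move=> Ja Jb /andP[ac cb] u; rewrite ge_min le_max => /andP[h1 h2].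
have [ut|tu] := leP u t.
  apply: Ja; rewrite ge_min le_max ut /=; case/orP: h1 => h1.
    by rewrite h1.
  by rewrite (le_trans ac h1) orbT.
apply: Jb; rewrite ge_min le_max (ltW tu) /=; case/orP: h2 => h2.
  by rewrite h2.
by rewrite (le_trans h2 cb) orbT.
Qed.

Lemma component_refl U t : U t -> component U t t.
Proof. by move=> Ut c; rewrite minxx maxxx => /le_anti <-. Qed.

Lemma component_sub U t s : component U t s -> U s.
Proof. by apply; rewrite ge_min le_max lexx !orbT. Qed.

Lemma component_eq U t s : component U t s -> component U s = component U t.
Proof.
have imp a b : component U a b -> component U b `<=` component U a.
  move=> Jab u Jbu c; rewrite ge_min le_max => /andP[h1 h2].
  have [cb|bc] := leP c b; have [ca|ac] := leP c a.
  - case/orP: h1 => h1; first by apply: Jab; rewrite ge_min le_max h1 ca.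
    by apply: Jbu; rewrite ge_min le_max h1 cb orbT.
  - by apply: Jab; rewrite ge_min le_max (ltW ac) cb orbT.
  - by apply: Jab; rewrite ge_min le_max (ltW bc) ca orbT.
  - case/orP: h2 => h2; first by rewrite ltNge h2 in ac.
    by apply: Jbu; rewrite ge_min le_max h2 (ltW bc) orbT.
have sym a b : component U a b -> component U b a.
  by move=> Jab c; rewrite minC maxC; apply: Jab.
by move=> Jts; apply/seteqP; split; [exact: imp | apply: imp; exact: sym].
Qed.

Lemma component_open U t : open U -> open (component U t).
Proof.
move=> Uo; rewrite openE => s Js.
have /nbhs_ballP[d /= d0 hd] := open_nbhs_nbhs (conj Uo (component_sub Js)).
apply/nbhs_ballP; exists d => // u /= su; rewrite -(component_eq Js) => c.
rewrite ge_min le_max => /andP[h1 h2]; apply: hd; rewrite /ball /= in su *.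
apply: le_lt_trans su.
case/orP: h1 => h1; case/orP: h2 => h2.
- have -> : c = s by apply: le_anti; rewrite h1 h2.
  by rewrite subrr normr0.
- by rewrite !ler0_norm ?subr_le0 // ?(le_trans h1) // lerN2 lerD2l lerN2.
- by rewrite !ger0_norm ?subr_ge0 // ?(le_trans h1) // lerD2l lerN2.
- have -> // : c = u by apply: le_anti; rewrite h1 h2.
Qed.

Lemma glue_open (U : set R) (dflt : E) : local_prop P -> open U ->
  (forall b, U b -> glues b) -> (forall b, U b -> sided_sol b) ->
  exists y, forall t, U t -> P y t.
Proof.
move=> loc Uo Ugl Usol.
have sol t0 : U t0 -> exists y, forall t, component U t0 t -> P y t.
  move=> Ut0; set J := component U t0.
  have JU t : J t -> U t by exact: component_sub.
  have Jo : open J by exact: component_open.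
  have [y1 [y2 [e [e0 h1 h2]]]] := Usol t0 Ut0.
  have [yr Pyr] : exists y, forall t, J t -> t0 < t -> P y t.
    apply: (@glue_right R E P J t0 y2 e) => //.
    - by move=> a b t Ja Jb; apply: componentP Ja Jb.
    - exact: component_refl.
    - move=> b Jb _ y e' e'0 Py; have [_ [z2 [e2 [e20 _ k2]]]] := Usol b (JU b Jb).
      have m0 : 0 < Num.min e' e2 by rewrite lt_min e'0.
      have [||[z [w [wP Pz zl zr]]] _] := Ugl b (JU b Jb) y z2 _ m0.
      + move=> t /andP[t1 t2]; apply: Py; rewrite t2 andbT (le_lt_trans _ t1) //.
        by rewrite lerD2l lerN2 ge_min lexx.
      + move=> t /andP[t1 t2]; apply: k2; rewrite t1 (lt_le_trans t2) // lerD2l.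
        by rewrite ge_min lexx orbT.
      + exists z, e2; split=> // t /andP[]; rewrite le_eqVlt => /orP[/eqP<- //|bt] tb.
        apply: (loc (w \o z2)); last by apply: wP; apply: k2; rewrite bt.
        by near=> s; rewrite /= zr //; near: s; exact: lt_nbhsr.
  (* The left half is the right half for reversed time. *)
  pose P' (y : R -> E) t := P (fun s => y (- s)) (- t).
  have cN (t : R) : - s @[s --> t] --> - t by apply: cvgN; exact: cvg_id.
  have loc' : local_prop P'.
    move=> y z t yz; apply: loc.
    have : \forall s \near - - t, y s = z s by rewrite opprK.
    by move=> /cN.
  have [yl Pyl] : exists y, forall t, J (- t) -> - t0 < t -> P' y t.
    apply: (@glue_right R E P' [set t | J (- t)] (- t0) (fun s => y1 (- s)) e) => //.
    - by apply: open_comp => // t _; exact: cN.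
    - move=> a b t Ja Jb /andP[at_ tb]; apply: componentP Jb Ja _.
      by rewrite !lerN2 at_ tb.
    - by rewrite /= opprK; exact: component_refl.
    - move=> t /andP[a1 a2]; rewrite /P' (_ : (fun s => _) = y1); last first.
        by apply/funext => s; rewrite opprK.
      apply: h1; lra.
    - move=> b Jb _ y e' e'0 Py.
      have [z1 [_ [e2 [e20 k1 _]]]] := Usol (- b) (JU _ Jb).
      have m0 : 0 < Num.min e' e2 by rewrite lt_min e'0.
      have me' : Num.min e' e2 <= e' by rewrite ge_min lexx.
      have me2 : Num.min e' e2 <= e2 by rewrite ge_min lexx orbT.
      have [||_ [z [w [wP Pz zr zl]]]] := Ugl (- b) (JU _ Jb) z1 (fun s => y (- s)) _ m0.
      + by move=> t /andP[t1 t2]; apply: k1; rewrite t2 andbT; lra.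
      + move=> t /andP[t1 t2]; have : P' y (- t) by apply: Py; apply/andP; split; lra.
        by rewrite /P' opprK.
      + exists (fun s => z (- s)), e2; split=> //.
          by move=> t tb; rewrite zr ?ltrN2 // opprK.
        have zN : (fun s => z (- - s)) = z by apply/funext => s; rewrite opprK.
        move=> t /andP[]; rewrite le_eqVlt /P' zN => /orP[/eqP<- //|bt] tb.
        apply: (loc (w \o z1)); last by apply: wP; apply: k1; apply/andP; split; lra.
        near=> s; rewrite /= zl //; near: s; apply: lt_nbhsl; lra.
  pose yl' s := yl (- s).
  have Pyl' t : J t -> t < t0 -> P yl' t.
    move=> Jt tt0; have : P' yl (- t) by apply: Pyl; rewrite ?opprK ?ltrN2.
    by rewrite /P' opprK.
  have [d d0 hd] : exists2 d, 0 < d & forall t, `|t0 - t| < d -> J t.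
    have Jt0 : J t0 by exact: component_refl.
    by have /nbhs_ballP[d /= d0 hd] := open_nbhs_nbhs (conj Jo Jt0); exists d.
  have [||[z [w [wP Pz zl zr]]] _] := Ugl t0 Ut0 yl' yr _ d0.
  - move=> t /andP[a1 a2]; apply: Pyl' => //; apply: hd.
    rewrite ger0_norm; lra.
  - move=> t /andP[a1 a2]; apply: Pyr => //; apply: hd.
    rewrite ler0_norm; lra.
  exists z => t Jt; case: (ltgtP t t0) => [tt0|t0t|->//].
    apply: (loc yl'); last exact: Pyl'.
    by near=> s; rewrite zl //; near: s; exact: lt_nbhsl.
  apply: (loc (w \o yr)); last by apply: wP; exact: Pyr.
  by near=> s; rewrite /= zr //; near: s; exact: lt_nbhsr.
(* The solution is chosen as a function of the component as a set, so that all the points of a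
   component receive the same one. *)
pose L (J : set R) := match pselect (exists y, forall t, J t -> P y t) with
  | left h => sval (cid h) | right _ => fun=> dflt end.
exists (fun t => L (component U t) t) => t Ut.
apply: (loc (L (component U t))); last first.
  rewrite /L; case: pselect => [h|nh]; last by case: nh; exact: sol.
  by apply: (svalP (cid h)); exact: component_refl.
have : \forall s \near t, component U t s.
  apply: open_nbhs_nbhs; split; last exact: component_refl.
  exact: component_open.
by apply: filterS => s /component_eq ->.
Unshelve. all: by end_near. Qed.

End GluingOpen.

(** * Existence of lifts with jets *)

Section LiftExists.
Variables (R : realType) (n : nat).
Notation E := 'cV[R]_n.
Implicit Types (H : seq 'M[R]_n) (x y z : R -> E) (v : E) (t s : R).

Lemma seq_min (T : eqType) (F : T -> R) (l : seq T) c : c \in l ->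
  exists2 m, m \in l & forall u, u \in l -> F m <= F u.
Proof.
elim: l c => // a l IH c _; case: l IH => [|b l] IH.
  by exists a; rewrite ?mem_head // => u; rewrite inE => /eqP ->.
have [m ml hm] := IH b (mem_head _ _).
have [am|ma] := leP (F a) (F m).
  exists a; rewrite ?mem_head // => u; rewrite inE => /orP[/eqP->//|/hm].
  exact: le_trans.
exists m; first by rewrite inE ml orbT.
by move=> u; rewrite inE => /orP[/eqP->|/hm//]; exact: ltW.
Qed.

Lemma near_all_seq (T : Type) (F : set_system T) {FF : Filter F} (A : eqType)
    (l : seq A) (P : A -> T -> Prop) :
  (forall a, a \in l -> \forall t \near F, P a t) ->
  \forall t \near F, forall a, a \in l -> P a t.
Proof.
elim: l => [|a l IH] h; first by apply: nearW.
have h1 : \forall t \near F, forall a, a \in l -> P a t.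
  by apply: IH => b bl; apply: h; rewrite inE bl orbT.
apply: filterS2 h1 (h a (mem_head _ _)) => t h1 h2 b.
by rewrite inE => /orP[/eqP->|/h1].
Qed.

Lemma nearest H x v : isgrp H -> exists a : R -> E, forall t,
  (exists2 g, g \in H & a t = g *m x t) /\
  forall g, g \in H -> nq (a t - v) <= nq (g *m x t - v).
Proof.
move=> HG.
have h t : exists a, (exists2 g, g \in H & a = g *m x t) /\
    forall g, g \in H -> nq (a - v) <= nq (g *m x t - v).
  have [m mH hm] := seq_min (fun g => nq (g *m x t - v)) (grp1 HG).
  by exists (m *m x t); split=> //; exists m.
by exists (fun t => sval (cid (h t))) => t; exact: (svalP (cid (h t))).
Qed.

Lemma nearest_cvg H x s : isgrp H -> gcurve 0 H x s ->
  exists a : R -> E, (forall t, exists2 g, g \in H & a t = g *m x t) /\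
    cvc (nbhs s) a (x s).
Proof.
move=> HG gx; have [a ha] := nearest x (x s) HG; exists a.
split=> [t|]; first by case: (ha t).
apply/cvc_nq; apply/cvgrPdist_lt => e e0.
have cd : dorb (orb H (x s)) (x t) @[t --> s] --> 0.
  have h := Ck_cont (gx _ (polyf_dorb _) (inv_dorb (x s) HG)).
  by rewrite /prop_for /continuous_at (dorb0 (orb_refl HG (x s))) in h.
have : \forall t \near s, dorb (orb H (x s)) (x t) < e ^+ size (orb H (x s)).
  by have /cvgr_lt := cd; apply; exact: exprn_gt0.
apply: filterS => t /(dorb_lt e0)[u /mem_orb[g gH ->] xt].
rewrite sub0r normrN ger0_norm ?nq_ge0 //.
have [_ /(_ _ (grpT HG gH))] := ha t; move/le_lt_trans; apply.
have og := grpO HG gH.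
by rewrite -(nq_orth (_ - x s) og) mulmxBr orthKT.
Qed.

(** The nearest point of the orbit may jump, but its distance to [v] is a minimum over [H] of
    distances that converge, as is seen on the convergent representatives [b]. *)
Lemma nearest_cont H x v (a : R -> E) s : isgrp H -> gcurve 0 H x s ->
  (forall t, (exists2 g, g \in H & a t = g *m x t) /\
    forall g, g \in H -> nq (a t - v) <= nq (g *m x t - v)) ->
  {for s, continuous (fun t => nq (a t - v))}.
Proof.
move=> HG gx ha; have [b [bx bs]] := nearest_cvg HG gx.
have cb g : nq (g *m b t - v) @[t --> s] --> nq (g *m x s - v).
  have pf : polyf (fun u : E => nq (g *m u - v)).
    exact: (polyf_comp_lin g (polyf_nqB v)).
  exact: (polyf_cvc pf bs).
have aH t g : g \in H -> nq (a t - v) <= nq (g *m b t - v).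
  by have [h hH ->] := bx t => gH; rewrite mulmxA; apply: (ha t).2; apply: (grpM HG).
have [[gs gsH asE] mins] := ha s.
apply/cvgrPdist_lt => e e0.
have up : \forall t \near s, nq (gs *m b t - v) < nq (a s - v) + e.
  by have /cvgr_lt := cb gs; apply; rewrite -asE ltrDl.
have low : \forall t \near s, forall g, g \in H -> nq (a s - v) - e < nq (g *m b t - v).
  apply: (@near_all_seq R (nbhs s) _ 'M[R]_n H (fun (g : 'M[R]_n) t => nq (a s - v) - e < nq (g *m b t - v))) => g gH.
  have /cvgr_gt := cb g; apply.
  by have := mins g gH; lra.
apply: filterS2 up low => t up low.
have [g gH E1] : exists2 g, g \in H & a t = g *m b t.
  have [[g gH ->] _] := ha t; have [h hH ->] := bx t.
  exists (g *m h^T); first by apply: (grpM HG) => //; apply: (grpT HG).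
  by rewrite -mulmxA orthTK //; exact: (grpO HG).
have := low g gH; rewrite -E1 => l1; have := aH t gs gsH => l2.
by rewrite ltr_norml; apply/andP; split; lra.
Qed.

(** The slice theorem asks only for continuity of the distance to the centre, and the orbit point
    nearest to [x b] provides it without any continuous choice. *)
Lemma slice_near m H x (O : set R) b : isgrp H -> open O -> O b ->
  (forall t, O t -> gcurve m H x t) ->
  exists a e, [/\ 0 < e, forall t, exists2 g, g \in H & a t = g *m x t &
    forall t, b - e < t < b + e -> gcurve m (stab H (x b)) a t].
Proof.
move=> HG Oo Ob gx; set v := x b.
have gx0 t : O t -> gcurve 0 H x t.
  by move=> Ot f pf fH; apply: cl_le (gx t Ot f pf fH).
have [a ha] := nearest x v HG.
have [k k0 sep] := orb_sep H v.
have ab : a b = v.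
  have [_ /(_ _ (grp1 HG))] := ha b; rewrite mul1mx subrr nq0 => h.
  by apply/eqP; rewrite -subr_eq0 -nq_eq0 eq_le h nq_ge0.
have On : \forall t \near b, O t by exact: open_nbhs_nbhs.
have ce t : O t -> {for t, continuous (fun t => nq (a t - v))}.
  by move=> Ot; apply: (nearest_cont HG (gx0 t Ot)).
have ek : \forall t \near b, nq (a t - v) < k / 8.
  by have /cvgr_lt := ce b Ob; apply; rewrite ab subrr nq0 divr_gt0.
have [e /= e0 he] := filterI On ek.
exists a, e; split=> // [t|t /andP[t1 t2]]; first by case: (ha t).
have tin : \forall s \near t, O s /\ nq (a s - v) < k / 8.
  near=> s; apply: he; rewrite /ball /= ltr_norml; apply/andP; split.
    have : s < b + e by near: s; exact: lt_nbhsl.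
    by lra.
  have : b - e < s by near: s; exact: lt_nbhsr.
  by lra.
apply: (gcurve_slice_at HG k0 sep).
- move=> f pf fH; apply: Ck_eq (gx t (nbhs_singleton tin).1 f pf fH).
  by near=> s; have [[g gH ->] _] := ha s; rewrite fH.
- by apply: filterS tin => s [Os _]; exact: ce.
- by apply: filterS tin => s [_ /ltW].
Unshelve. all: by end_near. Qed.

Section JetLemmas.
Implicit Types (a : nat -> E) (u : R -> E).

Lemma jet_eq (F : set_system R) {FF : Filter F} r a u u' :
  (\forall h \near F, u h = u' h) -> jet F r a u -> jet F r a u'.
Proof.
move=> uu; apply: (cvc_eq _); by apply: filterS uu => h ->.
Qed.

Lemma jet_coefs (F : set_system R) r a a' u : (forall j, (j <= r)%N -> a j = a' j) ->
  jet F r a u -> jet F r a' u.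
Proof.
move=> aa; congr (cvc _ _ _); apply/funext => h; congr (_ *: (_ - _)).
by apply: eq_bigr => j _; rewrite aa // -ltnS.
Qed.

Lemma jet_mul (F : set_system R) {FF : Filter F} r a u (g : 'M[R]_n) :
  jet F r a u -> jet F r (fun j => g *m a j) (fun h => g *m u h).
Proof.
move=> ju; have h := @cvc_mulmx R n R F FF _ 0 g ju; rewrite mulmx0 in h.
congr (cvc _ _ _): h; apply/funext => t.
rewrite -scalemxAr mulmxBr mulmx_sumr; congr (_ *: (_ - _)).
by apply: eq_bigr => j _; rewrite -scalemxAr.
Qed.

Lemma jetS r a u : jet 0^'+ r.+1 a u -> jet 0^'+ r a u.
Proof.
move=> ju.
have FF : Filter (0^'+ : set_system R) by apply: filter_filter.
have c0 : h @[h --> (0 : R)^'+] --> (0 : R) by apply: cvg_within.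
pose w h := (h ^+ r.+1)^-1 *: (u h - \sum_(j < r.+2) h ^+ j *: a j).
have h1 := @cvcZ R n R 0^'+ FF _ 0 w 0 c0 ju.
have h2 := @cvcZ R n R 0^'+ FF _ 0 _ (a r.+1) c0 (@cvc_cst R n R 0^'+ FF (a r.+1)).
have h3 := @cvcD R n R 0^'+ FF _ _ _ _ h1 h2.
rewrite !scale0r addr0 in h3; apply: (cvc_eq _ h3); near=> h.
have h0 : h != 0 by rewrite gt_eqF //; near: h; exact: nbhs_right_gt.
have uE : u h - \sum_(j < r.+1) h ^+ j *: a j = h ^+ r.+1 *: w h + h ^+ r.+1 *: a r.+1.
  rewrite /w scalerA mulfV ?expf_neq0 // scale1r [in RHS]big_ord_recr /= opprD addrA.
  by rewrite subrK.
rewrite /= uE -!scalerDr scalerA; congr (_ *: _).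
by rewrite exprSr mulKf ?expf_neq0.
Unshelve. all: by end_near. Qed.

Lemma jet_le r k a u : (k <= r)%N -> jet 0^'+ r a u -> jet 0^'+ k a u.
Proof.
by move=> kr; rewrite -(subnK kr); elim: (r - k)%N => // l IH; rewrite addSn => /jetS /IH.
Qed.

Lemma jet_lim r k a u : (k <= r)%N -> jet 0^'+ r a u ->
  cvc 0^'+ (fun h => (h ^+ k)^-1 *: (u h - \sum_(j < k) h ^+ j *: a j)) (a k).
Proof.
move=> kr /(jet_le kr) ju.
have FF : Filter (0^'+ : set_system R) by apply: filter_filter.
have h1 := @cvcD R n R 0^'+ FF _ _ _ _ ju (@cvc_cst R n R 0^'+ FF (a k)).
rewrite add0r in h1; apply: (cvc_eq _ h1); near=> h.
have h0 : h != 0 by rewrite gt_eqF //; near: h; exact: nbhs_right_gt.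
rewrite big_ord_recr /= opprD addrA scalerBr scalerA mulVf ?expf_neq0 // scale1r.
by rewrite subrK.
Unshelve. all: by end_near. Qed.

Lemma jet_lim0 r a u : jet 0^'+ r a u -> cvc 0^'+ u (a 0%N).
Proof.
have FF : Filter (0^'+ : set_system R) by apply: filter_filter.
move=> /(jet_lim (leq0n r)); apply: cvc_eq; near=> h.
by rewrite big_ord0 subr0 expr0 invr1 scale1r.
Unshelve. all: by end_near. Qed.

(** The first nonzero coefficient would dominate the function near [0]. *)
Lemma jet_freq0 r a u : jet 0^'+ r a u ->
  (forall e, 0 < e -> exists2 h, 0 < h < e & u h = 0) ->
  forall j, (j <= r)%N -> a j = 0.
Proof.
move=> ju fr; elim/ltn_ind => j IH jr.
have lj := jet_lim jr ju.
apply/matrixP => i k; rewrite ord1 mxE; apply/eqP; apply: contraT => aj0.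
have := lj i => /cvgr_neq0 /(_ aj0) [e /= e0 he].
have [h /andP[h0 h1] uh] := fr e e0.
have /eqP[] : ((h ^+ j)^-1 *: (u h - \sum_(l < j) h ^+ l *: a l)) i 0 != 0.
  by apply: he => //=; rewrite sub0r normrN gtr0_norm.
rewrite uh sub0r big1 ?oppr0 ?scaler0 ?mxE // => l _.
by rewrite IH ?scaler0 // (leq_trans (ltnW (ltn_ord l))).
Qed.

End JetLemmas.
Definition hasjet r y t := exists a, [/\ a 0%N = y t,
  jet 0^'+ r a (fun h => y (t + h)) &
  jet 0^'+ r (fun j => (-1) ^+ j *: a j) (fun h => y (t - h))].

Definition good r H x y t := (exists2 g, g \in H & y t = g *m x t) /\ hasjet r y t.

Lemma near_shift0 (P : R -> Prop) t : (\forall s \near t, P s) ->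
  (\forall h \near 0^'+, P (t + h)) /\ (\forall h \near 0^'+, P (t - h)).
Proof.
move=> [e /= e0 he]; split; exists e => // h; rewrite /= sub0r normrN => h1 h2.
  by apply: he; rewrite /= opprD addNKr normrN.
by apply: he; rewrite /= opprB addrC subrK.
Qed.

Lemma hasjet_local r : local_prop (hasjet r).
Proof.
move=> y z t yz [a [a0 jr jl]]; have [n1 n2] := near_shift0 yz.
exists a; split; first by rewrite a0 (nbhs_singleton yz).
  exact: jet_eq jr.
exact: jet_eq jl.
Qed.

Lemma good_local r H x : local_prop (good r H x).
Proof.
move=> y z t yz [[g gH yg] jy]; split; last exact: hasjet_local jy.
by exists g => //; rewrite -yg (nbhs_singleton yz).
Qed.

Lemma hasjet_mul r y t (g : 'M[R]_n) : hasjet r y t -> hasjet r (fun s => g *m y s) t.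
Proof.
move=> [a [a0 jr jl]]; exists (fun j => g *m a j); split; first by rewrite a0.
  exact: jet_mul jr.
apply: jet_coefs (jet_mul g jl) => j _; by rewrite -scalemxAr.
Qed.

Lemma good_mul r H x y t (g : 'M[R]_n) : isgrp H -> g \in H ->
  good r H x y t -> good r H x (fun s => g *m y s) t.
Proof.
move=> HG gH [[h hH yh] jy]; split; last exact: hasjet_mul.
by exists (g *m h); [exact: (grpM HG) | rewrite yh mulmxA].
Qed.

Lemma hasjet_cont r y t : hasjet r y t -> ccont y t.
Proof.
move=> [a [a0 jr jl]] i; apply/continuous_withinNshiftx.
have h1 : cvc 0^'+ (fun h => y (t + h)) (a 0%N) by exact: jet_lim0 jr.
have h2 : cvc 0^'+ (fun h => y (t - h)) ((-1) ^+ 0 *: a 0%N) by exact: jet_lim0 jl.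
move: (h1 i) (h2 i); rewrite expr0 scale1r a0 => {}h1 {}h2.
apply: cvg_dnbhs0.
  by apply: cvg_trans h1; apply: near_eq_cvg; near=> h; rewrite /= addrC.
by apply: cvg_trans h2; apply: near_eq_cvg; near=> h; rewrite /= addrC.
Unshelve. all: by end_near. Qed.

Lemma ccont_shift x t h : ccont x (t + h) -> ccont (fun s => x (t + s)) h.
Proof.
move=> cx i; apply: (@continuous_comp _ _ _ (fun s : R => t + s) (fun s => x s i 0)).
  by apply: cvgD; [exact: cvg_cst | exact: cvg_id].
exact: cx.
Qed.

Lemma lift_jets_at r d H x y b e : isgrp H -> gen d H -> (2 <= d)%N ->
  gcurve (r * d) H x b -> 0 < e -> y b = x b ->
  (forall t, b - e < t < b \/ b < t < b + e ->
     (exists2 g, g \in H & y t = g *m x t) /\ ccont y t) ->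
  exists a w, [/\ w \in H, exists2 g, g \in H & a 0%N = g *m x b,
    jet 0^'+ r a (fun h => y (b + h)) &
    jet 0^'+ r (fun j => (-1) ^+ j *: (w *m a j)) (fun h => y (b - h))].
Proof.
move=> HG genH d2 gx e0 yb hy.
have hy' h : h != 0 -> `|h| < e -> (exists2 g, g \in H & y (b + h) = g *m x (b + h))
    /\ ccont y (b + h).
  move=> h0; rewrite ltr_norml => /andP[h1 h2]; apply: hy.
  by case: (ltgtP h 0) h0 => // h0 _; [left | right]; apply/andP; split; lra.
have gy : gcurve (r * d) H (fun h => y (b + h)) 0.
  move=> f pf fH; have := Ck_shift (t := b) (s := 0); rewrite addr0 => sh.
  apply: Ck_eq (sh _ _ (gx f pf fH)).
  apply/nbhs_ballP; exists e => // h; rewrite /ball /= sub0r normrN => he.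
  have [->|h0] := eqVneq h 0; first by rewrite addr0 yb.
  by have [[g gH ->] _] := hy' h h0 he; rewrite fH.
have [|a [w [wH [g gH a0] jr jl]]] := lift_jets HG genH d2 gy.
  rewrite near_withinE; apply/nbhs_ballP; exists e => // h.
  rewrite /ball /= sub0r normrN => he h0; apply: ccont_shift.
  by have [] := hy' h h0 he.
by exists a, w; split=> //; exists g => //; rewrite a0 addr0 yb.
Qed.

Lemma glues_good r d H x b : isgrp H -> gen d H -> (2 <= d)%N ->
  gcurve (r * d) H x b -> glues (good r H x) b.
Proof.
move=> HG genH d2 gx y1 y2 e e0 h1 h2.
pose y t := if t < b then y1 t else if t == b then x b else y2 t.
have [|t ht|a [w [wH [g gH a0] jr jl]]] := lift_jets_at HG genH d2 gx e0 (_ : y b = x b).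
- by rewrite /y ltxx eqxx.
- case: ht => /andP[t1 t2].
    have [gy jy] := h1 t (introT andP (conj t1 t2)).
    split; first by rewrite /y t2.
    apply: ccont_eq (hasjet_cont jy); near=> s; rewrite /y ifT //.
    by near: s; exact: lt_nbhsl.
  have [gy jy] := h2 t (introT andP (conj t1 t2)).
  split; first by rewrite /y ltNge (ltW t1) /= gt_eqF.
  apply: ccont_eq (hasjet_cont jy); near=> s.
  have bs : b < s by near: s; exact: lt_nbhsr.
  by rewrite /y ltNge (ltW bs) /= gt_eqF.
have yl h : 0 < h -> y (b - h) = y1 (b - h) by move=> h0; rewrite /y gtrDl oppr_lt0 h0.
have yr h : 0 < h -> y (b + h) = y2 (b + h).
  by move=> h0; rewrite /y ltNge lerDl (ltW h0) /= gt_eqF // ltrDl.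
have FF : Filter (0^'+ : set_system R) by apply: filter_filter.
split.
  exists (fun t => if t < b then y1 t else if t == b then w *m a 0%N else w *m y2 t).
  exists (mulmx w : E -> E); split.
  - by move=> z t; exact: good_mul.
  - split; first by rewrite ltxx eqxx; exists (w *m g); rewrite ?a0 ?mulmxA //; exact: (grpM HG).
    exists (fun j => w *m a j); split; first by rewrite ltxx eqxx.
      apply: jet_eq (jet_mul w jr); near=> h.
      have h0 : 0 < h by near: h; exact: nbhs_right_gt.
      by rewrite yr // ltNge lerDl (ltW h0) /= gt_eqF // ltrDl.
    apply: jet_eq jl; near=> h.
    have h0 : 0 < h by near: h; exact: nbhs_right_gt.
    by rewrite yl // gtrDl oppr_lt0 h0.
  - by move=> t ->.
  - by move=> t bt; rewrite ltNge (ltW bt) /= gt_eqF.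
exists (fun t => if t < b then w^T *m y1 t else if t == b then a 0%N else y2 t).
exists (mulmx w^T : E -> E); split.
- by move=> z t; apply: good_mul => //; exact: (grpT HG).
- split; first by rewrite ltxx eqxx; exists g.
  exists a; split; first by rewrite ltxx eqxx.
    apply: jet_eq jr; near=> h.
    have h0 : 0 < h by near: h; exact: nbhs_right_gt.
    by rewrite yr // ltNge lerDl (ltW h0) /= gt_eqF // ltrDl.
  apply: (@jet_coefs _ _ (fun j => w^T *m ((-1) ^+ j *: (w *m a j)))) => [j _|].
    by rewrite -scalemxAr orthTK //; exact: (grpO HG).
  apply: jet_eq (jet_mul w^T jl); near=> h.
  have h0 : 0 < h by near: h; exact: nbhs_right_gt.
  by rewrite yl // gtrDl oppr_lt0 h0.
- by move=> t bt; rewrite ltNge (ltW bt) /= gt_eqF.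
- by move=> t ->.
Unshelve. all: by end_near. Qed.

End LiftExists.

Section JetLift.
Variables (R : realType) (n : nat).
Notation E := 'cV[R]_n.
Implicit Types (H : seq 'M[R]_n) (x y z : R -> E) (v : E) (t s : R).

Lemma fixpP H v : isgrp H -> fixp H v <-> nq (v - proj H *m v) = 0.
Proof.
move=> HG; split=> [fv|/eqP]; first by rewrite fix_proj // subrr nq0.
rewrite nq_eq0 subr_eq0 => /eqP ->; exact: proj_fix.
Qed.

Lemma polyf_off H : polyf (fun v : E => nq (v - proj H *m v)).
Proof.
apply: (@polyf_ext _ _ (fun v => nq ((1%:M - proj H) *m v))).
  by move=> v; rewrite mulmxBl mul1mx.
by apply: polyf_comp_lin; exact: polyf_nq.
Qed.

Lemma inv_off H : isgrp H -> inv H (fun v : E => nq (v - proj H *m v)).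
Proof.
move=> HG g v gH; rewrite proj_comm // -[X in _ - X](proj_fix v HG gH) -mulmxBr.
by rewrite nq_orth //; exact: (grpO HG).
Qed.

Lemma good_stab r H v x (a y : R -> E) t : isgrp H ->
  (exists2 g, g \in H & a t = g *m x t) -> good r (stab H v) a y t -> good r H x y t.
Proof.
move=> HG [g gH ag] [[h hS yh] jy]; split=> //; exists (h *m g).
  by apply: (grpM HG) => //; exact: stab_sub hS.
by rewrite yh ag mulmxA.
Qed.

(** Induction on the order of [H]. Away from the fixed points the isotropy groups are smaller, and
    local solutions are glued. An isolated fixed point separates two solutions and is passed by
    gluing again. At an accumulation point of fixed points the coefficients of the expansion are
    themselves fixed, so that the mismatch disappears. *)
Theorem jet_lift r d H x (O : set R) : isgrp H -> gen d H -> (2 <= d)%N ->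
  (0 < r)%N -> open O -> (forall t, O t -> gcurve (r * d) H x t) ->
  exists y, forall t, O t -> good r H x y t.
Proof.
have [N HN] := ubnP (size H); elim: N H HN x O => // N IH H HN x O HG genH d2 r0 Oo gx.
have gx0 t : O t -> gcurve 0 H x t.
  by move=> Ot f pf fH; apply: cl_le (gx t Ot f pf fH).
pose off v := nq (v - proj H *m v).
have coff t : O t -> {for t, continuous (fun s => off (x s))}.
  by move=> Ot; exact: Ck_cont (gx0 t Ot _ (polyf_off H) (inv_off HG)).
pose Z := [set t | O t /\ fixp H (x t)].
have gl b : O b -> glues (good r H x) b.
  by move=> Ob; exact: (glues_good HG genH d2 (gx b Ob)).
(* The points where the isotropy group drops are handled by induction. *)
pose U1 := [set t | O t /\ ~ fixp H (x t)].
have U1o : open U1.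
  rewrite openE => t [Ot nf].
  have off0 : 0 < off (x t).
    rewrite lt_neqAle nq_ge0 andbT eq_sym; apply/eqP => h; apply: nf.
    exact/fixpP.
  have On : \forall s \near t, O s by exact: open_nbhs_nbhs.
  have op : \forall s \near t, 0 < off (x s).
    by have /cvgr_gt := coff t Ot; apply.
  apply: filterS2 On op => s Os os; split=> // /(fixpP _ HG) h.
  by move: os; rewrite /off h ltxx.
have [y1 hy1] : exists y, forall t, U1 t -> good r H x y t.
  apply: (glue_open 0 (@good_local R n r H x) U1o); first by move=> b [Ob _]; exact: gl.
  move=> b [Ob nf].
  have [a [e [e0 ax ga]]] := slice_near HG Oo Ob gx.
  have [||y hy] := IH (stab H (x b)) _ a `]b - e, b + e[%classic
    (isgrp_stab _ HG) (gen_stab (v := x b) HG genH) d2 r0 (itv_open _ _).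
  - by rewrite -ltnS (leq_trans _ HN) // ltnS size_stab.
  - by move=> t; rewrite /= in_itv /=; exact: ga.
  exists y, y, e; split=> // t /andP[t1 t2]; apply: (good_stab HG (ax t)); apply: hy;
    rewrite /= in_itv /=; apply/andP; split; lra.
pose acc t := forall e, 0 < e -> exists2 s, Z s & 0 < `|s - t| < e.
pose U := [set t | O t /\ ~ (Z t /\ acc t)].
have notacc t : ~ acc t -> exists2 e, 0 < e & forall s, Z s -> 0 < `|s - t| -> e <= `|s - t|.
  move=> na; apply: contrapT => h; apply: na => e e0; apply: contrapT => h'.
  by apply: h; exists e => // s Zs s0; rewrite leNgt; apply/negP => se; apply: h'; exists s; rewrite ?s0.
have nearU t : U t -> exists2 e, 0 < e & forall s, `|s - t| < e -> s != t -> U1 s.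
  move=> [Ot nZ].
  have /nbhs_ballP[d0 /= d00 hd] : nbhs t O by exact: open_nbhs_nbhs.
  have hd' s : `|s - t| < d0 -> O s by move=> st; apply: hd; rewrite /ball /= distrC.
  have [Zt|nZt] := pselect (Z t).
    have [e e0 he] : exists2 e, 0 < e & forall s, Z s -> 0 < `|s - t| -> e <= `|s - t|.
      by apply: notacc => act; apply: nZ.
    exists (Num.min d0 e); first by rewrite lt_min d00.
    move=> s; rewrite lt_min => /andP[s1 s2] st; split; first exact: hd'.
    move=> fs; have := he s (conj (hd' s s1) fs); rewrite normr_gt0 subr_eq0 st.
    by move=> /(_ isT); rewrite leNgt s2.
  have U1t : U1 t by split=> // ft; apply: nZt.
  have /nbhs_ballP[e /= e0 he] : nbhs t U1 by exact: open_nbhs_nbhs.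
  by exists e => // s se _; apply: he; rewrite /ball /= distrC.
have U1U s : U1 s -> U s by move=> [Os nf]; split=> // -[[_ fs] _].
have Uo : open U.
  rewrite openE => t Ut; have [e e0 he] := nearU t Ut.
  apply/nbhs_ballP; exists e => // s; rewrite /ball /= distrC => st.
  by have [->//|/(he s st)/U1U] := eqVneq s t.
have [y2 hy2] : exists y, forall t, U t -> good r H x y t.
  apply: (glue_open 0 (@good_local R n r H x) Uo); first by move=> b [Ob _]; exact: gl.
  move=> b Ub; have [e e0 he] := nearU b Ub.
  exists y1, y1, e; split=> // t /andP[t1 t2]; apply: hy1; apply: he.
  - rewrite ltr0_norm; lra.
  - by rewrite lt_eqF.
  - rewrite gtr0_norm; lra.
  - by rewrite gt_eqF.
(* At the remaining times [x t] is fixed by [H]: there is nothing to choose, and [x] is kept. *)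
pose y t := if pselect (U t) then y2 t else x t.
have yU t : U t -> good r H x y t.
  move=> Ut; apply: good_local (hy2 t Ut).
  have : \forall s \near t, U s by exact: open_nbhs_nbhs.
  by apply: filterS => s Us; rewrite /y; case: pselect.
have yx t : O t -> exists2 g, g \in H & y t = g *m x t.
  move=> Ot; have [Ut|nU] := pselect (U t); first by case: (yU t Ut).
  by exists 1%:M; [exact: (grp1 HG) | rewrite mul1mx /y; case: pselect].
have yZ t : O t -> ~ U t -> Z t /\ acc t.
  by move=> Ot nU; apply: contrapT => h; apply: nU.
have cy t : O t -> ccont y t.
  move=> Ot; have [Ut|nU] := pselect (U t); first by have [_ /hasjet_cont] := yU t Ut.
  have [[_ fx] _] := yZ t Ot nU.
  have yt : y t = x t by rewrite /y; case: pselect.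
  have pf := polyf_nqB (x t).
  have fH : inv H (fun u => nq (u - x t)).
    by move=> g u gH; rewrite -{1}(fx g gH) -mulmxBr nq_orth //; exact: (grpO HG).
  have cn : {for t, continuous (fun s => nq (x s - x t))}.
    exact: Ck_cont (gx0 t Ot _ pf fH).
  have : cvc (nbhs t) y (x t).
    apply/cvc_nq; rewrite /prop_for /continuous_at subrr nq0 in cn.
    apply: cvg_trans cn; apply: near_eq_cvg.
    have : \forall s \near t, O s by exact: open_nbhs_nbhs.
    by apply: filterS => s Os; have [g gH ->] := yx s Os; rewrite fH.
  by move=> h i; have := h i; rewrite -yt.
exists y => t Ot; have [Ut|nU] := pselect (U t); first exact: yU.
split; first exact: yx.
have [[_ fx] act] := yZ t Ot nU.
have yt : y t = x t by rewrite /y; case: pselect.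
have yfix s : Z s -> fixp H (y s).
  by move=> [Os fs] g gH; have [h hH ->] := yx s Os; rewrite (fs h hH) (fs g gH).
have /nbhs_ballP[e /= e0 he] : nbhs t O by exact: open_nbhs_nbhs.
have [s sO|a [w [wH [g gH a0] jr jl]]] :=
    lift_jets_at HG genH d2 (gx t Ot) e0 yt.
  have Os : O s.
    apply: he; rewrite /ball /= ltr_norml; apply/andP.
    by case: sO => /andP[s1 s2]; split; lra.
  by split; [exact: yx | exact: cy].
have freq (sg : bool) : (forall e, 0 < e -> exists2 h, 0 < h < e & Z (if sg then t + h else t - h)) \/
    (exists2 e, 0 < e & forall h, 0 < h < e -> ~ Z (if sg then t + h else t - h)).
  have [h|h] := pselect (exists2 e, 0 < e & forall h, 0 < h < e ->
      ~ Z (if sg then t + h else t - h)); first by right.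
  left=> e' e'0; apply: contrapT => h'; apply: h; exists e' => // k ke Zk.
  by apply: h'; exists k.
have fixa (b : nat -> E) (u : R -> E) : jet 0^'+ r b u ->
    (forall e, 0 < e -> exists2 h, 0 < h < e & fixp H (u h)) ->
    forall j, (j <= r)%N -> fixp H (b j).
  move=> ju fr j jr' h hH; apply/eqP; rewrite -subr_eq0; apply/eqP.
  have FF : Filter (0^'+ : set_system R) by apply: filter_filter.
  have : (h - 1%:M) *m b j = 0.
    apply: (@jet_freq0 _ _ r (fun j => (h - 1%:M) *m b j)
      (fun s => (h - 1%:M) *m u s)) => //; first exact: jet_mul.
    move=> e' e'0; have [k ke fk] := fr e' e'0; exists k => //.
    by rewrite mulmxBl mul1mx fk // subrr.
  by rewrite mulmxBl mul1mx.
(* Fixed points accumulate at [t] from at least one side. From the right they make the [a j] fixed;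
   from the left they make the [w *m a j] fixed, and applying [w^T] gives the same conclusion. *)
have wa j : (j <= r)%N -> w *m a j = a j.
  move=> jr'; have [fr|[e1 e10 h1]] := freq true.
    apply: (fixa _ _ jr) => // e' e'0; have [h he' Zh] := fr e' e'0.
    by exists h => //; exact: yfix.
  have [fr|[e2 e20 h2]] := freq false; last first.
    have m0 : 0 < Num.min e1 e2 by rewrite lt_min e10.
    have [s Zs] := act _ m0; rewrite normr_gt0 lt_min subr_eq0 => /andP[st /andP[s1 s2]].
    case: (ltgtP s t) st => // st _.
      case: (h2 (t - s)); first by rewrite subr_gt0 st -[t - s]opprB -ltr0_norm ?subr_lt0.
      by rewrite opprB addrC subrK.
    case: (h1 (s - t)); first by rewrite subr_gt0 st -[s - t]gtr0_norm ?subr_gt0.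
    by rewrite addrC subrK.
  have f1 : fixp H (w *m a j).
    have h3 : fixp H ((-1) ^+ j *: (w *m a j)).
      apply: (fixa _ _ jl) => // e' e'0; have [h he' Zh] := fr e' e'0.
      by exists h => //; exact: yfix.
    move=> h hH; have := h3 h hH; rewrite -scalemxAr => /(congr1 (fun u => (-1) ^+ j *: u)).
    by rewrite !scalerA -exprMn mulrNN mulr1 expr1n !scale1r.
  by have := f1 w^T (grpT HG wH); rewrite (orthTK _ (grpO HG wH)) => h; symmetry.
exists a; split=> //; first by rewrite a0 yt fx.
by apply: jet_coefs jl => j jr'; rewrite wa.
Unshelve. all: by end_near. Qed.

End JetLift.

(** * A uniform Lipschitz estimate *)

Section Between.
Variable R : realDomainType.

Lemma between_norm (l u t s : R) : `|u| < l -> `|t| < l ->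
  Num.min u t <= s <= Num.max u t -> `|s| < l.
Proof.
rewrite !ltr_norml => /andP[u1 u2] /andP[t1 t2] /andP[s1 s2]; apply/andP; split.
  by apply: lt_le_trans s1; rewrite lt_min u1.
by apply: (le_lt_trans s2); rewrite gt_max u2.
Qed.

Lemma between0_norm (t s : R) : Num.min 0 t <= s <= Num.max 0 t -> `|s| <= `|t|.
Proof.
move=> /andP[s1 s2]; rewrite ler_norml; apply/andP; split.
  by apply: le_trans s1; rewrite le_min oppr_le0 normr_ge0 -[leRHS]opprK lerN2 -normrN ler_norm.
by apply: (le_trans s2); rewrite ge_max normr_ge0 ler_norm.
Qed.

End Between.

Section Interpolation.
Variable R : realType.
Implicit Types (g : nat -> R -> R) (A : R).

Lemma interp_point s A (l : R) : 0 < l -> exists2 C, 0 <= C &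
  forall g (a : R), (forall j t, (j < s)%N -> a < t < a + l ->
     is_derive t (1 : R) (g j) (g j.+1 t)) ->
  (forall t, a < t < a + l -> `|g 0%N t| <= A) ->
  exists2 t, a < t < a + l & `|g s t| <= C.
Proof.
elim: s l => [|s IH] l l0.
  exists `|A| => // g a _ gA; exists (a + l / 2); first by apply/andP; split; lra.
  by apply: le_trans (gA _ _) (ler_norm _); apply/andP; split; lra.
have l3 : 0 < l / 3 by rewrite divr_gt0.
have [C C0 hC] := IH _ l3.
exists (2 * C / (l / 3)); first by rewrite divr_ge0 ?mulr_ge0 // ltW.
move=> g a dg gA.
have [||t1 /andP[h1 h2] gt1] := hC g a.
- by move=> j t js /andP[u1 u2]; apply: dg; [exact: ltnW | apply/andP; split; lra].
- by move=> t /andP[u1 u2]; apply: gA; apply/andP; split; lra.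
have [||t2 /andP[h3 h4] gt2] := hC g (a + 2 * (l / 3)).
- by move=> j t js /andP[u1 u2]; apply: dg; [exact: ltnW | apply/andP; split; lra].
- by move=> t /andP[u1 u2]; apply: gA; apply/andP; split; lra.
have t12 : t1 <= t2 by lra.
have [|t] := @mvt R (g s) (g s.+1) t1 t2.
  rewrite min_l // max_r // => t /andP[u1 u2]; apply: dg => //.
  by apply/andP; split; lra.
rewrite min_l // max_r // => /andP[u1 u2] E1; exists t; first by apply/andP; split; lra.
have d0 : 0 < t2 - t1 by lra.
have -> : g s.+1 t = (g s t2 - g s t1) / (t2 - t1).
  by rewrite E1 mulfK // gt_eqF.
rewrite normrM normfV [`|t2 - t1|]gtr0_norm // ler_pM ?invr_ge0 ?(ltW d0) //.
  rewrite (le_trans (ler_normB _ _)) //; lra.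
by rewrite lef_pV2 ?posrE //; lra.
Qed.

(** An inequality of Landau-Kolmogorov type, descending from order [d]: a derivative is bounded at
    one point by [interp_point], and from there by means of the bound on the next derivative. *)
Lemma interp d A (l : R) : 0 < l -> exists2 C, 0 <= C &
  forall g, (forall j t, (j < d)%N -> `|t| < l ->
     is_derive t (1 : R) (g j) (g j.+1 t)) ->
  (forall t, `|t| < l -> `|g 0%N t| <= A) ->
  (forall t, `|t| < l -> `|g d t| <= A) ->
  forall j t, (j <= d)%N -> `|t| < l -> `|g j t| <= C.
Proof.
move=> l0.
suff step k : exists2 C, 0 <= C & forall g, (forall j t, (j < d)%N -> `|t| < l ->
     is_derive t (1 : R) (g j) (g j.+1 t)) ->
  (forall t, `|t| < l -> `|g 0%N t| <= A) ->
  (forall t, `|t| < l -> `|g d t| <= A) ->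
  forall j t, (d - k <= j <= d)%N -> `|t| < l -> `|g j t| <= C.
  have [C C0 hC] := step d; exists C => // g dg g0 gd j t jd.
  by apply: hC; rewrite ?subnn.
elim: k => [|k [C C0 hC]].
  exists `|A| => // g dg g0 gd j t; rewrite subn0 => /anti_leq <- tl.
  exact: le_trans (gd t tl) (ler_norm _).
have l20 : 0 < 2 * l by rewrite mulr_gt0.
have [D D0 hD] := interp_point (d - k.+1) A l20.
exists (C + (D + 2 * l * C)) => [|g dg g0 gd j t /andP[j1 j2] tl].
  by rewrite !addr_ge0 // !mulr_ge0 // ltW.
have [kj|jk] := leqP (d - k) j.
  rewrite (le_trans (hC g dg g0 gd j t _ tl)) ?kj ?j2 //.
  by rewrite lerDl addr_ge0 // !mulr_ge0 // ltW.
have E1 : j = (d - k.+1)%N by lia.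
have [||u] := hD g (- l).
- by move=> i s id /andP[s1 s2]; apply: dg; [exact: leq_trans id (leq_subr _ _) | rewrite ltr_norml; apply/andP; split; lra].
- by move=> s /andP[s1 s2]; apply: g0; rewrite ltr_norml; apply/andP; split; lra.
rewrite -E1 => /andP[u1 u2] gu.
have ul : `|u| < l by rewrite ltr_norml u1 (lt_le_trans u2) //; lra.
have [s /(between_norm ul tl) sl|s] := @mvt R (g j) (g j.+1) u t.
  by apply: dg => //; exact: leq_trans jk (leq_subr _ _).
move=> /(between_norm ul tl) sl E2.
have gs : `|g j.+1 s| <= C.
  by apply: hC => //; rewrite (leq_trans jk (leq_subr _ _)) andbT E1 subnS prednK // (leq_ltn_trans _ jk).
have -> : g j t = g j u + g j.+1 s * (t - u) by rewrite -E2 addrC subrK.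
rewrite (le_trans (ler_normD _ _)) // ler_wpDl // lerD //.
have [h1 h2] : - l < t /\ t < l by move: tl; rewrite ltr_norml => /andP[].
rewrite normrM mulrC ler_pM // ler_norml; apply/andP; split; lra.
Qed.

End Interpolation.

Section Chains.
Variables (R : realType) (I : Type) (F : set_system (I * R)).
Variable b : (I * R -> R) -> Prop.

Lemma cl_chain m f : cl F b m f -> exists phi : nat -> I * R -> R,
  [/\ phi 0%N = f, forall j, (j <= m)%N -> b (phi j) &
    forall j, (j < m)%N -> dtau F (phi j) (phi j.+1)].
Proof.
elim: m f => [|m IH] f.
  by move=> [bf _]; exists (fun=> f); split.
move=> [bf [f' [df /IH[phi [p0 pb pd]]]]].
exists (fun j => if j is j'.+1 then phi j' else f); split=> //.
- by case=> // j; apply: pb.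
- by case=> [_|j jm]; [rewrite p0 | apply: pd].
Qed.

Lemma chain_cl m (phi : nat -> I * R -> R) :
  (forall j, (j <= m)%N -> b (phi j)) ->
  (forall j, (j < m)%N -> dtau F (phi j) (phi j.+1)) -> cl F b m (phi 0%N).
Proof.
elim: m phi => [|m IH] phi pb pd; first by split=> //; apply: pb.
split; first exact: pb.
exists (phi 1%N); split; first exact: pd.
by apply: (IH (fun j => phi j.+1)) => j jm; [apply: pb | apply: pd].
Qed.

End Chains.

Section Elementary.
Variable R : realType.

Lemma isd_quot (f : R -> R) t l : is_derive t (1 : R) f l ->
  h^-1 * (f (t + h) - f t) @[h --> (0 : R)^'] --> l.
Proof.
move=> [df <-]; apply: cvg_trans (df); apply: near_eq_cvg; near=> h.
by rewrite /= [h *: 1]mulr1 [h + t]addrC.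
Unshelve. all: by end_near. Qed.

(** Otherwise the linear term would win at [t = - b * s] with [s] small. *)
Lemma lin_quad_ge0 (M r b : R) : 0 < M -> 0 < r ->
  (forall t, `|t| < r -> 0 <= b * t + M * t ^+ 2) -> b = 0.
Proof.
move=> M0 r0 h; apply/eqP; apply: contraT => b0.
have b1 : 0 < `|b| + 1 by rewrite ltr_wpDl.
pose s := Num.min (2 * M)^-1 (r / (2 * (`|b| + 1))).
have s0 : 0 < s by rewrite lt_min invr_gt0 divr_gt0 ?mulr_gt0.
have sM : M * s <= 1 / 2.
  rewrite (@le_trans _ _ (M * (2 * M)^-1)) //; first by rewrite ler_pM2l // ge_min lexx.
  by rewrite le_eqVlt; apply/orP; left; apply/eqP; field; rewrite gt_eqF.
have sr : `|- b * s| < r.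
  rewrite normrM normrN (gtr0_norm s0).
  have : (`|b| + 1) * s <= r / 2.
    rewrite (@le_trans _ _ ((`|b| + 1) * (r / (2 * (`|b| + 1))))) //.
      by rewrite ler_pM2l // ge_min lexx orbT.
    by rewrite le_eqVlt; apply/orP; left; apply/eqP; field; rewrite gt_eqF.
  by rewrite mulrDl mul1r; lra.
have := h _ sr; have b2 : 0 < b ^+ 2 by rewrite exprn_even_gt0.
have -> : b * (- b * s) + M * (- b * s) ^+ 2 = b ^+ 2 * s * (M * s - 1) by ring.
by rewrite (pmulr_rge0 _ (mulr_gt0 b2 s0)) subr_ge0 leNgt => /negP[]; lra.
Qed.

End Elementary.

Section Bounded.
Variables (R : realType) (I : Type) (U : set_system I).
Hypothesis UU : UltraFilter U.
Let UP : ProperFilter U := @ultra_proper _ _ UU.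
#[local] Existing Instance UP.

(** Families of curves on a time interval common to almost all parameters. With [U] an ultrafilter,
    passing to subsequences is built in. *)
Definition bfilter : set_system (I * R) := [set P | exists2 r, 0 < r &
  \forall i \near U, forall t, `|t| < r -> P (i, t)].

Definition bbase (f : I * R -> R) := exists M, bfilter [set p | `|f p| <= M].

Lemma bfilter_filter : Filter bfilter.
Proof.
split; first by exists 1 => //; apply: nearW.
  move=> P Q [r1 r10 h1] [r2 r20 h2]; exists (Num.min r1 r2).
    by rewrite lt_min r10.
  by apply: filterS2 h1 h2 => i h1 h2 t; rewrite lt_min => /andP[/h1 ? /h2 ?].
by move=> P Q PQ [r r0 h]; exists r => //; apply: filterS h => i h t /h /PQ.
Qed.

Lemma bounded_calculus : calculus bfilter bbase.
Proof.
have FF := bfilter_filter.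
split=> //.
- move=> P [r r0 h]; exists r => //; apply: filterS h => i h t tr /=.
  move: tr; rewrite ltr_norml => /andP[t1 t2]; near=> s; apply: h.
  rewrite ltr_norml; apply/andP; split; near: s; [exact: lt_nbhsr | exact: lt_nbhsl].
- move=> f g fg [M h]; exists M; apply: filterS2 fg h => p /= ->; exact.
- by move=> c; exists `|c|; apply: filterE => p /=.
- move=> f g [M h] [M' h']; exists (M + M'); apply: filterS2 h h' => p /= h h'.
  by rewrite (le_trans (ler_normD _ _)) // lerD.
- move=> f g [M h] [M' h']; exists (M * M'); apply: filterS2 h h' => p /= h h'.
  by rewrite normrM ler_pM.
- move=> f k k0 kf _; exists k^-1; apply: filterS kf => p /= kp.
  by rewrite normfV lef_pV2 // posrE // (lt_le_trans k0).
Unshelve. all: by end_near. Qed.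

Variable n : nat.
Notation E := 'cV[R]_n.
Implicit Types (H : seq 'M[R]_n) (Z : I * R -> E).

Definition dcurve Z Z' := \forall p \near bfilter,
  forall i, is_derive p.2 (1 : R) (fun s => Z (p.1, s) i 0) (Z' p i 0).

Lemma dcurve_mul Z Z' (A : 'M[R]_n) : dcurve Z Z' ->
  dcurve (fun p => A *m Z p) (fun p => A *m Z' p).
Proof.
apply: (@filterS _ _ bfilter_filter) => -[i t] /= dZ j.
rewrite mxE (_ : (fun s => _) = fun s => \sum_k A j k * Z (i, s) k 0); last first.
  by apply/funext => s; rewrite mxE.
apply: isd_sum => k.
Qed.

Lemma nq_cont (x : R -> E) (v : E) t :
  (forall i, exists l, is_derive t (1 : R) (fun s => x s i 0) l) ->
  {for t, continuous (fun s => nq (x s - v))}.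
Proof.
move=> dx; apply: (ccont_polyf (polyf_nqB v)) => i.
by have [l dl] := dx i; exact: isd_cont dl.
Qed.

Lemma bfilter0 (P : set (I * R)) : bfilter P -> \forall i \near U, P (i, 0).
Proof. by move=> [r r0 h]; apply: filterS h => i; apply; rewrite normr0. Qed.

(** Holding for almost all members of a family, the bound is a uniform one. Induction on the order
    of [H]: after the fixed space is split off, the curve is rescaled so as to pass through the unit
    sphere at time [0]. A limit of these unit vectors is not fixed by [H], and its isotropy group is
    smaller. *)
Theorem lift_lipschitz d H Z Z' : isgrp H -> gen d H -> (2 <= d)%N ->
  dcurve Z Z' ->
  (forall f, polyf f -> inv H f -> cl bfilter bbase d (fun p => f (Z p))) ->
  exists C, \forall i \near U, nq (Z' (i, 0)) <= C.
Proof.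
have [N HN] := ubnP (size H); elim: N H HN Z Z' => // N IH H HN Z Z' HG genH d2 dZ clZ.
have FF := bfilter_filter; have BC := bounded_calculus.

(* The component in the fixed space *)
pose P := proj H.
have [C1 hC1] : exists C, \forall i \near U, nq (P *m Z' (i, 0)) <= C.
  have coord (j : 'I_n) : exists M, \forall i \near U, `|(P *m Z' (i, 0)) j 0| <= M.
    have pj : polyf (fun u : E => (P *m u) j 0).
      exact: (polyf_comp_lin P (polyf_coord R j)).
    have ij : inv H (fun u : E => (P *m u) j 0) by move=> g u gH; rewrite proj_comm.
    have [_ [g' [dg' [[M hM] _]]]] := cl_le (ltnW d2) (clZ _ pj ij).
    exists M; suff /bfilter0 : bfilter [set p | `|(P *m Z' p) j 0| <= M] by [].
    apply: filterS3 hM dg' (dcurve_mul P dZ).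
    by move=> p /= hM dg dP; rewrite (isd_uniq (dP j) dg).
  have /choice[M hM] := coord.
  exists (\sum_j M j * M j).
  have hM' : \forall i \near U, forall j, `|(P *m Z' (i, 0)) j 0| <= M j.
    exact: filter_forall hM.
  apply: filterS hM' => i hMi; apply: ler_sum => j _.
  by rewrite -expr2 -real_normK ?num_real // expr2 ler_pM.

(* Reduction to the component orthogonal to the fixed space *)
pose Y p := Z p - P *m Z p.
pose Y' p := Z' p - P *m Z' p.
suff [C hC] : exists C, \forall i \near U, nq (Y' (i, 0)) <= C.
  exists (2 * C + 2 * C1); apply: filterS2 hC hC1 => i h1 h2.
  have -> : Z' (i, 0) = Y' (i, 0) + P *m Z' (i, 0) by rewrite subrK.
  by rewrite (le_trans (nqD_le _ _)) // lerD // ler_wpM2l.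
have YE p : Y p = (1%:M - P) *m Z p by rewrite mulmxBl mul1mx.
have dY : dcurve Y Y'.
  have := dcurve_mul (1%:M - P) dZ; apply: filterS => p dp i.
  have -> : (fun s => Y (p.1, s) i 0) = (fun s => ((1%:M - P) *m Z (p.1, s)) i 0).
    by apply/funext => s; rewrite YE.
  by apply: (isd_eq (dp i)); rewrite mulmxBl mul1mx.
have PY p : P *m Y p = 0.
  by rewrite mulmxBr (fix_proj HG (proj_fix _ HG)) subrr.
have clY f : polyf f -> inv H f -> cl bfilter bbase d (fun p => f (Y p)).
  move=> pf fH; apply: (clZ (fun u => f (u - P *m u))).
    apply: (@polyf_ext _ _ (fun u => f ((1%:M - P) *m u))).
      by move=> u; rewrite mulmxBl mul1mx.
    exact: polyf_comp_lin.
  move=> g u gH; rewrite proj_comm // -[X in f (_ - X)](proj_fix u HG gH).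
  by rewrite -mulmxBr fH.
have nqH : inv H (@nq R n) by move=> g u gH; rewrite nq_orth //; apply: (grpO HG).

(* Second order control of the squared norm *)
have [rho [rho0 rhob rhod]] := cl_chain (cl_le d2 (clY _ (polyf_nq _ _) nqH)).
have [M [M0 [r0 r00 hM]]] : exists M, 0 < M /\ bfilter [set p |
    [/\ `|rho 0%N p| <= M, `|rho 2 p| <= M,
      is_derive p.2 (1 : R) (fun s => rho 0%N (p.1, s)) (rho 1%N p),
      is_derive p.2 (1 : R) (fun s => rho 1%N (p.1, s)) (rho 2 p) &
      forall i, is_derive p.2 (1 : R) (fun s => Y (p.1, s) i 0) (Y' p i 0)]].
  have [M0 h0] := rhob 0%N isT; have [M2 h2] := rhob 2 isT.
  exists (`|M0| + `|M2| + 1); split; first by rewrite ltr_wpDl ?addr_ge0.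
  have d01 := rhod 0%N isT; have d12 := rhod 1%N isT.
  apply: filterS3 (filterI h0 h2) (filterI d01 d12) dY.
  move=> p [/= h0' h2'] [d01' d12'] dY'; split=> //.
    by rewrite (le_trans h0') // (le_trans (ler_norm _)) // -addrA lerDl addr_ge0.
  rewrite (le_trans h2') // (le_trans (ler_norm _)) //.
  by rewrite addrAC lerDr addr_ge0.
have rhoE p : rho 0%N p = nq (Y p) by rewrite rho0.
have taylor : \forall i \near U, forall t, `|t| < r0 ->
    `|rho 0%N (i, t) - rho 0%N (i, 0) - rho 1%N (i, 0) * t| <= M * t ^+ 2.
  apply: filterS hM => i hM t tr.
  have dj u : `|u| <= `|t| -> is_derive u (1 : R) (fun s => rho 0%N (i, s)) (rho 1%N (i, u))
      /\ is_derive u (1 : R) (fun s => rho 1%N (i, s)) (rho 2 (i, u)) /\ `|rho 2 (i, u)| <= M.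
    by move=> ut; have [] := hM u (le_lt_trans ut tr).
  have [|s /between0_norm st ->] := @mvt R (fun s => rho 0%N (i, s)) (fun s => rho 1%N (i, s)) 0 t.
    by move=> s /between0_norm /dj[].
  rewrite subr0 -mulrBl.
  have [|u /between0_norm us ->] := @mvt R (fun s => rho 1%N (i, s)) (fun s => rho 2 (i, s)) 0 s.
    by move=> u /between0_norm us; have [_ []] := dj u (le_trans us st).
  have [_ [_ hu]] := dj u (le_trans us st).
  rewrite subr0 !normrM -mulrA ler_pM ?mulr_ge0 //.
  by rewrite -(real_normK (num_real t)) expr2 ler_pM.
have z00 : `|0 : R| < r0 by rewrite normr0.
have nn i t : 0 <= rho 0%N (i, t) by rewrite rhoE nq_ge0.

(* Curves that vanish at time zero *)
have [z0|z0] := in_ultra_setVsetC [set i | rho 0%N (i, 0) = 0] UU.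
  exists (M + M); apply: filterS3 z0 taylor hM => i /= z0 ti hMi.
  have Y0 : Y (i, 0) = 0 by apply/eqP; rewrite -nq_eq0 -rhoE z0.
  have [_ _ _ _ dYi] := hMi 0 z00.
  (* The nonnegative function [rho] has a minimum at [0], so its linear term vanishes and it is at
     most [M t ^ 2]; dividing by [t ^ 2] bounds [nq Y']. *)
  have b1 : rho 1%N (i, 0) = 0.
    apply: (@lin_quad_ge0 _ M r0) => // t /ti; rewrite z0 subr0 ler_norml.
    by move=> /andP[_]; have := nn i t; lra.
  have c1 : cvc (0 : R)^' (fun t => t^-1 *: Y (i, t)) (Y' (i, 0)).
    move=> j; have := isd_quot (dYi j); rewrite Y0 mxE.
    apply: cvg_trans; apply: near_eq_cvg; near=> t.
    by rewrite !mxE add0r subr0.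
  have FD : ProperFilter (0 : R)^' by exact: _.
  have c2 : nq (t^-1 *: Y (i, t)) @[t --> (0 : R)^'] --> nq (Y' (i, 0)).
    exact: (polyf_cvc (polyf_nq _ _) c1).
  have c3 : (fun=> M + M) t @[t --> (0 : R)^'] --> M + M by exact: cvg_cst.
  apply: (ler_cvg_to c2 c3); near=> t.
  have t0 : t != 0 by near: t; exact: nbhs_dnbhs_neq.
  have tr : `|t| < r0 by near: t; exact: dnbhs0_lt.
  have := ti t tr; rewrite z0 b1 subr0 mul0r subr0 ger0_norm // rhoE => h.
  rewrite nqZ exprVn ler_pdivrMl ?exprn_even_gt0 // (le_trans h) // mulrC.
  by rewrite ler_wpM2l ?sqr_ge0 // lerDl ltW.
have {}z0 : \forall i \near U, 0 < rho 0%N (i, 0).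
  by apply: filterS z0 => i /= /eqP z0; rewrite lt_neqAle nn eq_sym z0.

(* Rescaling to the unit sphere *)
pose rr i := Num.sqrt (rho 0%N (i, 0)).
have rr2 i : rr i ^+ 2 = rho 0%N (i, 0) by rewrite sqr_sqrtr.
pose S := M + 1; have S0 : 0 < S by rewrite addr_gt0.
have rrS : \forall i \near U, 0 < rr i <= S.
  apply: filterS2 z0 hM => i zi hMi; rewrite sqrtr_gt0 zi /=.
  have [h0 _ _ _ _] := hMi 0 z00.
  rewrite -(@ler_pXn2r _ 2) ?nnegrE ?sqrtr_ge0 ?(ltW S0) // rr2.
  rewrite (le_trans (ler_norm _)) // (le_trans h0) // /S; nra.
pose ka := r0 / (2 * S); have ka0 : 0 < ka by rewrite divr_gt0 // mulr_gt0.
have kaS : ka * S < r0.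
  by rewrite /ka invfM mulrA -mulrA mulVf ?gt_eqF // mulr1 ltr_pdivrMr // ltr_pMr // ltr1n.
pose K := ka^-1 + M * ka.
have K0 : 0 < K by rewrite addr_gt0 ?invr_gt0 // mulr_gt0.
(* Glaeser's inequality: nonnegativity of [rho] at the times [ka * rr i] and [- (ka * rr i)] bounds
   its first derivative at [0] by a multiple of the square root of its value. *)
have glaeser : \forall i \near U, `|rho 1%N (i, 0)| <= K * rr i.
  apply: filterS2 rrS taylor => i /andP[ri0 riS] ti.
  have tr : ka * rr i < r0 by rewrite (le_lt_trans _ kaS) // ler_pM2l.
  have kr0 : 0 < ka * rr i by rewrite mulr_gt0.
  have t1 := ti (ka * rr i); have t2 := ti (- (ka * rr i)).
  rewrite normrN gtr0_norm // tr in t1 t2.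
  have := t1 isT; have := t2 isT; rewrite !ler_norml -!rr2.
  move=> /andP[_ u2] /andP[_ u1].
  have n1 := nn i (ka * rr i); have n2 := nn i (- (ka * rr i)).
  rewrite sqrrN in u2.
  have E : K * rr i * (ka * rr i) = rr i ^+ 2 + M * (ka * rr i) ^+ 2.
    by rewrite /K; field; rewrite gt_eqF.
  by apply/andP; split; rewrite -(ler_pM2r kr0) ?mulNr E; lra.
(* [c <= ka] keeps the rescaled window inside the interval, and [c * (K + M + 1) <= 1] makes each of
   the three terms in the expansion of [nq Y] at most [rr ^ 2], whence the bound [2 ^ 2] on
   [nq X]. *)
pose c := Num.min ka (K + M + 1)^-1.
have KM0 : 0 < K + M + 1 by exact: (addr_gt0 (addr_gt0 K0 M0) ltr01).
have c0 : 0 < c by rewrite lt_min ka0 invr_gt0.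
have cka : c <= ka by rewrite ge_min lexx.
have cKM : c * (K + M + 1) <= 1.
  by rewrite -ler_pdivlMr // mul1r ge_min lexx orbT.
have c1 : c <= 1 by rewrite (le_trans _ cKM) // ler_pMr //; lra.
(* Space is divided by [rr] and time is stretched by [(c * rr)^-1], so that the velocity only
   changes by the constant [c] and a bound for [X'] is one for [Y']. *)
pose X (p : I * R) : E := (rr p.1)^-1 *: Y (p.1, c * rr p.1 * p.2).
pose X' (p : I * R) : E := c *: Y' (p.1, c * rr p.1 * p.2).
have crr : \forall i \near U, forall t, `|t| < 1 -> `|c * rr i * t| < r0.
  apply: filterS rrS => i /andP[ri0 riS] t t1.
  rewrite normrM gtr0_norm ?mulr_gt0 // (le_lt_trans _ kaS) //.
  rewrite (le_trans (ler_wpM2l _ (ltW t1))) ?mulr_ge0 ?(ltW c0) ?(ltW ri0) // mulr1.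
  by rewrite ler_pM ?(ltW c0) ?(ltW ri0).
have X4 : \forall i \near U, forall t, `|t| < 1 -> nq (X (i, t)) <= 2 ^+ 2.
  apply: filterS3 (filterI rrS crr) glaeser taylor => i [/andP[ri0 riS] ci] gi ti t t1.
  have := ti _ (ci t t1); rewrite ler_norml => /andP[_ u].
  rewrite /X nqZ -rhoE exprVn ler_pdivrMl ?exprn_gt0 //=.
  have h1 : rho 1%N (i, 0) * (c * rr i * t) <= rr i ^+ 2.
    rewrite (le_trans (ler_norm _)) // normrM.
    have h2 : `|c * rr i * t| <= c * rr i.
      rewrite normrM gtr0_norm ?mulr_gt0 // -[leRHS]mulr1 ler_wpM2l ?mulr_ge0 ?ltW //.
    apply: (le_trans (ler_pM _ _ gi h2)) => //.
    have -> : K * rr i * (c * rr i) = (c * K) * rr i ^+ 2 by ring.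
    rewrite -[leRHS]mul1r ler_wpM2r ?sqr_ge0 // (le_trans _ cKM) // ler_pM2l //; lra.
  have h2 : M * (c * rr i * t) ^+ 2 <= rr i ^+ 2.
    have -> : M * (c * rr i * t) ^+ 2 = (M * c) * c * (t ^+ 2) * rr i ^+ 2 by ring.
    rewrite -[leRHS]mul1r ler_wpM2r ?sqr_ge0 // mulr_ile1 ?sqr_ge0 //.
    + by rewrite !mulr_ge0 // ltW.
    + rewrite mulr_ile1 ?mulr_ge0 ?(ltW c0) ?(ltW M0) //.
      by rewrite mulrC (le_trans _ cKM) // ler_pM2l //; lra.
    + by rewrite -(real_normK (num_real t)) exprn_ile1 // ltW.
  by move: u; rewrite -rr2; have := sqr_ge0 (rr i); lra.
have dX : dcurve X X'.
  exists 1 => //; apply: filterS3 rrS crr hM => i /andP[ri0 riS] ci hMi t t1 j.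
  have [_ _ _ _ /(_ j) dYj] := hMi _ (ci t t1).
  have dl : is_derive t (1 : R) (fun s => c * rr i * s) (c * rr i).
    by apply: (isd_eq (isdM (isd_cst (c * rr i) t) (isd_id t))); rewrite mul0r add0r mulr1.
  have dcomp := is_derive1_comp dYj dl.
  rewrite (_ : (fun s => _) = fun s => (rr i)^-1 * (Y (i, c * rr i * s) j 0)); last first.
    by apply/funext => s; rewrite mxE.
  apply: (isd_eq (isdM (isd_cst (rr i)^-1 t) dcomp)).
  by rewrite mul0r add0r /X' /= [in RHS]mxE; field; rewrite gt_eqF.
(* For a form of degree [m], the derivative of order [d] of [f X] carries the factor
   [c ^ d * rr ^ (d - m)], bounded because [m <= d]; [f X] is bounded as [X] is, and interpolation
   gives the orders in between. *)
have clX f : polyf f -> inv H f -> cl bfilter bbase d (fun p => f (X p)).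
  apply: (cl_gen BC genH) => {}f [pf fH [m [m0 md hf]]].
  have [phi [phi0 phib phid]] := cl_chain (clY f pf fH).
  have [Mp hMp] := phib d (leqnn d).
  have phid' : bfilter [set p | forall j : 'I_d,
      is_derive p.2 (1 : R) (fun s => phi j (p.1, s)) (phi j.+1 p)].
    by apply: (@filter_forall _ 'I_d (fun j p => is_derive p.2 (1 : R)
      (fun s => phi j (p.1, s)) (phi j.+1 p)) bfilter FF) => j; exact: phid.
  have [rp rp0 hrp] := filterI hMp phid'.
  have [A0 [A00 hA0]] := polyf_bound 2 pf.
  pose A := A0 + c ^+ d * S ^+ (d - m) * `|Mp|.
  have A1 : c ^+ d * S ^+ (d - m) * `|Mp| <= A by rewrite lerDr.
  have A2 : A0 <= A by rewrite lerDl !mulr_ge0 ?exprn_ge0 // ltW.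
  pose l := Num.min 1 (rp / (c * S)).
  have cS0 : 0 < c * S by rewrite mulr_gt0.
  have l0 : 0 < l by rewrite lt_min ltr01 divr_gt0.
  have l1 : l <= 1 by rewrite ge_min lexx.
  have lrp : c * S * l <= rp.
    by rewrite mulrC -ler_pdivlMr // ge_min lexx orbT.
  have [C C0 hC] := interp d A l0.
  pose Phi j (p : I * R) := (rr p.1)^-1 ^+ m * (c * rr p.1) ^+ j * phi j (p.1, c * rr p.1 * p.2).
  have Phi0 p : f (X p) = Phi 0%N p by rewrite /X hf /Phi expr0 mulr1 phi0.
  have good_i : \forall i \near U, (forall j t, (j < d)%N -> `|t| < l ->
      is_derive t (1 : R) (fun s => Phi j (i, s)) (Phi j.+1 (i, t))) /\
      (forall j t, (j <= d)%N -> `|t| < l -> `|Phi j (i, t)| <= C).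
    apply: filterS3 rrS hrp X4 => i /andP[ri0 riS] hi X4i.
    have win t : `|t| < l -> `|c * rr i * t| < rp.
      move=> tl; rewrite normrM gtr0_norm ?mulr_gt0 // (lt_le_trans _ lrp) //.
      rewrite (@le_lt_trans _ _ (c * S * `|t|)) ?ltr_pM2l //.
      by rewrite ler_wpM2r // ler_pM2l.
    have dPhi j t : (j < d)%N -> `|t| < l ->
        is_derive t (1 : R) (fun s => Phi j (i, s)) (Phi j.+1 (i, t)).
      move=> jd tl; have [_ /(_ (Ordinal jd)) /= dphi] := hi _ (win t tl).
      have dl : is_derive t (1 : R) (fun s => c * rr i * s) (c * rr i).
        by apply: (isd_eq (isdM (isd_cst (c * rr i) t) (isd_id t))); rewrite mul0r add0r mulr1.
      have dcomp := is_derive1_comp dphi dl.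
      apply: (isd_eq (isdM (isd_cst ((rr i)^-1 ^+ m * (c * rr i) ^+ j) t) dcomp)).
      by rewrite mul0r add0r /Phi /= exprS; ring.
    split=> // j t jd tl; apply: (hC (fun j s => Phi j (i, s))) => // [s sl|s sl].
      rewrite -Phi0 (le_trans _ A2) // hA0 // => k.
      by apply: coord_le_nq => //; apply: X4i; exact: lt_le_trans l1.
    have [hs _] := hi _ (win s sl).
    rewrite (le_trans _ A1) // /Phi normrM ler_pM //.
      rewrite ger0_norm ?mulr_ge0 ?exprn_ge0 ?invr_ge0 ?mulr_ge0 ?(ltW c0) ?(ltW ri0) //.
      rewrite /= exprMn exprVn mulrCA ler_pM2l ?exprn_gt0 //.
      have -> : rr i ^- m * rr i ^+ d = rr i ^+ (d - m).
        by rewrite -[X in _ * _ ^+ X](subnK md) exprD mulrCA mulVf ?mulr1 // gt_eqF ?exprn_gt0.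
      by rewrite lerXn2r // nnegrE ltW.
    by rewrite (le_trans hs) // ler_norm.
  apply: (@cl_ext' _ _ _ _ BC _ (Phi 0%N)) => [p|]; first by rewrite Phi0.
  apply: chain_cl => j jd.
    by exists C; exists l => //; apply: filterS good_i => i [_ h] t /h; apply.
  by exists l => //; apply: filterS good_i => i [h _] t /(h _ _ jd).

(* Passage to the isotropy group of a limit vector *)
have X0 : \forall i \near U, nq (X (i, 0)) = 1.
  apply: filterS rrS => i /andP[ri0 _].
  by rewrite /X nqZ /= mulr0 -rhoE -rr2 -exprMn mulVf ?expr1n // gt_eqF.
have cX (j : 'I_n) : cvg (X (i, 0) j 0 @[i --> U]).
  apply: (@ultra_cvg_real _ _ _ _ 1 UU); apply: filterS X0 => i X1.
  by apply: coord_le_nq => //; rewrite X1 expr1n.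
pose v : E := \col_j lim (X (i, 0) j 0 @[i --> U]).
have Xv : cvc U (fun i => X (i, 0)) v by move=> j; rewrite mxE; exact: cX.
have v1 : nq v = 1.
  have h1 : nq (X (i, 0)) @[i --> U] --> nq v by exact: (polyf_cvc (polyf_nq _ _) Xv).
  have h2 : nq (X (i, 0)) @[i --> U] --> (1 : R).
    apply: cvg_trans (@cvg_cst R 1 _ U _); apply: near_eq_cvg.
    by apply: filterS X0 => i ->.
  exact: (cvg_unique _ h1 h2).
have Pv : P *m v = 0.
  have h1 : cvc U (fun i => P *m X (i, 0)) (P *m v) by exact: cvc_mulmx.
  have h2 : cvc U (fun i => P *m X (i, 0)) 0.
    apply: (cvc_eq _ (@cvc_cst R n _ U _ 0)); apply: nearW => i.
    by rewrite /X -scalemxAr PY scaler0.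
  exact: (cvc_uniq h1 h2).
have nfix : ~ fixp H v.
  by move=> fv; move: v1; rewrite -(fix_proj HG fv) Pv nq0 => /eqP; rewrite eq_sym oner_eq0.
have [k k0 sep] := orb_sep H v.
pose e := k / 8; have e0 : 0 < e by rewrite divr_gt0.
have ek : 8 * e <= k by rewrite /e mulrC divfK.
set O := orb H v; pose N0 := size O.
have eN0 : 0 < e ^+ N0 by rewrite exprn_gt0.
(* The invariant [dorb O] has a bounded derivative and is small at time [0]. On a short common
   interval [X] therefore stays near the orbit of [v], and by [stay] near [v] itself. *)
have close : bfilter [set p | nq (X p - v) < e].
  have d1 : (1 <= d)%N by exact: ltnW.
  have [_ [b' [db' [[Mb hMb] _]]]] :=
    cl_le d1 (clX _ (polyf_dorb O) (inv_dorb v HG)).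
  have [rb rb0 hrb] := filterI (filterI hMb db') dX.
  have b0 : \forall i \near U, dorb O (X (i, 0)) < e ^+ N0 / 2.
    have h1 : dorb O (X (i, 0)) @[i --> U] --> dorb O v.
      exact: (polyf_cvc (polyf_dorb O) Xv).
    by have /cvgr_lt := h1; apply; rewrite dorb0 ?orb_refl // divr_gt0.
  have n0 : \forall i \near U, nq (X (i, 0) - v) < e.
    have h1 : nq (X (i, 0) - v) @[i --> U] --> nq (v - v).
      exact: (polyf_cvc (polyf_nqB v) Xv).
    by have /cvgr_lt := h1; apply; rewrite subrr nq0.
  pose l := Num.min rb (e ^+ N0 / (2 * (`|Mb| + 1))).
  have Mb1 : 0 < `|Mb| + 1 by rewrite ltr_wpDl.
  have l0 : 0 < l by rewrite lt_min rb0 divr_gt0 // mulr_gt0.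
  exists l => //; apply: filterS3 b0 n0 hrb => i b0 n0 hi t tl.
  have in_l (s : R) : Num.min 0 t <= s <= Num.max 0 t -> `|s| < l.
    by move=> /between0_norm /le_lt_trans; apply.
  have l_rb (s : R) : `|s| < l -> `|s| < rb by rewrite lt_min => /andP[].
  apply: (stay sep ek e0 (y := fun s => X (i, s)) (s0 := 0) (s := t)) => // s /in_l sl.
  split.
    apply: nq_cont => j; have [_ /(_ j) dj] := hi s (l_rb s sl).
    by eexists; exact: dj.
  have [|u us E1] := @mvt R (fun s => dorb O (X (i, s))) (fun s => b' (i, s)) 0 s.
    move=> u /between0_norm us; have ul : `|u| < l by exact: le_lt_trans sl.
    by have [[_ d1'] _] := hi u (l_rb u ul).
  have ul : `|u| < l by apply: le_lt_trans sl; exact: between0_norm.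
  have [[bu _] _] := hi u (l_rb u ul).
  have -> : dorb O (X (i, s)) = dorb O (X (i, 0)) + b' (i, u) * s.
    by rewrite -[s in RHS]subr0 -E1 addrC subrK.
  have : `|b' (i, u) * s| <= e ^+ N0 / 2.
    rewrite normrM (@le_trans _ _ ((`|Mb| + 1) * l)) //.
      rewrite ler_pM // ?(ltW sl) // (le_trans bu) // (le_trans (ler_norm _)) //.
      by rewrite lerDl.
    rewrite (@le_trans _ _ ((`|Mb| + 1) * (e ^+ N0 / (2 * (`|Mb| + 1))))) //.
      by rewrite ler_pM2l // ge_min lexx orbT.
    rewrite le_eqVlt; apply/orP; left; apply/eqP; move: (e ^+ N0) (`|Mb| + 1) Mb1 => E0 M1 M10.
    by field; rewrite gt_eqF.
  move=> /(le_trans (ler_norm _)) h; apply: (lt_le_trans (ltr_leD b0 h)).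
  by rewrite -splitr.
have HS := isgrp_stab v HG.
have clS f : polyf f -> inv (stab H v) f -> cl bfilter bbase d (fun p => f (X p)).
  apply: (cl_slice BC HG k0 sep clX).
  - have [Cb [Cb0 hCb]] := polyf_bound 2 (polyf_nqB v).
    exists Cb; exists 1 => //; apply: filterS X4 => i X4i t t1 /=.
    by apply: hCb => j; apply: coord_le_nq => //; exact: X4i.
  - apply: filterS dX => p dp; apply: nq_cont => j; by eexists; exact: dp.
  - by apply: filterS close => p /= /ltW.
have [|C hC] := IH (stab H v) _ X X' HS (gen_stab (v := v) HG genH) d2 dX clS.
  by rewrite -ltnS (leq_trans _ HN) // ltnS size_stab.
exists ((c ^+ 2)^-1 * C); apply: filterS hC => i.
rewrite /X' /= mulr0 nqZ => h.
by rewrite ler_pdivlMl ?exprn_gt0.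
Unshelve. all: by end_near. Qed.

End Bounded.

(** * Continuity of the derivative of a lift *)

Section Flat.
Variable R : realType.
Implicit Types (phi : nat -> R -> R) (f g : R -> R).

Lemma isd_comp f g t a b : is_derive (g t) (1 : R) f a -> is_derive t (1 : R) g b ->
  is_derive t (1 : R) (fun s => f (g s)) (a * b).
Proof. by move=> df dg; exact: (is_derive1_comp df dg). Qed.

Lemma cont_dnbhs f : {for 0, continuous f} -> f t @[t --> (0 : R)^'] --> f 0.
Proof. by move=> cf; apply: cvg_trans cf; apply: cvg_app; exact: cvg_within. Qed.

Lemma right_cvg f (l : R) : f t @[t --> (0 : R)^'] --> l -> f t @[t --> 0^'+] --> l.
Proof. by move=> cf; apply: cvg_trans cf; apply: cvg_app => P; exact: right_dnbhs. Qed.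

(** De l'Hospital's rule by way of [avg_limit]: the quotient solves the averaging equation for
    [psi], the quotient of the derivative by one power less. *)
Lemma flat_limit m phi : (forall i, (i < m)%N -> phi i 0 = 0) ->
  (forall i, (i < m)%N -> \forall t \near 0, is_derive t (1 : R) (phi i) (phi i.+1 t)) ->
  {for 0, continuous (phi m)} ->
  phi 0%N t / t ^+ m @[t --> (0 : R)^'] --> phi m 0 / m`!%:R.
Proof.
elim: m phi => [|m IH] phi phi0 dphi cphi.
  rewrite fact0 divr1; apply: cvg_trans (cont_dnbhs cphi).
  by apply: near_eq_cvg; apply: nearW => t; rewrite expr0 divr1.
pose c := phi m.+1 0 / m`!%:R.
have cc : phi 1%N t / t ^+ m @[t --> (0 : R)^'] --> c.
  apply: (IH (fun i => phi i.+1)) => // i im; [exact: phi0 | exact: dphi].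
pose psi t := if t == 0 then c else phi 1%N t / t ^+ m.
have cpsi : {for 0, continuous psi}.
  apply/continuous_withinNx; rewrite /psi eqxx; apply: cvg_trans cc.
  apply: near_eq_cvg; near=> t; rewrite ifF //; apply/negbTE.
  by near: t; exact: nbhs_dnbhs_neq.
have d0 := dphi 0%N isT.
have -> : phi m.+1 0 / (m.+1)`!%:R = psi 0 / m.+1%:R.
  by rewrite /psi eqxx /c factS natrM invfM mulrA mulrAC.
apply: avg_limit => //.
  have c0 := cont_dnbhs (isd_cont (nbhs_singleton d0)); rewrite phi0 // in c0.
  apply: cvg_trans c0; apply: near_eq_cvg; near=> t.
  have t0 : t != 0 by near: t; exact: nbhs_dnbhs_neq.
  by rewrite mulrC divfK // expf_neq0.
have d0' : \forall t \near (0 : R)^', is_derive t (1 : R) (phi 0%N) (phi 1%N t).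
  by apply: filterS d0.
near=> t; have t0 : t != 0 by near: t; exact: nbhs_dnbhs_neq.
have dt : is_derive t (1 : R) (phi 0%N) (phi 1%N t) by near: t.
have tm : t ^+ m.+1 != 0 by rewrite expf_neq0.
have dq := isdM dt (@isdV R (fun t => t ^+ m.+1) t _ tm (isd_pow m t)); apply: (isd_eq dq).
rewrite /psi (negbTE t0) exprS.
have tm' : t ^+ m != 0 by rewrite expf_neq0.
by move: (t ^+ m) tm' => u u0; field; rewrite t0 u0.
Unshelve. all: by end_near. Qed.

Lemma flat_vanish m phi (C : R) :
  (forall i, (i < m)%N -> \forall t \near 0, is_derive t (1 : R) (phi i) (phi i.+1 t)) ->
  (\forall t \near 0^', `|phi 0%N t| <= C * `|t| ^+ m) ->
  forall i, (i < m)%N -> phi i 0 = 0.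
Proof.
move=> dphi hC; elim/ltn_ind => i IH im.
have c1 : phi 0%N t / t ^+ i @[t --> (0 : R)^'] --> phi i 0 / i`!%:R.
  apply: flat_limit => [j ji|j ji|].
  - by apply: IH => //; exact: ltn_trans im.
  - by apply: dphi; exact: ltn_trans im.
  - exact: isd_cont (nbhs_singleton (dphi i im)).
have c2 : `|phi 0%N t / t ^+ i| @[t --> (0 : R)^'] --> `|phi i 0 / i`!%:R|.
  exact: cvg_norm.
have c3 : C * `|t| ^+ (m - i) @[t --> (0 : R)^'] --> C * `|0 : R| ^+ (m - i).
  apply: cvgM; first exact: cvg_cst.
  apply: cvg_expn; apply: cvg_norm; exact: cvg_within.
have : `|phi i 0 / i`!%:R| <= C * `|0 : R| ^+ (m - i).
  apply: (ler_cvg_to c2 c3); near=> t.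
  have t0 : t != 0 by near: t; exact: nbhs_dnbhs_neq.
  have ti : 0 < `|t| ^+ i by rewrite exprn_gt0 // normr_gt0.
  rewrite normrM normfV normrX ler_pdivrMr // -mulrA -exprD subnK ?(ltnW im) //.
  by near: t.
rewrite normr0 expr0n subn_eq0 leqNgt im mulr0 normr_le0 mulf_eq0 invr_eq0.
by rewrite pnatr_eq0 -leqn0 leqNgt fact_gt0 orbF => /eqP.
Unshelve. all: by end_near. Qed.

Lemma Ck_chain m f : Ck m 0 f -> exists phi : nat -> R -> R,
  [/\ phi 0%N = f,
    forall i, (i < m)%N -> \forall t \near 0, is_derive t (1 : R) (phi i) (phi i.+1 t) &
    {for 0, continuous (phi m)}].
Proof.
move=> /cl_chain[phi [p0 pb pd]]; exists (fun i t => phi i (tt, t)); split.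
- by rewrite p0.
- by move=> i im; exact: (pd i im).
- exact: (nbhs_singleton (pb m (leqnn m))).
Qed.

End Flat.

Section Windows.
Variable R : realType.

(** Windows of logarithmic time: the points [h * exp s] with [|s| < 1], as [h] decreases to [0].
    Differentiation in [s] is the operator [t d/dt], which respects quotients by powers of [t]. *)
Definition wfilter : set_system (R * R) :=
  [set P | \forall h \near 0^'+, forall s, `|s| < 1 -> P (h, s)].

Definition wbase (f : R * R -> R) := exists c : R, f p @[p --> wfilter] --> c.

Definition wtime (p : R * R) : R := p.1 * expR p.2.

Lemma wfilter_filter : Filter wfilter.
Proof.
split; first by apply: nearW.
  move=> P Q h1 h2; apply: (@filterS2 _ (0 : R)^'+ _ _ _ _ _ h1 h2) => h {}h1 {}h2 s s1.
  by split; [exact: h1 | exact: h2].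
by move=> P Q PQ hP; apply: (@filterS _ (0 : R)^'+ _ _ _ _ hP) => h Ph s /Ph /PQ.
Qed.
#[local] Existing Instance wfilter_filter.

Lemma wfilter_proper : ProperFilter wfilter.
Proof.
apply: Build_ProperFilter_ex => P h; have [t] := @filter_ex _ (0 : R)^'+ _ _ h.
by move=> /(_ 0); rewrite normr0 => /(_ ltr01) Pt; exists (t, 0).
Qed.
#[local] Existing Instance wfilter_proper.

Lemma wnear (P : R -> Prop) : (\forall t \near 0^'+, P t) -> wfilter [set p | P (wtime p)].
Proof.
move=> [d /= d0 hd]; exists (d / expR 1); first by rewrite /= divr_gt0 ?expR_gt0.
move=> h /=; rewrite sub0r normrN => hh h0 s; rewrite ltr_norml => /andP[_ s1].
have T0 : 0 < wtime (h, s) by rewrite mulr_gt0 ?expR_gt0.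
apply: hd => //=; rewrite sub0r normrN gtr0_norm // /wtime /=.
rewrite (@lt_trans _ _ (h * expR 1)) ?ltr_pM2l ?ltr_expR //.
by rewrite -ltr_pdivlMr ?expR_gt0 //; rewrite gtr0_norm in hh.
Qed.

Lemma wcvg (f : R -> R) (l : R) : f t @[t --> 0^'+] --> l ->
  f (wtime p) @[p --> wfilter] --> l.
Proof. by move=> cf P /cf /wnear. Qed.

Lemma wcalculus : calculus wfilter wbase.
Proof.
split; first exact: wfilter_filter.
- move=> P hP; apply: (@filterS _ (0 : R)^'+ _ _ _ _ hP) => h Ph t /=; rewrite ltr_norml => /andP[t1 t2].
  near=> s; apply: Ph; rewrite ltr_norml; apply/andP.
  split; near: s; [exact: lt_nbhsr | exact: lt_nbhsl].
- move=> f g fg [c cf]; exists c; apply: cvg_trans cf; apply: near_eq_cvg.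
  by apply: filterS fg => p ->.
- by move=> c; exists c; exact: cvg_cst.
- by move=> f g [c cf] [c' cg]; exists (c + c'); exact: cvgD.
- by move=> f g [c cf] [c' cg]; exists (c * c'); exact: cvgM.
- move=> f k k0 kf [c cf]; exists c^-1; apply: cvgV => //.
  have cn : `|f p| @[p --> wfilter] --> `|c| by exact: cvg_norm.
  have ck : (fun=> k) p @[p --> wfilter] --> k by exact: cvg_cst.
  by rewrite -normr_gt0 (lt_le_trans k0) //; exact: (ler_cvg_to ck cn).
Unshelve. all: by end_near. Qed.

Lemma isd_wtime h t : is_derive t (1 : R) (fun s => wtime (h, s)) (wtime (h, t)).
Proof. by apply: (isd_eq (isdM (isd_cst h t) (is_derive_expR t))); rewrite mul0r add0r. Qed.

Lemma wtime_cl m : cl wfilter wbase m wtime.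
Proof.
have b0 : wbase wtime.
  by exists 0; apply: (@wcvg id); apply: cvg_within.
elim: m => [|m IH]; first by split.
split=> //; exists wtime; split=> //; apply: filterE => -[h t]; exact: isd_wtime.
Qed.

(** In logarithmic time, dividing by [t ^ m] costs no derivatives: [t d/dt] maps [phi / t ^ m] to
    [phi' / t ^ (m - 1) - m * phi / t ^ m], terms of the same kind. *)
Lemma wcl_flat s D m (phi : nat -> R -> R) : (m <= D)%N -> (s <= D)%N ->
  (forall i, (i < m)%N -> phi i 0 = 0) ->
  (forall i, (i < D)%N -> \forall t \near 0, is_derive t (1 : R) (phi i) (phi i.+1 t)) ->
  {for 0, continuous (phi D)} ->
  cl wfilter wbase s (fun p => phi 0%N (wtime p) / wtime p ^+ m).
Proof.
have cphi D' (psi : nat -> R -> R) j : (j <= D')%N ->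
    (forall i, (i < D')%N -> \forall t \near 0, is_derive t (1 : R) (psi i) (psi i.+1 t)) ->
    {for 0, continuous (psi D')} -> {for 0, continuous (psi j)}.
  rewrite leq_eqVlt => /predU1P[->//|jD] dpsi _.
  exact: isd_cont (nbhs_singleton (dpsi j jD)).
elim: s D m phi => [|s IH] D m phi mD sD phi0 dphi cD.
  split=> //; exists (phi m 0 / m`!%:R).
  apply: (@wcvg (fun t => phi 0%N t / t ^+ m)); apply: right_cvg.
  apply: flat_limit => // [i im|]; last exact: cphi cD.
  by apply: dphi; exact: leq_trans im mD.
case: D mD sD dphi cD => // D mD sD dphi cD.
have d0 : wfilter [set p | 0 < wtime p /\
    is_derive (wtime p) (1 : R) (phi 0%N) (phi 1%N (wtime p))].
  apply: (@wnear (fun t => 0 < t /\ is_derive t (1 : R) (phi 0%N) (phi 1%N t))).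
  have d0 : \forall t \near (0 : R)^', is_derive t (1 : R) (phi 0%N) (phi 1%N t).
    by apply: filterS (dphi 0%N isT).
  have d1 := right_dnbhs d0.
  by near=> t; split; near: t; [exact: nbhs_right_gt | exact: d1].
have dc : dtau wfilter (fun p => phi 0%N (wtime p)) (fun p => phi 1%N (wtime p) * wtime p).
  apply: filterS d0 => -[h t] /= [_ dt].
  exact: (@isd_comp R _ (fun s => wtime (h, s)) t _ _ dt (isd_wtime h t)).
split; first exact: (cl_b (IH D.+1 m phi mD (ltnW sD) phi0 dphi cD)).
case: m mD phi0 => [|m] mD phi0.
  exists (fun p => phi 1%N (wtime p) * wtime p); split.
    apply: filterS dc => -[h t] /= dt.
    rewrite (_ : (fun s => _) = fun s => phi 0%N (wtime (h, s))) //.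
    by apply/funext => u; rewrite expr0 divr1.
  apply: (cl_mul wcalculus); last exact: wtime_cl.
  have h := IH D 0%N (fun i => phi i.+1) (leq0n D) sD.
  apply: (cl_ext' wcalculus) (h _ _ _) => // [p|i iD]; first by rewrite expr0 divr1.
  exact: dphi.
exists (fun p => phi 1%N (wtime p) / wtime p ^+ m -
  m.+1%:R * (phi 0%N (wtime p) / wtime p ^+ m.+1)); split.
  apply: filterS2 dc d0 => -[h t] /= dt [t0 _].
  have tm : wtime (h, t) ^+ m.+1 != 0 by rewrite expf_neq0 // gt_eqF.
  have dp := @isd_comp R _ (fun s => wtime (h, s)) t _ _ (isd_pow m (wtime (h, t))) (isd_wtime h t).
  have dq := isdM dt (@isdV R (fun s => wtime (h, s) ^+ m.+1) t _ tm dp); apply: (isd_eq dq).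
  have tm' : wtime (h, t) ^+ m != 0 by rewrite expf_neq0 // gt_eqF.
  rewrite /= exprS; move: (wtime (h, t)) (wtime (h, t) ^+ m) t0 tm' => u v u0 v0.
  by field; rewrite v0 gt_eqF.
apply: (cl_add wcalculus).
  apply: (IH D m (fun i => phi i.+1)) => // i iD; [exact: phi0 | exact: dphi].
apply: (cl_ext' wcalculus) (cl_mul wcalculus (cl_cst wcalculus s (- m.+1%:R))
  (IH D.+1 m.+1 phi mD (ltnW sD) phi0 dphi cD)) => p.
by rewrite mulNr.
Unshelve. all: by end_near. Qed.

(** A nonzero limit of [f'] would make [f] vary by a definite amount between the times [0] and
    [1 / 2] of a window, whereas [f] is nearly constant there. *)
Lemma wderiv0 f f' : wbase f -> wbase f' -> dtau wfilter f f' ->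
  f' p @[p --> wfilter] --> (0 : R).
Proof.
move=> [c cf] [c' cf'] df; suff c0 : c' = 0 by rewrite -c0.
apply/eqP; apply: contraT => c'0; pose e := `|c'| / 8.
have e0 : 0 < e by rewrite divr_gt0 // normr_gt0.
have ec : `|c'| = 8 * e by rewrite /e mulrC divfK.
have /cvgrPdist_lt /(_ e e0) h1 := cf; have /cvgrPdist_lt /(_ e e0) h2 := cf'.
have h3 : wfilter [set p | [/\ `|c - f p| < e, `|c' - f' p| < e &
    is_derive p.2 (1 : R) (fun s => f (p.1, s)) (f' p)]].
  by apply: filterS3 h1 h2 df.
have [k hk] := @filter_ex _ (0 : R)^'+ _ _ h3.
have h12 : (0 : R) <= 1 / 2 by rewrite divr_ge0.
have [|s] := @mvt R (fun s => f (k, s)) (fun s => f' (k, s)) 0 (1 / 2).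
  rewrite min_l // max_r // => s /andP[s1 s2].
  by have [|_ _] := hk s; first by rewrite ger0_norm //; lra.
rewrite min_l // max_r // => /andP[s1 s2].
have [|a1 a2 _] := hk s; first by rewrite ger0_norm //; lra.
have [|b1 _ _] := hk 0; first by rewrite normr0.
have [|b2 _ _] := hk (1 / 2); first by rewrite ger0_norm //; lra.
move: a2 b1 b2; rewrite !ltr_norml => /andP[u1 u2] /andP[u3 u4] /andP[u5 u6] E.
by case: (ler0P c') ec => c0 ec; lra.
Qed.

End Windows.

Section DerivLimit.
Variables (R : realType) (n : nat).
Notation E := 'cV[R]_n.
Implicit Types (H : seq 'M[R]_n) (x : R -> E).

#[local] Existing Instance wfilter_filter.
#[local] Existing Instance wfilter_proper.

Definition isdc x t (l : E) := forall i, is_derive t (1 : R) (fun s => x s i 0) (l i 0).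

Lemma isdc_cont x t l : isdc x t l -> ccont x t.
Proof. by move=> dx i; exact: isd_cont (dx i). Qed.

Lemma isdc_blowup x v t l : t != 0 -> isdc x t l ->
  isdc (fun s => s^-1 *: (x s - v)) t (t^-1 *: (l - t^-1 *: (x t - v))).
Proof.
move=> t0 dx i.
have dv := @isdV R (fun s => s) t _ t0 (isd_id t).
have dq := isdM dv (isdD (dx i) (isd_cst (- v i 0) t)).
rewrite (_ : (fun s => _) = fun s => s^-1 * (x s i 0 + - v i 0)).
  by apply: (isd_eq dq); rewrite !mxE; field.
by apply/funext => s; rewrite !mxE.
Qed.

Lemma wcl_null m f : cl (wfilter (R := R)) (wbase (R := R)) m f ->
  f p @[p --> wfilter (R := R)] --> 0 ->
  exists phi : nat -> R * R -> R, [/\ phi 0%N = f,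
    forall j, (j <= m)%N -> phi j p @[p --> wfilter (R := R)] --> 0 &
    forall j, (j < m)%N -> dtau (wfilter (R := R)) (phi j) (phi j.+1)].
Proof.
move=> /cl_chain[phi [p0 pb pd]] f0; exists phi; split=> // -[_|j jm]; first by rewrite p0.
exact: wderiv0 (pb j (ltnW jm)) (pb j.+1 jm) (pd j jm).
Qed.

(** The blow-up [z] of [x] at [0], read in the time [h * expR s], has [s]-derivative
    [x' - z]. Were it not to tend to [0], the curves [lam^-1 *: (z - a)] would
    violate [lift_lipschitz]. *)
Theorem deriv_right_limit d H x x' : isgrp H -> gen d H -> (2 <= d)%N ->
  gcurve d H x 0 -> (\forall s \near 0, isdc x s (x' s)) -> cvc 0^'+ x' (x' 0).
Proof.
move=> HG genH d2 gx dx.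
have FP : ProperFilter ((0 : R)^'+) by exact: _.
have [WC WP] := (@wcalculus R, @wfilter_proper R).
set W := wfilter (R := R) in WP *.
have cx : \forall s \near 0, {for s, continuous (fun s => nq (x s - x 0))}.
  by apply: filterS dx => s dxs; apply: nq_cont => i; eexists; exact: dxs.
have gxK := gcurve_slice HG gx cx.
set K := stab H (x 0) in gxK; have KG : isgrp K := isgrp_stab (x 0) HG.
have genK : gen d K := gen_stab (v := x 0) HG genH.
have fixK g : g \in K -> g *m x 0 = x 0 by rewrite mem_filter => /andP[/eqP].
pose a := x' 0; pose z t : E := t^-1 *: (x t - x 0).
have dx0 := nbhs_singleton dx.
have za' : cvc (0 : R)^' z a.
  move=> i; have := isd_quot (dx0 i); apply: cvg_trans; apply: near_eq_cvg.
  by apply: nearW => t; rewrite !mxE add0r.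
have za : cvc 0^'+ z a by move=> i; exact: right_cvg (za' i).
have dxr : \forall t \near (0 : R)^'+, 0 < t /\ isdc x t (x' t).
  have dx' : \forall t \near (0 : R)^', isdc x t (x' t) by apply: filterS dx.
  have dx'' := right_dnbhs dx'.
  by near=> t; split; near: t; [exact: nbhs_right_gt | exact: dx''].
have dz : W [set p | isdc (fun s => z (wtime (p.1, s))) p.2
    (x' (wtime p) - z (wtime p))].
  apply: filterS (wnear dxr) => -[h t] /= [t0 dxt] i.
  have dzt := isdc_blowup (x 0) (lt0r_neq0 t0) dxt i.
  have dc := @isd_comp R _ (fun s => wtime (h, s)) t _ _ dzt (isd_wtime h t).
  by apply: (isd_eq dc); rewrite /z !mxE; field; exact: lt0r_neq0.
have cl_inv_shift G (v : E) f : (forall g, g \in G -> g *m v = v) -> polyf f -> inv G f ->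
    polyf (fun u => f (u - v)) /\ inv G (fun u => f (u - v)).
  move=> fv pf fG; split; first exact: (polyf_shift (- v) pf).
  by move=> g u gG; rewrite -{1}(fv g gG) -mulmxBr fG.
(* As the class is taken in logarithmic time, the invariants of the blow-up keep all [d]
   derivatives. *)
have clz f : polyf f -> inv K f -> cl W (wbase (R := R)) d (fun p => f (z (wtime p))).
  apply: (cl_gen WC genK) => {}f [pf fH [m [m0 md hf]]].
  have [p1 p2] := cl_inv_shift K (x 0) f fixK pf fH.
  have [phi [phi0 dphi cphi]] := Ck_chain (gxK _ p1 p2).
  have fz t : t != 0 -> f (x t - x 0) = t ^+ m * f (z t).
    by move=> t0; rewrite -hf /z scalerA mulfV // scale1r.
  have van : forall i, (i < m)%N -> phi i 0 = 0.
    apply: (@flat_vanish R m phi (`|f a| + 1)).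
      by move=> i im; apply: dphi; exact: leq_trans im md.
    have cf : f (z t) @[t --> (0 : R)^'] --> f a by exact: (polyf_cvc pf za').
    have /cvgrPdist_lt /(_ 1 ltr01) h := cf.
    near=> t; have t0 : t != 0 by near: t; exact: nbhs_dnbhs_neq.
    have : `|f a - f (z t)| < 1 by near: t.
    rewrite phi0 fz // normrM normrX mulrC => h1; rewrite ler_wpM2r ?exprn_ge0 //.
    by rewrite -[f (z t)](subKr (f a)) (le_trans (ler_normB _ _)) // lerD2l ltW.
  apply: (cl_ext WC _ (wcl_flat md (leqnn d) van dphi cphi)).
  apply: filterS (wnear dxr) => p /= [t0 _]; rewrite phi0 fz ?lt0r_neq0 //.
  by rewrite mulrC mulKf // expf_neq0 // lt0r_neq0.
have zaW : cvc W (fun p => z (wtime p)) a by move=> i; exact: (@wcvg R (fun t => z t i 0)).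
have nzaW : nq (z (wtime p) - a) @[p --> W] --> 0 by exact/cvc_nq.
have [k k0 sep] := orb_sep K a.
have clza f : polyf f -> inv (stab K a) f -> cl W (wbase (R := R)) d (fun p => f (z (wtime p))).
  apply: (cl_slice WC KG k0 sep clz).
  - by exists 0.
  - by apply: filterS dz => p dzp; apply: nq_cont => i; eexists; exact: dzp.
  - have k8 : 0 < k / 8 by rewrite divr_gt0.
    by have /cvgr_lt /(_ _ k8) := nzaW; apply: filterS => p /ltW.
set L := stab K a in clza; have LG : isgrp L := isgrp_stab a KG.
have genL : gen d L := gen_stab (v := a) KG genK.
have fixL g : g \in L -> g *m a = a by rewrite mem_filter => /andP[/eqP].
pose w p : E := z (wtime p) - a; pose w' p : E := x' (wtime p) - z (wtime p).
have dw : W [set p | isdc (fun s => w (p.1, s)) p.2 (w' p)].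
  apply: filterS dz => -[h t] /= dzt i.
  have dq := isdD (dzt i) (isd_cst (- a i 0) t).
  rewrite (_ : (fun s => _) = fun s => z (wtime (h, s)) i 0 + - a i 0).
    by apply: (isd_eq dq); rewrite addr0.
  by apply/funext => s; rewrite !mxE.
have T0 h : wtime (h, 0) = h :> R by rewrite /wtime /= expR0 mulr1.
suff null : nq (w' (h, 0)) @[h --> (0 : R)^'+] --> 0.
  have h1 : cvc 0^'+ (fun h => w' (h, 0)) 0.
    by apply/cvc_nq; apply: cvg_trans null; apply: near_eq_cvg; apply: nearW => h; rewrite subr0.
  have h2 : cvc 0^'+ (fun h => w' (h, 0) + z h) (0 + a) by exact: cvcD.
  rewrite add0r in h2; apply: (cvc_eq _ h2); apply: nearW => h.
  by rewrite /w' T0 subrK.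
apply: contrapT => nonnull.
have [e e0 he] : exists2 e, 0 < e & ~ \forall h \near (0 : R)^'+, nq (w' (h, 0)) < e.
  apply: contrapT => h; apply: nonnull; apply/cvgrPdist_lt => e e0.
  have : \forall h \near (0 : R)^'+, nq (w' (h, 0)) < e.
    by apply: contrapT => h'; apply: h; exists e.
  by apply: filterS => u; rewrite sub0r normrN ger0_norm ?nq_ge0.
pose S := [set h | e <= nq (w' (h, 0))].
(* [h] tends to [0] before [lam] does: for each fixed [lam] the invariants of [lam^-1 *: w] become
   small, and [lam] can be taken small afterwards. Only the [h] at which [w'] stays large are
   kept. *)
pose FI : set_system (R * R) := [set P | \forall lam \near (0 : R)^'+,
  \forall h \near (0 : R)^'+, S h -> P (lam, h)].
have FIF : Filter FI.
  split.
  - by apply: nearW => lam; apply: nearW.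
  - move=> P Q h1 h2; apply: (@filterS2 _ (0 : R)^'+ _ _ _ _ _ h1 h2) => lam a1 a2.
    by apply: filterS2 a1 a2 => h a1 a2 Sh; split; [exact: a1 | exact: a2].
  - move=> P Q PQ hP; apply: (@filterS _ (0 : R)^'+ _ _ _ _ hP) => lam a1.
    by apply: filterS a1 => h a1 Sh; apply: PQ; exact: a1.
have FIP : ProperFilter FI.
  apply: Build_ProperFilter_ex => P h; have [lam hl] := @filter_ex _ (0 : R)^'+ _ _ h.
  apply: contrapT => nP; apply: he; apply: filterS hl => u Pu.
  by rewrite ltNge; apply/negP => Su; apply: nP; exists (lam, u); exact: Pu.
have [U [UU FIU]] := ultraFilterLemma FIP.
have UP : ProperFilter U := @ultra_proper _ _ UU.
pose Z (p : R * R * R) : E := p.1.1^-1 *: w (p.1.2, p.2).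
pose Z' (p : R * R * R) : E := p.1.1^-1 *: w' (p.1.2, p.2).
have dZ : dcurve U Z Z'.
  exists 1 => //; apply: FIU; apply: nearW => lam.
  apply: (@filterS _ (0 : R)^'+ _ _ _ _ dw) => h dwh _ t t1 i.
  have dq := isdM (isd_cst lam^-1 t) (dwh t t1 i).
  rewrite (_ : (fun s => _) = fun s => lam^-1 * w (h, s) i 0).
    by apply: (isd_eq dq); rewrite mul0r add0r /Z' [RHS]mxE.
  by apply/funext => s; rewrite mxE.
have clZ f : polyf f -> inv L f -> cl (bfilter U) (bbase U) d (fun p => f (Z p)).
  apply: (cl_gen (bounded_calculus R UU) genL) => {}f [pf fH [m [m0 md hf]]].
  have [p1 p2] := cl_inv_shift L a f fixL pf fH.
  have f0 : f (w p) @[p --> W] --> 0.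
    have -> : 0 = f (a - a) by rewrite subrr -(scale0r a) hf expr0n gtn_eqF // mul0r.
    exact: (polyf_cvc p1 zaW).
  (* Along with [f w], all its derivatives up to order [d] tend to [0], so that they remain bounded
     by [1] after division by [lam ^ m]. *)
  have [phi [phi0 phib phid]] := wcl_null (clza _ p1 p2) f0.
  pose Phi j (p : R * R * R) := p.1.1^-1 ^+ m * phi j (p.1.2, p.2).
  apply: (@cl_ext' _ _ _ _ (bounded_calculus R UU) _ (Phi 0%N)) => [p|].
    by rewrite /Phi phi0 /Z hf.
  apply: chain_cl => j jm.
    exists 1; exists 1 => //; apply: FIU.
    suff : \forall lam \near (0 : R)^'+, \forall h \near (0 : R)^'+, S h ->
      forall t, `|t| < 1 -> `|Phi j (lam, h, t)| <= 1 by [].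
    near=> lam; have l0 : 0 < lam by near: lam; exact: nbhs_right_gt.
    have lm : 0 < lam ^+ m by rewrite exprn_gt0.
    have /cvgrPdist_lt /(_ _ lm) h1 := phib j jm.
    apply: (@filterS _ (0 : R)^'+ _ _ _ _ h1) => h hh _ t t1 /=.
    have := hh t t1; rewrite sub0r normrN => /ltW hh'.
    by rewrite /Phi /= normrM normrX normfV (gtr0_norm l0) exprVn ler_pdivrMl ?mulr1.
  exists 1 => //; apply: FIU; apply: nearW => lam.
  apply: (@filterS _ (0 : R)^'+ _ _ _ _ (phid j jm)) => h dh _ t t1.
  have dq := isdM (isd_cst (lam^-1 ^+ m) t) (dh t t1).
  by apply: (isd_eq dq); rewrite mul0r add0r.
have [C hC] := lift_lipschitz UU LG genL d2 dZ clZ.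
have C1 : 0 < `|C| + 1 by rewrite ltr_wpDl.
(* For the [h] that were kept, [nq Z'] is at least [e / lam ^ 2], which exceeds [C] once [lam] is
   small. *)
have bad : U [set i | C < nq (Z' (i, 0))].
  apply: FIU.
  suff : \forall lam \near (0 : R)^'+, \forall h \near (0 : R)^'+, S h ->
    C < nq (Z' (lam, h, 0)) by [].
  near=> lam.
  have l0 : 0 < lam by near: lam; exact: nbhs_right_gt.
  have l1 : lam < 1 by near: lam; exact: nbhs_right_lt.
  have l2 : lam < e / (`|C| + 1) by near: lam; apply: nbhs_right_lt; rewrite divr_gt0.
  apply: nearW => h Sh; rewrite /Z' /= nqZ exprVn ltr_pdivlMl ?exprn_gt0 //.
  apply: lt_le_trans Sh; rewrite ltr_pdivlMr // in l2.
  rewrite (@le_lt_trans _ _ (lam * (`|C| + 1))) //.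
  rewrite (@le_trans _ _ (lam ^+ 2 * (`|C| + 1))) //.
    by rewrite ler_wpM2l ?sqr_ge0 // (le_trans (ler_norm _)) // lerDl.
  by rewrite ler_wpM2r ?(ltW C1) // expr2 ler_piMr ?ltW.
have [i [h1 h2]] := filter_ex (filterI hC bad).
by move: h1; rewrite leNgt h2.
Unshelve. all: by end_near. Qed.

End DerivLimit.

Section FiniteLift.
Variables (R : realType) (n : nat).
Notation E := 'cV[R]_n.
Implicit Types (H : seq 'M[R]_n) (x y : R -> E) (a : nat -> E).

Lemma quot_isd (f : R -> R) t l :
  h^-1 * (f (t + h) - f t) @[h --> (0 : R)^'] --> l -> is_derive t (1 : R) f l.
Proof.
move=> cf.
have c : h^-1 *: (f (h *: (1 : R) + t) - f t) @[h --> (0 : R)^'] --> l.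
  apply: cvg_trans cf; apply: near_eq_cvg; apply: nearW => h.
  by rewrite [h *: (1 : R)]mulr1 [h + t]addrC.
by apply: DeriveDef; [apply/cvg_ex; exists l | exact: cvg_lim].
Qed.

Lemma isdc_sides y t l : cvc 0^'+ (fun h => h^-1 *: (y (t + h) - y t)) l ->
  cvc 0^'+ (fun h => h^-1 *: (y (t - h) - y t)) (- l) -> isdc y t l.
Proof.
move=> h1 h2 i; apply: quot_isd; apply: cvg_dnbhs0.
  by apply: cvg_trans (h1 i); apply: near_eq_cvg; apply: nearW => h; rewrite !mxE.
have FF : Filter (0^'+ : set_system R) by apply: filter_filter.
have h3 : cvc 0^'+ (fun h => - (h^-1 *: (y (t - h) - y t))) l.
  by rewrite -[l]opprK; exact: cvcN h2.
apply: cvg_trans (h3 i); apply: near_eq_cvg.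
by apply: nearW => h; rewrite !mxE invrN mulNr.
Qed.

Lemma isdc_shift y t s l : isdc y (t + s) l -> isdc (fun u => y (t + u)) s l.
Proof.
move=> dy i; have dq := isdD (isd_cst t s) (isd_id s); rewrite add0r in dq.
by apply: (isd_eq (@isd_comp R _ (fun u => t + u) s _ _ (dy i) dq)); rewrite mulr1.
Qed.

Lemma isdc_opp y t l : isdc y (- t) l -> isdc (fun u => y (- u)) t (- l).
Proof.
move=> dy i; have dq := isdM (isd_cst (-1) t) (isd_id t).
have dq' : is_derive t (1 : R) (fun u : R => - u) (- 1).
  rewrite (_ : (fun u : R => - u) = fun u => -1 * u); last by apply/funext => u; rewrite mulN1r.
  by apply: (isd_eq dq); rewrite mul0r add0r mulr1.
by apply: (isd_eq (@isd_comp R _ (fun u => - u) t _ _ (dy i) dq')); rewrite mulrN1 mxE.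
Qed.

Lemma gcurve_shift m H y t s : gcurve m H y (t + s) -> gcurve m H (fun u => y (t + u)) s.
Proof. by move=> gy f pf fH; exact: (Ck_shift (gy f pf fH)). Qed.

Lemma gcurve_opp m H y t : gcurve m H y (- t) -> gcurve m H (fun u => y (- u)) t.
Proof. by move=> gy f pf fH; exact: (Ck_opp (gy f pf fH)). Qed.

Lemma jet_isdc r a y t : (0 < r)%N -> a 0%N = y t ->
  jet 0^'+ r a (fun h => y (t + h)) ->
  jet 0^'+ r (fun j => (-1) ^+ j *: a j) (fun h => y (t - h)) -> isdc y t (a 1%N).
Proof.
move=> r0 a0 jr jl.
have FF : Filter (0^'+ : set_system R) by apply: filter_filter.
have h1 := jet_lim r0 jr; have h2 := jet_lim r0 jl.
apply: isdc_sides.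
  apply: (cvc_eq _ h1); apply: nearW => h.
  by rewrite big_ord1 expr0 expr1 scale1r a0.
rewrite expr1 scaleN1r in h2; apply: (cvc_eq _ h2); apply: nearW => h.
by rewrite big_ord1 expr0 expr1 !scale1r a0.
Qed.

Lemma deriv_cont d H y y' t : isgrp H -> gen d H -> (2 <= d)%N ->
  gcurve d H y t -> (forall s, isdc y s (y' s)) -> ccont y' t.
Proof.
move=> HG genH d2 gy dy i; apply/continuous_withinNshiftx.
have h1 : cvc 0^'+ (fun s => y' (t + s)) (y' (t + 0)).
  apply: (deriv_right_limit HG genH d2 (x := fun s => y (t + s)) (x' := fun s => y' (t + s))).
    by apply: gcurve_shift; rewrite addr0.
  by near=> s; exact: isdc_shift.
have h2 : cvc 0^'+ (fun s => - y' (t - s)) (- y' (t - 0)).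
  apply: (deriv_right_limit HG genH d2 (x := fun s => y (t - s)) (x' := fun s => - y' (t - s))).
    apply: (@gcurve_opp d H (fun s => y (t + s)) 0); apply: gcurve_shift.
    by rewrite oppr0 addr0.
  by near=> s; apply: (@isdc_opp (fun s => y (t + s))); exact: isdc_shift.
rewrite addr0 in h1; rewrite subr0 in h2.
have FF : Filter (0^'+ : set_system R) by apply: filter_filter.
have h3 : cvc 0^'+ (fun s => - - y' (t - s)) (y' t).
  by rewrite -[y' t]opprK; exact: cvcN h2.
apply: cvg_dnbhs0.
  by apply: cvg_trans (h1 i); apply: near_eq_cvg; apply: nearW => h; rewrite /= addrC.
by apply: cvg_trans (h3 i); apply: near_eq_cvg; apply: nearW => h; rewrite /= opprK addrC.
Unshelve. all: by end_near. Qed.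

(** The blow-up [z] is differentiable at [0] with derivative [a 2], by the expansion of order two,
    and [deriv_right_limit] applied to [z] makes [z'] right continuous there. As [y' = z + t z'],
    the quotient is [z' + (z - a 1) / t], with limit [2 a 2]. *)
Lemma deriv_jet d H y y' a : isgrp H -> gen d H -> (2 <= d)%N ->
  gcurve (2 * d) H y 0 -> (forall s, isdc y s (y' s)) -> a 0%N = y 0 ->
  jet 0^'+ 2 a y -> jet 0^'+ 2 (fun j => (-1) ^+ j *: a j) (fun h => y (- h)) ->
  cvc 0^'+ (fun h => h^-1 *: (y' h - a 1%N)) (2 *: a 2).
Proof.
move=> HG genH d2 gy dy a0 jr jl.
have FF : Filter (0^'+ : set_system R) by apply: filter_filter.
have cy : \forall s \near 0, {for s, continuous (fun s => nq (y s - y 0))}.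
  by near=> s; apply: nq_cont => i; eexists; exact: dy.
have gyK := gcurve_slice HG gy cy.
set K := stab H (y 0) in gyK; have KG : isgrp K := isgrp_stab (y 0) HG.
have genK : gen d K := gen_stab (v := y 0) HG genH.
have fixK g : g \in K -> g *m y 0 = y 0 by rewrite mem_filter => /andP[/eqP].
have [b gz [G [GU FG Gb]]] := lift_blowup (r := 1) KG genK d2 gyK fixK (isdc_cont (dy 0)).
have GP := @ultra_proper _ _ GU.
have l1 := @jet_lim R n 2 1 a y isT jr; have l2 := @jet_lim R n 2 2 a y isT jr.
have l1' := @jet_lim R n 2 1 _ (fun h => y (- h)) isT jl; have l2' := @jet_lim R n 2 2 _ (fun h => y (- h)) isT jl.
have {Gb} ba : b = a 1%N.
  have l1G : cvc 0^'+ (fun t => t^-1 *: (y t - y 0)) (a 1%N).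
    apply: (cvc_eq _ l1); apply: nearW => h.
    by rewrite big_ord1 expr0 expr1 scale1r a0.
  by apply: (cvc_uniq Gb) => i P /(l1G i); exact: FG.
rewrite {}ba mul1n in gz.
set z := (fun t => _) in gz.
pose z' t := if t == 0 then a 2 else t^-1 *: (y' t - z t).
have z0 : z 0 = a 1%N by rewrite /z eqxx.
have zE t : t != 0 -> z t = t^-1 *: (y t - y 0) by rewrite /z => /negbTE ->.
have q2 : cvc 0^'+ (fun h => h^-1 *: (z h - a 1%N)) (a 2).
  apply: (cvc_eq _ l2); near=> h.
  have h0 : h != 0 by rewrite gt_eqF //; near: h; exact: nbhs_right_gt.
  rewrite zE // big_ord_recr big_ord1 /= expr0 expr1 scale1r a0 opprD addrA.
  move: (y h - y 0) => u; rewrite [LHS]scalerBr [RHS]scalerBr !scalerA.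
  by rewrite expr2 invfM -mulrA mulVf // mulr1.
have q2' : cvc 0^'+ (fun h => h^-1 *: (z (- h) - a 1%N)) (- a 2).
  have l3 : cvc 0^'+ (fun h => - (h ^- 2 *:
      (y (- h) - \sum_(j < 2) h ^+ j *: ((-1) ^+ j *: a j)))) (- a 2).
    by rewrite sqrrN expr1n scale1r in l2'; exact: cvcN l2'.
  apply: (cvc_eq _ l3); near=> h.
  have h0 : h != 0 by rewrite gt_eqF //; near: h; exact: nbhs_right_gt.
  rewrite zE ?oppr_eq0 // big_ord_recr big_ord1 /= expr0 expr1 !scale1r a0 opprD addrA.
  rewrite scaleN1r scalerN opprK invrN scaleNr -opprD scalerN; congr (- _).
  move: (y (- h) - y 0) => u; rewrite [LHS]scalerDr [RHS]scalerDr !scalerA.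
  by rewrite expr2 invfM -mulrA mulVf // mulr1.
have dz : \forall s \near 0, isdc z s (z' s).
  near=> s; rewrite /z'; case: (eqVneq s 0) => [->|s0].
    apply: isdc_sides; rewrite z0.
      by apply: (cvc_eq _ q2); apply: nearW => h; rewrite add0r.
    by apply: (cvc_eq _ q2'); apply: nearW => h; rewrite sub0r.
  rewrite zE // => i; apply: (near_eq_is_derive _ (isdc_blowup (y 0) s0 (dy s) i)).
  have /cvgr_neq0 /(_ s0) := @cvg_id _ (nbhs s); apply: filterS => u u0.
  by rewrite zE.
have zl := deriv_right_limit KG genK d2 gz dz.
rewrite {2}/z' eqxx in zl.
have sum : cvc 0^'+ (fun t => z' t + t^-1 *: (z t - a 1%N)) (a 2 + a 2) by exact: cvcD.
rewrite scaler_nat mulr2n.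
apply: (cvc_eq _ sum); near=> h.
have h0 : h != 0 by rewrite gt_eqF //; near: h; exact: nbhs_right_gt.
by rewrite /z' (negbTE h0) -scalerDr addrA subrK.
Unshelve. all: by end_near. Qed.

(** Invariant forms of degree one are linear, hence agree at [u] and at its average over [H]. As
    they separate the orbits, [u] lies in the orbit of a fixed point. *)
Lemma gen1_fix d H : isgrp H -> gen d H -> (d <= 1)%N -> forall u : E, fixp H u.
Proof.
move=> HG genH d1 u.
suff -> : u = proj H *m u by exact: proj_fix.
have [|w wH uw] := @gbase_separates R n d H (proj H *m u) u HG genH.
  move=> f [pf fH [m [m0 md hf]]].
  have m1 : m = 1%N by apply/eqP; rewrite eqn_leq m0 (leq_trans md d1).
  subst m.
  have fE v : f v = dd v f 0.
    rewrite /dd (@line_uniq _ _ f 0 v (f v *: 'X)) ?coefZ ?coefX ?mulr1 // => t.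
    by rewrite hornerZ hornerX add0r hf expr1 mulrC.
  have fD v v' : f (v + v') = f v + f v'.
    by rewrite !fE -[v in LHS]scale1r dd_linear // mul1r.
  have f0 : f 0 = 0 by rewrite -(scale0r (0 : E)) hf expr1 mul0r.
  have sH : (size H)%:R != 0 :> R by exact: size_grp_neq0.
  apply: (mulfI sH); rewrite projE hf expr1 mulrA mulfV // mul1r.
  rewrite (big_morph f fD f0) (eq_big_seq (fun=> f u)) => [|w wH]; last exact: fH.
  by rewrite big_const_seq count_predT iter_addr addr0 mulr_natl.
by rewrite {1}uw (proj_fix u HG wH).
Qed.

(** The index makes the dimension positive. The group acts trivially, so the coordinates are
    invariant, while [d = 0] would allow only constant invariants. *)
Lemma gen_low d H : isgrp H -> gen d H -> (d <= 1)%N -> 'I_n -> d = 1%N.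
Proof.
move=> HG genH d1 i; case: d d1 genH => [|[|]//] _ genH.
have iH : inv H (fun u : E => u i 0) by move=> g u gH; rewrite (gen1_fix HG genH).
have cst f : alg (gbase 0 H) f -> exists c, forall u, f u = c.
  elim=> [c|{}f [_ _ [[|m] []]]//|{}f g _ [c hc] _ [c' hc']|{}f g _ [c hc] _ [c' hc']].
  - by exists c.
  - by exists (c + c') => u; rewrite hc hc'.
  - by exists (c * c') => u; rewrite hc hc'.
have [c hc] := cst _ (genH _ (polyf_coord R i) iH).
have := hc (const_mx 1); rewrite mxE -(hc 0) mxE => /eqP.
by rewrite oner_eq0.
Qed.

Lemma low_Ck d r H x : isgrp H -> gen d H -> (d <= 1)%N ->
  (forall t, gcurve (r * d) H x t) -> forall t i, Ck r t (fun s => x s i 0).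
Proof.
move=> HG genH d1 gx t i; have := gx t _ (polyf_coord R i).
rewrite (gen_low HG genH d1 i) muln1; apply=> g u gH.
by rewrite (gen1_fix HG genH).
Qed.

Lemma Ck1_derive (f : R -> R) : (forall t, Ck 1 t f) ->
  exists2 f' : R -> R, forall t, is_derive t (1 : R) f (f' t) &
  forall m, (forall t, Ck m.+1 t f) -> forall t, Ck m t f'.
Proof.
move=> cf; have /choice[f' df] t : exists l, is_derive t (1 : R) f l.
  by have /CkS[g [dg _]] := cf t; exists (g t); exact: nbhs_singleton dg.
exists f' => // m cm t; have /CkS[g [dg cg]] := cm t.
by apply: Ck_eq cg; apply: filterS dg => s ds; exact: isd_uniq ds (df s).
Qed.

Theorem finite_lift_C1 d H x : isgrp H -> gen d H -> (forall t, gcurve d H x t) ->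
  exists y y', [/\ forall t, exists2 g, g \in H & y t = g *m x t,
    forall t, isdc y t (y' t) & forall t, ccont y' t].
Proof.
move=> HG genH gx; have [d2|d1] := leqP 2 d.
  have [t _|y hy] := jet_lift (r := 1) (x := x) (O := setT) HG genH d2 isT openT.
    by rewrite mul1n; exact: gx.
  have /choice[y' dy] t : exists l, isdc y t l.
    have [_ [a [a0 jr jl]]] := hy t I; exists (a 1%N); exact: (@jet_isdc 1 a y t isT a0 jr jl).
  have yx t : exists2 g, g \in H & y t = g *m x t by have [] := hy t I.
  exists y, y'; split=> // t; apply: (deriv_cont HG genH d2 _ dy).
  apply: inv_gcurve (gx t) => s f fH; have [g gH ->] := yx s.
  by rewrite fH.
(* For [d <= 1] the group acts trivially, and the coordinates of [x] are themselves invariants. *)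
have cx t i : Ck 1 t (fun s => x s i 0).
  by apply: (low_Ck HG genH) => // s; rewrite mul1n.
have /choice[x' hx] i : exists f' : R -> R, (forall t, is_derive t (1 : R) (fun s => x s i 0) (f' t))
    /\ forall t, Ck 0 t f'.
  by have [f' df hf] := Ck1_derive (fun t => cx t i); exists f'; split=> //; exact: hf.
exists x, (fun t => \col_i x' i t); split.
- by move=> t; exists 1%:M; [exact: (grp1 HG) | rewrite mul1mx].
- by move=> t i; rewrite mxE; exact: (hx i).1.
- move=> t i; rewrite (_ : (fun s => _) = x' i).
    exact: Ck_cont ((hx i).2 t).
  by apply/funext => s; rewrite mxE.
Qed.

Theorem finite_lift_D2 d H x : isgrp H -> gen d H -> (forall t, gcurve (2 * d) H x t) ->
  exists y y' y'', [/\ forall t, exists2 g, g \in H & y t = g *m x t,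
    forall t, isdc y t (y' t) & forall t, isdc y' t (y'' t)].
Proof.
move=> HG genH gx; have [d2|d1] := leqP 2 d.
  have [t _|y hy] := jet_lift (r := 2) (x := x) (O := setT) HG genH d2 isT openT.
    exact: gx.
  have /choice[a ha] t : exists a, [/\ a 0%N = y t, jet 0^'+ 2 a (fun h => y (t + h)) &
      jet 0^'+ 2 (fun j => (-1) ^+ j *: a j) (fun h => y (t - h))].
    by have [_] := hy t I.
  have dy t : isdc y t (a t 1%N).
    by have [a0 jr jl] := ha t; exact: (@jet_isdc 2 (a t) y t isT a0 jr jl).
  have yx t : exists2 g, g \in H & y t = g *m x t by have [] := hy t I.
  have gy t : gcurve (2 * d) H y t.
    apply: inv_gcurve (gx t) => s f fH; have [g gH ->] := yx s.
    by rewrite fH.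
  exists y, (fun t => a t 1%N), (fun t => 2 *: a t 2); split=> // t.
  have [a0 jr jl] := ha t; apply: isdc_sides.
    apply: (deriv_jet HG genH d2 (y := fun s => y (t + s)) (y' := fun s => a (t + s) 1%N)).
    - by apply: gcurve_shift; rewrite addr0.
    - by move=> s; exact: isdc_shift.
    - by rewrite addr0.
    - exact: jr.
    - exact: jl.
  have FF : Filter (0^'+ : set_system R) by apply: filter_filter.
  (* The left difference quotient is the right one of the reversed curve, whose derivative has the
     opposite sign. *)
  have h := @deriv_jet d H (fun s => y (t - s)) (fun s => - a (t - s) 1%N)
    (fun j => (-1) ^+ j *: a t j) HG genH d2.
  have {}h : cvc 0^'+ (fun h => h^-1 *: (- a (t - h) 1%N - (-1) ^+ 1 *: a t 1%N))
      (2 *: ((-1) ^+ 2 *: a t 2)).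
    apply: h.
    - apply: (@gcurve_opp _ H (fun s => y (t + s)) 0); apply: gcurve_shift.
      by rewrite oppr0 addr0.
    - by move=> s; apply: (@isdc_opp (fun s => y (t + s))); exact: isdc_shift.
    - by rewrite expr0 scale1r subr0.
    - exact: jl.
    - apply: (@jet_coefs _ _ _ _ (a t)) => [j _|].
        by rewrite scalerA -exprMn mulrNN mulr1 expr1n scale1r.
      by apply: jet_eq jr; apply: nearW => s; rewrite opprK.
  rewrite sqrrN expr1n scale1r in h.
  apply: (cvc_eq _ (cvcN h)); apply: nearW => s.
  by rewrite expr1 scaleN1r opprK -scalerN opprD opprK.
have cx t i : Ck 2 t (fun s => x s i 0) by exact: (low_Ck HG genH).
have cx1 t i : Ck 1 t (fun s => x s i 0) by exact: cl_le (cx t i).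
have /choice[x' hx] i : exists f' : R -> R, (forall t, is_derive t (1 : R) (fun s => x s i 0) (f' t))
    /\ forall t, Ck 1 t f'.
  by have [f' df hf] := Ck1_derive (fun t => cx1 t i); exists f'; split=> //; exact: hf.
have /choice[x'' hx'] i : exists f' : R -> R, forall t, is_derive t (1 : R) (x' i) (f' t).
  by have [f' df _] := Ck1_derive (hx i).2; exists f'.
exists x, (fun t => \col_i x' i t), (fun t => \col_i x'' i t); split.
- by move=> t; exists 1%:M; [exact: (grp1 HG) | rewrite mul1mx].
- by move=> t i; rewrite mxE; exact: (hx i).1.
- move=> t i; rewrite mxE (_ : (fun s => _) = x' i); first exact: hx'.
  by apply/funext => s; rewrite mxE.
Qed.

End FiniteLift.

(** * Harmonic polynomials *)

(** Compactness enters as the existence of limits along ultrafilters: the sets on which [f] is at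
    least one of its own values generate a filter, and a limit along a finer ultrafilter is a
    maximizer. *)
Lemma sup_attained (R : realType) (T : Type) (S : set T) (f : T -> R) (x0 : T) : S x0 ->
  (forall U : set_system T, UltraFilter U -> U S -> exists2 a, S a & f x @[x --> U] --> f a) ->
  exists2 x, S x & forall y, S y -> f y <= f x.
Proof.
move=> Sx0 cS.
pose F : set_system T := [set P | exists2 x1, S x1 & forall x, S x -> f x1 <= f x -> P x].
have FF : ProperFilter F.
  apply: Build_ProperFilter_ex; first by move=> P [x1 Sx1 hP]; exists x1; exact: hP.
  split.
  - by exists x0.
  - move=> P Q [x1 S1 h1] [x2 S2 h2]; case: (leP (f x1) (f x2)) => h12.
      exists x2 => // x Sx hx; split; [apply: h1 => //; exact: le_trans hx | exact: h2].
    exists x1 => // x Sx hx; split; first exact: h1.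
    by apply: h2 => //; apply: le_trans hx; exact: ltW.
  - by move=> P Q PQ [x1 S1 h1]; exists x1 => // x Sx hx; apply: PQ; exact: h1.
have [U [UU FU]] := ultraFilterLemma FF.
have UP : ProperFilter U := @ultra_proper _ _ UU.
have US : U S by apply: FU; exists x0.
have [a Sa fa] := cS U UU US; exists a => // y Sy.
have Fy : F [set x | f y <= f x] by exists y.
rewrite leNgt; apply/negP => fay; have /cvgr_lt /(_ _ fay) h := fa.
have [x [h1 h2]] := filter_ex (filterI h (FU _ Fy)).
by move: h2 => /=; rewrite leNgt h1.
Qed.

Section LocalMax.
Variable R : realType.

Lemma horner_bound (Q : {poly R}) : exists2 M, 0 < M & forall t, `|t| <= 1 -> `|Q.[t]| <= M.
Proof.
elim/poly_ind: Q => [|Q c [M M0 hM]]; first by exists 1 => // t _; rewrite horner0 normr0.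
exists (M + `|c|); first by rewrite ltr_wpDr.
move=> t t1; rewrite hornerMXaddC (le_trans (ler_normD _ _)) // lerD2r normrM.
by rewrite -[leRHS]mulr1 ler_pM ?hM.
Qed.

Lemma poly_max (P : {poly R}) (r : R) : 0 < r ->
  (forall t, `|t| < r -> P.[t] <= P.[0]) -> P`_1 = 0 /\ P`_2 <= 0.
Proof.
move=> r0 hP; pose Q := drop_poly 2 P; pose Q3 := drop_poly 3 P.
have PE t : P.[t] = P`_0 + P`_1 * t + t ^+ 2 * Q.[t].
  rewrite -{1}(poly_take_drop 2 P) hornerD hornerM hornerXn [Q.[t] * _]mulrC; congr (_ + _).
  rewrite /take_poly horner_poly !big_ord_recr big_ord0 /= add0r expr0 expr1 mulr1.
  by [].
have QE t : Q.[t] = P`_2 + t * Q3.[t].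
  have -> : Q = (P`_2)%:P + 'X * Q3.
    apply/polyP => i; rewrite coefD coefC coefXM !coef_drop_poly.
    by case: i => [|i] /=; rewrite ?addr0 ?add0r // addSnnS.
  by rewrite hornerD hornerC hornerM hornerX.
have P0 : P.[0] = P`_0 by rewrite horner_coef0.
have [M M0 hM] := horner_bound Q; have [M3 M30 hM3] := horner_bound Q3.
pose r1 := Num.min r 1; have r10 : 0 < r1 by rewrite lt_min r0 ltr01.
have c1 : P`_1 = 0.
  apply/eqP; rewrite -oppr_eq0; apply/eqP; apply: (lin_quad_ge0 M0 r10) => t.
  rewrite lt_min => /andP[tr t1]; have := hP t tr; rewrite P0 PE => h.
  have : `|t ^+ 2 * Q.[t]| <= t ^+ 2 * M.
    by rewrite normrM ger0_norm ?sqr_ge0 // ler_wpM2l ?sqr_ge0 // hM // ltW.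
  by rewrite ler_norml => /andP[h1 _]; rewrite mulNr [M * _]mulrC; lra.
split=> //; rewrite leNgt; apply/negP => c2.
pose t := Num.min (r1 / 2) (P`_2 / (2 * M3)).
have t0 : 0 < t by rewrite lt_min !divr_gt0 // mulr_gt0.
have tr1 : t < r1.
  rewrite (@le_lt_trans _ _ (r1 / 2)) ?ge_min ?lexx //; lra.
have [tr t1] : t < r /\ t < 1 by move: tr1; rewrite lt_min => /andP.
have tM : t * M3 <= P`_2 / 2.
  rewrite -ler_pdivlMr // (@le_trans _ _ (P`_2 / (2 * M3))) ?ge_min ?lexx ?orbT //.
  by rewrite invfM mulrA.
have := hP t; rewrite gtr0_norm // => /(_ tr); rewrite P0 PE c1 mul0r addr0 QE.
rewrite gerDl pmulr_rle0 ?exprn_gt0 //.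
have : `|t * Q3.[t]| <= t * M3.
  by rewrite normrM gtr0_norm // ler_pM2l // hM3 // gtr0_norm // ltW.
by rewrite ler_norml => /andP[h1 _] h2; lra.
Qed.

Variable n : nat.
Notation E := 'cV[R]_n.
Implicit Types (f g h F : E -> R) (x y v : E).

Lemma ddDE v f g : polyf f -> polyf g ->
  dd v (fun z => f z + g z) = fun x => dd v f x + dd v g x.
Proof. by move=> pf pg; apply/funext => x; rewrite ddD. Qed.

Lemma ddME v f g : polyf f -> polyf g ->
  dd v (fun z => f z * g z) = fun x => dd v f x * g x + f x * dd v g x.
Proof. by move=> pf pg; apply/funext => x; rewrite ddM. Qed.

Lemma ddZE v c f : polyf f -> dd v (fun z => c * f z) = fun x => c * dd v f x.
Proof. by move=> pf; apply/funext => x; rewrite ddZ. Qed.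

Lemma dd_coordE v i : dd v (fun z : E => z i 0) = fun=> v i 0.
Proof. by apply/funext => x; rewrite dd_coord. Qed.

Lemma line_deriv f x v : polyf f -> line (dd v f) x v = deriv (line f x v).
Proof.
elim=> [c|i|{}f g pf IHf pg IHg|{}f g pf IHf pg IHg].
- by rewrite dd_cst !line_cst derivC polyC0.
- by rewrite dd_coordE line_cst line_coord derivD derivC derivZ derivX add0r alg_polyC.
- by rewrite ddDE // !lineD ?derivD ?IHf ?IHg //; exact: polyf_dd.
- have pdf := polyf_dd v pf; have pdg := polyf_dd v pg.
  rewrite ddME // lineD; [|exact: polyf_mul|exact: polyf_mul].
  by rewrite !lineM // derivM IHf IHg.
Qed.

Lemma nqE_line x v t : nq (x + t *: v) = nq x + 2 * t * dp x v + t ^+ 2 * nq v.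
Proof. by rewrite /nq dpDl !dpDr !dpZl !dpZr (dpC v x); ring. Qed.

Lemma ball_max f (rho : R) : 0 <= rho -> polyf f ->
  exists2 x, nq x <= rho & forall y, nq y <= rho -> f y <= f x.
Proof.
move=> rho0 pf; apply: (@sup_attained _ _ [set x | nq x <= rho] f 0); first by rewrite /= nq0.
move=> U UU US; have UP : ProperFilter U := @ultra_proper _ _ UU.
have rho1 : 0 <= rho + 1 by rewrite addr_ge0.
have cU (i : 'I_n) : cvg (x i 0 @[x --> U]).
  apply: (@ultra_cvg_real _ _ _ _ (rho + 1) UU); apply: filterS US => x /= hx.
  apply: coord_le_nq => //; apply: (le_trans hx); nra.
pose a : E := \col_i lim (x i 0 @[x --> U]).
have ca : cvc U id a by move=> i; rewrite mxE; exact: cU.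
have cf f' : polyf f' -> f' x @[x --> U] --> f' a by move=> pf'; exact: (polyf_cvc pf' ca).
exists a; last exact: cf.
by apply: (ler_cvg_to (cf _ (polyf_nq _ _)) (@cvg_cst _ rho _ U _)).
Qed.

Lemma near0_ball x v (rho : R) : nq x < rho ->
  exists2 r, 0 < r & forall t, `|t| < r -> nq (x + t *: v) <= rho.
Proof.
move=> xr; pose e := rho - nq x; have e0 : 0 < e by rewrite subr_gt0.
pose D := 2 * `|dp x v| + nq v + 1.
have D0 : 0 < D by rewrite ltr_wpDl // addr_ge0 ?mulr_ge0 ?nq_ge0.
exists (Num.min 1 (e / D)); first by rewrite lt_min ltr01 divr_gt0.
move=> t; rewrite lt_min => /andP[t1]; rewrite ltr_pdivlMr // => tD.
rewrite nqE_line.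
have h1 : 2 * t * dp x v <= `|t| * (2 * `|dp x v|).
  by rewrite (le_trans (ler_norm _)) // !normrM ger0_norm // mulrAC mulrC mulrA.
have h2 : t ^+ 2 * nq v <= `|t| * nq v.
  by rewrite ler_wpM2r ?nq_ge0 // -(real_normK (num_real t)) expr2 ler_piMr // ltW.
have := nq_ge0 v; move: tD; rewrite /D !mulrDr mulr1; have := normr_ge0 t.
by move: h1 h2; rewrite /e; lra.
Qed.

Lemma max_dd f x (rho : R) : polyf f -> nq x < rho ->
  (forall y, nq y <= rho -> f y <= f x) ->
  forall v, dd v f x = 0 /\ dd v (dd v f) x <= 0.
Proof.
move=> pf xr hm v; have [r r0 hr] := near0_ball v xr.
have [|c1 c2] := @poly_max (line f x v) r r0.
  by move=> t tr; rewrite horner_coef0 line_coef0 // lineE //; apply: hm; exact: hr.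
split=> //; rewrite /dd -/(dd v f) line_deriv // coef_deriv.
by rewrite -mulr_natl mulr_ge0_le0.
Qed.

Definition lap f x : R := \sum_i pd i (pd i f) x.

Lemma polyf_lap f : polyf f -> polyf (lap f).
Proof. by move=> pf; apply: polyf_sum => i; do 2 apply: polyf_pd. Qed.

Lemma lapD f g x : polyf f -> polyf g -> lap (fun z => f z + g z) x = lap f x + lap g x.
Proof.
move=> pf pg; rewrite /lap -big_split; apply: eq_bigr => i _.
by rewrite /pd ddDE // ddD //; exact: polyf_dd.
Qed.

Lemma lapZ c f x : polyf f -> lap (fun z => c * f z) x = c * lap f x.
Proof.
move=> pf; rewrite /lap mulr_sumr; apply: eq_bigr => i _.
by rewrite /pd ddZE // ddZ //; exact: polyf_dd.
Qed.

Definition gam f g x : R := \sum_i pd i f x * pd i g x.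

Lemma lapM f g x : polyf f -> polyf g ->
  lap (fun z => f z * g z) x = f x * lap g x + 2 * gam f g x + g x * lap f x.
Proof.
move=> pf pg; rewrite /lap /gam !mulr_sumr -!big_split; apply: eq_bigr => i _ /=.
have pdf := polyf_pd i pf; have pdg := polyf_pd i pg.
rewrite /pd ddME // ddD; [|exact: polyf_mul|exact: polyf_mul].
by rewrite !ddM //; ring.
Qed.

Lemma pd_nq i x : pd i (@nq R n) x = 2 * x i 0.
Proof.
have -> : @nq R n = fun x : E => \sum_j x j 0 * x j 0 by [].
rewrite /pd dd_sum => [|j]; last by apply: polyf_mul; exact: polyf_coord.
rewrite (bigD1 i) //= big1 ?addr0 => [|j ji].
  by rewrite ddM ?dd_coord; [|exact: polyf_coord|exact: polyf_coord]; rewrite !mxE !eqxx /=; ring.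
rewrite ddM ?dd_coord; [|exact: polyf_coord|exact: polyf_coord].
by rewrite !mxE (negbTE ji) mul0r mulr0 addr0.
Qed.

Lemma lap_nq x : lap (@nq R n) x = 2 * n%:R.
Proof.
rewrite /lap (eq_bigr (fun=> 2)) => [|i _].
  by rewrite sumr_const card_ord mulr_natr.
have -> : pd i (@nq R n) = fun x => 2 * x i 0 by apply/funext => y; exact: pd_nq.
by rewrite /pd ddZ ?dd_coord; [rewrite !mxE !eqxx mulr1|exact: polyf_coord].
Qed.

Lemma lap_dd v f : polyf f -> lap (dd v f) = dd v (lap f).
Proof.
move=> pf; apply/funext => x; rewrite /lap dd_sum => [|i]; last by do 2 apply: polyf_pd.
by apply: eq_bigr => i _; rewrite /pd ![dd _ (dd v _)]dd_comm //; exact: polyf_dd.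
Qed.

(** Adding [k * nq] makes the Laplacian positive, which excludes an interior maximum; on the
    boundary this costs [k * rho = e]. *)
Theorem max_principle F (rho B : R) : (0 < n)%N -> 0 < rho -> polyf F ->
  (forall x, nq x < rho -> 0 <= lap F x) -> (forall x, nq x = rho -> F x <= B) ->
  forall x, nq x <= rho -> F x <= B.
Proof.
move=> n0 rho0 pF hl hB x xr; apply/ler_addgt0Pr => e e0.
pose k := e / rho; have k0 : 0 < k by rewrite divr_gt0.
pose G z := F z + k * nq z.
have pk : polyf (fun z : E => k * nq z) by apply: polyf_mul (polyf_cst _ _) (polyf_nq _ _).
have pG : polyf G by exact: polyf_add.
have [x0 h0 hm] := ball_max (ltW rho0) pG.
have Fx : F x <= G x0.
  by apply: le_trans (hm x xr); rewrite lerDl mulr_ge0 ?nq_ge0 // ltW.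
apply: (le_trans Fx); move: h0; rewrite le_eqVlt => /predU1P[h0|h0].
  by rewrite /G h0 divfK ?gt_eqF // lerD2r hB.
have : lap G x0 <= 0.
  by apply: sumr_le0 => i _; have [] := max_dd pG h0 hm (delta_mx i 0).
rewrite lapD // lapZ ?lap_nq; last exact: polyf_nq.
have n0' : 0 < n%:R :> R by rewrite ltr0n.
have : 0 < k * (2 * n%:R) by apply: mulr_gt0 => //; exact: mulr_gt0.
by have := hl x0 h0; lra.
Qed.

(** Bernstein's method: for [g] a directional derivative of [h], the function
    [(eta g) ^ 2 + lam h ^ 2] is subharmonic in the ball for suitable [lam], and [eta = rho - nq]
    vanishes on the sphere, where only [h] is left. *)
Theorem bernstein (rho : R) : (0 < n)%N -> 0 < rho -> exists2 C, 0 <= C &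
  forall h v B, polyf h -> (forall x, lap h x = 0) -> nq v <= 1 ->
  (forall x, nq x <= rho -> `|h x| <= B) ->
  forall x, nq x <= rho / 4 -> `|dd v h x| <= C * B.
Proof.
(* [12 rho] absorbs the gradient terms, at most [12 g ^ 2 nq], and [2 n rho] the Laplacian of [eta].
   The factor [16 / (9 rho ^ 2)] in [c] accounts for [eta >= 3 rho / 4] on the smaller ball. *)
move=> n0 rho0; pose lam := (12 + 2 * n%:R) * rho.
have lam0 : 0 <= lam by rewrite mulr_ge0 ?(ltW rho0) // addr_ge0 // mulr_ge0.
pose c := 16 * lam / (9 * rho ^+ 2).
have rho2 : 0 <= rho ^+ 2 := sqr_ge0 rho.
have c0 : 0 <= c by rewrite /c; apply: divr_ge0; exact: mulr_ge0.
exists (c + 1); first by rewrite addr_ge0.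
move=> h v B ph hh v1 hB x xr.
have B0 : 0 <= B.
  by apply: le_trans (hB 0 _); rewrite ?normr_ge0 // nq0 ltW.
pose g := dd v h; have pg : polyf g := polyf_dd v ph.
have hg y : lap g y = 0.
  rewrite /g lap_dd // (_ : lap h = fun=> 0) ?dd_cst //; exact/funext.
pose eta (z : E) : R := rho - nq z.
have peta : polyf eta := polyf_sub (polyf_cst _ rho) (polyf_nq _ _).
have deta i y : pd i eta y = - 2 * y i 0.
  have -> : eta = fun z => rho + (- 1) * nq z by apply/funext => z; rewrite /eta mulN1r.
  rewrite /pd ddD ?dd_cst; [|exact: polyf_cst|exact: polyf_mul (polyf_cst _ _) (polyf_nq _ _)].
  rewrite add0r ddZ; last exact: polyf_nq.
  by rewrite -[dd _ _ _]/(pd i (@nq R n) y) pd_nq mulN1r mulNr.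
have leta y : lap eta y = - 2 * n%:R.
  have -> : eta = fun z => rho + (- 1) * nq z by apply/funext => z; rewrite /eta mulN1r.
  rewrite lapD ?lapZ ?lap_nq; [|exact: polyf_nq|exact: polyf_cst|].
    rewrite (_ : lap _ y = 0); first by ring.
    by rewrite /lap big1 // => i _; rewrite /pd !dd_cst.
  exact: polyf_mul (polyf_cst _ _) (polyf_nq _ _).
pose G z := eta z * g z; have pG : polyf G by exact: polyf_mul.
pose phi z := G z * G z + lam * (h z * h z).
have pGG : polyf (fun z => G z * G z) by exact: polyf_mul.
have phh : polyf (fun z => h z * h z) by exact: polyf_mul.
have pphi : polyf phi by apply: polyf_add => //; apply: polyf_mul => //; exact: polyf_cst.
have gG i y : pd i G y = pd i eta y * g y + eta y * pd i g y by rewrite /pd ddM.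
have cs y : g y ^+ 2 <= gam h h y.
  rewrite /g dd_pd //.
  have := cauchy_schwarz v (\col_i pd i h y).
  have -> : dp v (\col_i pd i h y) = \sum_i v i 0 * pd i h y.
    by apply: eq_bigr => i _; rewrite mxE.
  have -> : nq (\col_i pd i h y) = gam h h y.
    by apply: eq_bigr => i _; rewrite !mxE.
  move/le_trans; apply; rewrite ler_piMl //.
  by apply: sumr_ge0 => i _; rewrite -expr2 sqr_ge0.
have key y : nq y < rho -> 0 <= lap phi y.
  move=> yr; rewrite lapD //; last by apply: polyf_mul => //; exact: polyf_cst.
  rewrite lapZ // !lapM // hh hg leta.
  have -> : gam G G y = \sum_i (pd i eta y * g y + eta y * pd i g y) ^+ 2.
    by apply: eq_bigr => i _; rewrite gG expr2.
  (* Completing the square: the mixed gradient term is absorbed in [S1] at the cost of a multiple of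
     [g ^ 2 |grad eta| ^ 2 = 4 g ^ 2 nq]. *)
  pose S1 := \sum_i (eta y * pd i g y + 2 * g y * pd i eta y) ^+ 2.
  have S10 : 0 <= S1 by apply: sumr_ge0 => i _; exact: sqr_ge0.
  pose S2 := gam eta g y.
  have E1 : \sum_i (pd i eta y * g y + eta y * pd i g y) ^+ 2 =
      S1 - 2 * eta y * g y * S2 - 3 * g y ^+ 2 * (4 * nq y).
    rewrite /S1 /S2 /gam /nq /dp !mulr_sumr -!sumrB; apply: eq_bigr => i _.
    by rewrite !deta; ring.
  rewrite E1 -/S2 {E1}.
  have -> : G y = eta y * g y by [].
  have e0 : 0 <= eta y <= rho.
    by rewrite subr_ge0 (ltW yr) /= lerBlDr lerDl nq_ge0.
  have h1 := cs y; have n1 := nq_ge0 y.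
  have h2 : lam * g y ^+ 2 <= lam * gam h h y by rewrite ler_wpM2l.
  have h3 : eta y * g y ^+ 2 * n%:R <= rho * g y ^+ 2 * n%:R.
    by case/andP: e0 => _ e1; rewrite ler_wpM2r // ler_wpM2r ?sqr_ge0.
  have h4 : g y ^+ 2 * nq y <= g y ^+ 2 * rho by rewrite ler_wpM2l ?sqr_ge0 // ltW.
  move: h2; rewrite {1}/lam; move: (n%:R : R) h3 => N h3.
  move=> {}h2; apply: (@le_trans _ _ (2 * S1 - 4 * (eta y * g y ^+ 2 * N) -
    24 * (g y ^+ 2 * nq y) + 2 * (lam * gam h h y))).
    by clear -S10 h2 h3 h4; move: (lam * gam h h y) h2 => A h2; lra.
  by rewrite le_eqVlt; apply/orP; left; apply/eqP; ring.
have hB2 y : nq y <= rho -> h y * h y <= B ^+ 2.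
  by move=> yr; rewrite -expr2 -(real_normK (num_real (h y))) lerXn2r ?nnegrE // hB.
have bnd : phi x <= lam * B ^+ 2.
  apply: (max_principle n0 rho0 pphi key) => [y yr|].
    by rewrite /phi /G /eta yr subrr !mul0r add0r ler_wpM2l // hB2 // yr.
  by rewrite (le_trans xr) // ler_pdivrMr // ler_peMr ?(ltW rho0) // ler1n.
have eta34 : 3 / 4 * rho <= eta x by rewrite /eta; lra.
have h1 : (3 / 4 * rho) ^+ 2 * g x ^+ 2 <= lam * B ^+ 2.
  apply: le_trans bnd; rewrite /phi /G -[leLHS]addr0 lerD //; last first.
    by rewrite mulr_ge0 // -expr2 sqr_ge0.
  rewrite [leRHS]mulrACA -!expr2 ler_wpM2r ?sqr_ge0 // lerXn2r ?nnegrE //.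
    by rewrite mulr_ge0 // ltW.
  by rewrite (le_trans _ eta34) // mulr_ge0 // ltW.
have h2 : g x ^+ 2 <= c * B ^+ 2.
  have r2 : 0 < rho ^+ 2 by rewrite exprn_gt0.
  rewrite /c mulrAC ler_pdivlMr ?mulr_gt0 //.
  have E : (3 / 4 * rho) ^+ 2 = 9 / 16 * rho ^+ 2 by field.
  by move: h1; rewrite E; lra.
have cB : 0 <= (c + 1) * B by rewrite mulr_ge0 // addr_ge0.
rewrite -(@ler_pXn2r _ 2) ?nnegrE // real_normK ?num_real // (le_trans h2) // exprMn.
by rewrite ler_wpM2r ?sqr_ge0 //; nra.
Qed.

Theorem bernstein_iter k (rho : R) : (0 < n)%N -> 0 < rho -> exists2 C, 0 <= C &
  forall h v B, polyf h -> (forall x, lap h x = 0) -> nq v <= 1 ->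
  (forall x, nq x <= rho -> `|h x| <= B) ->
  forall x, nq x <= rho / 4 ^+ k -> `|iter k (dd v) h x| <= C * B.
Proof.
move=> n0; elim: k rho => [|k IH] rho rho0.
  by exists 1 => // h v B _ _ _ hB x; rewrite expr0 divr1 mul1r; exact: hB.
have [C C0 hC] := bernstein n0 rho0.
have [|D D0 hD] := IH (rho / 4); first by rewrite divr_gt0.
exists (D * C); first by rewrite mulr_ge0.
move=> h v B ph hh v1 hB x; rewrite exprS invfM mulrA => xr.
rewrite iterSr -mulrA; apply: hD => //; first exact: polyf_dd.
  move=> y; rewrite lap_dd // (_ : lap h = fun=> 0) ?dd_cst //; exact/funext.
exact: hC.
Qed.

End LocalMax.

Section HomogCalculus.
Variables (R : realType) (n : nat).
Notation E := 'cV[R]_n.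
Implicit Types (f g h F : E -> R) (x y v : E).

Lemma homog_cancel j m g g' : polyf g ->
  (forall s x, s ^+ j * g (s *: x) = s ^+ (j + m) * g' x) ->
  forall s x, g (s *: x) = s ^+ m * g' x.
Proof.
move=> pg hg s x; suff PE : line g 0 x = g' x *: 'X^m.
  by have := lineE 0 x s pg; rewrite PE add0r hornerZ hornerXn mulrC => <-.
have Xj : 'X^j != 0 :> {poly R} by rewrite -size_poly_eq0 size_polyXn.
apply: (mulfI Xj); apply: poly_inj_horner => t.
rewrite !hornerM hornerZ !hornerXn lineE // add0r hg exprD; ring.
Qed.

Lemma homog_cancel0 j m g g' : polyf g -> (m < j)%N ->
  (forall s x, s ^+ j * g (s *: x) = s ^+ m * g' x) -> forall x, g x = 0.
Proof.
move=> pg mj hg x; have PE : 'X^j * line g 0 x = g' x *: 'X^m.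
  apply: poly_inj_horner => t.
  by rewrite hornerM hornerZ !hornerXn lineE // add0r hg mulrC.
have := congr1 (fun p : {poly R} => p`_m) PE.
rewrite coefXnM mj coefZ coefXn eqxx mulr1 => h.
by have := hg 1 x; rewrite !expr1n scale1r !mul1r -h.
Qed.

Lemma dd_homog m f v : polyf f -> homog m f ->
  forall s x, s * dd v f (s *: x) = s ^+ m * dd v f x.
Proof.
move=> pf hf s x; rewrite -[RHS]ddZ //.
rewrite (_ : (fun z => s ^+ m * f z) = fun z => f (s%:M *m z)); last first.
  by apply/funext => z; rewrite mul_scalar_mx hf.
rewrite dd_comp_lin // !mul_scalar_mx.
by rewrite -[s *: v]addr0 dd_linear // dd0 // addr0.
Qed.

Lemma dd2_homog m f v : polyf f -> homog m f ->
  forall s x, s ^+ 2 * dd v (dd v f) (s *: x) = s ^+ m * dd v (dd v f) x.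
Proof.
move=> pf hf s x; have pd := polyf_dd v pf.
have E : (fun z => s * dd v f (s%:M *m z)) = fun z => s ^+ m * dd v f z.
  by apply/funext => z; rewrite mul_scalar_mx (dd_homog v pf hf).
have := congr1 (fun F => dd v F x) E; rewrite /= !ddZ //; last exact: polyf_comp_lin.
rewrite dd_comp_lin // !mul_scalar_mx -{1}[s *: v]addr0 dd_linear // dd0 // => <-.
by rewrite addr0 expr2 mulrA.
Qed.

Lemma lap_homog m f : polyf f -> homog m f ->
  forall s x, s ^+ 2 * lap f (s *: x) = s ^+ m * lap f x.
Proof.
move=> pf hf s x; rewrite /lap !mulr_sumr; apply: eq_bigr => i _.
exact: dd2_homog.
Qed.

Lemma homog_pd m f i : polyf f -> homog m.+1 f -> homog m (pd i f).
Proof.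
move=> pf hf; apply: (@homog_cancel 1) => [|s x]; first exact: polyf_pd.
by rewrite expr1 (dd_homog _ pf hf) add1n.
Qed.

Lemma homog_lap m f : polyf f -> homog m.+2 f -> homog m (lap f).
Proof.
move=> pf hf; apply: (@homog_cancel 2) => [|s x]; first exact: polyf_lap.
exact: lap_homog.
Qed.

Lemma lap_low m f : polyf f -> homog m f -> (m < 2)%N -> forall x, lap f x = 0.
Proof.
move=> pf hf m2; apply: (homog_cancel0 (polyf_lap pf) m2) => s x.
exact: lap_homog.
Qed.

Lemma euler m f x : polyf f -> homog m f -> \sum_i x i 0 * pd i f x = m%:R * f x.
Proof.
move=> pf hf; rewrite -dd_pd // /dd.
have -> : line f x x = f x *: ('X + 1) ^+ m.
  apply: line_uniq => s; rewrite -[X in f (X + _)]scale1r -scalerDl hf.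
  by rewrite hornerZ horner_exp hornerD hornerX hornerC mulrC addrC.
rewrite coefZ mulrC; congr (_ * _).
rewrite -[_`_1]mulr1n -[in LHS](coef_deriv _ 0) deriv_exp derivD derivX derivC addr0 mul1r.
by rewrite coefMn -horner_coef0 horner_exp hornerD hornerX hornerC add0r expr1n.
Qed.

Lemma lap_nqM k g x : polyf g -> homog k g ->
  lap (fun z => nq z * g z) x = nq x * lap g x + (4 * k%:R + 2 * n%:R) * g x.
Proof.
move=> pg hg; rewrite lapM ?lap_nq //; last exact: polyf_nq.
have -> : gam (@nq R n) g x = 2 * (k%:R * g x).
  rewrite -euler // /gam mulr_sumr; apply: eq_bigr => i _.
  by rewrite pd_nq mulrA.
by ring.
Qed.

Definition kinv (K : 'M[R]_n -> Prop) f := forall (g : 'M[R]_n) x, K g -> f (g *m x) = f x.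
Definition korth (K : 'M[R]_n -> Prop) := forall g : 'M[R]_n, K g -> g^T *m g = 1%:M.

Lemma lap_basis (Q : 'M[R]_n) f x : polyf f -> Q *m Q^T = 1%:M ->
  lap f x = \sum_i dd (col i Q) (dd (col i Q) f) x.
Proof.
move=> pf QQ.
have e1 i y : dd (col i Q) f y = \sum_k Q k i * pd k f y.
  by rewrite dd_pd //; apply: eq_bigr => k _; rewrite mxE.
have e2 i : dd (col i Q) (dd (col i Q) f) x = \sum_j \sum_k Q j i * Q k i * pd j (pd k f) x.
  have -> : dd (col i Q) f = fun y => \sum_k Q k i * pd k f y by apply/funext => y; exact: e1.
  rewrite dd_sum => [|k]; last by apply: polyf_mul (polyf_cst _ _) _; exact: polyf_pd.
  rewrite exchange_big; apply: eq_bigr => k _; rewrite ddZ; last exact: polyf_pd.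
  rewrite dd_pd; last exact: polyf_pd.
  by rewrite mulr_sumr; apply: eq_bigr => j _; rewrite mxE; ring.
rewrite (eq_bigr _ (fun i _ => e2 i)) exchange_big; apply: eq_bigr => j _ /=.
rewrite exchange_big (bigD1 j) //= [X in _ + X]big1 ?addr0 => [|k kj]; last first.
  have := congr1 (fun (M : 'M[R]_n) => M j k) QQ; rewrite !mxE eq_sym (negbTE kj) => h.
  rewrite -mulr_suml (eq_bigr (fun i => Q j i * Q^T i k)) => [|i _]; last by rewrite mxE.
  by rewrite h mul0r.
have := congr1 (fun (M : 'M[R]_n) => M j j) QQ; rewrite !mxE eqxx => h.
rewrite -mulr_suml (eq_bigr (fun i => Q j i * Q^T i j)) => [|i _]; last by rewrite mxE.
by rewrite h mul1r.
Qed.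

Lemma kinv_lap K f : korth K -> polyf f -> kinv K f -> kinv K (lap f).
Proof.
move=> KO pf fK g x Kg; rewrite (@lap_basis g) //; last exact/mulmx1C/KO.
apply: eq_bigr => i _; rewrite colE.
have pdg := polyf_dd (g *m delta_mx i 0) pf.
rewrite -dd_comp_lin // /pd; congr (dd _ _ x); apply/funext => z.
by rewrite -dd_comp_lin //; congr (dd _ _ z); apply/funext => w; exact: fK.
Qed.

Lemma kinv_nq K : korth K -> kinv K (@nq R n).
Proof. by move=> KO g x Kg; rewrite nq_orth //; exact: KO. Qed.

Lemma kinvD K f g : kinv K f -> kinv K g -> kinv K (fun x => f x + g x).
Proof. by move=> fK gK k x Kk; rewrite fK ?gK. Qed.

Lemma kinvM K f g : kinv K f -> kinv K g -> kinv K (fun x => f x * g x).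
Proof. by move=> fK gK k x Kk; rewrite fK ?gK. Qed.

Lemma kinv_hcomp K j f : polyf f -> kinv K f -> kinv K (hcomp j f).
Proof.
move=> pf fK g x Kg; rewrite /hcomp -{1}(mulmx0 _ g) -line_comp_lin //.
by congr ((line _ 0 x)`_j); apply/funext => z; exact: fK.
Qed.

(** Taking Laplacians, [p = lap q] must solve an equation of the same form with degree lowered by
    two and a larger constant. Conversely such a [p] gives [q = (f - nq p) / c]. *)
Lemma solve_nq_lap K k (c : R) f : korth K -> 0 < c -> polyf f -> homog k f -> kinv K f ->
  exists q, [/\ polyf q, homog k q, kinv K q & forall x, nq x * lap q x + c * q x = f x].
Proof.
move=> KO; elim/ltn_ind: k c f => k IH c f c0 pf hf fK.
have [k2|k2] := ltnP k 2.
  exists (fun x => c^-1 * f x); split.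
  - exact: polyf_mul (polyf_cst _ _) pf.
  - exact: homog_mul_cst.
  - by move=> g x Kg; rewrite fK.
  - by move=> x; rewrite lapZ // (lap_low pf hf k2) !mulr0 add0r mulrA mulfV ?mul1r // gt_eqF.
case: k k2 IH hf => [|[|k]] // _ IH hf.
have pl := polyf_lap pf.
have c'0 : 0 < c + (4 * k%:R + 2 * n%:R) :> R by rewrite ltr_wpDr // addr_ge0 // mulr_ge0.
have [p [pp hp pK pE]] := IH k (ltnW (leqnn _)) _ _ c'0 pl (homog_lap pf hf) (kinv_lap KO pf fK).
have pnp : polyf (fun x => nq x * p x) := polyf_mul (polyf_nq _ _) pp.
have pnp' : polyf (fun x => (-1) * (nq x * p x)) := polyf_mul (polyf_cst _ _) pnp.
have pF : polyf (fun x => f x + (-1) * (nq x * p x)) := polyf_add pf pnp'.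
exists (fun x => c^-1 * (f x + (-1) * (nq x * p x))); split.
- exact: polyf_mul (polyf_cst _ _) pF.
- move=> s x; rewrite hf hp nqZ !exprS; ring.
- by move=> g x Kg; rewrite fK // pK // (kinv_nq KO).
- move=> x; rewrite lapZ // lapD // lapZ // (lap_nqM _ pp hp) -pE.
  by field; rewrite gt_eqF.
Qed.

(** If [lap (nq q) = lap f] then [f - nq q] is harmonic and equals [f - q] on the sphere. It remains
    to replace [q], whose degree is lower by two. *)
Lemma harmonic_replacement_homog K k f : (0 < n)%N -> korth K -> polyf f -> homog k f ->
  kinv K f -> exists h, [/\ polyf h, kinv K h, forall x, lap h x = 0 &
    forall x, nq x = 1 -> h x = f x].
Proof.
move=> n0 KO; elim/ltn_ind: k f => k IH f pf hf fK.
have [k2|k2] := ltnP k 2.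
  by exists f; split=> //; exact: lap_low hf k2.
case: k k2 IH hf => [|[|k]] // _ IH hf.
have pl := polyf_lap pf.
have c0 : 0 < 4 * k%:R + 2 * n%:R :> R.
  by rewrite ltr_wpDl ?mulr_ge0 // mulr_gt0 // ltr0n.
have [q [pq hq qK qE]] := solve_nq_lap KO c0 pl (homog_lap pf hf) (kinv_lap KO pf fK).
have [h [ph hK lh hE]] := IH k (ltnW (leqnn _)) q pq hq qK.
have pnp : polyf (fun x => nq x * q x) := polyf_mul (polyf_nq _ _) pq.
have pnp' : polyf (fun x => (-1) * (nq x * q x)) := polyf_mul (polyf_cst _ _) pnp.
have pF : polyf (fun x => f x + (-1) * (nq x * q x)) := polyf_add pf pnp'.
exists (fun x => f x + (-1) * (nq x * q x) + h x); split.
- exact: polyf_add.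
- by move=> g x Kg; rewrite fK // qK // hK // (kinv_nq KO).
- by move=> x; rewrite lapD // lapD // lapZ // (lap_nqM _ pq hq) qE lh; ring.
- by move=> x x1; rewrite hE // x1; ring.
Qed.

Theorem harmonic_replacement K f : (0 < n)%N -> korth K -> polyf f -> kinv K f ->
  exists h, [/\ polyf h, kinv K h, forall x, lap h x = 0 & forall x, nq x = 1 -> h x = f x].
Proof.
move=> n0 KO pf fK; have [M /(_ M (leqnn _)) fE] := hcomp_sum pf.
have /choice[h hh] j : exists h, [/\ polyf h, kinv K h, forall x, lap h x = 0 &
    forall x, nq x = 1 -> h x = hcomp j f x].
  apply: (harmonic_replacement_homog n0 KO); [exact: polyf_hcomp|exact: homog_hcomp|].
  exact: kinv_hcomp.
exists (fun x => \sum_(j < M) h j x); split.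
- by apply: polyf_sum => j; have [] := hh j.
- by move=> g x Kg; apply: eq_bigr => j _; have [_ hK _ _] := hh j; exact: hK.
- move=> x; rewrite /lap; under eq_bigr => i _.
    have -> : pd i (fun x => \sum_(j < M) h j x) = fun x => \sum_(j < M) pd i (h j) x.
      by apply/funext => z; rewrite /pd dd_sum // => j; have [] := hh j.
    rewrite /pd dd_sum; last by move=> j; apply: polyf_dd; have [] := hh j.
    over.
  by rewrite exchange_big big1 // => j _; have [_ _ + _] := hh j; exact.
- by move=> x x1; rewrite fE; apply: eq_bigr => j _; have [_ _ _ ->] := hh j.
Qed.

End HomogCalculus.

Section HarmonicLimit.
Variable R : realType.

Lemma coef_weights m : exists w : 'I_m.+1 -> 'I_m.+1 -> R,
  forall P : {poly R}, (size P <= m.+1)%N ->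
    forall j : 'I_m.+1, P`_j = \sum_i w j i * P.[i%:R].
Proof.
pose a : 'rV[R]_m.+1 := \row_j j%:R.
pose V := Vandermonde m.+1 a.
have Vu : V \in unitmx.
  rewrite unitmxE unitfE det_Vandermonde; apply/prodf_neq0 => i _; apply/prodf_neq0 => j ij.
  by rewrite !mxE subr_eq0 eqr_nat gtn_eqF.
exists (fun j i => invmx V i j) => P sP j.
pose c : 'rV[R]_m.+1 := \row_j P`_j; pose v : 'rV[R]_m.+1 := \row_i P.[i%:R].
have cV : c *m V = v.
  apply/rowP => i; rewrite !mxE (horner_coef_wide _ sP); apply: eq_bigr => k _.
  by rewrite !mxE.
have := congr1 (fun u => (u *m invmx V) 0 j) cV; rewrite /= mulmxK // !mxE => ->.
by apply: eq_bigr => i _; rewrite !mxE mulrC.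
Qed.

Lemma taylor_bound k (Q : {poly R}) (rho A : R) :
  (forall t, `|t| <= rho -> `|(iter k (@deriv R) Q).[t]| <= A) ->
  (forall i, (i < k)%N -> Q`_i = 0) ->
  forall t, `|t| <= rho -> `|Q.[t]| <= A * `|t| ^+ k.
Proof.
elim: k Q => [|k IH] Q hA Q0 t tr; first by rewrite expr0 mulr1; exact: hA.
have hQ' : forall s, `|s| <= rho -> `|(deriv Q).[s]| <= A * `|s| ^+ k.
  apply: IH => [s sr|i ik]; first by rewrite -iterSr; exact: hA.
  by rewrite coef_deriv Q0 // mul0rn.
have [s /between0_norm st] :=
  @mvt R (horner Q) (horner (deriv Q)) 0 t (fun s _ => isd_horner Q s).
rewrite horner_coef0 Q0 // !subr0 => ->.
rewrite normrM exprSr mulrA ler_wpM2r // (le_trans (hQ' s (le_trans st tr))) //.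
have A0 : 0 <= A.
  apply: le_trans (hA 0 _); first by rewrite normr_ge0.
  by rewrite normr0 (le_trans _ tr).
by rewrite ler_wpM2l // lerXn2r ?nnegrE.
Qed.

Variable n : nat.
Notation E := 'cV[R]_n.
Implicit Types (f g h U : E -> R) (x y v : E).

(** Partial derivatives of forms of a fixed degree are fixed linear combinations of values, so they
    converge too; by induction their limits are polynomials, and Euler's identity recovers [U]. *)
Lemma homog_limit m (g : nat -> E -> R) U :
  (forall k, polyf (g k)) -> (forall k, homog m (g k)) ->
  (forall x, g k x @[k --> \oo] --> U x) -> polyf U.
Proof.
elim: m g U => [|m IH] g U pg hg gU.
  apply: (polyf_ext (f := fun=> U 0)) => [x|]; last exact: polyf_cst.
  have c : g k 0 @[k --> \oo] --> U x.
    apply: cvg_trans (gU x); apply: near_eq_cvg.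
    by apply: nearW => k; have := hg k 0 x; rewrite scale0r expr0 mul1r.
  exact: (cvg_unique _ (gU 0) c).
have [w hw] := coef_weights m.+1.
pose D i x := \sum_j w 1 j * U (x + j%:R *: delta_mx i 0).
have gD i x : pd i (g k) x @[k --> \oo] --> D i x.
  rewrite (_ : (fun k => _) = fun k => \sum_j w 1 j * g k (x + j%:R *: delta_mx i 0)).
    by apply: cvg_bsum => j _; apply: cvgM; [exact: cvg_cst | exact: gU].
  apply/funext => k; rewrite /pd /dd -[1%N]/(val (1 : 'I_m.+2)) hw.
    by apply: eq_bigr => j _; rewrite lineE.
  by apply: size_line_homog; [exact: pg | exact: hg].
have pD i : polyf (D i).
  apply: (IH (fun k => pd i (g k))) => // k; first exact: polyf_pd.
  exact: homog_pd.
apply: (polyf_ext (f := fun x => m.+1%:R^-1 * \sum_i x i 0 * D i x)) => [x|]; last first.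
  apply: polyf_mul (polyf_cst _ _) _; apply: polyf_sum => i.
  exact: polyf_mul (polyf_coord _ _) (pD i).
have c1 : m.+1%:R^-1 * (\sum_i x i 0 * pd i (g k) x) @[k --> \oo] -->
    m.+1%:R^-1 * \sum_i x i 0 * D i x.
  apply: cvgM; first exact: cvg_cst.
  by apply: cvg_bsum => i _; apply: cvgM; [exact: cvg_cst | exact: gD].
have c2 : m.+1%:R^-1 * (\sum_i x i 0 * pd i (g k) x) @[k --> \oo] --> U x.
  apply: cvg_trans (gU x); apply: near_eq_cvg; apply: nearW => k.
  by rewrite (euler _ (pg k) (hg k)) mulrA mulVf ?mul1r // pnatr_eq0.
exact: (cvg_unique _ c1 c2).
Qed.

(** The derivatives of [h k] along rays are bounded by Bernstein's estimates, so that
    the part of degree [m] of [h k] can be read off values of [h k], up to a term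
    that vanishes near the origin. *)
Theorem harmonic_limit m (h : nat -> E -> R) U : (0 < n)%N ->
  (forall k, polyf (h k)) -> (forall k x, lap (h k) x = 0) ->
  (forall k x, nq x <= 1 -> `|h k x - U x| <= k.+1%:R^-1) ->
  (forall t x, 0 <= t -> U (t *: x) = t ^+ m * U x) -> polyf U.
Proof.
move=> n0 ph lh hU Um.
have [B0 [B00 hB0]] := polyf_bound 1 (ph 0%N).
pose B := B0 + 2.
have hB k x : nq x <= 1 -> `|h k x| <= B.
  move=> x1; have h0 : `|h 0%N x| <= B0.
    by apply: hB0 => i; apply: coord_le_nq => //; rewrite expr1n.
  have h1 := hU 0%N x x1; have h2 := hU k x x1; rewrite invr1 in h1.
  have {}h2 : `|h k x - U x| <= 1.
    by rewrite (le_trans h2) // invf_le1 ?ltr0n // ler1n.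
  have -> : h k x = (h k x - U x) - (h 0%N x - U x) + h 0%N x by ring.
  rewrite (le_trans (ler_normD _ _)) // (le_trans (lerD (ler_normB _ _) (lexx _))) //.
  by rewrite /B; lra.
have [C C0 hC] := @bernstein_iter R n m.+1 1 n0 ltr01.
have B_ge0 : 0 <= B by rewrite addr_ge0.
pose A := C * B; have A0 : 0 <= A by rewrite mulr_ge0.
(* Each of the [m + 1] derivatives in [bernstein_iter] divides the squared radius by [4], that is,
   the radius by [2]. *)
pose r1 : R := (2 ^+ m.+1)^-1; have r10 : 0 < r1 by rewrite invr_gt0 exprn_gt0.
have r11 : r1 <= 1 by rewrite invf_le1 ?exprn_gt0 // exprn_ege1 // ler1n.
have [w hw] := coef_weights m.
pose W := \sum_i `|w ord_max i|; have W0 : 0 <= W by apply: sumr_ge0.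
(* The coefficient is sampled at the points [tau * i]: there [h k] differs from [U] by at most
   [1 / (k + 1)], and the Taylor remainder is of order [tau ^ (m + 1)], one power more than what is
   divided out. *)
have comp_le k x (tau : R) : nq x <= 1 -> 0 < tau -> tau * m.+1%:R <= r1 ->
    tau ^+ m * `|hcomp m (h k) x - U x| <= W * (k.+1%:R^-1 + A * (tau * m.+1%:R) ^+ m.+1).
  move=> x1 t0 tr; pose P := line (h k) 0 x; pose Q := P - take_poly m.+1 P.
  have Qb t : `|t| <= r1 -> `|Q.[t]| <= A * `|t| ^+ m.+1.
    move=> tr1; apply: (taylor_bound (rho := r1)) => // [s sr|i im]; last first.
      by rewrite coefB coef_take_poly im subrr.
    have iterB j (p q : {poly R}) : iter j (@deriv R) (p - q) = iter j (@deriv R) p - iter j (@deriv R) q.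
      by elim: j => //= j ->; rewrite derivB.
    rewrite /Q iterB [X in _ - X](_ : _ = 0); last first.
      by have := @derivn_poly0 R (take_poly m.+1 P) m.+1; apply; exact: size_take_poly.
    have iterl j : polyf (iter j (dd x) (h k)) /\
        iter j (@deriv R) P = line (iter j (dd x) (h k)) 0 x.
      elim: j => //= j [pj ->]; split; first exact: polyf_dd.
      by rewrite line_deriv.
    have [pj ->] := iterl m.+1; rewrite subr0 lineE // add0r.
    apply: hC => //; first exact: hB.
    rewrite nqZ -(real_normK (num_real s)).
    have -> : 1 / 4 ^+ m.+1 = r1 ^+ 2.
      by rewrite /r1 exprVn -exprM mulnC exprM div1r; congr (_ ^+ _)^-1; ring.
    rewrite -[leRHS]mulr1 ler_pM ?sqr_ge0 ?nq_ge0 //.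
    by rewrite lerXn2r ?nnegrE // ltW.
  pose S := take_poly m.+1 P - U x *: 'X^m.
  have sS : (size S <= m.+1)%N.
    rewrite (leq_trans (size_polyD _ _)) // geq_max size_take_poly size_polyN.
    by rewrite (leq_trans (size_scale_leq _ _)) // size_polyXn.
  have sS' : (size (S \Po (tau *: 'X)) <= m.+1)%N.
    rewrite (leq_trans (size_comp_poly_leq _ _)) // size_scale ?gt_eqF // size_polyX /= muln1.
    by case: (size S) sS.
  have Sm : (S \Po (tau *: 'X))`_m = tau ^+ m * S`_m.
    have -> : S \Po (tau *: 'X) = \poly_(i < m.+1) (tau ^+ i * S`_i).
      apply: poly_inj_horner => t; rewrite horner_comp hornerZ hornerX.
      rewrite (horner_coef_wide _ sS) horner_poly; apply: eq_bigr => i _.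
      by rewrite exprMn; ring.
    by rewrite coef_poly leqnn.
  have -> : hcomp m (h k) x - U x = S`_m.
    by rewrite coefB coef_take_poly leqnn coefZ coefXn eqxx mulr1.
  rewrite -{1}(gtr0_norm t0) -normrX -normrM -Sm -[m]/(val (@ord_max m)) (hw _ sS').
  rewrite (le_trans (ler_norm_sum _ _ _)) // mulr_suml; apply: ler_sum => i _.
  rewrite normrM ler_wpM2l // horner_comp hornerZ hornerX.
  set t := tau * i%:R.
  have t00 : 0 <= t by rewrite mulr_ge0 // ltW.
  have tm : t <= tau * m.+1%:R by rewrite ler_pM2l // ler_nat ltnW.
  have tr1 : `|t| <= r1 by rewrite ger0_norm // (le_trans tm).
  have -> : S.[t] = (h k (t *: x) - U (t *: x)) - Q.[t].
    rewrite /S /Q !(hornerD, hornerN) hornerZ hornerXn Um // /P lineE // add0r.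
    by ring.
  rewrite (le_trans (ler_normB _ _)) // lerD //.
    apply: hU; rewrite nqZ -[leRHS]mulr1 ler_pM ?sqr_ge0 ?nq_ge0 //.
    by rewrite exprn_ile1 // (le_trans _ r11) // -(ger0_norm t00).
  rewrite (le_trans (Qb t tr1)) // ler_wpM2l // ger0_norm // lerXn2r ?nnegrE //.
  by rewrite mulr_ge0 // ltW.
have cvg1 x : nq x <= 1 -> hcomp m (h k) x @[k --> \oo] --> U x.
  move=> x1; apply/cvgrPdist_le => e e0.
  pose M : R := m.+1%:R; have M0 : 0 < M by rewrite ltr0n.
  pose L := W * A * M ^+ m.+1 + 1.
  have L0 : 0 < L by rewrite ltr_wpDl // !mulr_ge0 // exprn_ge0 // ltW.
  (* [tau] is fixed to make the remainder small; only then is [k] taken large. *)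
  pose tau := Num.min (r1 / M) (e / (2 * L)).
  have t0 : 0 < tau by rewrite lt_min !divr_gt0 // mulr_gt0.
  have tM : tau * M <= r1 by rewrite -ler_pdivlMr // ge_min lexx.
  have tL : tau * L <= e / 2.
    rewrite -ler_pdivlMr // (@le_trans _ _ (e / (2 * L))) ?ge_min ?lexx ?orbT //.
    by rewrite invfM mulrA.
  have tm0 : 0 < tau ^+ m by rewrite exprn_gt0.
  have We : \forall k \near \oo, W * k.+1%:R^-1 <= tau ^+ m * (e / 2).
    have d0 : 0 < tau ^+ m * (e / 2) / (W + 1) by rewrite divr_gt0 ?mulr_gt0 ?divr_gt0 // ltr_wpDl.
    near=> k; have k1 : k.+1%:R^-1 < tau ^+ m * (e / 2) / (W + 1).
      near: k; exact: (near_infty_natSinv_lt (PosNum d0)).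
    have W1 : 0 < W + 1 by rewrite ltr_wpDl.
    rewrite ltr_pdivlMr // in k1; apply: le_trans (ltW k1).
    by rewrite mulrC ler_wpM2l // lerDl.
  apply: filterS We => k We; rewrite distrC -(ler_pM2l tm0).
  rewrite (le_trans (comp_le k x tau x1 t0 tM)) // mulrDr.
  have -> : tau ^+ m * e = tau ^+ m * (e / 2) + tau ^+ m * (e / 2) by field.
  rewrite lerD // exprMn exprS.
  have -> : W * (A * (tau * tau ^+ m * m.+1%:R ^+ m.+1)) = tau ^+ m * (tau * (W * A * M ^+ m.+1)).
    by rewrite /M; ring.
  by rewrite ler_pM2l // (le_trans _ tL) // ler_pM2l // lerDl.
apply: (@homog_limit m (fun k => hcomp m (h k)) U) => [k|k|x].
- exact: polyf_hcomp.
- exact: homog_hcomp.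
- pose s := 1 + nq x; have s0 : 0 < s by rewrite ltr_wpDr ?nq_ge0.
  have y1 : nq (s^-1 *: x) <= 1.
    rewrite nqZ exprVn mulrC ler_pdivrMr ?exprn_gt0 // mul1r /s.
    have := nq_ge0 x; nra.
  have xE : x = s *: (s^-1 *: x) by rewrite scalerA mulfV ?scale1r // gt_eqF.
  have c1 : s ^+ m * hcomp m (h k) (s^-1 *: x) @[k --> \oo] --> s ^+ m * U (s^-1 *: x).
    by apply: cvgM; [exact: cvg_cst | exact: cvg1].
  rewrite -Um ?(ltW s0) // -xE in c1; apply: cvg_trans c1; apply: near_eq_cvg.
  by apply: nearW => k; rewrite -homog_hcomp // -xE.
Unshelve. all: by end_near. Qed.

End HarmonicLimit.

(** * Approximation by invariant polynomials *)

Section LimitBounds.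
Variables (R : realType) (T : Type) (U : set_system T).
Hypothesis UP : ProperFilter U.

Lemma cvg_le_cst (f : T -> R) (l c : R) : f t @[t --> U] --> l ->
  (\forall t \near U, f t <= c) -> l <= c.
Proof.
move=> fl fc; rewrite leNgt; apply/negP => cl; have /cvgr_gt /(_ _ cl) h := fl.
have [t [h1 h2]] := filter_ex (filterI h fc).
by move: h1; rewrite ltNge h2.
Qed.

Lemma cvg_ge_cst (f : T -> R) (l c : R) : f t @[t --> U] --> l ->
  (\forall t \near U, c <= f t) -> c <= l.
Proof.
move=> fl fc; rewrite leNgt; apply/negP => cl; have /cvgr_lt /(_ _ cl) h := fl.
have [t [h1 h2]] := filter_ex (filterI h fc).
by move: h1; rewrite ltNge h2.
Qed.

End LimitBounds.

Section AbsApprox.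
Variable R : realType.

(** The classical iteration increasing to [|t|] on the interval from [-1] to [1]. *)
Fixpoint abs_poly k : {poly R} :=
  if k is k'.+1 then abs_poly k' + 2^-1 *: ('X ^+ 2 - abs_poly k' ^+ 2) else 0.

(** Each step multiplies the error by [1 - (|t| + p) / 2 <= 1 - |t| / 2]. The second bound states
    this decay in a form that is uniform down to [t = 0]. *)
Lemma abs_polyP k (t : R) : `|t| <= 1 -> let e := `|t| - (abs_poly k).[t] in
  0 <= e <= `|t| /\ e * (1 + k%:R * (`|t| / 2)) <= `|t|.
Proof.
move=> t1; elim: k => [|k [/andP[e0 e1] IH]] /=.
  by rewrite horner0 subr0 normr_ge0 lexx mul0r addr0 mulr1.
set q := (abs_poly k).[t] in e0 e1 IH *; set a := `|t| in t1 e0 e1 IH *.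
have a0 : 0 <= a by exact: normr_ge0.
have -> : (abs_poly k + 2^-1 *: ('X^2 - abs_poly k ^+ 2)).[t] = q + 2^-1 * (a ^+ 2 - q ^+ 2).
  by rewrite hornerD hornerZ hornerD hornerN hornerXn horner_exp -(real_normK (num_real t)).
have -> : a - (q + 2^-1 * (a ^+ 2 - q ^+ 2)) = (a - q) * (1 - (a + q) / 2) by field.
have q0 : 0 <= q by move: e1; rewrite gerBl.
have qa : q <= a by rewrite -subr_ge0.
set e := a - q in e0 e1 IH *.
have f0 : 0 <= 1 - (a + q) / 2 by lra.
have f1 : 1 - (a + q) / 2 <= 1 - a / 2 by lra.
split.
  rewrite mulr_ge0 //= (le_trans _ e1) // ler_piMr //; lra.
rewrite (@le_trans _ _ (e * (1 - a / 2) * (1 + k.+1%:R * (a / 2)))) //.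
  rewrite ler_wpM2r ?ler_wpM2l // addr_ge0 // mulr_ge0 // divr_ge0 //.
rewrite (le_trans _ IH) // -mulrA ler_wpM2l // -[k.+1%:R]natr1.
have k0 : 0 <= k%:R :> R by exact: ler0n.
have : 0 <= (k%:R + 1) * (a / 2) ^+ 2 by rewrite mulr_ge0 ?sqr_ge0 // addr_ge0.
move: (k%:R : R) k0 => K K0; rewrite expr2; set b := a / 2; lra.
Qed.

Lemma abs_approx (B e : R) : 0 < B -> 0 < e -> exists q : {poly R},
  forall t, `|t| <= B -> `| `|t| - q.[t] | <= e.
Proof.
move=> B0 e0; pose d := e / B; have d0 : 0 < d by rewrite divr_gt0.
have [k kd] : exists k, 2 <= k.+1%:R * d.
  exists (Num.truncn (2 / d)); rewrite -ler_pdivrMr //.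
  by apply/ltW; exact: truncnS_gt.
exists (B *: (abs_poly k.+1 \Po (B^-1 *: 'X))) => t tB.
pose s := B^-1 * t; have sE : t = B * s by rewrite /s mulrA mulfV ?mul1r // gt_eqF.
have s1 : `|s| <= 1.
  by rewrite /s normrM normfV (gtr0_norm B0) mulrC ler_pdivrMr // mul1r.
have [/andP[h0 h1] h2] := abs_polyP k.+1 s1.
rewrite hornerZ horner_comp hornerZ hornerX -/s {1}sE normrM (gtr0_norm B0).
rewrite -mulrBr normrM (gtr0_norm B0) -ler_pdivlMl // mulrC -/d ger0_norm //.
set E := (`|s| - _) in h0 h1 h2 *; set a := `|s| in s1 h1 h2 *.
have a0 : 0 <= a by exact: normr_ge0.
rewrite leNgt; apply/negP => dE.
have h3 : 2 < k.+1%:R * E by apply: (le_lt_trans kd); rewrite ltr_pM2l // ltr0n.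
have h4 : a <= k.+1%:R * E * (a / 2).
  have : 2 * (a / 2) <= k.+1%:R * E * (a / 2) by rewrite ler_wpM2r ?divr_ge0 // ltW.
  by rewrite mulrC divfK.
by move: h2; rewrite mulrDr mulr1; have := lt_trans d0 dE; move: h4; lra.
Qed.

End AbsApprox.

Section Weierstrass.
Variables (R : realType) (n : nat).
Notation E := 'cV[R]_n.
Implicit Types (f g h p F G : E -> R) (x y v : E).

Definition approx F := forall e, 0 < e ->
  exists2 p, polyf p & forall x, nq x <= 1 -> `|F x - p x| <= e.

Lemma approx_polyf f : polyf f -> approx f.
Proof. by move=> pf e e0; exists f => // x _; rewrite subrr normr0 ltW. Qed.

Lemma approx_ext F G : F =1 G -> approx F -> approx G.
Proof. by move=> /funext ->. Qed.

Lemma approxD F G : approx F -> approx G -> approx (fun x => F x + G x).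
Proof.
move=> aF aG e e0; have e2 : 0 < e / 2 by rewrite divr_gt0.
have [p pp hp] := aF _ e2; have [q pq hq] := aG _ e2.
exists (fun x => p x + q x); first exact: polyf_add.
move=> x x1; rewrite opprD addrACA (le_trans (ler_normD _ _)) //.
by rewrite [leRHS]splitr lerD ?hp ?hq.
Qed.

Lemma approxZ c F : approx F -> approx (fun x => c * F x).
Proof.
move=> aF e e0; have c0 : 0 < `|c| + 1 by rewrite ltr_wpDl.
have [|p pp hp] := aF (e / (`|c| + 1)); first by rewrite divr_gt0.
exists (fun x => c * p x); first exact: polyf_mul (polyf_cst _ _) pp.
move=> x x1; rewrite -mulrBr normrM.
rewrite (@le_trans _ _ ((`|c| + 1) * (e / (`|c| + 1)))) //.
  by rewrite ler_pM ?hp // lerDl.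
by rewrite mulrC divfK // gt_eqF.
Qed.

Lemma approx_sum (I : Type) (r : seq I) (F : I -> E -> R) :
  (forall i, approx (F i)) -> approx (fun x => \sum_(i <- r) F i x).
Proof.
move=> aF; elim: r => [|i r IH].
  by apply: (approx_ext _ (approx_polyf (polyf_cst _ 0))) => x; rewrite big_nil.
by apply: (approx_ext _ (approxD (aF i) IH)) => x; rewrite big_cons.
Qed.

Lemma polyf_horner (q : {poly R}) f : polyf f -> polyf (fun x => q.[f x]).
Proof.
move=> pf; apply: (polyf_ext (f := fun x => \sum_(i < size q) q`_i * f x ^+ i)) => [x|].
  by rewrite horner_coef.
by apply: polyf_sum => i; apply: polyf_mul (polyf_cst _ _) _; exact: polyf_exp.
Qed.

Lemma ball_coord x : nq x <= 1 -> forall i, `|x i 0| <= 1.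
Proof. by move=> x1 i; apply: coord_le_nq => //; rewrite expr1n. Qed.

Lemma approx_abs F : approx F -> approx (fun x => `|F x|).
Proof.
move=> aF e e0; have e2 : 0 < e / 2 by rewrite divr_gt0.
have [p pp hp] := aF _ e2; have [C [C0 hC]] := polyf_bound 1 pp.
have C1 : 0 < C + 1 by rewrite ltr_wpDl.
have [q hq] := abs_approx C1 e2.
exists (fun x => q.[p x]); first exact: polyf_horner.
move=> x x1; rewrite -[`|F x|](subrK `|p x|) -addrA (le_trans (ler_normD _ _)) //.
rewrite [leRHS]splitr lerD //.
  by rewrite (le_trans (ler_dist_dist _ _)) // hp.
by apply: hq; rewrite (le_trans (hC x (ball_coord x1))) // lerDl.
Qed.

Lemma approx_min F G : approx F -> approx G -> approx (fun x => Num.min (F x) (G x)).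
Proof.
move=> aF aG.
have aN := approxD aF (approxZ (-1) aG).
have := approxZ (2^-1) (approxD (approxD aF aG) (approxZ (-1) (approx_abs aN))).
apply: approx_ext => x; rewrite !mulN1r; case: (leP (F x) (G x)) => h.
  by rewrite ler0_norm ?subr_le0 //; field.
by rewrite gtr0_norm ?subr_gt0 //; field.
Qed.

Definition ucont F := forall (T : Type) (U : set_system T) (u : T -> E) a,
  UltraFilter U -> cvc U u a -> F (u t) @[t --> U] --> F a.

Definition box x := forall i, `|x i 0| <= 1.

Lemma box_limit (U : set_system E) : UltraFilter U -> U box ->
  exists2 a, box a & cvc U id a.
Proof.
move=> UU Ub; have UP : ProperFilter U := @ultra_proper _ _ UU.
have cU (i : 'I_n) : cvg (x i 0 @[x --> U]).
  by apply: (@ultra_cvg_real _ _ _ _ 1 UU); apply: filterS Ub => x; exact.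
pose a : E := \col_i lim (x i 0 @[x --> U]).
have ca : cvc U id a by move=> i; rewrite mxE; exact: cU.
exists a => // i; have c1 : `|x i 0| @[x --> U] --> `|a i 0| by apply: cvg_norm; exact: ca.
by apply: (cvg_le_cst UP c1); apply: filterS Ub => x; exact.
Qed.

Lemma ucont_bounded F : ucont F -> exists2 M, 0 <= M & forall x, box x -> `|F x| <= M.
Proof.
move=> cF; have b0 : box 0 by move=> i; rewrite mxE normr0.
have cF' : ucont (fun x => - F x) by move=> T U u a UU ua; apply: cvgN; exact: cF.
have mx G : ucont G -> exists2 x, box x & forall y, box y -> G y <= G x.
  move=> cG; apply: (@sup_attained R _ box G 0 b0) => U UU /(box_limit UU)[a ba ca].
  by exists a => //; exact: (cG _ _ _ _ UU ca).
have [x1 bx1 h1] := mx _ cF; have [x2 bx2 h2] := mx _ cF'.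
exists (`|F x1| + `|F x2|); first by rewrite addr_ge0.
move=> x bx; rewrite ler_norml; apply/andP; split.
  rewrite lerNl (le_trans (h2 x bx)) // (le_trans (ler_norm _)) // normrN lerDr //.
by rewrite (le_trans (h1 x bx)) // (le_trans (ler_norm _)) // lerDl.
Qed.

Lemma ucont_unif F e : ucont F -> 0 < e -> exists2 d, 0 < d & forall x y, box x -> box y ->
  (forall i, `|x i 0 - y i 0| <= d) -> `|F x - F y| <= e.
Proof.
move=> cF e0; apply: contrapT => h.
have bad k : exists xy : E * E, [/\ box xy.1, box xy.2,
    forall i, `|xy.1 i 0 - xy.2 i 0| <= k.+1%:R^-1 & e < `|F xy.1 - F xy.2|].
  apply: contrapT => h'; apply: h; exists k.+1%:R^-1; first by rewrite invr_gt0 ltr0n.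
  move=> x y bx by' xy; rewrite leNgt; apply/negP => exy; apply: h'.
  by exists (x, y).
have /choice[xy hxy] := bad.
have b1 : \forall k \near \oo, forall i, `|(xy k).1 i 0| <= 1.
  by apply: nearW => k; have [] := hxy k.
have [U [UU oU [a xa]]] := @ultra_cvc R n nat \oo (fun k => (xy k).1) 1 _ b1.
have UP : ProperFilter U := @ultra_proper _ _ UU.
have ya : cvc U (fun k => (xy k).2) a.
  move=> i; have c0 : (xy k).1 i 0 - (xy k).2 i 0 @[k --> U] --> 0.
    apply/cvgrPdist_le => e' e'0; apply: oU; near=> k.
    rewrite sub0r normrN; have [_ _ /(_ i) h1 _] := hxy k; apply: (le_trans h1); apply/ltW.
    near: k; exact: (near_infty_natSinv_lt (PosNum e'0)).
  have c2 : (xy k).1 i 0 - ((xy k).1 i 0 - (xy k).2 i 0) @[k --> U] --> a i 0 - 0.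
    by apply: cvgB => //; exact: xa.
  rewrite subr0 in c2; apply: cvg_trans c2; apply: near_eq_cvg.
  by apply: nearW => k /=; rewrite opprB addrC subrK.
have c1 : F (xy k).1 - F (xy k).2 @[k --> U] --> F a - F a.
  by apply: cvgB; exact: (cF _ _ _ _ UU).
rewrite subrr in c1.
have /cvgrPdist_lt /(_ e e0) h1 := c1.
have [k] := filter_ex h1; rewrite sub0r normrN; have [_ _ _ h2] := hxy k.
by move=> /(lt_trans h2); rewrite ltxx.
Unshelve. all: by end_near. Qed.

Lemma approx_minseq (T : Type) (s : seq T) (t0 : T) (F : T -> E -> R) :
  (forall t, approx (F t)) ->
  approx (fun x => foldr (fun t m => Num.min (F t x) m) (F t0 x) s).
Proof.
move=> aF; elim: s => [|t s IH] /=; first exact: aF.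
exact: approx_min.
Qed.

Lemma minseq_ge (T : eqType) (s : seq T) (F : T -> R) t0 c :
  c <= F t0 -> (forall t, t \in s -> c <= F t) -> c <= foldr (fun t m => Num.min (F t) m) (F t0) s.
Proof.
move=> c0; elim: s => //= t s IH hs; rewrite le_min hs ?mem_head //=.
by apply: IH => u us; apply: hs; rewrite inE us orbT.
Qed.

Lemma minseq_le (T : eqType) (s : seq T) (F : T -> R) t0 t :
  t \in s -> foldr (fun t m => Num.min (F t) m) (F t0) s <= F t.
Proof.
elim: s => //= u s IH; rewrite inE ge_min => /predU1P[->|/IH ->]; first by rewrite lexx.
by rewrite orbT.
Qed.

(** [F] is close to the least of finitely many cones [F p + L |x - p|] with apices [p] on a grid,
    and absolute values and minima of approximable functions are approximable. *)
Theorem weierstrass F : ucont F -> approx F.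
Proof.
move=> cF e e0; have e3 : 0 < e / 3 by rewrite divr_gt0.
have [M M0 hM] := ucont_bounded cF; have [d d0 hd] := ucont_unif cF e3.
(* Farther than [d] from its apex, a cone has risen by more than [2 M], the possible oscillation of
   [F]. The bound [k >= D] makes the mesh finer than [d] and the cone with apex next to [x] rise by
   at most [e / 3]. *)
pose L := 2 * M / d; have L0 : 0 <= L by rewrite divr_ge0 ?mulr_ge0 // ltW.
pose D := 2 / d + 2 * L * n%:R / (e / 3).
have D1 : 0 <= 2 / d by rewrite divr_ge0 // ltW.
have D2 : 0 <= 2 * L * n%:R / (e / 3).
  apply: divr_ge0; last exact: ltW.
  by apply: mulr_ge0 => //; exact: mulr_ge0.
have D0 : 0 <= D by exact: addr_ge0.
pose k := (Num.truncn D).+1; have kD : D <= k%:R by apply/ltW; exact: truncnS_gt.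
have k0 : 0 < k%:R :> R by rewrite ltr0n.
have kd : 2 / k%:R <= d.
  by rewrite ler_pdivrMr // mulrC -ler_pdivrMr // (le_trans _ kD) // lerDl.
have ke : L * (n%:R * (2 / k%:R)) <= e / 3.
  have -> : L * (n%:R * (2 / k%:R)) = 2 * L * n%:R / k%:R by ring.
  by rewrite ler_pdivrMr // [e / 3 * _]mulrC -ler_pdivrMr // (le_trans _ kD) // lerDr.
pose FT := {ffun 'I_n -> 'I_k.+1}.
pose pt (f : FT) : E := \col_i (2 * (f i)%:R / k%:R - 1).
have pt_box (f : FT) : box (pt f).
  move=> i; rewrite mxE; have : (f i)%:R / k%:R <= 1 :> R.
    by rewrite ler_pdivrMr // mul1r ler_nat -ltnS.
  have : 0 <= (f i)%:R / k%:R :> R by rewrite divr_ge0 // ltW.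
  by rewrite ler_norml -mulrA; move: (_ / _) => z h0 h1; apply/andP; split; lra.
have near_pt x : box x -> exists f : FT, forall i, `|x i 0 - pt f i 0| <= 2 / k%:R.
  move=> bx.
  have in_k i : (Num.truncn (k%:R * (x i 0 + 1) / 2)%R < k.+1)%N.
    have := bx i; rewrite ler_norml => /andP[x0 x1].
    rewrite ltnS truncn_le_nat // (@le_lt_trans _ _ k%:R) ?ltr_nat //.
    rewrite -mulrA ler_piMr ?(ltW k0) //; lra.
  exists [ffun i => Ordinal (in_k i)] => i; rewrite mxE ffunE /=.
  have := bx i; rewrite ler_norml => /andP[x0 x1].
  set z := k%:R * (x i 0 + 1) / 2.
  have z0 : 0 <= z by rewrite divr_ge0 // mulr_ge0 ?(ltW k0) //; lra.
  have /andP[t1 t2] := truncn_itv z0.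
  have -> : x i 0 = 2 * z / k%:R - 1 by rewrite /z; field; rewrite gt_eqF.
  rewrite opprB addrA subrK -mulrBl -mulrBr normrM normfV (gtr0_norm k0).
  rewrite ler_pM2r ?invr_gt0 // normrM ger0_norm // -[leRHS]mulr1 ler_pM2l //.
  by rewrite ger0_norm ?subr_ge0 // lerBlDl -[X in _ + X]/(1%:R) -natrD addn1 ltW.
pose G (f : FT) x := F (pt f) + L * \sum_i `|x i 0 - pt f i 0|.
have aG (f : FT) : approx (G f).
  apply: approxD; first exact: approx_polyf (polyf_cst _ _).
  apply: approxZ; apply: approx_sum => i; apply: approx_abs; apply: approx_polyf.
  exact: polyf_sub (polyf_coord _ i) (polyf_cst _ _).
have [|f0 _] := near_pt 0; first by move=> i; rewrite mxE normr0.
have [q pq hq] := approx_minseq (enum {: FT}) f0 aG e3.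
exists q => // x x1; have bx := ball_coord x1.
pose m x := foldr (fun t a => Num.min (G t x) a) (G f0 x) (enum {: FT}).
have {}hq : forall x, nq x <= 1 -> `|m x - q x| <= e / 3 by exact: hq.
have mF : `|F x - m x| <= 2 * (e / 3).
  have Gge (f : FT) : F x - e / 3 <= G f x.
    have S0 : 0 <= \sum_i `|x i 0 - pt f i 0| by exact: sumr_ge0.
    have [h|h] := pselect (forall i, `|x i 0 - pt f i 0| <= d).
      have := hd x (pt f) bx (pt_box f) h; rewrite ler_norml => /andP[_ h1].
      by rewrite /G lerBlDr -addrA -lerBlDl (le_trans h1) // lerDr mulr_ge0.
    have [i di] : exists i, d < `|x i 0 - pt f i 0|.
      by apply: contrapT => h'; apply: h => i; rewrite leNgt; apply/negP => di; apply: h'; exists i.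
    have h2 : 2 * M <= L * \sum_i `|x i 0 - pt f i 0|.
      rewrite /L mulrAC ler_pdivlMr // ler_wpM2l ?mulr_ge0 //.
      by rewrite (bigD1 i) //= (le_trans (ltW di)) // lerDl sumr_ge0.
    have := hM x bx; have := hM _ (pt_box f); rewrite !ler_norml => /andP[u1 _] /andP[_ u2].
    by rewrite /G; lra.
  have lo : F x - e / 3 <= m x by apply: (@minseq_ge _ _ (fun f : FT => G f x)).
  have hi : m x <= F x + 2 * (e / 3).
    have [f hf] := near_pt x bx.
    have := @minseq_le _ _ (fun f : FT => G f x) f0 f (mem_enum _ f); move/le_trans; apply.
    have h1 := hd (pt f) x (pt_box f) bx; rewrite /G.
    have {}h1 : F (pt f) - F x <= e / 3.
      apply: le_trans (ler_norm _) _; apply: h1 => i; rewrite distrC (le_trans (hf i)) //.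
    have h2 : L * \sum_i `|x i 0 - pt f i 0| <= e / 3.
      apply: le_trans ke; rewrite ler_wpM2l //.
      apply: (@le_trans _ _ (\sum_(i < n) (2 / k%:R))); first exact: ler_sum.
      by rewrite sumr_const card_ord [leRHS]mulr_natl.
    by lra.
  by rewrite ler_norml; apply/andP; split; lra.
have -> : F x - q x = (F x - m x) + (m x - q x) by rewrite addrA subrK.
rewrite (le_trans (ler_normD _ _)) //; have := hq x x1; lra.
Qed.

End Weierstrass.

Section Reynolds.
Variables (R : realType) (n : nat).
Notation E := 'cV[R]_n.
Variable K : 'M[R]_n -> Prop.
Hypothesis KM : forall g h, K g -> K h -> K (g *m h).
Hypothesis K1 : K 1%:M.

Definition rdp (I : finType) (S T : I -> R) : R := \sum_i S i * T i.

(** [f] factors through a representation on which [K] acts by isometries; [adj g]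
    is the adjoint of the action of [g]. *)
Definition repable (f : E -> R) := exists (I : finType) (v : E -> I -> R) (T : I -> R)
  (adj : 'M[R]_n -> (I -> R) -> I -> R), [/\ forall x, f x = rdp T (v x),
    forall g S x, K g -> rdp (adj g S) (v x) = rdp S (v (g *m x)),
    forall g S, K g -> rdp (adj g S) (adj g S) = rdp S S &
    forall i, polyf (fun x => v x i)].

Hypothesis KO : korth K.

(** Constants and coordinates come from the trivial and the given representation; sums use direct
    sums, and products use tensor products, whose adjoints act one factor at a time. *)
Lemma polyf_repable f : polyf f -> repable f.
Proof.
elim=> [c|i|{}f g _ [I [v [T [adj [fE av aa pv]]]]] _ [J [w [S [adj' [gE aw aa' pw]]]]]|
        {}f g _ [I [v [T [adj [fE av aa pv]]]]] _ [J [w [S [adj' [gE aw aa' pw]]]]]].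
- exists unit, (fun _ _ => 1), (fun=> c), (fun _ S => S); split=> //.
    by move=> x; rewrite /rdp (big_pred1 tt) ?mulr1 // => -[].
  by move=> ?; exact: polyf_cst.
- exists 'I_n, (fun x j => x j 0), (fun j => (delta_mx i 0 : E) j 0).
  exists (fun g S j => (g^T *m (\col_k S k)) j 0); split.
  + move=> x; rewrite /rdp (bigD1 i) //= big1 ?addr0 => [|j ji].
      by rewrite mxE !eqxx mul1r.
    by rewrite mxE (negbTE ji) mul0r.
  + move=> g S x Kg; transitivity (dp (g^T *m \col_k S k) x); first by [].
    rewrite dpC /dp.
    transitivity (((x^T *m g^T) *m \col_k S k) 0 0).
      by rewrite -mulmxA mxE; apply: eq_bigr => j _; rewrite [x^T _ _]mxE.
    rewrite -trmx_mul mxE; apply: eq_bigr => j _.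
    by rewrite [(_^T) _ _]mxE [(\col__ _) _ _]mxE mulrC.
  + move=> g S Kg; transitivity (nq (g^T *m \col_k S k)); first by [].
    rewrite nq_orth; first by apply: eq_bigr => j _; rewrite !mxE.
    by rewrite /orth trmxK; exact/mulmx1C/KO.
  + by move=> j; exact: polyf_coord.
- pose vw x (k : I + J) := match k with inl i => v x i | inr j => w x j end.
  exists (I + J)%type, vw, (fun k => match k with inl i => T i | inr j => S j end).
  exists (fun g Q k => match k with inl i => adj g (fun i => Q (inl i)) i
    | inr j => adj' g (fun j => Q (inr j)) j end); split.
  + by move=> x; rewrite fE gE /rdp big_sumType.
  + by move=> h Q x Kh; rewrite /rdp !big_sumType /= [X in X + _](av h _ x Kh) [X in _ + X](aw h _ x Kh).
  + by move=> h Q Kh; rewrite /rdp !big_sumType /= [X in X + _](aa h _ Kh) [X in _ + X](aa' h _ Kh).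
  + by case.
- exists (I * J)%type, (fun x k => v x k.1 * w x k.2), (fun k => T k.1 * S k.2).
  exists (fun h Q k => adj h (fun i => adj' h (fun j => Q (i, j)) k.2) k.1).
  have pairE (F : I * J -> R) : \sum_k F k = \sum_i \sum_j F (i, j).
    by rewrite pair_bigA; apply: eq_bigr => -[].
  have pairE' (F : I * J -> R) : \sum_k F k = \sum_j \sum_i F (i, j).
    by rewrite pairE exchange_big.
  split.
  + move=> x; rewrite fE gE /rdp pairE mulr_suml; apply: eq_bigr => i _.
    by rewrite mulr_sumr; apply: eq_bigr => j _ /=; ring.
  + move=> h Q x Kh; rewrite /rdp pairE'.
    transitivity (\sum_j w x j * rdp (adj h (fun i => adj' h (fun j => Q (i, j)) j)) (v x)).
      by apply: eq_bigr => j _; rewrite /rdp mulr_sumr; apply: eq_bigr => i _ /=; ring.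
    transitivity (\sum_i v (h *m x) i * rdp (adj' h (fun j => Q (i, j))) (w x)).
      under eq_bigr => j _ do rewrite (av h _ x Kh) /rdp mulr_sumr.
      rewrite exchange_big; apply: eq_bigr => i _; rewrite /rdp mulr_sumr.
      by apply: eq_bigr => j _; ring.
    rewrite pairE; apply: eq_bigr => i _; rewrite (aw h _ x Kh) /rdp mulr_sumr.
    by apply: eq_bigr => j _ /=; ring.
  + move=> h Q Kh; rewrite /rdp pairE' /=.
    transitivity (\sum_j \sum_i adj' h (fun j => Q (i, j)) j * adj' h (fun j => Q (i, j)) j).
      by apply: eq_bigr => j _; exact: (aa h (fun i => adj' h (fun j => Q (i, j)) j) Kh).
    rewrite exchange_big pairE; apply: eq_bigr => i _.
    exact: (aa' h (fun j => Q (i, j)) Kh).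
  + by move=> k; apply: polyf_mul.
Qed.

(** Instead of averaging, take the vector of least norm among those satisfying the
    same bounds as [T]: it is unique, hence [K]-invariant. *)
Theorem reynolds f : polyf f -> exists p, [/\ polyf p, kinv K p &
  forall x c e, (forall g, K g -> c <= f (g *m x) <= e) -> c <= p x <= e].
Proof.
move=> /polyf_repable[I [v [T [adj [fE av aa pv]]]]].
(* All the two-sided bounds that [f] satisfies on orbits: a closed convex condition, stable under
   the adjoints. *)
pose C (S : I -> R) := forall x c e, (forall g, K g -> c <= f (g *m x) <= e) ->
  c <= rdp S (v x) <= e.
have CT : C T by move=> x c e h; rewrite -fE -[x]mul1mx; exact: h.
pose B := rdp T T + 1.
have B0 : 0 <= B by rewrite addr_ge0 // sumr_ge0 // => i _; rewrite -expr2 sqr_ge0.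
have [S [CS SB] Smin] : exists2 S, C S /\ rdp S S <= B &
    forall S', C S' /\ rdp S' S' <= B -> - rdp S' S' <= - rdp S S.
  apply: (@sup_attained R _ (fun S => C S /\ rdp S S <= B) (fun S => - rdp S S) T).
    by split=> //; rewrite lerDl.
  move=> U UU UC; have UP : ProperFilter U := @ultra_proper _ _ UU.
  have cU (i : I) : cvg (S i @[S --> U]).
    apply: (@ultra_cvg_real _ _ _ _ (B + 1) UU); apply: filterS UC => S [_ SB].
    have : S i ^+ 2 <= B.
      by apply: le_trans SB; rewrite /rdp (bigD1 i) //= -expr2 lerDl sumr_ge0 // => j _; rewrite -expr2 sqr_ge0.
    rewrite -(real_normK (num_real (S i))) => h; have := sqr_ge0 (`|S i| - 1).
    by rewrite sqrrB expr1n mulr1; lra.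
  pose a i := lim (S i @[S --> U]).
  have ca i : S i @[S --> U] --> a i by exact: cU.
  have cr x : rdp S (v x) @[S --> U] --> rdp a (v x).
    by apply: cvg_bsum => i _; apply: cvgM => //; exact: cvg_cst.
  have cq : rdp S S @[S --> U] --> rdp a a by apply: cvg_bsum => i _; exact: cvgM.
  exists a; last exact: cvgN.
  split.
    move=> x c e h; apply/andP; split.
      by apply: (cvg_ge_cst UP (cr x)); apply: filterS UC => S [/(_ x c e h) /andP[]].
    by apply: (cvg_le_cst UP (cr x)); apply: filterS UC => S [/(_ x c e h) /andP[]].
  by apply: (cvg_le_cst UP cq); apply: filterS UC => S [].
have {}Smin S' : C S' -> rdp S S <= rdp S' S'.
  move=> CS'; have [h|h] := leP (rdp S' S') B; last by rewrite (le_trans SB) // ltW.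
  by rewrite -lerN2; exact: Smin.
have fixS g : K g -> adj g S = S.
  move=> Kg; have Cg : C (adj g S).
    move=> x c e h; rewrite av //; apply: CS => k Kk.
    by rewrite mulmxA; apply: h; exact: KM.
  pose P i := 2^-1 * (S i + adj g S i).
  have CP : C P.
    move=> x c e h; have /andP[a1 a2] := CS x c e h; have /andP[b1 b2] := Cg x c e h.
    have -> : rdp P (v x) = 2^-1 * (rdp S (v x) + rdp (adj g S) (v x)).
      by rewrite /rdp -big_split mulr_sumr; apply: eq_bigr => i _; rewrite /P /=; ring.
    by apply/andP; split; lra.
  (* By the parallelogram identity, the midpoint of [S] and [adj g S], which have equal norms, is
     strictly shorter unless the two coincide. *)
  have := Smin _ CP.
  have -> : rdp P P = 2^-1 * (rdp S S + rdp (adj g S) (adj g S)) -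
      4^-1 * \sum_i (S i - adj g S i) ^+ 2.
    by rewrite /rdp -big_split !mulr_sumr -sumrB; apply: eq_bigr => i _; rewrite /P /=; field.
  rewrite aa // => h.
  have z0 : \sum_i (S i - adj g S i) ^+ 2 = 0.
    apply/eqP; rewrite eq_le sumr_ge0 ?andbT => [|i _]; last exact: sqr_ge0.
    by move: h; lra.
  apply/funext => i; apply/eqP; rewrite eq_sym -subr_eq0 -sqrf_eq0; apply/eqP.
  have := @psumr_eq0P _ _ xpredT (fun i => (S i - adj g S i) ^+ 2) _ z0 i isT.
  by apply=> j _; exact: sqr_ge0.
exists (fun x => rdp S (v x)); split.
- by apply: polyf_sum => i; apply: polyf_mul (polyf_cst _ _) (pv i).
- by move=> g x Kg; rewrite -av // fixS.
- exact: CS.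
Qed.

Theorem invariant_approx U e : ucont U -> kinv K U -> 0 < e ->
  exists p, [/\ polyf p, kinv K p & forall x, nq x <= 1 -> `|U x - p x| <= e].
Proof.
move=> cU UK e0; have [q pq hq] := weierstrass cU e0.
have [p [pp pK hp]] := reynolds pq; exists p; split=> // x x1.
have /andP[a b] : U x - e <= p x <= U x + e.
  apply: hp => g Kg; have := hq (g *m x); rewrite UK // nq_orth //; last exact: KO.
  by move/(_ x1); rewrite ler_norml => /andP[? ?]; apply/andP; split; lra.
by rewrite ler_norml; apply/andP; split; lra.
Qed.

End Reynolds.

(** * Compact linear groups and their Lie algebras *)

Section Matrices.
Variables (R : realType) (n : nat).
Notation M := 'M[R]_n.
Implicit Types (A B D g h : M) (a b c d e lam : R).

Definition bnd A c := forall i j, `|A i j| <= c.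

Lemma bnd_le A c d : c <= d -> bnd A c -> bnd A d.
Proof. by move=> cd hA i j; exact: le_trans (hA i j) cd. Qed.

Lemma bndD A B a b : bnd A a -> bnd B b -> bnd (A + B) (a + b).
Proof. by move=> hA hB i j; rewrite mxE (le_trans (ler_normD _ _)) // lerD. Qed.

Lemma bndN A a : bnd A a -> bnd (- A) a.
Proof. by move=> hA i j; rewrite mxE normrN. Qed.

Lemma bndZ c A a : bnd A a -> bnd (c *: A) (`|c| * a).
Proof. by move=> hA i j; rewrite mxE normrM ler_wpM2l. Qed.

Lemma bndT A a : bnd A a -> bnd A^T a.
Proof. by move=> hA i j; rewrite mxE. Qed.

Lemma bndM A B a b : bnd A a -> bnd B b -> bnd (A *m B) (n%:R * (a * b)).
Proof.
move=> hA hB i j; rewrite mxE (le_trans (ler_norm_sum _ _ _)) //.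
apply: (@le_trans _ _ (\sum_(k < n) a * b)); last by rewrite sumr_const card_ord mulr_natl.
by apply: ler_sum => k _; rewrite normrM ler_pM.
Qed.

Lemma bnd_self A : bnd A (\sum_i \sum_j `|A i j|).
Proof.
move=> i j; rewrite (bigD1 i) //= (bigD1 j) //= -addrA lerDl addr_ge0 // sumr_ge0 // => k _.
exact: sumr_ge0.
Qed.

Lemma bnd_orth h : orth h -> bnd h 1.
Proof.
move=> Oh i j; have := congr1 (fun X : M => X j j) Oh; rewrite !mxE eqxx => hj.
rewrite -(@ler_pXn2r _ 2) ?nnegrE // expr1n real_normK ?num_real // -[leRHS]hj.
rewrite (bigD1 i) //= mxE -expr2 lerDl sumr_ge0 // => k _; rewrite mxE -expr2.
exact: sqr_ge0.
Qed.

Definition mpow h (k : nat) : M := iter k (mulmx^~ h) 1%:M.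

Lemma mpowD h k l : mpow h (k + l) = mpow h k *m mpow h l.
Proof.
elim: l => [|l IH]; first by rewrite addn0 mulmx1.
by rewrite addnS /= IH mulmxA.
Qed.

Lemma mpow_orth h k : orth h -> orth (mpow h k).
Proof.
move=> Oh; elim: k => [|k IH] /=; first by rewrite /orth trmx1 mulmx1.
by rewrite /orth trmx_mul mulmxA -[_ *m _ *m mpow h k]mulmxA IH mulmx1.
Qed.

Lemma mpow_sub1 h k d : orth h -> bnd (h - 1%:M) d -> bnd (mpow h k - 1%:M) (k%:R * (n%:R * d)).
Proof.
move=> Oh hd; elim: k => [|k IH] /=.
  by rewrite subrr mul0r => i j; rewrite mxE normr0.
have -> : mpow h k *m h - 1%:M = (mpow h k - 1%:M) + mpow h k *m (h - 1%:M).
  by rewrite mulmxBr mulmx1 [RHS]addrC addrA subrK.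
rewrite -natr1 mulrDl mul1r; apply: bndD => //.
by have := bndM (bnd_orth (mpow_orth k Oh)) hd; rewrite mul1r.
Qed.

Lemma mpow_sub2 h k d : orth h -> bnd (h - 1%:M) d ->
  bnd (mpow h k - 1%:M - k%:R *: (h - 1%:M)) ((k%:R * (n%:R * d)) ^+ 2).
Proof.
move=> Oh hd; elim: k => [|k IH] /=.
  by rewrite subrr scale0r subrr mul0r expr0n => i j; rewrite mxE normr0.
have -> : mpow h k *m h - 1%:M - k.+1%:R *: (h - 1%:M) =
    (mpow h k - 1%:M - k%:R *: (h - 1%:M)) + (mpow h k - 1%:M) *m (h - 1%:M).
  rewrite mulmxBl mul1mx mulmxBr mulmx1 -natr1 scalerDl scale1r.
  by apply/matrixP => i j; rewrite !mxE; ring.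
apply: bnd_le (bndD IH (bndM (mpow_sub1 k Oh hd) hd)).
rewrite -natr1; have k0 : 0 <= k%:R :> R by exact: ler0n.
have -> : n%:R * (k%:R * (n%:R * d) * d) = k%:R * (n%:R * d) ^+ 2 by ring.
rewrite -subr_ge0; have -> : ((k%:R + 1) * (n%:R * d)) ^+ 2 -
  ((k%:R * (n%:R * d)) ^+ 2 + k%:R * (n%:R * d) ^+ 2) = (k%:R + 1) * (n%:R * d) ^+ 2 by ring.
by rewrite mulr_ge0 ?sqr_ge0 // addr_ge0.
Qed.

Definition mcvg (T : Type) (U : set_system T) (u : T -> M) A :=
  forall i j, u t i j @[t --> U] --> A i j.

Section Limits.
Variables (T : Type) (U : set_system T).
Hypothesis UP : ProperFilter U.
Implicit Types u w : T -> M.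

Lemma mcvgM u w A B : mcvg U u A -> mcvg U w B -> mcvg U (fun t => u t *m w t) (A *m B).
Proof.
move=> uA wB i j; rewrite mxE (_ : (fun t => _) = fun t => \sum_k u t i k * w t k j).
  by apply: cvg_bsum => k _; apply: cvgM; [exact: uA | exact: wB].
by apply/funext => t; rewrite mxE.
Qed.

Lemma mcvgD u w A B : mcvg U u A -> mcvg U w B -> mcvg U (fun t => u t + w t) (A + B).
Proof.
move=> uA wB i j; rewrite mxE (_ : (fun t => _) = fun t => u t i j + w t i j).
  by apply: cvgD; [exact: uA | exact: wB].
by apply/funext => t; rewrite mxE.
Qed.

Lemma mcvgZ (c : T -> R) u a A : c t @[t --> U] --> a -> mcvg U u A ->
  mcvg U (fun t => c t *: u t) (a *: A).
Proof.
move=> ca uA i j; rewrite mxE (_ : (fun t => _) = fun t => c t * u t i j).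
  by apply: cvgM => //; exact: uA.
by apply/funext => t; rewrite mxE.
Qed.

Lemma mcvgN u A : mcvg U u A -> mcvg U (fun t => - u t) (- A).
Proof.
move=> uA i j; rewrite mxE (_ : (fun t => _) = fun t => - u t i j).
  by apply: cvgN; exact: uA.
by apply/funext => t; rewrite mxE.
Qed.

Lemma mcvgB u w A B : mcvg U u A -> mcvg U w B -> mcvg U (fun t => u t - w t) (A - B).
Proof. by move=> uA wB; apply: mcvgD => //; exact: mcvgN. Qed.

Lemma mcvgT u A : mcvg U u A -> mcvg U (fun t => (u t)^T) A^T.
Proof.
move=> uA i j; rewrite mxE (_ : (fun t => _) = fun t => u t j i); first exact: uA.
by apply/funext => t; rewrite mxE.
Qed.

Lemma mcvg_cst A : mcvg U (fun=> A) A.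
Proof. by move=> i j; exact: cvg_cst. Qed.

Lemma mcvg_uniq u A B : mcvg U u A -> mcvg U u B -> A = B.
Proof. by move=> uA uB; apply/matrixP => i j; exact: (cvg_unique _ (uA i j) (uB i j)). Qed.

Lemma mcvg_eq u w A : (\forall t \near U, u t = w t) -> mcvg U u A -> mcvg U w A.
Proof.
move=> uw uA i j; apply: cvg_trans (uA i j); apply: near_eq_cvg.
by apply: filterS uw => t ->.
Qed.

Lemma mcvg_bnd u A c : mcvg U u A -> (\forall t \near U, bnd (u t) c) -> bnd A c.
Proof.
move=> uA uc i j; have cn : `|u t i j| @[t --> U] --> `|A i j| by apply: cvg_norm; exact: uA.
rewrite leNgt; apply/negP => cl; have /cvgr_gt /(_ _ cl) h := cn.
have [t [h1 h2]] := filter_ex (filterI h uc).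
by move: h1; rewrite ltNge h2.
Qed.

Lemma mcvg0 u : (forall e, 0 < e -> \forall t \near U, bnd (u t) e) -> mcvg U u 0.
Proof.
move=> h i j; rewrite mxE; apply/cvgrPdist_le => e e0; apply: filterS (h e e0) => t ht.
by rewrite sub0r normrN.
Qed.

Lemma mcvg_near u A e : mcvg U u A -> 0 < e -> \forall t \near U, bnd (u t - A) e.
Proof.
move=> uA e0.
have h : \forall t \near U, forall ij : 'I_n * 'I_n, `|(u t - A) ij.1 ij.2| <= e.
  apply: filter_forall => -[i j] /=; have /cvgrPdist_le /(_ e e0) := uA i j.
  by apply: filterS => t; rewrite !mxE distrC.
by apply: filterS h => t ht i j; exact: (ht (i, j)).
Qed.

Lemma mcvg_mulv u A (x : T -> 'cV[R]_n) y : mcvg U u A -> cvc U x y ->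
  cvc U (fun t => u t *m x t) (A *m y).
Proof.
move=> uA xy i; rewrite mxE (_ : (fun t => _) = fun t => \sum_k u t i k * x t k 0).
  by apply: cvg_bsum => k _; apply: cvgM; [exact: uA | exact: xy].
by apply/funext => t; rewrite mxE.
Qed.

End Limits.

(** Compactness of the group is the clause [cgC], in the form of limits along ultrafilters. *)
Record cgrp (K : M -> Prop) : Prop := {
  cg_orth : korth K ;
  cg1 : K 1%:M ;
  cgM : forall g h, K g -> K h -> K (g *m h) ;
  cgT : forall g, K g -> K g^T ;
  cgC : forall (T : Type) (U : set_system T) (u : T -> M), UltraFilter U ->
    (\forall t \near U, K (u t)) -> exists2 k, K k & mcvg U u k
}.

Lemma mpow_cgrp K h k : cgrp K -> K h -> K (mpow h k).
Proof. by move=> KG Kh; elim: k => [|k IH] /=; [exact: cg1 | exact: cgM]. Qed.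

(** The elements of [K] close to [1] are followed at arbitrarily small scales
    [lam]; [lie_oneparam] recovers the one-parameter group of [A]. *)
Definition lie (K : M -> Prop) A := forall e, 0 < e -> exists h lam,
  [/\ K h, 0 < lam, lam < e & bnd (h - 1%:M - lam *: A) (e * lam)].

(** Expand [h^T *m h = 1] to first order in [lam]. *)
Lemma lie_skew K A : cgrp K -> lie K A -> A^T = - A.
Proof.
move=> KG lA; apply/eqP; rewrite -subr_eq0 opprK; apply/eqP.
pose a := \sum_i \sum_j `|A i j|.
have a0 : 0 <= a by apply: sumr_ge0 => i _; exact: sumr_ge0.
have hA := bnd_self A; rewrite -/a in hA.
pose N : R := n%:R; have N0 : 0 <= N by exact: ler0n.
pose C := 2 + N * (a + 1) ^+ 2.
have C0 : 0 < C by rewrite ltr_wpDr // mulr_ge0 ?sqr_ge0.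
have small e : 0 < e -> e < 1 -> bnd (A^T + A) (C * e).
  move=> e0 e1; have [h [lam [Kh l0 le hb]]] := lA e e0.
  set X := h - 1%:M - lam *: A in hb; have hE : h = 1%:M + (lam *: A + X).
    by rewrite /X; apply/matrixP => i j; rewrite !mxE; ring.
  have hY : bnd (lam *: A + X) (lam * (a + 1)).
    have h1 := bndZ lam hA; rewrite gtr0_norm // in h1.
    apply: bnd_le (bndD h1 hb); rewrite mulrDr mulr1 lerD2l.
    by rewrite -[leRHS]mul1r ler_wpM2r // ltW.
  have := cg_orth KG Kh; rewrite hE; set Y := lam *: A + X in hY *.
  rewrite /orth [(_ + _)^T]raddfD /= trmx1 mulmxDl mul1mx mulmxDr mulmx1 => E.
  have E2 : lam *: (A^T + A) = - (X^T + X + Y^T *m Y).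
    have : Y + Y^T + Y^T *m Y = 0.
      move: E; rewrite -!addrA => /(congr1 (fun Z => - 1%:M + Z)); rewrite addKr addNr => <-.
      by rewrite addrA.
    move/matrixP => E'; apply/matrixP => i j; have := E' i j.
    by rewrite /Y !mxE; move: (\sum_k _) => S; lra.
  have h2 : bnd (lam *: (A^T + A)) (e * lam + e * lam + N * (lam * (a + 1) * (lam * (a + 1)))).
    rewrite E2; apply: bndN; apply: bndD; last exact: bndM (bndT hY) hY.
    by apply: bndD => //; exact: bndT.
  move=> i j; have := h2 i j; rewrite mxE normrM gtr0_norm // => h3.
  rewrite -(ler_pM2l l0) (le_trans h3) //.
  have h4 : lam * (lam * (N * (a + 1) ^+ 2)) <= lam * (e * (N * (a + 1) ^+ 2)).
    by rewrite ler_pM2l // ler_wpM2r ?(ltW le) // mulr_ge0 ?sqr_ge0.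
  by rewrite /C; move: h4; rewrite !expr2; lra.
apply/matrixP => i j; suff : (A^T + A) i j = 0 by rewrite addrC => ->; rewrite [RHS]mxE.
apply/eqP; rewrite -normr_le0; apply/ler_addgt0Pr => e e0.
pose d := Num.min (1 / 2) (e / C).
have d0 : 0 < d by rewrite lt_min !divr_gt0.
have d1 : d < 1 by rewrite (@le_lt_trans _ _ (1 / 2)) ?ge_min ?lexx //; lra.
rewrite add0r (le_trans (small d d0 d1 i j)) // mulrC -ler_pdivlMr //.
by rewrite ge_min lexx orbT.
Qed.

(** [phi t] is a limit, along an ultrafilter, of the powers of [h k] with exponent the integer part
    of [t / lam k], where the [h k] approach [1] in the direction [A]. *)
Lemma lie_oneparam_pos K A : cgrp K -> lie K A -> exists phi : R -> M,
  [/\ forall t, 0 <= t -> K (phi t),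
    forall s t, 0 <= s -> 0 <= t -> phi (s + t) = phi s *m phi t &
    exists2 C, 0 <= C & forall t, 0 <= t -> bnd (phi t - 1%:M - t *: A) (C * t ^+ 2)].
Proof.
move=> KG lA.
have /choice[hl hhl] (k : nat) : exists hl : M * R, [/\ K hl.1, 0 < hl.2, hl.2 < k.+1%:R^-1 &
    bnd (hl.1 - 1%:M - hl.2 *: A) (k.+1%:R^-1 * hl.2)].
  have [|h [lam [a b c d]]] := lA k.+1%:R^-1; first by rewrite invr_gt0 ltr0n.
  by exists (h, lam).
pose h (k : nat) := (hl k).1; pose lam (k : nat) := (hl k).2.
have Kh k : K (h k) by have [] := hhl k.
have l0 k : 0 < lam k by have [] := hhl k.
have ll k : lam k < k.+1%:R^-1 by have [] := hhl k.
have hb k : bnd (h k - 1%:M - lam k *: A) (k.+1%:R^-1 * lam k) by have [] := hhl k.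
have [U [UU oU]] := ultraFilterLemma (eventually_filter).
have UP : ProperFilter U := @ultra_proper _ _ UU.
have inv_small e : 0 < e -> \forall k \near U, k.+1%:R^-1 < e.
  move=> e0; apply: oU; near=> k; near: k; exact: (near_infty_natSinv_lt (PosNum e0)).
pose a := \sum_i \sum_j `|A i j|.
have a0 : 0 <= a by apply: sumr_ge0 => i _; exact: sumr_ge0.
have hA := bnd_self A; rewrite -/a in hA.
have inv1 k : k.+1%:R^-1 <= 1 :> R by rewrite invf_le1 ?ltr0n // ler1n.
have h1b k : bnd (h k - 1%:M) (lam k * (a + 1)).
  have -> : h k - 1%:M = lam k *: A + (h k - 1%:M - lam k *: A) by rewrite [RHS]addrC subrK.
  have h1 := bndZ (lam k) hA; rewrite gtr0_norm // in h1.
  apply: bnd_le (bndD h1 (hb k)); rewrite mulrDr mulr1 lerD2l.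
  by rewrite -[leRHS]mul1r ler_wpM2r // ltW.
have h1 : mcvg U h 1%:M.
  have c0 : mcvg U (fun k => h k - 1%:M) 0.
    apply: mcvg0 => e e0; have d0 : 0 < e / (a + 1) by rewrite divr_gt0 // ltr_wpDl.
    apply: filterS (inv_small _ d0) => k kd; apply: bnd_le (h1b k).
    by rewrite -ler_pdivlMr ?ltr_wpDl // ltW // (lt_trans (ll k)).
  have cc : mcvg U (fun=> 1%:M) 1%:M by move=> i j; exact: cvg_cst.
  have := mcvgD UP c0 cc; rewrite add0r; apply: (mcvg_eq UP).
  by apply: nearW => k; rewrite subrK.
pose kk t k := Num.truncn (t / lam k).
have kk1 t k : 0 <= t -> (kk t k)%:R * lam k <= t.
  by move=> t0; rewrite -ler_pdivlMr //; rewrite truncn_le divr_ge0 // ltW.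
have kk2 t k : 0 <= t -> t < ((kk t k)%:R + 1) * lam k.
  by move=> t0; rewrite -ltr_pdivrMr // natr1; exact: truncnS_gt.
have /choice[phi hphi] (t : R) : exists p, K p /\ mcvg U (fun k => mpow (h k) (kk t k)) p.
  have [p Kp cp] := @cgC _ KG _ U (fun k => mpow (h k) (kk t k)) UU
    (nearW _ (fun k => mpow_cgrp _ KG (Kh k))).
  by exists p.
exists phi; split.
- by move=> t _; exact: (hphi t).1.
- move=> s t s0 t0.
  (* Integer parts are additive up to one, and the extra factor [h k] tends to [1]. *)
  have kkD k : exists b : bool, kk (s + t)%R k = (kk s k + kk t k + b)%N.
    have st0 : 0 <= s + t by rewrite addr_ge0.
    have u1 := kk1 (s + t) k st0; have u2 := kk2 (s + t) k st0.
    have lo : (kk s k + kk t k <= kk (s + t)%R k)%N.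
      rewrite -ltnS -(ltr_nat R) -(ltr_pM2r (l0 k)) -natr1 (le_lt_trans _ u2) //.
      by rewrite natrD mulrDl lerD ?kk1.
    have hi : (kk (s + t)%R k < (kk s k + kk t k).+2)%N.
      rewrite -(ltr_nat R) -(ltr_pM2r (l0 k)) (le_lt_trans u1) //.
      have := kk2 s k s0; have := kk2 t k t0; rewrite -!natr1 natrD; lra.
    exists (kk (s + t)%R k != (kk s k + kk t k)%N).
    case: eqP => [->|/eqP ne]; first by rewrite addn0.
    by apply/eqP; rewrite addn1 eqn_leq -ltnS hi /= ltn_neqAle eq_sym ne.
  have c1 : mcvg U (fun k => mpow (h k) (kk s k) *m mpow (h k) (kk t k)) (phi s *m phi t).
    by apply: mcvgM; [exact: (hphi s).2 | exact: (hphi t).2].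
  have c0 : mcvg U (fun k => mpow (h k) (kk (s + t) k) -
      mpow (h k) (kk s k) *m mpow (h k) (kk t k)) 0.
    apply: mcvg0 => e e0.
    pose N : R := n%:R; have N0 : 0 <= N by exact: ler0n.
    have d0 : 0 < e / (N + 1) by rewrite divr_gt0 // ltr_wpDl.
    apply: filterS (mcvg_near UP h1 d0) => k hk.
    have [b ->] := kkD k; rewrite !mpowD -[X in _ - X]mulmx1 -mulmxBr -mpowD.
    have -> : mpow (h k) b - 1%:M = b%:R *: (h k - 1%:M).
      by case: b; rewrite /= ?mul1mx ?scale1r // scale0r subrr.
    have Ob := bnd_orth (mpow_orth (kk s k + kk t k) (cg_orth KG (Kh k))).
    apply: bnd_le (bndM Ob (bndZ b%:R hk)).
    rewrite mul1r ger0_norm // (@le_trans _ _ (N * (1 * (e / (N + 1))))) //.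
      by rewrite ler_wpM2l // ler_wpM2r ?(ltW d0) //; case: b => //=; exact: ler01.
    by rewrite mul1r mulrA ler_pdivrMr ?ltr_wpDl // mulrC ler_wpM2l ?(ltW e0) // lerDl.
  apply: (mcvg_uniq UP (hphi (s + t)).2).
  have := mcvgD UP c0 c1; rewrite add0r; apply: (mcvg_eq UP).
  by apply: nearW => k; rewrite subrK.
- pose N : R := n%:R; have N0 : 0 <= N by exact: ler0n.
  exists ((N * (a + 1)) ^+ 2); first exact: sqr_ge0.
  move=> t t0.
  have c1 : mcvg U (fun k => mpow (h k) (kk t k) - 1%:M - (kk t k)%:R *: (h k - 1%:M))
      (phi t - 1%:M - t *: A).
    apply: mcvgB; first by apply: mcvgB; [exact: (hphi t).2 | exact: mcvg_cst].
    have c2 : mcvg U (fun k => (kk t k)%:R *: (h k - 1%:M) - t *: A) 0.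
      apply: mcvg0 => e e0.
      have D0 : 0 < t + a + 1 by rewrite ltr_wpDl // addr_ge0.
      have d0 : 0 < e / (t + a + 1) by rewrite divr_gt0.
      apply: filterS (inv_small _ d0) => k kd.
      have -> : (kk t k)%:R *: (h k - 1%:M) - t *: A =
          (kk t k)%:R *: (h k - 1%:M - lam k *: A) + ((kk t k)%:R * lam k - t) *: A.
        by apply/matrixP => i j; rewrite !mxE; ring.
      apply: bnd_le (bndD (bndZ _ (hb k)) (bndZ _ hA)).
      rewrite ger0_norm // mulrCA.
      have u1 := kk1 t k t0; have u2 := kk2 t k t0.
      have u3 : `|(kk t k)%:R * lam k - t| <= lam k.
        by rewrite ler_norml; apply/andP; split; move: u2; have := l0 k; lra.
      have u4 := ltW (ll k).
      rewrite (@le_trans _ _ (k.+1%:R^-1 * t + k.+1%:R^-1 * a)) //.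
        rewrite lerD //; first by rewrite ler_wpM2l // invr_ge0.
        by rewrite ler_wpM2r // (le_trans u3).
      rewrite -mulrDr; rewrite ltr_pdivlMr // in kd; apply: le_trans (ltW kd).
      by rewrite ler_wpM2l ?invr_ge0 // lerDl.
    have cc : mcvg U (fun=> t *: A) (t *: A) by move=> i j; exact: cvg_cst.
    have := mcvgD UP c2 cc; rewrite add0r; apply: (mcvg_eq UP).
    by apply: nearW => k; rewrite subrK.
  apply: (mcvg_bnd UP c1); apply: nearW => k.
  apply: bnd_le (mpow_sub2 (kk t k) (cg_orth KG (Kh k)) (h1b k)).
  have -> : (kk t k)%:R * (n%:R * (lam k * (a + 1))) = (N * (a + 1)) * ((kk t k)%:R * lam k).
    by rewrite /N; ring.
  rewrite -exprMn lerXn2r ?nnegrE ?mulr_ge0 ?addr_ge0 // ?(ltW (l0 k)) //.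
  by rewrite ler_wpM2l ?kk1 // mulr_ge0 // addr_ge0.
Unshelve. all: by end_near. Qed.

Definition oneparam (K : M -> Prop) A (phi : R -> M) :=
  [/\ forall t, K (phi t), forall s t, phi (s + t) = phi s *m phi t &
    exists2 C, 0 <= C & forall t, bnd (phi t - 1%:M - t *: A) (C * t ^+ 2)].

Theorem lie_oneparam K A : cgrp K -> lie K A -> exists phi, oneparam K A phi.
Proof.
move=> KG lA; have [p [Kp pD [C C0 hC]]] := lie_oneparam_pos KG lA.
have sk := lie_skew KG lA.
have pT t : 0 <= t -> (p t)^T *m p t = 1%:M by move=> t0; exact/(cg_orth KG)/Kp.
have pT' t : 0 <= t -> p t *m (p t)^T = 1%:M by move=> t0; exact/mulmx1C/pT.
have pC s t : 0 <= s -> 0 <= t -> p s *m p t = p t *m p s.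
  by move=> s0 t0; rewrite -!pD // addrC.
pose phi t := if 0 <= t then p t else (p (- t))^T.
have phN t : phi (- t) = (phi t)^T.
  rewrite /phi oppr_ge0 opprK; case: (ltgtP t 0) => [t0|t0|->].
  - by rewrite trmxK.
  - by [].
  - rewrite oppr0; have h : p 0 = 1%:M.
      have := pD 0 0 (lexx _) (lexx _); rewrite addr0 => /(congr1 (mulmx (p 0)^T)).
      by rewrite mulmxA pT // mul1mx.
    by rewrite h trmx1.
have diff s t : 0 <= t -> t <= s -> phi (s - t) = p s *m (p t)^T.
  move=> t0 ts; have st : 0 <= s - t by rewrite subr_ge0.
  have e : p s = p (s - t) *m p t by rewrite -pD // subrK.
  by rewrite /phi st e -mulmxA pT' // mulmx1.
have diff' s t : 0 <= s -> 0 <= t -> phi (s - t) = p s *m (p t)^T.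
  move=> s0 t0; have [ts|st] := leP t s; first exact: diff.
  rewrite -[s - t]opprK opprB phN diff ?(ltW st) // trmx_mul trmxK.
  have := pC s t s0 t0 => /(congr1 (fun X => (p t)^T *m X *m (p t)^T)).
  by rewrite !mulmxA pT // mul1mx -!mulmxA pT' // mulmx1 mulmxA.
have part (t : R) : exists s u, [/\ 0 <= s, 0 <= u & t = s - u].
  case: (leP 0 t) => t0; first by exists t, 0; rewrite subr0.
  by exists 0, (- t); rewrite oppr_ge0 (ltW t0) sub0r opprK.
exists phi; split.
- by move=> t; rewrite /phi; case: leP => t0; [exact: Kp | apply/(cgT KG)/Kp; rewrite oppr_ge0 ltW].
- move=> x y; have [s [u [s0 u0 ->]]] := part x; have [s' [u' [s0' u0' ->]]] := part y.
  have -> : s - u + (s' - u') = (s + s') - (u + u') by ring.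
  rewrite !diff' ?addr_ge0 // !pD // trmx_mul.
  have cT : (p u)^T *m p s' = p s' *m (p u)^T.
    have /(congr1 (fun X => (p u)^T *m X *m (p u)^T)) := pC s' u s0' u0.
    by rewrite -!mulmxA pT' // mulmx1 !mulmxA pT // mul1mx.
  have cT2 : (p u')^T *m (p u)^T = (p u)^T *m (p u')^T by rewrite -!trmx_mul pC.
  by rewrite cT2 !mulmxA -[p s *m (p u)^T *m p s']mulmxA cT !mulmxA.
- exists C => // t; rewrite /phi; case: leP => t0; first exact: hC.
  have := bndT (hC (- t) (_ : 0 <= - t)); rewrite oppr_ge0 (ltW t0) sqrrN => /(_ isT).
  rewrite !raddfB /= trmx1 [(- t *: A)^T]linearZ /= sk scaleNr scalerN opprK.
  by [].
Qed.

End Matrices.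

Section LieAlgebra.
Variables (R : realType) (n : nat).
Notation M := 'M[R]_n.
Implicit Types (A B g h : M) (x y : 'cV[R]_n).

Lemma polyf_isd p (y : R -> 'cV[R]_n) t l : polyf p -> isdc y t l ->
  is_derive t (1 : R) (fun s => p (y s)) (dd l p (y t)).
Proof.
move=> pp dy; elim: pp => [c|i|f g pf df pg dg|f g pf df pg dg].
- by rewrite dd_cst; exact: isd_cst.
- by rewrite dd_coord; exact: dy.
- by rewrite ddD //; exact: isdD.
- by rewrite ddM //; exact: isdM.
Qed.

Lemma isdc_cst_eq (y : R -> 'cV[R]_n) : (forall t, isdc y t 0) -> forall t, y t = y 0.
Proof.
move=> dy t; apply/colP => i.
have [|s _] := @mvt R (fun t => y t i 0) (fun=> 0) 0 t.
  by move=> s _; have := dy s i; rewrite mxE.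
by rewrite mul0r => /eqP; rewrite subr_eq0 => /eqP.
Qed.

Lemma oneparam_lie (K : M -> Prop) A phi : oneparam K A phi -> lie K A.
Proof.
move=> [Kp _ [C C0 hC]] e e0.
have C1 : 0 < C + 1 by rewrite ltr_wpDl.
pose t := Num.min (e / 2) (e / (C + 1)).
have t0 : 0 < t by rewrite lt_min !divr_gt0.
have t1 : t <= e / 2 by rewrite ge_min lexx.
have t2 : t * (C + 1) <= e by rewrite -ler_pdivlMr // ge_min lexx orbT.
exists (phi t), t; split=> //; first by move: t1; lra.
apply: bnd_le (hC t); rewrite expr2 mulrA ler_pM2r //.
by move: t2; rewrite mulrDr mulr1 mulrC; lra.
Qed.

Variable K : M -> Prop.
Hypothesis KG : cgrp K.

Lemma oneparam_cvg A phi : oneparam K A phi ->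
  mcvg (0^'+ : set_system R) (fun t => t^-1 *: (phi t - 1%:M)) A.
Proof.
move=> [Kp _ [C C0 hC]] i j; apply/cvgrPdist_le => e e0.
have C1 : 0 < C + 1 by rewrite ltr_wpDl.
near=> t; have t0 : 0 < t by near: t; exact: nbhs_right_gt.
have te : t < e / (C + 1) by near: t; apply: nbhs_right_lt; rewrite divr_gt0.
have := hC t i j; rewrite !mxE => h.
have tn : t != 0 by rewrite gt_eqF.
rewrite distrC -(ler_pM2l t0) -{1}(gtr0_norm t0) -normrM mulrBr mulVKf //.
rewrite (le_trans h) // expr2 mulrCA ler_pM2l //.
by move: te; rewrite ltr_pdivlMr // mulrDr mulr1 mulrC; have := t0; lra.
Unshelve. all: by end_near. Qed.

Lemma oneparam_cvg1 A phi : oneparam K A phi -> mcvg (0^'+ : set_system R) phi 1%:M.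
Proof.
move=> op; have P0 : ProperFilter (0^'+ : set_system R) by exact: at_right_proper_filter.
have c0 : t @[t --> (0 : R)^'+] --> (0 : R) by exact/cvg_at_right_filter/cvg_id.
have cc : mcvg (0^'+ : set_system R) (fun=> 1%:M : M) 1%:M by move=> i j; exact: cvg_cst.
have := mcvgD P0 (mcvgZ P0 c0 (oneparam_cvg op)) cc; rewrite scale0r add0r.
apply: (mcvg_eq P0); near=> t; have t0 : t != 0.
  by rewrite gt_eqF //; near: t; exact: nbhs_right_gt.
by rewrite scalerA divff // scale1r subrK.
Unshelve. all: by end_near. Qed.

Lemma lie_lim (T : Type) (U : set_system T) (h : T -> M) (lam : T -> R) A : ProperFilter U ->
  (\forall t \near U, K (h t)) -> (\forall t \near U, 0 < lam t) ->
  lam t @[t --> U] --> 0 -> mcvg U (fun t => (lam t)^-1 *: (h t - 1%:M)) A -> lie K A.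
Proof.
move=> UP Kh l0 lc hA e e0.
have /cvgrPdist_lt/(_ e e0) le := lc.
have [t [[k1 k2] [k3 k4]]] := filter_ex (filterI (filterI Kh l0)
  (filterI le (mcvg_near UP hA e0))).
exists (h t), (lam t); split=> //; first by move: k3; rewrite sub0r normrN gtr0_norm.
have -> : h t - 1%:M - lam t *: A = lam t *: ((lam t)^-1 *: (h t - 1%:M) - A).
  by rewrite scalerBr scalerA divff ?gt_eqF // scale1r.
by have := bndZ (lam t) k4; rewrite gtr0_norm // mulrC.
Qed.

Lemma lie_lim0 (h : R -> M) A : (forall t, K (h t)) ->
  mcvg (0^'+ : set_system R) (fun t => t^-1 *: (h t - 1%:M)) A -> lie K A.
Proof.
move=> Kh; apply: (@lie_lim _ _ h id).
- by near=> t; exact: Kh.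
- by near=> t; near: t; exact: nbhs_right_gt.
- exact/cvg_at_right_filter/cvg_id.
Unshelve. all: by end_near. Qed.

Lemma lieZ c A : lie K A -> lie K (c *: A).
Proof.
move=> /(lie_oneparam KG)[phi [Kp pD [C C0 hC]]].
apply: (@oneparam_lie _ _ (fun t => phi (t * c))); split=> [t|s t|].
- exact: Kp.
- by rewrite mulrDl pD.
- exists (C * c ^+ 2); first by rewrite mulr_ge0 ?sqr_ge0.
  by move=> t; have := hC (t * c); rewrite scalerA exprMn mulrA mulrAC.
Qed.

Lemma lieD A B : lie K A -> lie K B -> lie K (A + B).
Proof.
move=> /(lie_oneparam KG)[phi op] /(lie_oneparam KG)[psi oq].
have P0 : ProperFilter (0^'+ : set_system R) by exact: at_right_proper_filter.
apply: (@lie_lim0 (fun t => phi t *m psi t)).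
  by move=> t; apply: cgM => //; [case: op | case: oq].
have := mcvgD P0 (mcvgM P0 (oneparam_cvg op) (oneparam_cvg1 oq)) (oneparam_cvg oq).
rewrite mulmx1; apply: (mcvg_eq P0); apply: nearW => t.
by rewrite -scalemxAl -scalerDr mulmxBl mul1mx addrA subrK.
Qed.

Lemma lieN A : lie K A -> lie K (- A).
Proof. by move=> /(lieZ (-1)); rewrite scaleN1r. Qed.

Lemma lieB A B : lie K A -> lie K B -> lie K (A - B).
Proof. by move=> lA lB; apply: lieD => //; exact: lieN. Qed.

Lemma lie0 : lie K 0.
Proof.
move=> e e0; exists 1%:M, (e / 2); split; [exact: cg1 | exact: divr_gt0 | lra |].
by rewrite subrr scaler0 subrr => i j; rewrite mxE normr0 mulr_ge0 // ltW // divr_gt0.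
Qed.

Lemma lie_sum (I : Type) (r : seq I) (P : pred I) (F : I -> M) :
  (forall i, lie K (F i)) -> lie K (\sum_(i <- r | P i) F i).
Proof. by move=> lF; elim/big_ind: _ => //; [exact: lie0 | exact: lieD]. Qed.

Lemma lieJ g A : K g -> lie K A -> lie K (g *m A *m g^T).
Proof.
move=> Kg /(lie_oneparam KG)[phi op].
have P0 : ProperFilter (0^'+ : set_system R) by exact: at_right_proper_filter.
apply: (@lie_lim0 (fun t => g *m phi t *m g^T)).
  by move=> t; apply: cgM => //; [apply: cgM => //; case: op | exact: cgT].
have cg : mcvg (0^'+ : set_system R) (fun=> g) g by move=> i j; exact: cvg_cst.
have := mcvgM P0 (mcvgM P0 cg (oneparam_cvg op)) (mcvgT cg).
apply: (mcvg_eq P0); apply: nearW => t.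
rewrite -scalemxAr -scalemxAl mulmxBr mulmx1 mulmxBl; congr (_ *: (_ - _)).
exact/mulmx1C/(cg_orth KG Kg).
Qed.

Lemma lie_closed (T : Type) (U : set_system T) (A : T -> M) B : ProperFilter U ->
  (\forall t \near U, lie K (A t)) -> mcvg U A B -> lie K B.
Proof.
move=> UP lA cA e e0; have e2 : 0 < e / 2 by exact: divr_gt0.
have [t [k1 k2]] := filter_ex (filterI lA (mcvg_near UP cA e2)).
have [h [lam [Kh l0 le hb]]] := k1 (e / 2) e2.
exists h, lam; split=> //; first lra.
have -> : h - 1%:M - lam *: B = (h - 1%:M - lam *: A t) + lam *: (A t - B).
  by apply/matrixP => i j; rewrite !mxE; ring.
apply: bnd_le (bndD hb (bndZ lam k2)); rewrite gtr0_norm //; lra.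
Qed.

(** The bracket is the derivative at [0] of the conjugates [phi t *m B *m (phi t)^T], and the Lie
    algebra is closed under limits. *)
Lemma lieR A B : lie K A -> lie K B -> lie K (A *m B - B *m A).
Proof.
move=> lA lB; have sk := lie_skew KG lA; have [phi op] := lie_oneparam KG lA.
have P0 : ProperFilter (0^'+ : set_system R) by exact: at_right_proper_filter.
apply: (@lie_closed _ _ (fun t => t^-1 *: (phi t *m B *m (phi t)^T - B)) _ P0).
  by apply: nearW => t; apply/lieZ/lieB => //; apply: lieJ => //; case: op.
have cB : mcvg (0^'+ : set_system R) (fun=> B) B by move=> i j; exact: cvg_cst.
have c1 := mcvgM P0 (mcvgM P0 (oneparam_cvg op) cB) (mcvgT (oneparam_cvg1 op)).
have := mcvgD P0 c1 (mcvgM P0 cB (mcvgT (oneparam_cvg op))).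
rewrite trmx1 mulmx1 sk mulmxN; apply: (mcvg_eq P0); apply: nearW => t.
rewrite [(_ *: _)^T]linearZ /= -!scalemxAl -scalemxAr -scalerDr; congr (_ *: _).
by rewrite [(_ - _)^T]raddfB /= trmx1 mulmxBl mul1mx mulmxBr mulmx1 mulmxBl addrA subrK.
Qed.

Lemma oneparam_isd A phi t i j : oneparam K A phi ->
  is_derive t (1 : R) (fun s => phi s i j) ((phi t *m A) i j).
Proof.
move=> [Kp pD [C C0 hC]]; apply: quot_isd; apply/cvgrPdist_le => e e0.
pose N : R := n%:R; have N0 : 0 <= N by exact: ler0n.
have C1 : 0 < N * C + 1 by rewrite ltr_wpDl // mulr_ge0.
near=> h; have h0 : h != 0 by near: h; exact: nbhs_dnbhs_neq.
have h1 : `|h| < e / (N * C + 1).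
  by near: h; apply: dnbhs0_lt; rewrite divr_gt0.
have nh : 0 < `|h| by rewrite normr_gt0.
rewrite distrC -(ler_pM2l nh) -normrM mulrBr mulVKf //.
have -> : phi (t + h) i j - phi t i j - h * (phi t *m A) i j =
    (phi t *m (phi h - 1%:M - h *: A)) i j.
  by rewrite !mulmxBr mulmx1 -pD -scalemxAr !mxE.
have := bndM (bnd_orth (cg_orth KG (Kp t))) (hC h) => /(_ i j)/le_trans; apply.
rewrite mul1r -normr_id -real_normK ?num_real // normr_id expr2 !mulrA [leLHS]mulrC ler_pM2l //.
by move: h1; rewrite ltr_pdivlMr // mulrDr mulr1 mulrC -/N; lra.
Unshelve. all: by end_near. Qed.

Lemma oneparam_isdc A phi t x : oneparam K A phi ->
  isdc (fun s => phi s *m x) t (phi t *m (A *m x)).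
Proof.
move=> op i; rewrite mulmxA mxE.
rewrite (_ : (fun s => _) = fun s => \sum_k phi s i k * x k 0); last first.
  by apply/funext => s; rewrite mxE.
apply: isd_sum => k.
by apply: (isd_eq (isdM (oneparam_isd t i k op) (isd_cst _ _))); rewrite mulr0 addr0.
Qed.

Lemma oneparam0 A phi : oneparam K A phi -> phi 0 = 1%:M.
Proof.
move=> [Kp pD _]; have := pD 0 0; rewrite addr0 => /(congr1 (mulmx (phi 0)^T)).
by rewrite mulmxA (cg_orth KG (Kp 0)) mul1mx.
Qed.

Lemma oneparam_fix A phi x t : oneparam K A phi -> A *m x = 0 -> phi t *m x = x.
Proof.
move=> op Ax; have := @isdc_cst_eq (fun s => phi s *m x) _ t.
rewrite (oneparam0 op) mul1mx; apply => s.
by rewrite -(mulmx0 _ (phi s)) -Ax; exact: oneparam_isdc.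
Qed.

Lemma kinv_dd p A x : polyf p -> kinv K p -> lie K A -> dd (A *m x) p x = 0.
Proof.
move=> pp Kp /(lie_oneparam KG)[phi op].
have := polyf_isd pp (oneparam_isdc 0 x op); rewrite (oneparam0 op) !mul1mx => h.
apply: (isd_uniq h); rewrite (_ : (fun s => _) = fun=> p x); first exact: isd_cst.
by apply/funext => s; rewrite Kp //; case: op.
Qed.

Lemma lie_sub (K0 : M -> Prop) A : cgrp K0 -> (forall g, K0 g -> K g) -> lie K0 A -> lie K A.
Proof. by move=> K0G sub lA e e0; have [h [lam [/sub]]] := lA e e0; exists h, lam. Qed.

Lemma cgrp_fix (P : 'cV[R]_n -> Prop) : cgrp (fun g => K g /\ forall x, P x -> g *m x = x).
Proof.
split.
- by move=> g [Kg _]; exact: (cg_orth KG).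
- by split; [exact: cg1 | move=> x _; rewrite mul1mx].
- move=> g h [Kg fg] [Kh fh]; split; first exact: cgM.
  by move=> x Px; rewrite -mulmxA fh ?fg.
- move=> g [Kg fg]; split; first exact: cgT.
  by move=> x Px; rewrite -{1}(fg x Px) orthTK //; exact: (cg_orth KG).
- move=> T U u UU near_u; have UP : ProperFilter U := @ultra_proper _ _ UU.
  have [|k Kk uk] := @cgC _ _ _ KG T U u UU; first by apply: filterS near_u => t [].
  exists k => //; split=> // x Px.
  have c1 : cvc U (fun t => u t *m x) (k *m x).
    by apply: mcvg_mulv => //; exact: cvc_cst.
  apply: (@cvc_uniq _ _ _ _ _ (fun t => u t *m x) _ _ c1).
  have c2 : cvc U (fun=> x) x by exact: cvc_cst.
  by apply: cvc_eq c2; apply: filterS near_u => t [_ ->].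
Qed.

Lemma lie_fix (P : 'cV[R]_n -> Prop) A : lie (fun g => K g /\ forall x, P x -> g *m x = x) A <->
  lie K A /\ forall x, P x -> A *m x = 0.
Proof.
split=> [lA|[lA AP]].
  have cf := cgrp_fix P; have [phi op] := lie_oneparam cf lA.
  split=> [|x Px]; first by apply: lie_sub lA => // g [].
  have op' : oneparam K A phi by case: op => h1 h2 h3; split=> // t; have [] := h1 t.
  have := oneparam_isdc 0 x op'; rewrite (oneparam0 op') mul1mx => d; apply/colP => i.
  apply: (isd_uniq (d i)); rewrite (_ : (fun s => _) = fun=> x i 0); last first.
    by apply/funext => s; case: op => /(_ s)[_ ->].
  by rewrite mxE; exact: isd_cst.
have [phi op] := lie_oneparam KG lA; have [h1 h2 h3] := op.
apply: (@oneparam_lie _ _ phi); split=> // t; split=> // x Px.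
by apply: (oneparam_fix _ op); exact: AP.
Qed.

End LieAlgebra.

Section Dichotomy.
Variables (R : realType) (n : nat).
Notation M := 'M[R]_n.
Implicit Types (A B g h X : M).

Definition fr X := \sum_i \sum_j `|X i j|.

Lemma fr_ge0 X : 0 <= fr X.
Proof. by apply: sumr_ge0 => i _; exact: sumr_ge0. Qed.

Lemma fr_bnd X c : bnd X c -> fr X <= n%:R * (n%:R * c).
Proof.
move=> Xc; apply: (@le_trans _ _ (\sum_(i < n) \sum_(j < n) c)).
  by apply: ler_sum => i _; apply: ler_sum => j _; exact: Xc.
by rewrite sumr_const card_ord sumr_const card_ord -[leLHS]mulr_natl -[c *+ n]mulr_natl.
Qed.

Lemma fr_cvg (T : Type) (U : set_system T) (u : T -> M) A : ProperFilter U -> mcvg U u A ->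
  fr (u t) @[t --> U] --> fr A.
Proof.
move=> UP uA; apply: cvg_bsum => i _; apply: cvg_bsum => j _; apply: cvg_norm; exact: uA.
Qed.

(* [k t] is a best approximation of [(h t)^-1] in [K0]; the limit direction [A]
   cannot be tangent to [K0], as moving [k t] along [- A] would improve it. *)
Theorem lie_dichotomy (K K0 : M -> Prop) (T : Type) (U : set_system T) (h : T -> M) :
  cgrp K -> cgrp K0 -> (forall g, K0 g -> K g) -> UltraFilter U ->
  (forall t, K (h t)) -> mcvg U h 1%:M ->
  (\forall t \near U, K0 (h t)) \/
  exists k lam A, [/\ forall t, K0 (k t), (\forall t \near U, 0 < lam t),
    lam t @[t --> U] --> (0 : R), lie K A /\ ~ lie K0 A &
    mcvg U (fun t => (lam t)^-1 *: (h t *m k t - 1%:M)) A].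
Proof.
move=> KG K0G sub UU Kh h1; have UP : ProperFilter U := @ultra_proper _ _ UU.
have /choice[k hk] t : exists k, K0 k /\ forall g, K0 g -> fr (h t *m k - 1%:M) <= fr (h t *m g - 1%:M).
  have [|k Kk hk] := @sup_attained R M K0 (fun g => - fr (h t *m g - 1%:M)) 1%:M (cg1 K0G).
    move=> U' UU' UK; have UP' : ProperFilter U' := @ultra_proper _ _ UU'.
    have [a Ka ua] := @cgC _ _ _ K0G M U' id UU' UK; exists a => //.
    have ch : mcvg U' (fun=> h t) (h t) by move=> i j; exact: cvg_cst.
    have c1 : mcvg U' (fun=> 1%:M : M) 1%:M by move=> i j; exact: cvg_cst.
    apply: cvgN; exact: (fr_cvg UP' (mcvgB UP' (mcvgM UP' ch ua) c1)).
  by exists k; split=> // g Kg; have := hk g Kg; rewrite lerN2.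
pose lam t := fr (h t *m k t - 1%:M).
have [l0|l0] := in_ultra_setVsetC [set t | lam t = 0] UU.
  left; apply: filterS l0 => t l0; have [Kk _] := hk t.
  have E : h t *m k t = 1%:M.
    apply/matrixP => i j; apply/eqP; rewrite -subr_eq0 -normr_le0 -[leRHS]l0.
    by have := bnd_self (h t *m k t - 1%:M) i j; rewrite !mxE.
  have -> : h t = (k t)^T by rewrite -[LHS]mulmx1 -(mulmx1C (cg_orth K0G Kk)) mulmxA E mul1mx.
  exact: (cgT K0G).
right; have {}l0 : \forall t \near U, 0 < lam t.
  by apply: filterS l0 => t l0; rewrite lt_neqAle fr_ge0 andbT eq_sym; apply/eqP.
have c1 : mcvg U (fun=> 1%:M : M) 1%:M by move=> i j; exact: cvg_cst.
have lc : lam t @[t --> U] --> (0 : R).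
  have fc := fr_cvg UP (mcvgB UP h1 c1); rewrite subrr in fc.
  have f0 : fr (0 : M) = 0 by apply: big1 => i _; apply: big1 => j _; rewrite mxE normr0.
  rewrite f0 in fc; apply: (squeeze_cvgr _ _ fc); last by exact: (cvg_cst (0 : R)).
  apply: nearW => t; rewrite fr_ge0 /=.
  by have [_ /(_ 1%:M (cg1 K0G))] := hk t; rewrite mulmx1.
have Xb : \forall t \near U, bnd ((lam t)^-1 *: (h t *m k t - 1%:M)) 1.
  apply: filterS l0 => t t0 i j.
  rewrite [X in `|X|]mxE normrM gtr0_norm ?invr_gt0 // ler_pdivrMl // mulr1.
  exact: (bnd_self (h t *m k t - 1%:M) i j).
have [A hA] : exists A, mcvg U (fun t => (lam t)^-1 *: (h t *m k t - 1%:M)) A.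
  exists (\matrix_(i, j) lim (((lam t)^-1 *: (h t *m k t - 1%:M)) i j @[t --> U])) => i j.
  rewrite [X in _ --> X]mxE.
  by apply: (@ultra_cvg_real _ _ _ _ 1 UU); apply: filterS Xb => t; apply.
exists k, lam, A; split=> //; first by move=> t; have [] := hk t.
have KK t : K (h t *m k t) by apply: (cgM KG) => //; apply: sub; have [] := hk t.
split; first by apply: (lie_lim UP _ l0 lc hA); exact: nearW.
move=> /(lie_oneparam K0G)[phi [Kp pD [C C0 hC]]].
have d0 : mcvg U (fun t => (lam t)^-1 *: (phi (- lam t) - 1%:M)) (- A).
  have c0 : mcvg U (fun t => (lam t)^-1 *: (phi (- lam t) - 1%:M) + A) 0.
    apply: (mcvg0 UP) => e e0; have C1 : 0 < C + 1 by rewrite ltr_wpDl.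
    have d0 : 0 < e / (C + 1) by rewrite divr_gt0.
    have /cvgrPdist_lt/(_ _ d0) ld := lc; apply: filterS (filterI l0 ld) => t [t0].
    rewrite /= sub0r normrN gtr0_norm // => td.
    have -> : (lam t)^-1 *: (phi (- lam t) - 1%:M) + A =
        (lam t)^-1 *: (phi (- lam t) - 1%:M - (- lam t) *: A).
      by rewrite scaleNr opprK [RHS]scalerDr scalerA mulVf ?gt_eqF // scale1r.
    apply: bnd_le (bndZ (lam t)^-1 (hC (- lam t))).
    rewrite gtr0_norm ?invr_gt0 // sqrrN ler_pdivrMl // expr2 mulrCA ler_pM2l //.
    by move: td; rewrite ltr_pdivlMr // mulrDr mulr1 mulrC; lra.
  have cA : mcvg U (fun=> A) A by move=> i j; exact: cvg_cst.
  have := mcvgB UP c0 cA; rewrite sub0r; apply: (mcvg_eq UP).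
  by apply: nearW => t; rewrite addrK.
have p1 : mcvg U (fun t => phi (- lam t)) 1%:M.
  have := mcvgD UP (mcvgZ UP lc d0) c1; rewrite scale0r add0r; apply: (mcvg_eq UP).
  by apply: filterS l0 => t t0; rewrite scalerA divff ?gt_eqF // scale1r subrK.
have c0 : mcvg U (fun t => (lam t)^-1 *: (h t *m (k t *m phi (- lam t)) - 1%:M)) 0.
  have := mcvgD UP (mcvgM UP hA p1) d0; rewrite mulmx1 subrr; apply: (mcvg_eq UP).
  apply: nearW => t; rewrite -scalemxAl -scalerDr mulmxBl mul1mx addrA subrK mulmxA //.
(* An entrywise bound by [lam * e] gives [fr <= n ^ 2 * e * lam < lam], against the minimality of
   [k t]. *)
pose e : R := (n%:R * n%:R + 1)^-1.
have N0 : 0 <= n%:R * n%:R :> R by rewrite mulr_ge0.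
have e0 : 0 < e by rewrite invr_gt0 ltr_wpDl.
have [t [t0 te]] := filter_ex (filterI l0 (mcvg_near UP c0 e0)).
have [Kk kmin] := hk t; have := kmin _ (cgM K0G Kk (Kp (- lam t))).
rewrite -/(lam t) leNgt => /negP; apply.
have := bndZ (lam t) te; rewrite subr0 scalerA divff ?gt_eqF // scale1r gtr0_norm // => /fr_bnd fb.
apply: (le_lt_trans fb); rewrite mulrA mulrCA -[ltRHS]mulr1 ltr_pM2l //.
by rewrite /e -ltr_pdivlMr ?invr_gt0 ?ltr_wpDl // div1r invrK ltrDl.
Qed.

End Dichotomy.

Section Free.
Variables (R : realType) (n : nat).

Lemma row_free_ext k (X : 'M[R]_(k, n)) (v : 'rV[R]_n) : row_free X ->
  (forall w, v <> w *m X) -> row_free (col_mx X v).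
Proof.
move=> fX nv; apply: inj_row_free => w; rewrite -(hsubmxK w) mul_row_col => E.
have [r0|r0] := eqVneq (rsubmx w 0 0) 0.
  have r1 : rsubmx w = 0 by apply/rowP => i; rewrite ord1 r0 mxE.
  move: E; have /row_freeP[D XV] := fX; rewrite r1 mul0mx addr0 => /(congr1 (mulmxr D)) /=.
  by rewrite -mulmxA XV mulmx1 mul0mx => ->; rewrite row_mx0.
case: (nv (- (rsubmx w 0 0)^-1 *: lsubmx w)).
have : rsubmx w *m v = rsubmx w 0 0 *: v.
  by apply/rowP => j; rewrite [LHS]mxE big_ord1 [RHS]mxE.
move: E => /eqP; rewrite addrC addr_eq0 => /eqP -> /(congr1 (fun u => (rsubmx w 0 0)^-1 *: u)).
by rewrite scalerA mulVf // scale1r => <-; rewrite scalerN -scaleNr -scalemxAl.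
Qed.

Lemma max_free (Q : forall k, 'M[R]_(k, n) -> Prop) (X0 : 'M[R]_(0, n)) : Q 0%N X0 ->
  exists k (X : 'M[R]_(k, n)), [/\ row_free X, Q k X &
    forall X' : 'M[R]_(k + 1, n), Q (k + 1)%N X' -> ~ row_free X'].
Proof.
move=> Q0; pose p k := `[< exists2 X : 'M[R]_(k, n), row_free X & Q k X >].
have p0 : exists k, p k by exists 0%N; apply/asboolP; exists X0 => //; apply: inj_row_free => v _; apply/rowP => -[].
have pn k : p k -> (k <= n)%N.
  by move=> /asboolP[X fX _]; have := rank_leq_col X; rewrite (eqP fX).
case: (ex_maxnP p0 pn) => k /asboolP[X fX QX] kmax; exists k, X; split=> // X' QX' fX'.
have := kmax (k + 1)%N; rewrite addn1 ltnn => h; apply: notF; apply: h.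
by rewrite -addn1; apply/asboolP; exists X'.
Qed.

(** After multiplication by a right inverse [D] of [Z0], the perturbed matrix becomes
    [1 + t (Z1 *m D)], which for [t = - 1 / u] is singular only if [u] is an eigenvalue of
    [Z1 *m D]. *)
Lemma row_free_pert k (Z0 Z1 : 'M[R]_(k, n)) : row_free Z0 ->
  exists2 t : R, t != 0 & row_free (Z0 + t *: Z1).
Proof.
move=> /row_freeP[D ZD]; set p := char_poly (Z1 *m D).
have p0 : p * 'X != 0 by rewrite mulf_neq0 ?polyX_eq0 // monic_neq0 // char_poly_monic.
have [u pu] : exists u, (p * 'X).[u] != 0.
  apply: contrapT => h; case/eqP: p0; apply: poly_inj_horner => s.
  by rewrite horner0; apply/eqP; apply: contrapT => /negP h'; apply: h; exists s.
move: pu; rewrite hornerM hornerX mulf_eq0 negb_or => /andP[pu u0].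
exists (- u^-1); first by rewrite oppr_eq0 invr_eq0.
apply: inj_row_free => w /(congr1 (mulmxr D)) /=; rewrite mul0mx -mulmxA mulmxDl ZD.
rewrite mulmxDr mulmx1 -scalemxAl -scalemxAr scaleNr => /eqP; rewrite subr_eq0 => /eqP E.
apply/eqP; apply: contraT => w0; move: pu; rewrite -[_ == 0]/(root p u) -eigenvalue_root_char.
move=> /negP[]; apply/eigenvalueP; exists w => //.
by rewrite [in RHS]E scalerA divff // scale1r.
Qed.

Lemma poly_near0 (p : {poly R}) : p != 0 -> \forall t \near (0 : R)^'+, p.[t] != 0.
Proof.
move=> p0; have [m [q]] := multiplicity_XsubC p 0; rewrite p0 /= => q0 ->.
have qc : q.[t] @[t --> (0 : R)] --> q.[0] by exact: (isd_cont (isd_horner q 0)).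
have qc' : q.[t] @[t --> (0 : R)^'+] --> q.[0] by exact: cvg_at_right_filter.
have qn := cvgr_neq0 _ qc' q0.
near=> t; rewrite hornerM horner_exp hornerXsubC subr0 mulf_neq0 //; first by near: t; exact: qn.
by rewrite expf_neq0 // gt_eqF //; near: t; exact: nbhs_right_gt.
Unshelve. all: by end_near. Qed.

End Free.

(** * Regular points of a polar representation *)

Section Polar.
Variables (R : realType) (n : nat).
Notation M := 'M[R]_n.
Notation E := 'cV[R]_n.
Variables (K : M -> Prop) (P : M).
Hypothesis KG : cgrp K.
Hypothesis PT : P^T = P.
Hypothesis PP : P *m P = P.
Notation S := (fun x : E => P *m x = x).
Hypothesis cover : forall x, exists2 k, K k & S (k *m x).
Hypothesis polar : forall A x y, lie K A -> S x -> S y -> dp (A *m x) y = 0.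
Implicit Types (A B C D g h : M) (x y z s xi : E).

Lemma lie_dp A x y : lie K A -> dp (A *m x) y = - dp x (A *m y).
Proof. by move=> lA; rewrite dp_mulmx (lie_skew KG lA) mulNmx dpNr. Qed.

Definition normal s y := forall A, lie K A -> dp (A *m s) y = 0.

Definition velocity k (B : 'I_k -> M) s : 'M[R]_(k, n) := \matrix_(i, j) (B i *m s) j 0.

(** [s] maximizes the number of independent orbit velocities. If [A] killed [s] but not a normal
    vector [y], then [A y] would be orthogonal to all velocities at [s], and for suitable [t] the
    velocity of [t^-1 A] at [s + t y], which is [A y], would be one more independent velocity. *)
Lemma generic_point : exists s, forall A y, lie K A -> A *m s = 0 -> normal s y -> A *m y = 0.
Proof.
pose Q k (X : 'M[R]_(k, n)) := exists s (B : 'I_k -> M), (forall i, lie K (B i)) /\ X = velocity B s.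
have [|k [X [fX [s [B [lB XE]]] kmax]]] := @max_free R n Q (velocity (fun=> 0) 0).
  by exists 0, (fun=> 0); split=> // i; exact: lie0.
exists s => A y lA As ny; apply: contrapT => /eqP Ay.
have yA : dp (A *m y) (A *m y) != 0 by rewrite -[dp _ _]/(nq _) nq_eq0.
have ort C : lie K C -> dp (C *m s) (A *m y) = 0.
  move=> lC; rewrite dpC (lie_dp _ _ lA) mulmxA.
  have := ny _ (lieR KG lA lC); rewrite mulmxBl -[C *m A *m s]mulmxA As mulmx0 subr0 dpC => ->.
  by rewrite oppr0.
have fZ : row_free (col_mx X (A *m y)^T).
  apply: row_free_ext => // w E; case/eqP: yA.
  have E' : A *m y = \sum_i w 0 i *: (B i *m s).
    apply/colP => j; have := congr1 (fun u : 'rV_n => u 0 j) E; rewrite mxE [RHS]mxE => ->.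
    by rewrite summxE; apply: eq_bigr => i _; rewrite XE !mxE.
  by rewrite {1}E' dp_suml big1 // => i _; rewrite dpZl ort ?mulr0.
have [t t0 ft] := row_free_pert (col_mx (velocity B y) 0) fZ.
apply: (kmax _ _ ft); exists (s + t *: y), (fun i => match fintype.split i with inl j => B j | inr _ => t^-1 *: A end).
split; first by move=> i; case: splitP => j _; [exact: lB | exact: lieZ].
apply/matrixP => i j; rewrite [LHS]mxE [X in _ + X]mxE [RHS]mxE ![col_mx _ _ i j]mxE.
case: splitP => l _.
  by rewrite mulmxDr -scalemxAr XE !mxE.
by rewrite -scalemxAl mulmxDr As add0r -scalemxAr scalerA mulVf // scale1r !mxE mulr0 addr0 ord1.
Qed.

Lemma normal_span s : exists m (y : 'I_m -> E), (forall i, normal s (y i)) /\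
  forall z, normal s z -> exists w : 'I_m -> R, z = \sum_i w i *: y i.
Proof.
pose Q k (X : 'M[R]_(k, n)) := forall i, normal s (row i X)^T.
have [|k [X [fX QX kmax]]] := @max_free R n Q 0; first by move=> [].
exists k, (fun i => (row i X)^T); split=> // z nz; apply: contrapT => nw.
apply: (kmax (col_mx X z^T)).
  move=> i; rewrite (_ : row i _ = match fintype.split i with inl j => row j X | inr _ => z^T end); last first.
    by apply/rowP => j; rewrite !mxE; case: splitP => l _; rewrite ?mxE // ord1.
  by case: splitP => l _; [exact: QX | rewrite trmxK].
apply: row_free_ext => // w E; apply: nw; exists (w 0); rewrite -[z]trmxK E.
by apply/colP => j; rewrite mxE summxE mxE; apply: eq_bigr => i _; rewrite !mxE.
Qed.

Lemma cvc_closed (T : Type) (U : set_system T) (u : T -> E) x A : ProperFilter U -> cvc U u x ->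
  (\forall t \near U, A *m u t = u t) -> A *m x = x.
Proof.
move=> UP ux h; have c1 : cvc U (fun t => A *m u t) (A *m x) by exact: cvc_mulmx.
apply: (@cvc_uniq _ _ _ U UP u _ _ _ ux).
by apply: cvc_eq c1.
Qed.

(** [s] being of maximal orbit dimension, write [s + z e = h e *m se e] with [z e]
    a polynomial curve running through a basis of the normal space and [se e] in a
    fixed translate of the section.  By [lie_dichotomy] either [h e] fixes the
    normal space, so that [z e] lies in that translate, or [s + z e - se e] has a
    nonzero component tangent to the orbit, which is absurd. *)
Theorem regular_point : exists2 x0, S x0 & forall y, normal x0 y -> S y.
Proof.
have [s sgen] := generic_point; have [m [y [ny yspan]]] := normal_span s.
(* The exponents start at [1], so that [z] vanishes at [0]; being distinct, they allow each [y i] to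
   be recovered from the curve. *)
pose z (e : R) := \sum_i e ^+ (i : 'I_m).+1 *: y i.
have /choice[k hk] e : exists k, K k /\ S (k *m (s + z e)) by have [k] := cover (s + z e); exists k.
have [U [UU oU]] := ultraFilterLemma (at_right_proper_filter (0 : R)).
have UP : ProperFilter U := @ultra_proper _ _ UU.
have [|k0 K0 kk] := @cgC _ _ _ KG R U k UU.
  by apply: (@filterE _ U) => e; have [] := hk e.
have e0 : e @[e --> U] --> (0 : R).
  apply/cvgrPdist_lt => r r0; apply: oU.
  apply: (filterS _ (filterI (nbhs_right_gt (0 : R)) (nbhs_right_lt r0))) => t [t0 tr].
  by rewrite sub0r normrN gtr0_norm.
have zc : cvc U (fun e => s + z e) s.
  rewrite -[X in cvc _ _ X]addr0; have sc : cvc U (fun=> s) s by exact: cvc_cst.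
  suff zc : cvc U z 0 by exact: cvcD.
  move=> i; rewrite mxE (_ : (fun e => _) = fun e => \sum_(j < m) e ^+ j.+1 * y j i 0); last first.
    by apply/funext => e; rewrite summxE; apply: eq_bigr => j _; rewrite mxE.
  rewrite [X in _ --> X](_ : _ = \sum_(j < m) (0 : R)); last by rewrite big1.
  apply: cvg_bsum => j _; rewrite -(mul0r (y j i 0)); apply: cvgMl.
  by have := cvg_comp _ _ e0 (@exprn_continuous R j.+1 0); rewrite expr0n.
have O0 := cg_orth KG K0; have O0' := orthT O0.
have sS : S (k0 *m s).
  by apply: (cvc_closed UP (mcvg_mulv UP kk zc)); apply: (@filterE _ U) => e; have [] := hk e.
have subN x : S (k0 *m x) -> normal s x.
  move=> Sx A lA; have := polar (lieJ KG K0 lA) sS Sx.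
  by rewrite !mulmxA -[k0 *m A *m k0^T *m k0]mulmxA O0 mulmx1 -mulmxA dp_orth.
suff Sy i : S (k0 *m y i).
  exists (k0 *m s) => // x nx.
  have [|w E] := yspan (k0^T *m x).
    move=> A lA; rewrite -(dp_orth _ _ O0) orthKT //.
    have := nx _ (lieJ KG K0 lA).
    by rewrite !mulmxA -[k0 *m A *m k0^T *m k0]mulmxA O0 mulmx1.
  rewrite -(orthKT x O0) E !mulmx_sumr; apply: eq_bigr => j _.
  by rewrite -!scalemxAr Sy.
pose h e := (k e)^T *m k0; pose se e := k0^T *m (k e *m (s + z e)).
have hse e : h e *m se e = s + z e.
  rewrite /h /se -mulmxA orthKT // orthTK //; apply: (cg_orth KG); by have [] := hk e.
have Sse e : S (k0 *m se e) by rewrite /se orthKT //; have [] := hk e.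
have Kh e : K (h e) by apply: (cgM KG) => //; apply: (cgT KG); have [] := hk e.
have k0c : mcvg U (fun=> k0) k0 by move=> i' j'; exact: cvg_cst.
have h1 : mcvg U h 1%:M by have := mcvgM UP (mcvgT kk) k0c; rewrite O0.
have nz e : normal s (z e).
  by move=> A lA; rewrite dp_sumr big1 // => j _; rewrite dpZr ny ?mulr0.
pose K1 g := K g /\ forall x, normal s x -> g *m x = x.
have K1G : cgrp K1 by exact: cgrp_fix.
have sub1 g : K1 g -> K g by case.
have [k1|[kt [lam [A [Kkt l0 lc [lA nlA] cA]]]]] := lie_dichotomy KG K1G sub1 UU Kh h1.
  have Sz : \forall e \near U, P *m (k0 *m z e) = k0 *m z e.
    apply: filterS k1 => e [_ fe].
    have := Sse e; rewrite -(fe (se e) (subN _ (Sse e))) hse !mulmxDr sS.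
    by move/addrI.
  pose c j : E := P *m (k0 *m y j) - k0 *m y j.
  suff : c i = 0 by move/eqP; rewrite subr_eq0 => /eqP.
  apply/colP => l; rewrite [RHS]mxE.
  pose p : {poly R} := \sum_(j < m) (c j l 0) *: 'X^(j.+1).
  have pE e : p.[e] = (P *m (k0 *m z e) - k0 *m z e) l 0.
    rewrite /z !mulmx_sumr -sumrB summxE horner_sum; apply: eq_bigr => j _.
    by rewrite -!scalemxAr -scalerBr hornerZ hornerXn [RHS]mxE mulrC.
  have p0 : p = 0.
    apply/eqP; apply: contraT => p0; have := oU _ (poly_near0 p0) => np.
    have [e [e1 e2]] := filter_ex (filterI np Sz).
    by move: e1; rewrite pE e2 subrr mxE eqxx.
  have := congr1 (fun q : {poly R} => q`_i.+1) p0; rewrite coef0 coef_sum (bigD1 i) //= big1.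
    by rewrite addr0 coefZ coefXn eqxx mulr1.
  by move=> j ji; rewrite coefZ coefXn eqSS eq_sym -val_eqE /= in ji *; rewrite (negPf ji) mulr0.
(* [A] is not tangent to the subgroup fixing the normal space, so by the choice of [s] it moves [s].
   But the vectors in the difference quotient are all normal at [s], hence orthogonal to [A s], and
   in the limit [A s] is orthogonal to itself. *)
exfalso; have As : A *m s <> 0.
  move=> As; apply: nlA; apply/(lie_fix KG); split=> // x nx; exact: sgen As nx.
have sec : cvc U se s.
  have := mcvg_mulv UP (mcvgT k0c) (mcvg_mulv UP kk zc).
  by rewrite orthTK.
have c1 : dp ((lam e)^-1 *: (h e *m kt e - 1%:M) *m se e) (A *m s) @[e --> U] --> dp (A *m s) (A *m s).
  exact: (polyf_cvc (polyf_dp (A *m s)) (mcvg_mulv UP cA sec)).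
apply: As; apply/eqP; rewrite -nq_eq0; apply/eqP.
suff c2 : dp ((lam e)^-1 *: (h e *m kt e - 1%:M) *m se e) (A *m s) @[e --> U] --> (0 : R).
  exact: (cvg_unique _ c1 c2).
rewrite (_ : (fun e => _) = fun=> 0); first exact: cvg_cst.
apply/funext => e; rewrite -scalemxAl dpZl mulmxBl mul1mx -mulmxA.
have [_ ->] := Kkt e; last exact: subN (Sse e).
rewrite hse dpDl dpDl dpNl !(dpC _ (A *m s)) (nz e) // (subN _ (Sse e)) // (subN _ sS) //.
by rewrite addr0 oppr0 addr0 mulr0.
Qed.

End Polar.

(** * Simultaneous diagonalization *)

Section Symmetric.
Variables (R : realType) (n : nat).
Notation M := 'M[R]_n.
Notation E := 'cV[R]_n.
Implicit Types (A B C D g h : M) (x y z s xi : E).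

Lemma colE1 x : x = \sum_i x i 0 *: delta_mx i 0.
Proof.
apply/colP => k; rewrite summxE (bigD1 k) //= big1; first by rewrite !mxE !eqxx mulr1 addr0.
by move=> j jk; rewrite !mxE eq_sym (negPf jk) mulr0.
Qed.

Lemma symP A : (forall u v, dp (A *m u) v = dp u (A *m v)) -> A^T = A.
Proof.
move=> h; apply/matrixP => i j; have := h (delta_mx i 0) (delta_mx j 0).
by rewrite dp_delta dpC dp_delta -!colE !mxE.
Qed.

(** Induction on the list, inside the kernel of [C]: a maximizer of the quadratic form of [A] on the
    unit sphere of this kernel is an eigenvector, and the rows of [A - l] are then added to [C]. *)
Lemma shared_eigenvector (Ms : seq M) m (C : 'M[R]_(m, n)) :
  (forall A, A \in Ms -> A^T = A) ->
  (forall A B, A \in Ms -> B \in Ms -> A *m B = B *m A) ->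
  (forall A (v : E), A \in Ms -> C *m v = 0 -> C *m (A *m v) = 0) ->
  (exists2 v : E, C *m v = 0 & v != 0) ->
  exists v : E, [/\ nq v = 1, C *m v = 0 & forall A, A \in Ms -> exists l, A *m v = l *: v].
Proof.
elim: Ms m C => [|A Ms IH] m C symM comM invM [v Cv v0].
  have q0 : 0 < nq v by rewrite nq_gt0.
  have s0 : 0 < Num.sqrt (nq v) by rewrite sqrtr_gt0.
  exists ((Num.sqrt (nq v))^-1 *: v); split=> //; last by rewrite -scalemxAr Cv scaler0.
  by rewrite nqZ exprVn sqr_sqrtr ?(ltW q0) // mulVf // gt_eqF.
have AM : A \in A :: Ms by exact: mem_head.
have sA := symM A AM.
pose Sv (v : E) := nq v = 1 /\ C *m v = 0.
pose f (v : E) := dp (A *m v) v.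
have pf : polyf f.
  apply: polyf_sum => i; apply: polyf_mul (polyf_coord _ i).
  exact: (polyf_comp_lin A (polyf_coord _ i)).
have [q0 s0] : 0 < nq v /\ 0 < Num.sqrt (nq v) by rewrite sqrtr_gt0 nq_gt0.
have [||u [u1 Cu] um] := @sup_attained R E Sv f ((Num.sqrt (nq v))^-1 *: v).
- split; last by rewrite -scalemxAr Cv scaler0.
  by rewrite nqZ exprVn sqr_sqrtr ?(ltW q0) // mulVf // gt_eqF.
- move=> U UU US; have UP : ProperFilter U := @ultra_proper _ _ UU.
  have [|a _ ua] := box_limit UU.
    apply: filterS US => z [z1 _] i; rewrite -(expr1n _ 2) in z1.
    by apply: coord_le_nq => //; rewrite z1.
  exists a; last exact: polyf_cvc ua.
  split.
    have c1 : nq z @[z --> U] --> nq a by exact: (polyf_cvc (polyf_nq R n) ua).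
    have c2 : nq z @[z --> U] --> (1 : R).
      by apply: cvg_near_cst; apply: filterS US => z [-> _].
    exact: (cvg_unique _ c1 c2).
  apply/colP => i; rewrite [RHS]mxE.
  have pc : polyf (fun z : E => (C *m z) i 0) by exact: (polyf_comp_lin C (polyf_coord _ i)).
  have c2 : (C *m z) i 0 @[z --> U] --> (0 : R).
    by apply: cvg_near_cst; apply: filterS US => z [_ ->]; rewrite mxE.
  have c1 : (C *m z) i 0 @[z --> U] --> (C *m a) i 0 by exact: (polyf_cvc pc ua).
  exact: (cvg_unique _ c1 c2).
set l := f u in um.
have hom (w : E) : C *m w = 0 -> f w <= l * nq w.
  move=> Cw; have [->|w0] := eqVneq w 0; first by rewrite /f mulmx0 dp0l nq0 mulr0.
  have qw : 0 < nq w by rewrite nq_gt0.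
  have sw : 0 < Num.sqrt (nq w) by rewrite sqrtr_gt0.
  have := um ((Num.sqrt (nq w))^-1 *: w); rewrite /f -scalemxAr dpZl dpZr mulrA -expr2 exprVn.
  rewrite sqr_sqrtr ?(ltW qw) // ler_pdivrMl // [_ * l]mulrC; apply; split.
    by rewrite nqZ exprVn sqr_sqrtr ?(ltW qw) // mulVf // gt_eqF.
  by rewrite -scalemxAr Cw scaler0.
have crit (w : E) : C *m w = 0 -> dp (A *m u) w = l * dp u w.
  move=> Cw; pose b := 2 * (l * dp u w - dp (A *m u) w).
  pose a := l * nq w - f w.
  have a0 : 0 < `|a| + 1 by rewrite ltr_wpDl.
  suff : b = 0 by rewrite /b; lra.
  apply: (@lin_quad_ge0 R (`|a| + 1) 1) => // t _.
  have := hom (u + t *: w); rewrite mulmxDr Cu -scalemxAr Cw scaler0 addr0 => /(_ erefl).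
  rewrite /f nqD u1 dpZr nqZ mulmxDr -scalemxAr dpDl !dpDr !dpZr !dpZl ?dpZr.
  have -> : dp (A *m w) u = dp (A *m u) w by rewrite dp_mulmx sA dpC.
  rewrite -/(f u) -/(f w) -/l => h1.
  have h2 : a * t ^+ 2 <= (`|a| + 1) * t ^+ 2.
    by rewrite ler_wpM2r ?sqr_ge0 // (le_trans (ler_norm _)) // lerDl.
  by move: h1 h2; rewrite /b /a; move: (dp (A *m u) w) => X; lra.
have Au : A *m u = l *: u.
  apply/eqP; rewrite -subr_eq0 -nq_eq0; apply/eqP.
  have := crit (A *m u - l *: u); rewrite mulmxBr (invM A u AM Cu) -scalemxAr Cu scaler0 subr0.
  move=> /(_ erefl) h; rewrite /nq [LHS]dpDl h dpNl dpZl; lra.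
have [||||v' [v1 Cv' ev]] := IH _ (col_mx C (A - l%:M)).
- by move=> B BM; apply: symM; rewrite inE BM orbT.
- by move=> B D BM DM; apply: comM; rewrite inE ?BM ?DM orbT.
- move=> B w BM /eqP; rewrite mul_col_mx col_mx_eq0.
  move=> /andP[/eqP Cw /eqP Aw].
  rewrite mul_col_mx invM ?inE ?BM ?orbT // mulmxA mulmxBl mul_scalar_mx.
  rewrite (comM A B) ?inE ?eqxx ?BM ?orbT //.
  have -> : B *m A - l *: B = B *m (A - l%:M) by rewrite mulmxBr mul_mx_scalar.
  by rewrite -mulmxA Aw mulmx0 col_mx0.
- exists u; last by rewrite -nq_gt0 u1.
  by rewrite mul_col_mx Cu mulmxBl Au mul_scalar_mx subrr col_mx0.
move: Cv'; rewrite mul_col_mx => /eqP; rewrite col_mx_eq0 => /andP[/eqP Cv' /eqP].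
rewrite mulmxBl mul_scalar_mx => /eqP; rewrite subr_eq0 => /eqP Av'.
exists v'; split=> // B; rewrite inE => /orP[/eqP ->|BM]; [by exists l | exact: ev].
Qed.

Theorem shared_eigenbasis (Ms : seq M) :
  (forall A, A \in Ms -> A^T = A) ->
  (forall A B, A \in Ms -> B \in Ms -> A *m B = B *m A) ->
  exists2 Q : M, Q *m Q^T = 1%:M &
    forall A i, A \in Ms -> exists l, A *m col i Q = l *: col i Q.
Proof.
move=> symM comM.
pose ok k (X : 'M[R]_(k, n)) := X *m X^T = 1%:M /\
  forall A i, A \in Ms -> exists l, A *m (row i X)^T = l *: (row i X)^T.
have [|k [X [fX [XX ev] kmax]]] := @max_free R n ok 0.
  by split; [apply/matrixP => -[] | move=> A []].
have inj (v : E) : X *m v = 0 -> v = 0.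
  move=> Xv; apply: contrapT => /eqP v0.
  have [||w [w1 Xw evw]] := @shared_eigenvector Ms k X symM comM.
  - move=> A u AM Xu; apply/colP => i; rewrite [RHS]mxE.
    have [l El] := ev A i AM.
    have -> : (X *m (A *m u)) i 0 = ((row i X *m A) *m u) 0 0.
      by rewrite -!row_mul -mulmxA [RHS]mxE.
    rewrite -[row i X *m A]trmxK trmx_mul (symM A AM) El linearZ /= trmxK -scalemxAl -row_mul Xu.
    by rewrite !mxE mulr0.
  - by exists v.
  - have XW : col_mx X w^T *m (col_mx X w^T)^T = 1%:M.
      have wX : w^T *m X^T = 0 by rewrite -trmx_mul Xw trmx0.
      rewrite tr_col_mx trmxK mul_col_row XX Xw wX.
      have -> : w^T *m w = 1%:M.
        apply/matrixP => i j; rewrite !ord1 !mxE eqxx -[RHS]w1; apply: eq_bigr => l _; by rewrite mxE.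
      by rewrite -scalar_mx_block.
    apply: (kmax (col_mx X w^T)); last by apply/row_freeP; exists (col_mx X w^T)^T.
    split=> // A i AM.
    rewrite (_ : row i _ = match fintype.split i with inl j => row j X | inr _ => w^T end); last first.
      by apply/rowP => j; rewrite !mxE; case: splitP => l _; rewrite ?mxE // ord1.
    by case: splitP => l _; [exact: ev | rewrite trmxK; exact: evw].
have kn : k = n.
  have fT : row_free X^T.
    apply: inj_row_free => w E; rewrite -[w]trmxK (inj w^T) ?trmx0 //.
    by rewrite -[X]trmxK -trmx_mul E trmx0.
  by apply: etrans (esym (eqP fX)) _; have := eqP fT; rewrite mxrank_tr.
subst k; exists X^T; first by rewrite trmxK; exact: mulmx1C.
by move=> A i AM; rewrite -tr_row; exact: ev.
Qed.

Lemma dp_col (Q : M) i j : Q *m Q^T = 1%:M -> dp (col i Q) (col j Q) = (i == j)%:R.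
Proof.
move=> /mulmx1C/matrixP/(_ i j); rewrite !mxE => <-; apply: eq_bigr => k _.
by rewrite !mxE.
Qed.

Lemma col_expand (Q : M) v : Q *m Q^T = 1%:M -> v = \sum_i dp v (col i Q) *: col i Q.
Proof.
move=> QQ; rewrite -[LHS]mul1mx -QQ -mulmxA; apply/colP => k; rewrite mxE summxE.
apply: eq_bigr => i _; rewrite !mxE mulrC; congr (_ * _); apply: eq_bigr => j _.
by rewrite !mxE mulrC.
Qed.

End Symmetric.

(** * Roots with respect to a section *)

Section Roots.
Variables (R : realType) (n : nat).
Notation M := 'M[R]_n.
Notation E := 'cV[R]_n.
Variables (K : M -> Prop) (P : M).
Hypothesis KG : cgrp K.
Hypothesis PT : P^T = P.
Hypothesis PP : P *m P = P.
Notation S := (fun x : E => P *m x = x).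
Hypothesis cover : forall x, exists2 k, K k & S (k *m x).
Hypothesis polar : forall A x y, lie K A -> S x -> S y -> dp (A *m x) y = 0.
Implicit Types (A B C D g h : M) (x y z s xi : E).

(** The columns of [Q] killed by [P] span the complement of the section. For such [i], the vector
    [a i] is a root, normalized at the regular point [x0], and [A i] is a root vector: it moves the
    section along [col i Q] with speed [dp (a i)]. *)
Record roots (x0 : E) (Q : M) (a : 'I_n -> E) (A : 'I_n -> M) : Prop := {
  rt_orth : Q *m Q^T = 1%:M ;
  rt_split : forall i, P *m col i Q = col i Q \/ P *m col i Q = 0 ;
  rt_base : S x0 ;
  rt_sec : forall i, S (a i) ;
  rt_lie : forall i, lie K (A i) ;
  rt_act : forall i xi, P *m col i Q = 0 -> S xi -> A i *m xi = dp (a i) xi *: col i Q ;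
  rt_base1 : forall i, P *m col i Q = 0 -> dp (a i) x0 = 1 ;
  rt_gen : forall C xi, lie K C -> S xi -> C *m xi =
    \sum_(i | P *m col i Q == 0) (dp (C *m x0) (col i Q) * dp (a i) xi) *: col i Q
}.

Lemma dp_proj x y : dp (P *m x) y = dp x (P *m y).
Proof. by rewrite dp_mulmx PT. Qed.

Lemma proj_eq0 w : (forall y, S y -> dp w y = 0) -> P *m w = 0.
Proof.
move=> h; apply/eqP; rewrite -nq_eq0 /nq dp_proj; apply/eqP/h.
by rewrite mulmxA PP mulmxA PP.
Qed.

Lemma proj_lie A xi : lie K A -> S xi -> P *m (A *m xi) = 0.
Proof. by move=> lA Sx; apply: proj_eq0 => y; exact: polar. Qed.

Theorem roots_exist : exists x0 Q a (A : 'I_n -> M), roots x0 Q a A.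
Proof.
have [x0 Sx0 reg] := regular_point KG cover polar.
(* At a regular point the orbit directions fill the whole complement of the section. *)
have lift z : P *m z = 0 -> exists2 C, lie K C & C *m x0 = z.
  move=> Pz; pose ok k (X : 'M[R]_(k, n)) := exists2 B : 'I_k -> M,
    forall i, lie K (B i) & X = velocity B x0.
  have [|k [X [fX [B lB XE] kmax]]] := @max_free R n ok (velocity (fun=> 0) x0).
    by exists (fun=> 0) => // i; exact: (lie0 KG).
  have span C : lie K C -> exists w : 'rV_k, (C *m x0)^T = w *m X.
    move=> lC; apply: contrapT => nw; apply: (kmax (col_mx X (C *m x0)^T)).
      exists (fun i => match fintype.split i with inl j => B j | inr _ => C end).
        by move=> i; case: splitP.
      apply/matrixP => i j; rewrite [LHS]mxE [RHS]mxE; case: splitP => l _; rewrite ?XE mxE //.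
      by rewrite ord1.
    by apply: row_free_ext => // w E; apply: nw; exists w.
  have [w wE] : exists w : 'rV_k, z^T = w *m X.
    suff /submxP[w ->] : (z^T <= X)%MS by exists w.
    rewrite submxE; apply/eqP/rowP => j; rewrite [RHS]mxE.
    pose y := col j (cokermx X).
    have Xy : X *m y = 0 by rewrite /y colE mulmxA mulmx_coker mul0mx.
    have Sy : S y.
      apply: reg => C lC; have [w' E] := span C lC.
      transitivity (((C *m x0)^T *m y) 0 0).
        by rewrite [RHS]mxE; apply: eq_bigr => l _; rewrite [X in _ = X * _]mxE.
      by rewrite E -mulmxA Xy mulmx0 mxE.
    transitivity (dp z y).
      by rewrite mxE; apply: eq_bigr => l _; rewrite !mxE.
    by rewrite -Sy -dp_proj Pz dp0l.
  exists (\sum_i w 0 i *: B i); first by apply: (lie_sum KG) => i; exact: (lieZ KG).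
  apply/colP => j; have := congr1 (fun u : 'rV_n => u 0 j) wE; rewrite mxE => ->.
  rewrite mulmx_suml summxE mxE; apply: eq_bigr => i _; rewrite -scalemxAl XE.
  by rewrite [LHS]mxE [X in _ = _ * X]mxE.
(* On the section, a Lie algebra element is determined by its value at [x0]: one that kills [x0]
   maps the section into the normal space of [x0], that is, into the section, and polarity makes it
   vanish. *)
have key C D xi : lie K C -> lie K D -> S xi -> C *m x0 = D *m x0 -> C *m xi = D *m xi.
  move=> lC lD Sxi CD; apply/eqP; rewrite -subr_eq0 -mulmxBl; set B := C - D.
  have lB : lie K B by exact: (lieB KG).
  have B0 : B *m x0 = 0 by rewrite mulmxBl CD subrr.
  have SB : S (B *m xi).
    apply: reg => F lF; rewrite dpC (lie_dp KG _ _ lB) mulmxA.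
    have := polar (lieR KG lB lF) Sx0 Sxi; rewrite mulmxBl -[F *m B *m x0]mulmxA B0 mulmx0 subr0.
    by rewrite dpC => ->; rewrite oppr0.
  by rewrite -nq_eq0 /nq (polar lB Sxi SB).
have /choice[Ci hCi] (i : 'I_n) : exists C, lie K C /\ C *m x0 = delta_mx i 0 - P *m delta_mx i 0.
  have [|C lC CE] := lift (delta_mx i 0 - P *m delta_mx i 0); last by exists C.
  by rewrite mulmxBr mulmxA PP subrr.
pose Cv (v : E) : M := \sum_i v i 0 *: Ci i.
have lCv v : lie K (Cv v) by apply: (lie_sum KG) => i; apply: (lieZ KG); have [] := hCi i.
have Cv0 v : Cv v *m x0 = v - P *m v.
  have vE : v = \sum_i v i 0 *: delta_mx i 0 by exact: colE1.
  rewrite [in RHS]vE /Cv mulmx_suml mulmx_sumr -sumrB; apply: eq_bigr => i _.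
  by rewrite -scalemxAl (hCi i).2 -scalemxAr scalerBr.
(* [Mx xi] is the map [C x0 |-> C xi], extended by [0] on the section. By [lie_sym] these operators
   are symmetric and commute; their joint eigenvalues are the roots. *)
pose Mx xi : M := \matrix_(b, i) (Ci i *m xi) b 0.
have MxE xi v : Mx xi *m v = Cv v *m xi.
  rewrite /Cv mulmx_suml; apply/colP => b; rewrite mxE summxE; apply: eq_bigr => i _.
  by rewrite -scalemxAl [X in X * _]mxE [RHS]mxE mulrC.
have PM xi : S xi -> P *m Mx xi = 0.
  move=> Sxi; apply/matrixP => i j; rewrite [RHS]mxE.
  have : (P *m (Mx xi *m (delta_mx j 0 : E))) i 0 = 0 by rewrite MxE proj_lie ?mxE.
  by rewrite mulmxA -colE mxE.
have MS xi v : S xi -> S v -> Mx xi *m v = 0.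
  move=> Sxi Sv; rewrite MxE (key _ 0 _ (lCv v) (lie0 KG)) ?mul0mx //.
  by rewrite Cv0 Sv subrr.
have lie_sym C D xi eta : lie K C -> lie K D -> S xi -> S eta ->
    dp (C *m xi) (D *m eta) = dp (C *m eta) (D *m xi).
  move=> lC lD Sx Se; have := polar (lieR KG lC lD) Se Sx.
  rewrite mulmxBl dpDl dpNl -!mulmxA (lie_dp KG _ _ lC) (lie_dp KG _ _ lD).
  by rewrite (dpC xi); lra.
have dpM xi u v : S xi -> dp (Mx xi *m u) v = dp (Cv u *m xi) (Cv v *m x0).
  move=> Sxi; rewrite MxE Cv0 dpDr dpNr -dp_proj proj_lie // dp0l subr0 //.
have Msym xi : S xi -> (Mx xi)^T = Mx xi.
  move=> Sxi; apply: symP => u v; rewrite dpM // [RHS]dpC dpM // [RHS]dpC.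
  by rewrite lie_sym.
have MP xi : S xi -> Mx xi *m P = 0.
  by move=> Sxi; rewrite -[LHS]trmxK trmx_mul PT Msym // PM // trmx0.
have MM xi eta : S xi -> S eta -> Mx xi *m Mx eta = Mx eta *m Mx xi.
  have half xi' eta' u v : S xi' -> S eta' ->
      dp (Mx xi' *m (Mx eta' *m u)) v = dp (Cv u *m eta') (Cv v *m xi').
    by move=> Sx Se; rewrite dp_mulmx Msym // !MxE.
  move=> Sx Se; apply/matrixP => i j.
  have : dp (Mx xi *m (Mx eta *m delta_mx j 0)) (delta_mx i 0) =
      dp (Mx eta *m (Mx xi *m delta_mx j 0)) (delta_mx i 0).
    by rewrite !half // lie_sym.
  by rewrite !dp_delta !mulmxA -!colE !mxE.
pose eta j : E := P *m delta_mx j 0.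
have Seta j : S (eta j) by rewrite /eta mulmxA PP.
pose Ms := P :: [seq Mx (eta j) | j <- enum 'I_n].
have [||Q QQ ev] := shared_eigenbasis (Ms := Ms).
- by move=> A; rewrite inE => /orP[/eqP ->|/mapP[j _ ->]] //; exact: Msym.
- move=> A B; rewrite !inE => /orP[/eqP ->|/mapP[j _ ->]] /orP[/eqP ->|/mapP[l _ ->]] //.
  + by rewrite PM // MP.
  + by rewrite PM // MP.
  + exact: MM.
have nz i : col i Q != 0.
  apply/eqP => c0; have := dp_col i i QQ; rewrite c0 dp0l eqxx => /eqP.
  by rewrite eq_sym oner_eq0.
have /choice[lam hl] (i : 'I_n) : exists l : E, forall j, Mx (eta j) *m col i Q = l j 0 *: col i Q.
  have /choice[l hl] j : exists l, Mx (eta j) *m col i Q = l *: col i Q.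
    by apply: ev; rewrite inE; apply/orP; right; apply: map_f; rewrite mem_enum.
  by exists (\col_j l j) => j; rewrite mxE.
have split i : P *m col i Q = col i Q \/ P *m col i Q = 0.
  have [|l El] := ev P i; first exact: mem_head.
  have : (l - l ^+ 2) *: col i Q = 0.
    by rewrite scalerBl -El expr2 -scalerA -El scalemxAr -El mulmxA PP subrr.
  move/eqP; rewrite scaler_eq0 (negPf (nz i)) orbF expr2 -{1}[l]mulr1 -mulrBr mulf_eq0.
  move=> /orP[/eqP l0|]; first by right; rewrite El l0 scale0r.
  by rewrite subr_eq0 => /eqP l1; left; rewrite El -l1 scale1r.
have act i xi : P *m col i Q = 0 -> S xi -> Cv (col i Q) *m xi = dp (P *m lam i) xi *: col i Q.
  move=> _ Sxi; have -> : Cv (col i Q) *m xi = \sum_j xi j 0 *: (Cv (col i Q) *m eta j).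
    rewrite -{1}Sxi {1}(colE1 xi).
    by rewrite !mulmx_sumr; apply: eq_bigr => j _; rewrite -!scalemxAr.
  rewrite dp_proj Sxi /dp scaler_suml; apply: eq_bigr => j _.
  by rewrite -MxE hl scalerA mulrC.
exists x0, Q, (fun i => P *m lam i), (fun i => Cv (col i Q)); split=> //.
- by move=> i; rewrite mulmxA PP.
- move=> i Pi; apply/eqP; rewrite -subr_eq0; have := act i x0 Pi Sx0.
  rewrite Cv0 Pi subr0 => /eqP; rewrite -subr_eq0 -{1}[col i Q]scale1r -scalerBl scaler_eq0.
  by rewrite (negPf (nz i)) orbF -opprB oppr_eq0.
- move=> C xi lC Sxi.
  pose D := \sum_(i | P *m col i Q == 0) dp (C *m x0) (col i Q) *: Cv (col i Q).
  have lD : lie K D by apply: (lie_sum KG) => i; exact: (lieZ KG).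
  have DE y : S y -> D *m y =
      \sum_(i | P *m col i Q == 0) (dp (C *m x0) (col i Q) * dp (P *m lam i) y) *: col i Q.
    move=> Sy; rewrite mulmx_suml; apply: eq_bigr => i /eqP Pi.
    by rewrite -scalemxAl act // scalerA.
  suff CD : C *m x0 = D *m x0 by rewrite (key _ _ _ lC lD Sxi CD) DE.
  rewrite {1}(col_expand (C *m x0) QQ) /D mulmx_suml.
  rewrite (bigID (fun i => P *m col i Q == 0)) /= [X in _ + X]big1 ?addr0.
    by apply: eq_bigr => i /eqP Pi; rewrite -scalemxAl Cv0 Pi subr0.
  move=> i /eqP Pi; have [Pc|//] := split i.
  by rewrite -Pc -dp_proj proj_lie // dp0l scale0r.
Qed.

End Roots.

(** * Reflections and Weyl group orbits *)

Section Weyl.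
Variables (R : realType) (n : nat).
Notation M := 'M[R]_n.
Notation E := 'cV[R]_n.
Variables (K : M -> Prop) (P : M).
Hypothesis KG : cgrp K.
Hypothesis PT : P^T = P.
Hypothesis PP : P *m P = P.
Notation S := (fun x : E => P *m x = x).
Hypothesis polar : forall A x y, lie K A -> S x -> S y -> dp (A *m x) y = 0.
Implicit Types (B C D g h : M) (x y z s xi : E).

(** [g P g^T] is a projection into the section with the same trace as [P], so their difference is a
    projection of trace zero. *)
Lemma stable_comm g : orth g -> (forall x, S x -> S (g *m x)) -> g *m P = P *m g.
Proof.
move=> Og st; have Og' := orthT Og.
have PgP : P *m (g *m P) = g *m P.
  apply/matrixP => i j; have := st (P *m (delta_mx j 0 : E)); rewrite mulmxA PP => /(_ erefl).
  by move=> /colP/(_ i); rewrite !mulmxA -!colE ![col _ _ i 0]mxE.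
have gg : g *m g^T = 1%:M by exact: mulmx1C.
pose F := g *m P *m g^T.
have FT : F^T = F by rewrite /F !trmx_mul trmxK PT mulmxA.
have PF : P *m F = F by rewrite /F !mulmxA -[P *m g *m P]mulmxA PgP.
have FP : F *m P = F by rewrite -[LHS]trmxK trmx_mul FT PT PF FT.
have FF : F *m F = F.
  by rewrite /F !mulmxA -[g *m P *m g^T *m g]mulmxA Og mulmx1 -[g *m P *m P]mulmxA PP.
have DD : (P - F)^T *m (P - F) = P - F.
  have -> : (P - F)^T = P - F by rewrite [LHS]raddfB /= PT FT.
  by rewrite mulmxBl !mulmxBr PP PF FP FF subrr subr0.
have t0 : \tr (P - F) = 0.
  by rewrite raddfB /= /F mxtrace_mulC mulmxA Og mul1mx subrr.
have PF0 : P = F.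
  apply/eqP; rewrite -subr_eq0; apply/eqP/matrixP => i j; rewrite [RHS]mxE.
  have t1 : \tr ((P - F)^T *m (P - F)) = 0 by rewrite DD.
  set X := P - F in t1 *.
  have : \sum_k \sum_l X l k ^+ 2 = 0.
    by rewrite -[RHS]t1; apply: eq_bigr => k _; rewrite [RHS]mxE; apply: eq_bigr => l _; rewrite [X in _ = X * _]mxE expr2.
  move/eqP; rewrite psumr_eq0; last by move=> k _; apply: sumr_ge0 => l _; exact: sqr_ge0.
  move=> /allP/(_ j (mem_index_enum _))/=; rewrite psumr_eq0; last by move=> l _; exact: sqr_ge0.
  by move=> /allP/(_ i (mem_index_enum _))/=; rewrite sqrf_eq0 => /eqP.
by rewrite [in RHS]PF0 /F -[RHS]mulmxA Og mulmx1.
Qed.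

Lemma bnd_dp B c x y : bnd B c -> `|dp (B *m x) y| <= c * \sum_i \sum_j `|x j 0| * `|y i 0|.
Proof.
move=> Bc; rewrite mulr_sumr (le_trans (ler_norm_sum _ _ _)) //; apply: ler_sum => i _.
rewrite mxE mulr_suml mulr_sumr (le_trans (ler_norm_sum _ _ _)) //; apply: ler_sum => j _.
by rewrite !normrM mulrA ler_wpM2r // ler_wpM2r.
Qed.

Lemma oneparam_crit (K' : M -> Prop) (A : M) phi x y : oneparam K' A phi ->
  (forall t, dp x y <= dp (phi t *m x) y) -> dp (A *m x) y = 0.
Proof.
move=> [_ _ [c c0 hc]] ge; pose D := \sum_i \sum_j `|x j 0| * `|y i 0|.
have D0 : 0 <= D by apply: sumr_ge0 => i _; apply: sumr_ge0 => j _; rewrite mulr_ge0.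
have M0 : 0 < c * D + 1 by rewrite ltr_wpDl // mulr_ge0.
apply: (@lin_quad_ge0 R (c * D + 1) 1) => // t _.
have := bnd_dp x y (hc t); rewrite -/D !mulmxBl mul1mx -scalemxAl !dpDl !dpNl dpZl.
move=> /(le_trans (ler_norm _)); have := ge t; have := sqr_ge0 t.
by rewrite mulrDl mul1r [c * _ * D]mulrAC [t * _]mulrC; lra.
Qed.

Lemma cvg_dp_mul (T : Type) (U : set_system T) (u : T -> M) (x y : T -> E) B v w :
  ProperFilter U -> mcvg U u B -> cvc U x v -> cvc U y w ->
  dp (u t *m x t) (y t) @[t --> U] --> dp (B *m v) w.
Proof.
move=> UP uB xv yw; apply: cvg_bsum => i _; apply: cvgM; last exact: yw.
exact: (mcvg_mulv UP uB xv).
Qed.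

Lemma dp_max (K' : M -> Prop) x y : cgrp K' -> exists2 k, K' k &
  forall g, K' g -> dp (g *m x) y <= dp (k *m x) y.
Proof.
move=> KG'; have [|k Kk hk] := @sup_attained R M K' (fun g => dp (g *m x) y) 1%:M (cg1 KG').
  move=> U UU UK; have UP : ProperFilter U := @ultra_proper _ _ UU.
  have [a Ka ua] := @cgC _ _ _ KG' M U id UU UK; exists a => //.
  by apply: (@cvg_dp_mul M U id (fun=> x) (fun=> y) a x y UP ua); exact: cvc_cst.
by exists k.
Qed.

Variables (x0 : E) (Q : M) (a : 'I_n -> E) (A : 'I_n -> M).
Hypothesis rt : roots K P x0 Q a A.

Lemma sec_in x : (forall i, P *m col i Q = 0 -> dp x (col i Q) = 0) -> S x.
Proof.
move=> h /=; have E := col_expand x (rt_orth rt); apply: etrans (esym E).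
rewrite {1}E mulmx_sumr.
apply: eq_bigr => i _; rewrite -scalemxAr; have [->//|Pi] := rt_split rt i.
by rewrite h // !scale0r.
Qed.

Lemma nq_col i : nq (col i Q) = 1.
Proof. by rewrite /nq (dp_col _ _ (rt_orth rt)) eqxx. Qed.

Lemma root_neq0 i : P *m col i Q = 0 -> 0 < nq (a i).
Proof.
move=> Pi; rewrite nq_gt0; apply/eqP => a0; have := rt_base1 rt Pi.
by rewrite a0 dp0l => /eqP; rewrite eq_sym oner_eq0.
Qed.

(** Over the subgroup fixing the mirror of [al], minimize [<g al, al>]. At a minimum [k], the vector
    [k al] lies in the section and is orthogonal to the mirror, hence is [al] or [- al], and the
    first case is impossible. *)
Theorem root_reflection i : P *m col i Q = 0 -> exists k, [/\ K k, k *m P = P *m k &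
  forall xi, S xi -> k *m xi = xi - (2 * dp (a i) xi / nq (a i)) *: a i].
Proof.
move=> Pi; set al := a i; have al0 : 0 < nq al := root_neq0 Pi.
have Sal : S al := rt_sec rt i.
pose Z x := S x /\ dp al x = 0; pose K1 g := K g /\ forall x, Z x -> g *m x = x.
have KG1 : cgrp K1 by exact: cgrp_fix.
have [k [Kk fk] kmin] := dp_max al (- al) KG1.
have {}kmin g : K1 g -> dp (k *m al) al <= dp (g *m al) al.
  by move=> /kmin; rewrite !dpNr lerN2.
have Ok := cg_orth KG Kk.
have Z_split x : S x -> Z (x - (dp al x / nq al) *: al).
  move=> Sx; split; first by rewrite mulmxBr Sx -scalemxAr Sal.
  by rewrite dpDr dpNr dpZr -/(nq al) divfK ?subrr // gt_eqF.
have kZ x : Z x -> k^T *m x = x by move=> Zx; rewrite -{1}(fk x Zx) orthTK.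
have orth_e j : P *m col j Q = 0 -> dp (k *m al) (col j Q) = 0.
  move=> Pj; have Sj := rt_sec rt j.
  have [Za _] := Z_split _ Sj; set eta := a j - _ in Za.
  (* If [a j] is a multiple of [al], the normalization makes them equal, and [A j] generates a
     subgroup fixing the mirror, along which [k] is critical. Otherwise [eta] is on the mirror of
     [al] but off that of [a j], and polarity is used for a conjugate of [A j]. *)
  have [eta0|eta0] := eqVneq eta 0.
    have ajE : a j = al.
      have E0 : a j = (dp al (a j) / nq al) *: al by apply/eqP; rewrite -subr_eq0; apply/eqP.
      have := rt_base1 rt Pj; rewrite E0 dpZl (rt_base1 rt Pi) mulr1 => ->.
      by rewrite scale1r.
    have lA1 : lie K1 (A j).
      apply/(lie_fix KG); split=> [|x [Sx al_x]]; first exact: (rt_lie rt).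
      by rewrite (rt_act rt Pj Sx) ajE al_x scale0r.
    have [phi op] := lie_oneparam KG1 lA1.
    have : dp (A j *m (k *m al)) al = 0.
      apply: (oneparam_crit op) => t; rewrite mulmxA; apply: kmin.
      by apply: (cgM KG1) => //; case: op.
    rewrite (lie_dp KG _ _ (rt_lie rt j)) (rt_act rt Pj Sal) ajE dpZr -/(nq al) => /eqP.
    by rewrite oppr_eq0 mulf_eq0 gt_eqF //= => /eqP.
  have Zeta : Z eta by exact: Z_split.
  have de : dp (a j) eta = nq eta.
    rewrite -[in LHS](subrK ((dp al (a j) / nq al) *: al) (a j)) -/eta dpDl dpZl.
    by case: Zeta => _ ->; rewrite mulr0 addr0.
  have lC := lieJ KG (cgT KG Kk) (rt_lie rt j); rewrite trmxK in lC.
  have : dp (k *m al) (A j *m eta) = 0.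
    rewrite dp_mulmx -{1}(fk _ Zeta) dpC !mulmxA.
    exact: (polar lC Za Sal).
  rewrite (rt_act rt Pj Za) dpZr de => /eqP; rewrite mulf_eq0 nq_eq0 (negPf eta0) /=.
  by move/eqP.
have Sk : S (k *m al) by exact: sec_in.
have kal : k *m al = - al.
  set w := k *m al in Sk orth_e kmin *; pose c := dp al w / nq al.
  have Zw := Z_split w Sk; have wE : w = c *: al.
    apply/eqP; rewrite -subr_eq0 -nq_eq0 /nq dpDl dpNl dpZl -/c; case: (Zw) => _ h.
    by rewrite h mulr0 subr0 {1}/w dp_mulmx (kZ _ Zw) h.
  have c2 : c ^+ 2 = 1.
    have := nq_orth al Ok; rewrite -/w wE nqZ => h; apply: (mulIf (x := nq al)); last by rewrite mul1r.
    by rewrite gt_eqF.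
  have : (c - 1) * (c + 1) = 0 by rewrite -subr_sqr c2 expr1n subrr.
  move/eqP; rewrite mulf_eq0 => /orP[|]; last first.
    by rewrite addr_eq0 => /eqP c1; rewrite wE c1 scaleN1r.
  (* If the minimum were [nq al], the whole subgroup would fix [al], while [A i] belongs to its Lie
     algebra and moves [al]. *)
  rewrite subr_eq0 => /eqP c1; exfalso.
  have fixal g : K1 g -> g *m al = al.
    move=> Kg; have := kmin g Kg; rewrite wE c1 scale1r -/(nq al) => h.
    apply/eqP; rewrite -subr_eq0 -nq_eq0 eq_le nq_ge0 andbT nqB (nq_orth _ (cg_orth KG1 Kg)).
    by move: h; lra.
  pose Z' x := Z x \/ x = al; pose K2 g := K g /\ forall x, Z' x -> g *m x = x.
  have lA1 : lie K1 (A i).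
    apply/(lie_fix KG); split=> [|x [Sx al_x]]; first exact: (rt_lie rt).
    by rewrite (rt_act rt Pi Sx) al_x scale0r.
  have lA2 : lie K2 (A i).
    apply: (lie_sub KG1 _ lA1) => g Kg; split; first by case: Kg.
    by move=> x [Zx|->]; [case: Kg => _; apply | exact: fixal].
  have [_ /(_ al (or_intror erefl))] := (lie_fix KG Z' (A i)).1 lA2.
  rewrite (rt_act rt Pi Sal) -/al -/(nq al) => /eqP; rewrite scaler_eq0 gt_eqF //= => /eqP e0.
  by have := nq_col i; rewrite e0 nq0 => /eqP; rewrite eq_sym oner_eq0.
have act xi : S xi -> k *m xi = xi - (2 * dp al xi / nq al) *: al.
  move=> Sxi; have := fk _ (Z_split xi Sxi); rewrite mulmxBr -scalemxAr kal scalerN opprK.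
  move/(canRL (addrK _)) => ->.
  by rewrite -addrA -opprD -scalerDl; congr (_ - _ *: _); ring.
exists k; split=> //; apply: stable_comm => // x Sx.
by rewrite act // mulmxBr Sx -scalemxAr Sal.
Qed.

Lemma regular_normal z y : S z -> (forall i, P *m col i Q = 0 -> dp (a i) z != 0) ->
  normal K z y -> S y.
Proof.
move=> Sz az ny; apply: sec_in => i Pi; have := ny _ (rt_lie rt i).
rewrite (rt_act rt Pi Sz) dpZl (dpC (col i Q)) => /eqP; rewrite mulf_eq0 (negPf (az i Pi)) /=.
by move/eqP.
Qed.

Lemma near_regular x : \forall e \near (0 : R)^'+, forall i, P *m col i Q = 0 ->
  dp (a i) (x + e *: x0) != 0.
Proof.
apply: filter_forall => i; have [Pi|Pi] := eqVneq (P *m col i Q) 0; last first.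
  by near=> e => /eqP; rewrite (negPf Pi).
have p0 : (dp (a i) x)%:P + 'X != 0 :> {poly R}.
  apply/eqP => /(congr1 (fun p : {poly R} => p`_1)); rewrite coefD coefC coefX coef0 add0r.
  by move/eqP; rewrite oner_eq0.
apply: filterS (poly_near0 p0) => e; rewrite hornerD hornerC hornerX => h _.
by rewrite dpDr dpZr (rt_base1 rt Pi) mulr1.
Unshelve. all: by end_near. Qed.

(** Maximizing [<k (y + e x0), x + e x0>] over [k] in [K] sends [y + e x0] into the
    normal space of a regular point, that is into the section. *)
Theorem weyl_orbit x g : K g -> S x -> S (g *m x) ->
  exists k, [/\ K k, k *m P = P *m k & k *m (g *m x) = x].
Proof.
move=> Kg Sx Sy; set y := g *m x in Sy *; have S0 := rt_base rt.
have /choice[k hk] (e : R) : exists k, K k /\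
    forall h, K h -> dp (h *m (y + e *: x0)) (x + e *: x0) <= dp (k *m (y + e *: x0)) (x + e *: x0).
  by have [k Kk hk] := dp_max (y + e *: x0) (x + e *: x0) KG; exists k.
have [U [UU oU]] := ultraFilterLemma (at_right_proper_filter (0 : R)).
have UP : ProperFilter U := @ultra_proper _ _ UU.
have [|k0 Kk0 kk] := @cgC _ _ _ KG R U k UU.
  by apply: (@filterE _ U) => e; have [] := hk e.
have Se z e : S z -> S (z + e *: x0) by move=> Sz; rewrite mulmxDr -scalemxAr Sz S0.
have comm : \forall e \near U, k e *m P = P *m k e.
  apply: filterS (filterI (oU _ (near_regular x)) (oU _ (near_regular y))) => e [rx ry].
  have [Kk kmax] := hk e; have Ok := cg_orth KG Kk.
  set x1 := x + e *: x0 in rx kmax; set y1 := y + e *: x0 in ry kmax.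
  have Sk : S (k e *m y1).
    apply: (regular_normal (Se x e Sx) rx) => C lC.
    have [phi op] := lie_oneparam KG lC; rewrite (lie_dp KG _ _ lC) dpC; apply/eqP.
    rewrite oppr_eq0 -oppr_eq0 -dpNr; apply/eqP.
    apply: (oneparam_crit op) => t; rewrite !dpNr lerN2 mulmxA; apply: kmax.
    by apply: (cgM KG) => //; case: op.
  have Ok' := orthT Ok.
  have : (k e)^T *m P = P *m (k e)^T.
    apply: stable_comm => // w Sw; apply: (regular_normal (Se y e Sy) ry) => C lC.
    rewrite -(dp_orth _ _ Ok) orthKT //.
    have := polar (lieJ KG Kk lC) Sk Sw; rewrite !mulmxA -[k e *m C *m _ *m _]mulmxA Ok mulmx1.
    by [].
  by move=> /(congr1 (fun X => X^T)); rewrite !trmx_mul trmxK PT.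
have e0 : e @[e --> U] --> (0 : R).
  apply/cvgrPdist_lt => r r0; apply: oU.
  apply: (filterS _ (filterI (nbhs_right_gt (0 : R)) (nbhs_right_lt r0))) => t [t0 tr].
  by rewrite sub0r normrN gtr0_norm.
have lim z : cvc U (fun e => z + e *: x0) z.
  rewrite -[X in cvc _ _ X]addr0 -(scale0r x0); apply: cvcD; first exact: cvc_cst.
  by apply: cvcZ => //; exact: cvc_cst.
exists k0; split=> //.
  have Pc : mcvg U (fun=> P) P by move=> i j; exact: cvg_cst.
  apply: (mcvg_uniq UP (mcvgM UP kk Pc)).
  by apply: (mcvg_eq UP _ (mcvgM UP Pc kk)); apply: filterS comm => e ->.
have gc : mcvg U (fun=> g^T) g^T by move=> i j; exact: cvg_cst.
have ge : nq x <= dp (k0 *m y) x.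
  have -> : nq x = dp (g^T *m y) x by rewrite /y orthTK //; exact: (cg_orth KG).
  rewrite -subr_ge0.
  have c1 : dp (k e *m (y + e *: x0)) (x + e *: x0) - dp (g^T *m (y + e *: x0)) (x + e *: x0)
      @[e --> U] --> dp (k0 *m y) x - dp (g^T *m y) x.
    by apply: cvgB; apply: cvg_dp_mul.
  apply: (cvg_ge_cst UP c1); apply: (@filterE _ U) => e; rewrite subr_ge0.
  by have [_] := hk e; apply; exact: (cgT KG).
apply/eqP; rewrite -subr_eq0 -nq_eq0 eq_le nq_ge0 andbT nqB (nq_orth _ (cg_orth KG Kk0)).
by rewrite {1}/y (nq_orth _ (cg_orth KG Kg)); move: ge; lra.
Qed.

End Weyl.

(** * Division by linear forms *)

Section Directional.
Variables (R : realType) (n : nat).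
Notation M := 'M[R]_n.
Notation E := 'cV[R]_n.
Implicit Types (f : E -> R) (x y z b : E).

Lemma dd_grad f x : polyf f -> exists g, forall y, dd y f x = dp y g.
Proof.
move=> pf; exists (\col_i pd i f x) => y; rewrite dd_pd //.
by apply: eq_bigr => i _; rewrite mxE.
Qed.

Lemma ddZv (c : R) y f x : polyf f -> dd (c *: y) f x = c * dd y f x.
Proof. by move=> /(dd_grad x)[g h]; rewrite !h dpZl. Qed.

Lemma dd_polyD f (y z : E) x : polyf f -> (forall s : R, dd y f (x + s *: y) + s * dd z f (x + s *: y) = 0) ->
  dd y (dd y f) x + dd z f x = 0.
Proof.
move=> pf h; pose p := line (dd y f) x y + 'X * line (dd z f) x y.
have p0 : p = 0.
  apply: poly_inj_horner => s; rewrite horner0 hornerD hornerM hornerX !lineE ?h //; exact: polyf_dd.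
have := congr1 (fun q : {poly R} => q`_1) p0; rewrite coef0 coefD coefXM /= line_coef0 //.
exact: polyf_dd.
Qed.

Lemma dp_cancel b f : 0 < nq b -> polyf f -> (forall x, dp b x * f x = 0) -> forall x, f x = 0.
Proof.
move=> b0 pf h x; pose p := (dp b x)%:P + nq b *: 'X.
have p0 : p != 0.
  apply/eqP => /(congr1 (fun p : {poly R} => p`_1)); rewrite coefD coefC coefZ coefX coef0 add0r mulr1.
  by move/eqP; rewrite gt_eqF.
have : p * line f x b = 0.
  apply: poly_inj_horner => s; rewrite horner0 hornerM lineE // -(h (x + s *: b)).
  by rewrite /p hornerD hornerC hornerZ hornerX dpDr dpZr [s * _]mulrC.
move/eqP; rewrite mulf_eq0 (negPf p0) /= => /eqP l0.
by have := line_coef0 x b pf; rewrite l0 coef0.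
Qed.

(** Taylor expansion along [b] from the foot [T x] of [x] on the hyperplane: the constant term
    vanishes, and [dp b x] factors out of the others. *)
Lemma dp_divide b f : 0 < nq b -> polyf f -> (forall x, dp b x = 0 -> f x = 0) ->
  exists2 q, polyf q & forall x, f x = dp b x * q x.
Proof.
move=> b0 pf h; pose b' := (nq b)^-1 *: b.
pose T : M := 1%:M - b' *m b^T.
have TE x : T *m x = x - dp b x *: b'.
  rewrite mulmxBl mul1mx -mulmxA; congr (_ - _); apply/colP => i.
  rewrite mxE big_ord1 [RHS]mxE mulrC; congr (_ * _); rewrite mxE.
  by apply: eq_bigr => j _; rewrite mxE.
have [N hN] := size_line pf.
exists (fun x => \sum_(j < N) (line f (T *m x) b')`_(j.+1) * dp b x ^+ j).
  apply: polyf_sum => j; apply: polyf_mul.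
    exact: (polyf_comp_lin T (polyf_line_l b' j.+1 pf)).
  by apply: polyf_exp; apply: polyf_ext (polyf_dp b) => x; exact: dpC.
move=> x; have -> : f x = (line f (T *m x) b').[dp b x] by rewrite lineE // TE subrK.
rewrite (@horner_coef_wide _ N.+1) ?(leq_trans (hN _ _)) // big_ord_recl line_coef0 // h; last first.
  by rewrite TE dpDr dpNr dpZr dpZr -/(nq b) mulVf ?mulr1 ?subrr // gt_eqF.
rewrite mul0r add0r mulr_sumr; apply: eq_bigr => j _.
by rewrite lift0 exprS; ring.
Qed.

Lemma dd_even f b : polyf f -> (forall x, dp b x = 0 -> forall s, f (x + s *: b) = f (x - s *: b)) ->
  forall x, dp b x = 0 -> dd b f x = 0.
Proof.
move=> pf h x bx; have E : line f x (-1 *: b) = line f x b.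
  by apply: line_uniq => s; rewrite lineE // h // scalerA mulrN1 scaleNr.
have := line_scale x b (-1) 1 pf; rewrite E expr1 mulN1r /dd; lra.
Qed.

End Directional.

(** * Surjectivity of the restriction to the section *)

Section Chevalley.
Variables (R : realType) (n : nat).
Notation M := 'M[R]_n.
Notation E := 'cV[R]_n.
Variables (K : M -> Prop) (P : M).
Hypothesis KG : cgrp K.
Hypothesis PT : P^T = P.
Hypothesis PP : P *m P = P.
Notation S := (fun x : E => P *m x = x).
Hypothesis cover : forall x, exists2 k, K k & S (k *m x).
Hypothesis polar : forall A x y, lie K A -> S x -> S y -> dp (A *m x) y = 0.
Implicit Types (B C D g : M) (x y z xi : E) (p v w : E -> R).
Variables (x0 : E) (Q : M) (a : 'I_n -> E) (A : 'I_n -> M).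
Hypothesis rt : roots K P x0 Q a A.

Definition Weyl g := K g /\ g *m P = P *m g.

Lemma Weyl_orth : korth Weyl.
Proof. by move=> g [Kg _]; exact: (cg_orth KG). Qed.

(** A function on the section is stored as its pullback by [P], so that derivatives and Laplacians
    of the ambient space apply to it. *)
Definition on_sec v := [/\ polyf v, forall x, v (P *m x) = v x & kinv Weyl v].

Notation pos i := (P *m col i Q = 0).

Definition radial v (q : 'I_n -> E -> R) := forall i, polyf (q i) /\
  (pos i -> forall x, dd (a i) v x = dp (a i) x * q i x).

(** The radial part of the Laplacian; [q i] is [dd (a i) v] divided by the root. *)
Definition Lop v (q : 'I_n -> E -> R) x := lap v x + \sum_(i | P *m col i Q == 0) q i x.

Lemma dp_secr i x : dp (a i) (P *m x) = dp (a i) x.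
Proof. by rewrite -(dp_proj PT) (rt_sec rt). Qed.

Lemma cancel_sec i f : pos i -> polyf f -> (forall x, S x -> dp (a i) x * f x = 0) ->
  forall x, S x -> f x = 0.
Proof.
move=> Pi pf h x Sx; rewrite -Sx.
apply: (@dp_cancel _ _ (a i) (fun z => f (P *m z)) (root_neq0 rt Pi)) => [|z].
  exact: polyf_comp_lin.
by rewrite -dp_secr h // mulmxA PP.
Qed.

(** Invariance under the reflection makes [v] even across the mirror, so its derivative along the
    root vanishes there and is divisible by the root. *)
Lemma radial_exists v : on_sec v -> exists q, radial v q.
Proof.
move=> ov; have [pv vP vW] := ov.
have /choice[q hq] i : exists q, polyf q /\ (pos i -> forall x, dd (a i) v x = dp (a i) x * q x).
  have [Pi|Pi] := eqVneq (P *m col i Q) 0; last first.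
    by exists (fun=> 0); split; [exact: polyf_cst | move/eqP; rewrite (negPf Pi)].
  have [k [Kk kP kE]] := root_reflection KG PT PP polar rt Pi.
  have a0 := root_neq0 rt Pi.
  have [|q pq qE] := dp_divide a0 (polyf_dd (a i) pv); last by exists q.
  apply: dd_even => // x ax s.
  have kW : Weyl k by [].
  rewrite -[LHS]vP -[RHS]vP -(vW k (P *m _) kW) kE ?mulmxA ?PP //; congr (v _).
  rewrite dp_secr !mulmxDr dpDr ax add0r mulmxN -!scalemxAr (rt_sec rt) dpZr -/(nq (a i)).
  have -> : 2 * (s * nq (a i)) / nq (a i) = s + s by rewrite mulrA mulfK ?gt_eqF //; ring.
  by rewrite scalerDl opprD addrA addrK.
by exists q => i; exact: hq.
Qed.

Lemma on_secD v w : on_sec v -> on_sec w -> on_sec (fun x => v x + w x).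
Proof.
move=> [pv vP vW] [pw wP wW]; split; first exact: polyf_add.
  by move=> x; rewrite vP wP.
exact: kinvD.
Qed.

Lemma on_secZ (c : R) v : on_sec v -> on_sec (fun x => c * v x).
Proof.
move=> [pv vP vW]; split; first exact: polyf_mul (polyf_cst _ _) pv.
  by move=> x; rewrite vP.
by move=> g x Wg; rewrite vW.
Qed.

Lemma radial_lin (c : R) v w q q' : polyf v -> polyf w -> radial v q -> radial w q' ->
  radial (fun x => v x + c * w x) (fun i x => q i x + c * q' i x).
Proof.
move=> pv pw rq rq' i; have [pq hq] := rq i; have [pq' hq'] := rq' i.
have pc f : polyf f -> polyf (fun x => c * f x) by move=> pf; exact: polyf_mul (polyf_cst _ _) pf.
split=> [|Pi x]; first by apply: polyf_add => //; exact: pc.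
by rewrite ddD ?ddZ ?hq ?hq' //; [ring | exact: pc].
Qed.

Lemma Lop_lin (c : R) v w q q' x : polyf v -> polyf w ->
  Lop (fun x => v x + c * w x) (fun i x => q i x + c * q' i x) x = Lop v q x + c * Lop w q' x.
Proof.
move=> pv pw; rewrite /Lop lapD ?lapZ //; last exact: polyf_mul (polyf_cst _ _) pw.
by rewrite big_split /= -mulr_sumr; ring.
Qed.

Definition sec_fun p x := p (P *m x).

Lemma on_sec_kinv p : polyf p -> kinv K p -> on_sec (sec_fun p).
Proof.
move=> pp Kp; split; first exact: polyf_comp_lin.
  by move=> x; rewrite /sec_fun mulmxA PP.
by move=> g x [Kg gP]; rewrite /sec_fun mulmxA -gP -mulmxA Kp.
Qed.

(** Off the mirror of [a i], the direction [col i Q] is tangent to the orbit; on the mirror the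
    claim follows by cancelling the root. *)
Lemma dd_normal p x i : polyf p -> kinv K p -> S x -> pos i -> dd (col i Q) p x = 0.
Proof.
move=> pp Kp Sx Pi; apply: (cancel_sec Pi (polyf_dd (col i Q) pp)) Sx => y Sy.
by rewrite -ddZv // -(rt_act rt Pi Sy) (kinv_dd KG) //; exact: (rt_lie rt).
Qed.

Lemma dd_proj p x y : polyf p -> kinv K p -> S x -> dd y p x = dd (P *m y) p x.
Proof.
move=> pp Kp Sx; have [g hg] := dd_grad x pp.
rewrite !hg (col_expand y (rt_orth rt)) mulmx_sumr !dp_suml; apply: eq_bigr => i _.
rewrite -scalemxAr !dpZl; have [->//|Pi] := rt_split rt i.
by rewrite Pi dp0l -hg dd_normal.
Qed.

(** For [e = col i Q], differentiating the invariance of [p] twice along [A i] gives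
    [<a i, z> ^ 2 p_ee = <a i, z> d_(a i) p] on the section, so that the second derivative along [e]
    is the quotient [q i]. *)
Lemma lap_radial p q x : polyf p -> kinv K p -> radial (sec_fun p) q -> S x ->
  Lop (sec_fun p) q x = lap p x.
Proof.
move=> pp Kp rq Sx; have [ps _ _] := on_sec_kinv pp Kp.
have dds y z : dd y (sec_fun p) z = dd (P *m y) p (P *m z) by rewrite -dd_comp_lin.
rewrite /Lop !(lap_basis x _ (rt_orth rt)) //.
rewrite (bigID (fun i => P *m col i Q == 0)) /= [X in X + _ + _]big1 ?add0r; last first.
  move=> i /eqP Pi; have -> : dd (col i Q) (sec_fun p) = fun=> 0.
    by apply/funext => z; rewrite dds Pi dd0.
  by rewrite dd_cst.
rewrite [RHS](bigID (fun i => P *m col i Q == 0)) /= [LHS]addrC; congr (_ + _); last first.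
  apply: eq_bigr => i Pi; have [Pc|/eqP] := rt_split rt i; last by rewrite (negPf Pi).
  have -> : dd (col i Q) (sec_fun p) = fun z => dd (col i Q) p (P *m z).
    by apply/funext => z; rewrite dds Pc.
  by rewrite dd_comp_lin ?Pc ?Sx //; exact: polyf_dd.
apply: eq_bigr => i /eqP Pi; have [pq hq] := rq i; set e := col i Q in Pi *.
apply/eqP; rewrite -subr_eq0; apply/eqP.
have pd2 : polyf (dd e (dd e p)) by apply: polyf_dd; exact: polyf_dd.
have pr : polyf (fun z => q i z - dd e (dd e p) z) by exact: polyf_sub.
apply: (cancel_sec Pi pr) Sx => y Sy.
have pd1 : polyf (dd (a i) p) by exact: polyf_dd.
rewrite mulrBr -hq // dds Sy (rt_sec rt).
apply: (@cancel_sec i (fun z => dd (a i) p z - dp (a i) z * dd e (dd e p) z) Pi _ _ y Sy).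
  apply: polyf_sub => //; apply: polyf_mul => //.
  by apply: polyf_ext (polyf_dp (a i)) => z; exact: dpC.
move=> z Sz; have lA := rt_lie rt i; have Az := rt_act rt Pi Sz.
have := @dd_polyD R n p (A i *m z) (A i *m (A i *m z)) z pp.
have -> : dd (A i *m z) (dd (A i *m z) p) z = dp (a i) z ^+ 2 * dd e (dd e p) z.
  rewrite Az ddZv; last exact: polyf_dd.
  have -> : dd (dp (a i) z *: e) p = fun y => dp (a i) z * dd e p y.
    by apply/funext => y'; rewrite ddZv.
  by rewrite ddZ ?expr2 ?mulrA //; exact: polyf_dd.
(* Skew symmetry of [A i] turns [A i xi = <a i, xi> e] into [P (A i e) = - a i]. *)
have PAe : P *m (A i *m e) = - a i.
  apply/eqP; rewrite -subr_eq0 opprK -{1}(rt_sec rt i) -mulmxDr; apply/eqP/(proj_eq0 PT PP) => w Sw.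
  rewrite dpDl (lie_dp KG _ _ lA) (rt_act rt Pi Sw) dpZr -/(nq _) (nq_col rt) mulr1.
  by rewrite addrC subrr.
have -> : dd (A i *m (A i *m z)) p z = dp (a i) z * (-1 * dd (a i) p z).
  by rewrite Az -scalemxAr ddZv // (dd_proj _ pp Kp Sz) PAe -scaleN1r ddZv.
move=> h; have {}h := h _; rewrite mulrBr; have -> : forall X Y Z : R, X * Y - X * (X * Z) = - (X ^+ 2 * Z + X * (-1 * Y)).
  by move=> X Y Z; ring.
rewrite h ?oppr0 // => t.
have [gr hg] := dd_grad (z + t *: (A i *m z)) pp.
have := kinv_dd KG (z + t *: (A i *m z)) pp Kp lA.
by rewrite !hg mulmxDr -scalemxAr dpDl dpZl.
Qed.

(** [g] need not permute the columns of [Q], but wherever [o i j] is nonzero it matches the root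
    [a i] with a multiple of [a j] and [q i] with [q j]. The squares of the [o i j] form a doubly
    stochastic matrix, so the sums agree. *)
Theorem Lop_Weyl v q g x : on_sec v -> radial v q -> Weyl g -> S x -> Lop v q (g *m x) = Lop v q x.
Proof.
move=> ov rq Wg Sx; have [pv vP vW] := ov; have [Kg gP] := Wg.
have Og := cg_orth KG Kg; have Og' := orthT Og.
have gTP : g^T *m P = P *m g^T by rewrite -{1}PT -trmx_mul -gP trmx_mul PT.
rewrite /Lop (kinv_lap Weyl_orth pv vW) //; congr (_ + _).
pose o i j := dp (g^T *m col i Q) (col j Q).
have Sg y : S y -> S (g *m y) by move=> Sy; rewrite mulmxA -gP -mulmxA Sy.
have key i j : pos i -> pos j -> o i j != 0 -> q i (g *m x) = q j x.
  move=> Pi Pj oij; pose b := g^T *m a i.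
  have Sb : S b by rewrite /b mulmxA -gTP -mulmxA (rt_sec rt).
  have lC := lieJ KG (cgT KG Kg) (rt_lie rt i); rewrite trmxK in lC; set C := _ *m g in lC.
  pose c := dp (C *m x0) (col j Q); pose mu := c / o i j.
  have bE : b = mu *: a j.
    have E xi : S xi -> dp b xi * o i j = c * dp (a j) xi.
      move=> Sxi; have CE : C *m xi = dp b xi *: (g^T *m col i Q).
        by rewrite /C -!mulmxA (rt_act rt Pi (Sg _ Sxi)) -scalemxAr /b dp_mulmx trmxK.
      have := congr1 (fun u => dp u (col j Q)) (rt_gen rt lC Sxi).
      rewrite CE dpZl -/(o i j) => ->; rewrite dp_suml (bigD1 j) ?Pj //= big1 ?addr0.
        by rewrite dpZl -/(nq _) (nq_col rt) mulr1.
      move=> l /andP[_ lj]; rewrite dpZl (dp_col _ _ (rt_orth rt)) (negPf lj) mulr0 //.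
    apply/eqP; rewrite -subr_eq0 -nq_eq0; set w := b - _.
    have Sw : S w by rewrite mulmxBr Sb -scalemxAr (rt_sec rt).
    rewrite /nq {1}/w dpDl dpNl dpZl subr_eq0 -(inj_eq (mulIf oij)) E //.
    by rewrite /mu mulrAC divfK.
  have mu0 : mu != 0.
    apply/eqP => mu0; have := nq_orth (a i) Og'; rewrite -/b bE mu0 scale0r nq0 => /esym/eqP.
    by rewrite gt_eqF // (root_neq0 rt).
  have [pqi hqi] := rq i; have [pqj hqj] := rq j.
  apply/eqP; rewrite -subr_eq0; apply/eqP.
  have pr : polyf (fun z => q i (g *m z) - q j z) by apply: polyf_sub => //; exact: polyf_comp_lin.
  apply: (cancel_sec Pj pr) Sx => z Sz; apply: (mulfI mu0); rewrite mulr0 mulrBr.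
  have e1 : dd (a i) v (g *m z) = mu * (dp (a j) z * q j z).
    rewrite -hqj // -ddZv // -bE -[a i](orthKT _ Og) -/b -dd_comp_lin //; congr (dd _ _ _).
    by apply/funext => u; rewrite vW.
  rewrite mulrBr mulrA -[mu * dp _ _]dpZl -bE /b -e1 hqi //.
  by rewrite [dp (g^T *m _) _]dp_mulmx trmxK subrr.
have par (i : 'I_n) : pos i -> \sum_(j | P *m col j Q == 0) o i j ^+ 2 = 1.
  move=> Pi; rewrite -(nq_col rt i) -(nq_orth (col i Q) Og') /nq.
  rewrite {2}(col_expand (g^T *m col i Q) (rt_orth rt)) dp_sumr.
  rewrite [RHS](bigID (fun j => P *m col j Q == 0)) /= [X in _ + X]big1 ?addr0.
    by apply: eq_bigr => j _; rewrite dpZr expr2.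
  move=> j Pj; have [Pc|/eqP] := rt_split rt j; last by rewrite (negPf Pj).
  by rewrite dpZr -{1}Pc -(dp_proj PT) mulmxA -gTP -mulmxA Pi mulmx0 dp0l mul0r.
have par' (j : 'I_n) : pos j -> \sum_(i | P *m col i Q == 0) o i j ^+ 2 = 1.
  move=> Pj; rewrite -(nq_col rt j) -(nq_orth (col j Q) Og) /nq.
  rewrite {2}(col_expand (g *m col j Q) (rt_orth rt)) dp_sumr.
  rewrite [RHS](bigID (fun j => P *m col j Q == 0)) /= [X in _ + X]big1 ?addr0.
    by apply: eq_bigr => i _; rewrite dpZr -expr2 /o dp_mulmx trmxK dpC.
  move=> i Pi; have [Pc|/eqP] := rt_split rt i; last by rewrite (negPf Pi).
  by rewrite dpZr -{1}Pc -(dp_proj PT) mulmxA -gP -mulmxA Pj mulmx0 dp0l mul0r.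
transitivity (\sum_(i | P *m col i Q == 0) \sum_(j | P *m col j Q == 0) o i j ^+ 2 * q j x).
  apply: eq_bigr => i /eqP Pi; rewrite -[LHS]mul1r -(par i Pi) mulr_suml.
  apply: eq_bigr => j /eqP Pj; have [->|oij] := eqVneq (o i j) 0; first by rewrite expr0n !mul0r.
  by rewrite (key i j).
rewrite exchange_big /=; apply: eq_bigr => j /eqP Pj.
by rewrite -mulr_suml par' // mul1r.
Qed.

Lemma polyf_Lop v q : polyf v -> radial v q -> polyf (Lop v q).
Proof.
move=> pv rq; apply: polyf_add; first exact: polyf_lap.
by apply: polyf_sum => i; have [] := rq i.
Qed.

Lemma Lop_homog m v q s x : on_sec v -> radial v q -> homog m v ->
  s ^+ 2 * Lop v q (s *: x) = s ^+ m * Lop v q x.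
Proof.
move=> [pv vP vW] rq hv; rewrite /Lop mulrDr (lap_homog pv hv) mulrDr; congr (_ + _).
rewrite !mulr_sumr; apply: eq_bigr => i /eqP Pi; have [pq hq] := rq i.
apply/eqP; rewrite -subr_eq0; apply/eqP.
have pc c f : polyf f -> polyf (fun x => c * f x) by move=> pf; exact: polyf_mul (polyf_cst _ _) pf.
apply: (@dp_cancel _ _ (a i) (fun z => s ^+ 2 * q i (s *: z) - s ^+ m * q i z) (root_neq0 rt Pi)).
  apply: polyf_sub; apply: (pc) => //.
  by apply: polyf_ext (polyf_comp_lin s%:M pq) => z; rewrite mul_scalar_mx.
move=> z; have := dd_homog (a i) pv hv s z; rewrite !hq // dpZr => h.
rewrite mulrBr [X in _ - X]mulrCA -h expr2; ring.
Qed.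

(* At an interior maximum lying on a root hyperplane the singular term of [Lop]
   is a second derivative along the root, so that it is nonpositive too. *)
Lemma sec_maximum p (c : R) v q : polyf p -> kinv K p -> (forall x, S x -> 0 < lap p x) ->
  on_sec v -> radial v q -> (forall y, S y -> Lop v q y = 0) ->
  exists x, [/\ S x, nq x = 1 & forall y, S y -> nq y <= 1 -> p y + c * v y <= p x + c * v x].
Proof.
move=> pp Kp lp ov rq Lv; have [pv vP _] := ov; have op := on_sec_kinv pp Kp.
have [ps sP _] := op; have [qp rqp] := radial_exists op.
pose G x := sec_fun p x + c * v x; pose qG i x := qp i x + c * q i x.
have rG : radial G qG by exact: radial_lin.
have pG : polyf G by apply: polyf_add => //; exact: polyf_mul (polyf_cst _ _) pv.
have GP x : G (P *m x) = G x by rewrite /G sP vP.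
have [x1 x1b hmax] := ball_max ler01 pG.
pose z := P *m x1; have Sz : S z by rewrite /z mulmxA PP.
have nz : nq z <= 1.
  apply: le_trans x1b; have := nq_ge0 (x1 - P *m x1); rewrite nqB.
  have -> : dp x1 (P *m x1) = nq z by rewrite /nq /z (dp_proj PT) mulmxA PP.
  by rewrite -/z; lra.
have zmax y : nq y <= 1 -> G y <= G z by move=> /hmax; rewrite /z GP.
exists z; split=> //; last first.
  by move=> y Sy ny; have := zmax y ny; rewrite /G /sec_fun Sy Sz.
apply/eqP; rewrite eq_le nz leNgt; apply/negP => z1.
have : 0 < Lop G qG z by rewrite Lop_lin // lap_radial // Lv // mulr0 addr0 lp.
apply/negP; rewrite -leNgt /Lop.
have l1 : lap G z <= 0 by apply: sumr_le0 => i _; have [] := max_dd pG z1 zmax (delta_mx i 0).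
have l2 : \sum_(i | P *m col i Q == 0) qG i z <= 0.
  apply: sumr_le0 => i /eqP Pi; have [pq hq] := rG i.
  have [d1 d2] := max_dd pG z1 zmax (a i); have a0 := root_neq0 rt Pi.
  have [az|az] := eqVneq (dp (a i) z) 0; last first.
    by move: d1; rewrite hq // => /eqP; rewrite mulf_eq0 (negPf az) /= => /eqP ->.
  move: d2; have -> : dd (a i) G = fun x => dp (a i) x * qG i x by apply/funext => x; exact: hq.
  have pa : polyf (dp (a i)) by apply: polyf_ext (polyf_dp (a i)) => x; exact: dpC.
  have [g hg] := dd_grad z pa.
  rewrite ddM // az mul0r addr0; have -> : dd (a i) (dp (a i)) z = nq (a i).
    by apply: (@addIr _ 0); rewrite addr0 addr0 /dd (@line_uniq _ _ _ _ _ ((dp (a i) z)%:P + nq (a i) *: 'X)) ?coefD ?coefC ?coefZ ?coefX ?add0r ?mulr1 // => s; rewrite hornerD hornerC hornerZ hornerX dpDr dpZr mulrC.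
  by rewrite pmulr_rle0.
by lra.
Qed.

Lemma hcomp_sec v j : on_sec v -> on_sec (hcomp j v).
Proof.
move=> [pv vP vW]; split; [exact: polyf_hcomp | | exact: kinv_hcomp].
move=> x; rewrite /hcomp (_ : line v 0 (P *m x) = line v 0 x) //; apply: line_uniq => s.
by rewrite lineE // !add0r scalemxAr vP.
Qed.

Lemma hcomp_on_sec p v j : polyf p -> polyf v -> homog j v -> (forall x, S x -> p x = v x) ->
  forall x, S x -> hcomp j p x = v x.
Proof.
move=> pp pv hv pE x Sx; have <- : hcomp j v x = v x by rewrite (hcomp_homog x pv hv) eqxx.
rewrite /hcomp (_ : line p 0 x = line v 0 x) //; apply: line_uniq => s.
by rewrite lineE // !add0r pE // -scalemxAr Sx.
Qed.

(** [U], the [K]-invariant extension of [v], is a uniform limit on the unit ball of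
    harmonic [K]-invariant polynomials, by the maximum principle for [Lop]. *)
Lemma extend_null m v q : (0 < n)%N -> on_sec v -> homog m v -> radial v q ->
  (forall y, S y -> Lop v q y = 0) ->
  exists p, [/\ polyf p, kinv K p & forall x, S x -> p x = v x].
Proof.
move=> n0 ov hv rq Lv; have [pv vP vW] := ov.
have /choice[k hk] x : exists k, K k /\ S (k *m x) by have [k] := cover x; exists k.
(* Independent of the choice of [k x]: by [weyl_orbit], two points of the section in one orbit
   differ by an element of [Weyl], under which [v] is invariant. *)
pose U x := v (k x *m x).
have UE g x : K g -> S (g *m x) -> U x = v (g *m x).
  move=> Kg Sg; have [Kk Sk] := hk x.
  have [|h [Kh hP hE]] := @weyl_orbit R n K P KG PT PP polar x0 Q a A rt (k x *m x)
      (g *m (k x)^T) (cgM KG Kg (cgT KG Kk)) Sk.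
    by rewrite -mulmxA orthTK //; exact: (cg_orth KG).
  rewrite /U -hE vW //; first by rewrite -mulmxA orthTK //; exact: (cg_orth KG).
have US x : S x -> U x = v x.
  by move=> Sx; rewrite (UE 1%:M) ?mul1mx //; exact: (cg1 KG).
have UK : kinv K U.
  move=> g x Kg; have [Kk Sk] := hk (g *m x).
  by rewrite (UE (k (g *m x) *m g) x) -?mulmxA //; exact: (cgM KG).
have Uh t x : U (t *: x) = t ^+ m * U x.
  have [Kk Sk] := hk x; rewrite (UE (k x)) //; first by rewrite -scalemxAr hv.
  by rewrite -!scalemxAr Sk.
have Uc : ucont U.
  move=> T F u b UF ub; have FP : ProperFilter F := @ultra_proper _ _ UF.
  have [|k0 Kk0 kk] := @cgC _ _ _ KG T F (fun t => k (u t)) UF.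
    by apply: (@filterE _ F) => t; have [] := hk (u t).
  have kc := mcvg_mulv FP kk ub.
  rewrite (UE k0) //; first exact: polyf_cvc.
  by apply: (cvc_closed FP kc); apply: (@filterE _ F) => t; have [] := hk (u t).
have approx (j : nat) : exists h, [/\ polyf h, kinv K h, forall x, lap h x = 0 &
    forall x, nq x <= 1 -> `|h x - U x| <= j.+1%:R^-1].
  have e0 : 0 < j.+1%:R^-1 :> R by rewrite invr_gt0 ltr0n.
  move: (j.+1%:R^-1) e0 => e e0.
  have [p [pp Kp pU]] := invariant_approx (cgM KG) (cg1 KG) (cg_orth KG) Uc UK e0.
  have [h [ph Kh lh hp]] := harmonic_replacement n0 (cg_orth KG) pp Kp.
  exists h; split=> // x x1; have [Kk Sk] := hk x.
  rewrite -(Kh _ _ Kk) -(UK _ _ Kk) US //.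
  have : nq (k x *m x) <= 1 by rewrite nq_orth //; exact: (cg_orth KG).
  move: (k x *m x) Sk => y Sy y1.
  (* For [c] equal to [1] or [-1], the maximum of [c (h - v) + r nq] on the section is reached on
     the unit sphere, where [h] equals the polynomial approximating [U]. *)
  have bound (c : R) : c ^+ 2 = 1 -> c * (h y - v y) <= e.
    move=> c2; apply/ler_addgt0Pr => r r0.
    have pn : polyf (fun z : E => r * nq z) by apply: polyf_mul (polyf_cst _ _) (polyf_nq _ _).
    have ph' : polyf (fun z => c * h z) by exact: polyf_mul (polyf_cst _ _) ph.
    have [|||z [Sz z1 zmax]] := @sec_maximum (fun z => c * h z + r * nq z) (- c) v q _ _ _ ov rq Lv.
    - exact: polyf_add.
    - move=> g z Kg; rewrite Kh // (kinv_nq (cg_orth KG)) //.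
    - move=> z _; rewrite lapD // lapZ // lh mulr0 add0r lapZ ?lap_nq; last exact: polyf_nq.
      by rewrite mulr_gt0 // mulr_gt0 // ltr0n.
    have := zmax y Sy y1; rewrite z1 mulr1 -(US z) // => h1.
    have h2 : c * (h z - U z) <= e.
      have := pU z; rewrite z1 lexx -hp // distrC => /(_ isT) h3.
      apply: le_trans h3; rewrite -[leRHS]mul1r -(_ : `|c| = 1) -?normrM ?ler_norm //.
      by apply/eqP; rewrite -(@eqrXn2 _ 2) // expr1n real_normK ?num_real // c2.
    have h3 : 0 <= r * nq y by rewrite mulr_ge0 ?nq_ge0 // ltW.
    by move: h1 h2; rewrite !mulrBr !mulNr; lra.
  have b1 := bound 1 (expr1n _ _); have b2 : -1 * (h y - v y) <= e by apply: bound; rewrite sqrrN expr1n.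
  by rewrite ler_norml; apply/andP; split; move: b1 b2; lra.
have /choice[h hh] := approx.
exists U; split=> //.
apply: (@harmonic_limit R n m h U n0) => [j|j x|j x|t x _]; last exact: Uh; by have [] := hh j; auto.
Qed.

(** The radial part of [v] has degree [m - 2] and extends to a [K]-invariant [f] by induction. With
    [f] written as the Laplacian of [p = nq * r], the difference [v - p] is annihilated by the
    radial part. *)
Theorem chevalley_homog m v : (0 < n)%N -> on_sec v -> homog m v ->
  exists p, [/\ polyf p, kinv K p & forall x, S x -> p x = v x].
Proof.
move=> n0; have [N] := ubnP m; elim: N m v => // N IH m v mN ov hv.
have [pv vP vW] := ov; have [q rq] := radial_exists ov.
have pL := polyf_Lop pv rq.
have oL : on_sec (sec_fun (Lop v q)).
  split; first exact: polyf_comp_lin.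
    by move=> x; rewrite /sec_fun mulmxA PP.
  move=> g x Wg; have [_ gP] := Wg.
  by rewrite /sec_fun mulmxA -gP -mulmxA (Lop_Weyl ov rq Wg) // mulmxA PP.
have pL' : polyf (sec_fun (Lop v q)) by case: oL.
have hL s x : s ^+ 2 * sec_fun (Lop v q) (s *: x) = s ^+ m * sec_fun (Lop v q) x.
  by rewrite /sec_fun -scalemxAr (Lop_homog s _ ov rq hv).
have [m2|m2] := ltnP m 2.
  apply: (extend_null n0 ov hv rq) => y Sy.
  by have := homog_cancel0 pL' m2 hL y; rewrite /sec_fun Sy.
pose l := (m - 2)%N; have ml : m = (2 + l)%N by rewrite /l subnKC.
have hL' : homog l (sec_fun (Lop v q)) by apply: (@homog_cancel _ _ 2 l _ _ pL') => s x; rewrite -ml; exact: hL.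
have [|f [pf Kf fE]] := IH l _ _ oL hL'; first by move: mN; rewrite ml; lia.
have fE' := hcomp_on_sec pf pL' hL' fE.
have pf' := polyf_hcomp l pf; have hf' := homog_hcomp l pf.
have c0 : 0 < 4 * l%:R + 2 * n%:R :> R by rewrite ltr_wpDl ?mulr_ge0 // mulr_gt0 // ltr0n.
have [r [pr hr Kr rE]] := solve_nq_lap (cg_orth KG) c0 pf' hf' (kinv_hcomp l pf Kf).
pose p x := nq x * r x.
have pp : polyf p by apply: polyf_mul => //; exact: polyf_nq.
have Kp : kinv K p by apply: kinvM => //; exact: (kinv_nq (cg_orth KG)).
have hp : homog m p by rewrite ml; apply: homogM => //; exact: homog_nq.
have lp x : lap p x = hcomp l f x by rewrite (lap_nqM x pr hr) rE.
have op := on_sec_kinv pp Kp; have [ps _ _] := op; have [qp rqp] := radial_exists op.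
have ow := on_secD ov (on_secZ (-1) op).
have rw := radial_lin (-1) pv ps rq rqp.
have hw : homog m (fun x => v x + -1 * sec_fun p x).
  by move=> s x; rewrite hv /sec_fun -scalemxAr hp; ring.
have [|p' [pp' Kp' pE']] := extend_null n0 ow hw rw.
  move=> y Sy; rewrite Lop_lin // lap_radial // lp fE' // /sec_fun Sy; ring.
exists (fun x => p' x + p x); split; [exact: polyf_add | exact: kinvD |].
by move=> x Sx; rewrite pE' // /sec_fun Sx; ring.
Qed.

Theorem chevalley_restriction v : on_sec v ->
  exists p, [/\ polyf p, kinv K p & forall x, S x -> p x = v x].
Proof.
move=> ov; have [pv _ _] := ov.
have [n0|n0] := posnP n.
  exists v; split=> // g x _; congr v; apply/colP => i; exfalso.
  by have := ltn_ord i; rewrite {2}n0.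
have /choice[p hp] j : exists p, [/\ polyf p, kinv K p & forall x, S x -> p x = hcomp j v x].
  exact: chevalley_homog n0 (hcomp_sec j ov) (homog_hcomp j pv).
have [N hN] := hcomp_sum pv; exists (fun x => \sum_(j < N) p j x); split.
- by apply: polyf_sum => j; have [] := hp j.
- by move=> g x Kg; apply: eq_bigr => j _; have [_ ->] := hp j.
- by move=> x Sx; rewrite (hN N) //; apply: eq_bigr => j _; have [_ _ ->] := hp j.
Qed.

End Chevalley.

(** * Orthonormal coordinates *)

Section InnerProduct.
Variables (R : realType) (E : innerVectType R).
Implicit Types (u v w : E) (c : R).

Lemma dotDl u v w : dot (u + v) w = dot u w + dot v w.
Proof. by have := dot_linearl 1 u v w; rewrite scale1r mul1r. Qed.

Lemma dot0l w : dot (0 : E) w = 0.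
Proof. by have := dotDl 0 0 w; rewrite addr0 => h; apply: (@addrI _ (dot 0 w)); rewrite addr0. Qed.

Lemma dotZl c u w : dot (c *: u) w = c * dot u w.
Proof. by have := dot_linearl c u 0 w; rewrite addr0 dot0l addr0. Qed.

Lemma dotZr c u w : dot w (c *: u) = c * dot w u.
Proof. by rewrite dotC dotZl dotC. Qed.

Lemma dot_suml (I : Type) (r : seq I) (Q : pred I) (F : I -> E) w :
  dot (\sum_(i <- r | Q i) F i) w = \sum_(i <- r | Q i) dot (F i) w.
Proof.
by elim/big_rec2: _ => [|i y x _ <-]; [exact: dot0l | rewrite dotDl].
Qed.

Definition orthonormal_family k (e : 'I_k -> E) := forall i j, dot (e i) (e j) = (i == j)%:R.

Lemma orthonormal_le k (e : 'I_k -> E) : orthonormal_family e -> (k <= \dim {:E})%N.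
Proof.
move=> oe; have fr : free (mktuple e).
  apply/freeP => c c0 i; have {}c0 : \sum_i c i *: e i = 0.
    by rewrite -[RHS]c0; apply: eq_bigr => j _; rewrite -tnth_nth tnth_mktuple.
  have := congr1 (fun u => dot u (e i)) c0.
  rewrite dot0l dot_suml (bigD1 i) //= big1 => [|j ji].
    by rewrite addr0 dotZl oe eqxx mulr1.
  by rewrite dotZl oe (negPf ji) mulr0.
have <- : size (mktuple e) = k by rewrite size_tuple.
by move: fr; rewrite /free => /eqP <-; apply: dimvS; exact: subvf.
Qed.

Definition frame k (U : {vspace E}) (e : 'I_k -> E) := [/\ forall i, e i \in U,
  orthonormal_family e & forall v, v \in U -> v = \sum_i dot v (e i) *: e i].

Theorem frame_exists (U : {vspace E}) : exists k (e : 'I_k -> E), frame U e.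
Proof.
pose p k := `[< exists2 e : 'I_k -> E, forall i, e i \in U & orthonormal_family e >].
have p0 : exists k, p k by exists 0%N; apply/asboolP; exists (fun=> 0) => -[].
have pn k : p k -> (k <= \dim {:E})%N by move=> /asboolP[e _ /orthonormal_le].
case: (ex_maxnP p0 pn) => k /asboolP[e eU oe] kmax; exists k, e; split=> // v vU.
apply/eqP; rewrite -subr_eq0; apply: contraT; set w := v - _ => w0; exfalso.
have wU : w \in U by rewrite rpredB // rpred_sum // => i _; exact: rpredZ.
have we i : dot w (e i) = 0.
  rewrite dotDl -scaleN1r dotZl mulN1r dot_suml (bigD1 i) //= big1 => [|j ji].
    by rewrite addr0 dotZl oe eqxx mulr1 subrr.
  by rewrite dotZl oe (negPf ji) mulr0.
have ww : 0 < dot w w by apply: dot_gt0.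
pose c := (Num.sqrt (dot w w))^-1.
have cc : c * (c * dot w w) = 1.
  by rewrite mulrA -expr2 exprVn sqr_sqrtr ?(ltW ww) // mulVf // gt_eqF.
pose e' (i : 'I_k.+1) := if unlift ord_max i is Some j then e j else c *: w.
have := kmax k.+1; rewrite ltnn => h; apply: notF; apply: h; apply/asboolP; exists e' => [i|i j].
  by rewrite /e'; case: unliftP => [j _|_] //; exact: rpredZ.
rewrite /e'; case: (unliftP _ i) => [i' ->|->]; case: (unliftP _ j) => [j' ->|->].
- by rewrite oe (inj_eq lift_inj).
- by rewrite dotZr dotC we mulr0 eq_sym (negPf (neq_lift _ _)).
- by rewrite dotZl we mulr0 (negPf (neq_lift _ _)).
- by rewrite dotZl dotZr cc eqxx.
Qed.

Definition co k (e : 'I_k -> E) v : 'cV[R]_k := \col_i dot v (e i).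
Definition ev k (e : 'I_k -> E) (x : 'cV[R]_k) : E := \sum_i x i 0 *: e i.

Section Frame.
Variables (k : nat) (U : {vspace E}) (e : 'I_k -> E).
Hypothesis fe : frame U e.
Implicit Types x y : 'cV[R]_k.

Lemma ev_in x : ev e x \in U.
Proof. by apply: rpred_sum => i _; apply: rpredZ; case: fe. Qed.

Lemma ev_co v : v \in U -> ev e (co e v) = v.
Proof.
move=> vU; case: fe => _ _ /(_ v vU) E1; rewrite [RHS]E1; apply: eq_bigr => i _; by rewrite mxE.
Qed.

Lemma dot_ev x v : dot (ev e x) v = dp x (co e v).
Proof. by rewrite dot_suml; apply: eq_bigr => i _; rewrite dotZl mxE dotC. Qed.

Lemma co_ev x : co e (ev e x) = x.
Proof.
apply/colP => i; rewrite mxE dot_ev; case: fe => _ oe _.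
rewrite -[RHS]dp_delta; congr dp; apply/colP => j; rewrite !mxE oe eq_sym.
by rewrite (andbT (j == i)) eq_sym.
Qed.

Lemma evZ c x : ev e (c *: x) = c *: ev e x.
Proof. by rewrite scaler_sumr; apply: eq_bigr => i _; rewrite mxE scalerA. Qed.

Lemma dp_co u v : u \in U -> dp (co e u) (co e v) = dot u v.
Proof. by move=> uU; rewrite -dot_ev ev_co. Qed.

End Frame.
End InnerProduct.

Section PolynomialFunctions.
Variable R : realType.

Lemma polyf_meval m (p : mpoly.mpoly m R) : polyf (fun x : 'cV[R]_m => mpoly.meval (fun i => x i 0) p).
Proof.
apply: (@polyf_ext _ _ (fun x : 'cV[R]_m => \sum_(u <- mpoly.msupp p)
    mpoly.mcoeff u p * \prod_i x i 0 ^+ u i)).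
  by move=> x; rewrite mpoly.mevalE.
apply: polyf_sum => u; apply: polyf_mul (polyf_cst _ _) _; apply: polyf_prod => i.
exact: polyf_exp (polyf_coord _ i).
Qed.

Lemma alg_meval n m (B : ('cV[R]_n -> R) -> Prop) (f : 'I_m -> 'cV[R]_n -> R) (p : mpoly.mpoly m R) :
  (forall i, alg B (f i)) -> alg B (fun x => mpoly.meval (fun i => f i x) p).
Proof.
move=> Bf; apply: (@alg_ext _ _ _ (fun x => (fun z : 'cV[R]_m => mpoly.meval (fun i => z i 0) p)
    (\col_i f i x))).
  by move=> x; apply: mpoly.meval_eq => i; rewrite mxE.
suff h (F : 'cV[R]_m -> R) : polyf F -> alg B (fun x => F (\col_i f i x)).
  exact: (h _ (polyf_meval p)).
elim=> [c|i|g h _ ag _ ah|g h _ ag _ ah].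
- exact: alg_cst.
- by apply: alg_ext (Bf i) => x; rewrite mxE.
- exact: alg_add.
- exact: alg_mul.
Qed.

Lemma Ck_meval m k t (c : 'I_m -> R -> R) (p : mpoly.mpoly m R) :
  (forall i, Ck k t (c i)) -> Ck k t (fun s => mpoly.meval (fun i => c i s) p).
Proof.
move=> ck; apply: (@Ck_eq _ k t (fun s => (fun z : 'cV[R]_m => mpoly.meval (fun i => z i 0) p)
    (\col_i c i s))).
  by near=> s; apply: mpoly.meval_eq => i; rewrite mxE.
apply: (cl_polyf (germ_calculus t) (x := fun q => \col_i c i q.2) (polyf_meval p)) => i.
have := ck i; apply: (@cl_ext _ _ _ _ (germ_calculus t)).
by near=> q; rewrite mxE.
Unshelve. all: by end_near. Qed.

Variable E : innerVectType R.
Implicit Type f : E -> R.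

Lemma is_poly_add f g : is_poly_fun f -> is_poly_fun g -> is_poly_fun (fun v => f v + g v).
Proof.
by move=> [p hp] [q hq]; exists (p + q) => v; rewrite hp hq /poly_eval mpoly.mevalD.
Qed.

Lemma is_poly_mul f g : is_poly_fun f -> is_poly_fun g -> is_poly_fun (fun v => f v * g v).
Proof.
by move=> [p hp] [q hq]; exists (p * q) => v; rewrite hp hq /poly_eval mpoly.mevalM.
Qed.

Lemma is_poly_cst c : @is_poly_fun R E (fun=> c).
Proof. by exists (mpoly.mpolyC _ c) => v; rewrite /poly_eval mpoly.mevalC. Qed.

Lemma is_poly_dot w : is_poly_fun (fun v : E => dot v w).
Proof.
exists (\sum_(j < \dim {:E}) dot (vbasis {:E})`_j w *: mpoly.mpolyX R (mpoly.mnm1 j)) => v.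
rewrite /poly_eval [RHS]raddf_sum /= [in LHS](coord_vbasis (memvf v)) dot_suml.
apply: eq_bigr => j _; rewrite dotZl mulrC [RHS]mpoly.mevalZ; congr (_ * _).
by rewrite mpoly.mevalXU.
Qed.

Lemma polyf_is_poly k (e : 'I_k -> E) (f : 'cV[R]_k -> R) : polyf f -> is_poly_fun (fun v => f (co e v)).
Proof.
elim=> [c|i|{}f g _ pf _ pg|{}f g _ pf _ pg].
- exact: is_poly_cst.
- by have [p hp] := is_poly_dot (e i); exists p => v; rewrite mxE hp.
- exact: is_poly_add.
- exact: is_poly_mul.
Qed.

Lemma poly_eval_ev k (e : 'I_k -> E) p : polyf (fun x => poly_eval p (ev e x)).
Proof.
pose T : 'M[R]_(\dim {:E}, k) := \matrix_(i, l) coord (vbasis {:E}) i (e l).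
apply: (@polyf_ext _ _ (fun x => (fun z => mpoly.meval (fun i => z i 0) p) (T *m x))).
  move=> x; apply: mpoly.meval_eq => i; rewrite mxE linear_sum; apply: eq_bigr => l _.
  by rewrite linearZ /= mxE mulrC.
exact: (polyf_comp_lin T (polyf_meval p)).
Qed.

Lemma homog_ev k (e : 'I_k -> E) d f : is_homog_fun d f -> homog d (fun x => f (ev e x)).
Proof.
move=> [p hp fE] s x; rewrite !fE /poly_eval !mpoly.mevalE mulr_sumr; apply: eq_big_seq => u up.
rewrite mulrCA; congr (_ * _).
have <- : mpoly.mdeg u = d by exact: (mpoly.dhomogP _ _ _ hp).
rewrite mpoly.mdegE -prodrXr -big_split; apply: eq_bigr => i _ /=.
by rewrite evZ linearZ /= exprMn.
Qed.

End PolynomialFunctions.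

Lemma ultra_fmap (T S : Type) (f : T -> S) (U : set_system T) :
  UltraFilter U -> UltraFilter (f @ U).
Proof.
move=> UU; have UP : ProperFilter U := @ultra_proper _ _ UU.
split=> [|H HP sub]; first exact: fmap_proper_filter.
rewrite eqEsubset; split=> // B HB.
have [//|nB] := in_ultra_setVsetC (f @^-1` B) UU.
have nHB : H (~` B) by apply: sub.
by have [x []] := filter_ex (filterI HB nHB).
Qed.

Section Curves.
Variables (R : realType) (V : normedModType R).

Lemma isd_scale (f : R -> R) t l (v : V) : is_derive t (1 : R) f l ->
  is_derive t (1 : R) (fun s => f s *: v) (l *: v).
Proof.
move=> [df fl].
have c : h^-1 *: (f (h *: (1 : R) + t) - f t) @[h --> (0 : R)^'] --> l by rewrite -fl; exact: df.
have c' : h^-1 *: (f (h *: (1 : R) + t) *: v - f t *: v) @[h --> (0 : R)^'] --> l *: v.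
  apply: cvg_trans (cvgZ c (cvg_cst v)); apply: near_eq_cvg; near=> h.
  by rewrite -scalerBl scalerA.
by apply: DeriveDef; [apply/cvg_ex; exists (l *: v) | exact: cvg_lim].
Unshelve. all: by end_near. Qed.

Lemma isd_vsum (I : Type) (r : seq I) (f : I -> R -> V) (l : I -> V) t :
  (forall i, is_derive t (1 : R) (f i) (l i)) ->
  is_derive t (1 : R) (fun s => \sum_(i <- r) f i s) (\sum_(i <- r) l i).
Proof.
move=> df; elim: r => [|i r IH].
  rewrite big_nil (_ : (fun s => _) = cst 0); first exact: is_derive_cst.
  by apply/funext => s; rewrite big_nil.
rewrite big_cons (_ : (fun s => _) = f i + (fun s => \sum_(j <- r) f j s)); first exact: is_deriveD.
by apply/funext => s; rewrite big_cons.
Qed.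

Lemma cvg_vsum (I T : Type) (F : set_system T) (r : seq I) (f : I -> T -> V) (l : I -> V) :
  Filter F -> (forall i, f i t @[t --> F] --> l i) ->
  \sum_(i <- r) f i t @[t --> F] --> \sum_(i <- r) l i.
Proof.
move=> FF fl; elim: r => [|i r IH].
  rewrite big_nil (_ : (fun s => _) = fun=> 0); first exact: cvg_cst.
  by apply/funext => s; rewrite big_nil.
rewrite big_cons (_ : (fun s => _) = fun s => f i s + \sum_(j <- r) f j s); first exact: cvgD.
by apply/funext => s; rewrite big_cons.
Qed.

Lemma derive1_isd (f f' : R -> V) : (forall t, is_derive t (1 : R) f (f' t)) -> f^`() = f'.
Proof. by move=> df; apply/funext => t; rewrite derive1E; case: (df t). Qed.

End Curves.

(** * From the representation to a compact matrix group *)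

Section Representation.
Variables (R : realType) (G : topologicalGroupType) (V : euclideanType R) (rho : orthRep G V).
Hypothesis G_compact : compact [set: G].
Hypothesis rho_continuous : continuous (fun p : G * V => rho p.1 p.2).
Variables (N : nat) (e : 'I_N -> V).
Hypothesis fe : frame fullv e.
Implicit Types (u v w : V) (x y z : 'cV[R]_N).

Lemma frameK v : ev e (co e v) = v.
Proof. exact: (ev_co fe (memvf v)). Qed.

Lemma dp_coV u v : dp (co e u) (co e v) = dot u v.
Proof. exact: (dp_co fe _ (memvf u)). Qed.

Lemma dot_norm u w : `|dot u w| <= `|u| * `|w|.
Proof.
have q0 v : 0 <= dot v v by rewrite -dp_coV; exact: nq_ge0.
rewrite -(@ler_pXn2r _ 2) ?nnegrE ?mulr_ge0 // exprMn !norm_dot !sqr_sqrtr // real_normK ?num_real //.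
by rewrite -!dp_coV; exact: cauchy_schwarz.
Qed.

Lemma cvg_dot (T : Type) (F : set_system T) (u : T -> V) v w : Filter F ->
  u t @[t --> F] --> v -> dot (u t) w @[t --> F] --> dot v w.
Proof.
move=> FF uv; apply/cvgrPdist_le => r r0.
have w1 : 0 < `|w| + 1 by rewrite ltr_wpDl.
have d0 : 0 < r / (`|w| + 1) by rewrite divr_gt0.
have /cvgrPdist_le/(_ _ d0) := uv; apply: filterS => t ht.
have -> : dot v w - dot (u t) w = dot (v - u t) w by rewrite dotDl -[in RHS]scaleN1r dotZl mulN1r.
apply: le_trans (dot_norm _ _) _; apply: (@le_trans _ _ (r / (`|w| + 1) * `|w|)).
  by rewrite ler_wpM2r.
by rewrite mulrAC ler_pdivrMr // ler_wpM2l ?(ltW r0) // lerDl.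
Qed.

Lemma cvg_ev k (s : 'I_k -> V) (T : Type) (F : set_system T) (y : T -> 'cV[R]_k) a : Filter F ->
  cvc F y a -> ev s (y t) @[t --> F] --> ev s a.
Proof.
by move=> FF ya; apply: cvg_vsum => i; apply: cvgZ; [exact: ya | exact: cvg_cst].
Qed.

Lemma isdc_ev k (s : 'I_k -> V) (y : R -> 'cV[R]_k) t l : isdc y t l ->
  is_derive t (1 : R) (fun q : R => ev s (y q) : V) (ev s l).
Proof. by move=> dy; apply: isd_vsum => i; apply: isd_scale; exact: dy. Qed.

Definition mat g : 'M[R]_N := \matrix_(i, j) dot (rho g (e j)) (e i).

Lemma matE g v : mat g *m co e v = co e (rho g v).
Proof.
apply/colP => i; rewrite -[in RHS](frameK v) !mxE linear_sum dot_suml; apply: eq_bigr => j _.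
by rewrite linearZ dotZl !mxE mulrC.
Qed.

Lemma matE' g x : mat g *m x = co e (rho g (ev e x)).
Proof. by rewrite -matE (co_ev fe). Qed.

Lemma mat_ext (A B : 'M[R]_N) : (forall v, A *m co e v = B *m co e v) -> A = B.
Proof.
move=> h; apply/matrixP => i j.
have := h (ev e (delta_mx j 0)); rewrite (co_ev fe) -!colE => /colP/(_ i).
by rewrite !mxE.
Qed.

Lemma mat1 : mat 1%g = 1%:M.
Proof. by apply: mat_ext => v; rewrite matE rep1 mul1mx. Qed.

Lemma matM g h : mat (g * h)%g = mat g *m mat h.
Proof. by apply: mat_ext => v; rewrite -mulmxA !matE repM. Qed.

Lemma matV g : mat g^-1%g = (mat g)^T.
Proof. by apply/matrixP => i j; rewrite !mxE -(rep_dot rho g) repVK dotC. Qed.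

Definition matgrp M := exists g, M = mat g.

(** Limits along an ultrafilter are taken in the compact space [G] and carried over by the
    continuous action. *)
Lemma cgrp_matgrp : cgrp matgrp.
Proof.
split.
- by move=> _ [g ->]; rewrite -matV -matM mulVg mat1.
- by exists 1%g; rewrite mat1.
- by move=> _ _ [g ->] [h ->]; exists (g * h)%g; rewrite matM.
- by move=> _ [g ->]; exists g^-1%g; rewrite matV.
move=> T U u UU Ku; have UP : ProperFilter U := @ultra_proper _ _ UU.
have /choice[g hg] (t : T) : exists g, matgrp (u t) -> u t = mat g.
  by have [[g ->]|nK] := pselect (matgrp (u t)); [exists g | exists 1%g].
have := G_compact; rewrite compact_ultra => /(_ _ (ultra_fmap g UU) filterT)[g0 [_ gg]].
exists (mat g0); first by exists g0.
apply: (@mcvg_eq _ _ _ _ UP (fun t => mat (g t))); first by apply: filterS Ku => t /hg ->.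
move=> i j; rewrite mxE (_ : (fun t => _) = fun t => dot (rho (g t) (e j)) (e i)); last first.
  by apply/funext => t; rewrite mxE.
apply: cvg_dot.
have c1 : (g t, e j) @[t --> U] --> (g0, e j) by apply: cvg_pair => //; exact: cvg_cst.
exact: (cvg_comp _ _ c1 (@rho_continuous (g0, e j))).
Qed.

Variables (r : nat) (s : 'I_r -> V) (Sigma : {vspace V}).
Hypothesis fs : frame Sigma s.
Hypothesis Sigma_section : is_section rho Sigma.

Definition proj_mx : 'M[R]_N := \matrix_(i, j) \sum_l dot (s l) (e i) * dot (s l) (e j).

Lemma proj_mxE v : proj_mx *m co e v = co e (ev s (co s v)).
Proof.
apply/colP => i; rewrite !mxE dot_suml.
transitivity (\sum_l \sum_j dot (s l) (e i) * dot (s l) (e j) * dot v (e j)).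
  by rewrite exchange_big; apply: eq_bigr => j _; rewrite !mxE mulr_suml.
apply: eq_bigr => l _; rewrite dotZl mxE mulrC -[dot v (s l)]dp_coV mulr_sumr.
by apply: eq_bigr => j _; rewrite !mxE; ring.
Qed.

Lemma proj_mxT : proj_mx^T = proj_mx.
Proof. by apply/matrixP => i j; rewrite !mxE; apply: eq_bigr => l _; rewrite mulrC. Qed.

Lemma proj_mxP x : proj_mx *m x = x <-> ev e x \in Sigma.
Proof.
rewrite -{1 2}(co_ev fe x) proj_mxE; split=> [/(congr1 (ev e))|xS].
  by rewrite !frameK => <-; exact: (ev_in fs).
by rewrite (ev_co fs).
Qed.

Lemma proj_mxK : proj_mx *m proj_mx = proj_mx.
Proof. by apply: mat_ext => v; rewrite -mulmxA proj_mxE; apply/proj_mxP; rewrite frameK (ev_in fs). Qed.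

Lemma matgrp_cover x : exists2 M, matgrp M & proj_mx *m (M *m x) = M *m x.
Proof.
have [h _] := Sigma_section; have [_ [g _ <-] gS] := h (ev e x).
by exists (mat g); [exists g | apply/proj_mxP; rewrite matE' frameK].
Qed.

(** A one-parameter group moves [x] along a smooth curve inside the orbit, so [A x] is a tangent
    vector to which the section condition applies. *)
Lemma matgrp_polar A x y : lie matgrp A -> proj_mx *m x = x -> proj_mx *m y = y ->
  dp (A *m x) y = 0.
Proof.
move=> lA /proj_mxP Sx /proj_mxP Sy; have KG := cgrp_matgrp.
have [phi op] := lie_oneparam KG lA.
rewrite -(co_ev fe (A *m x)) -(co_ev fe y) dp_coV dotC.
have [_ ] := Sigma_section; apply; [exact: Sx | exact: Sy |].
pose ga z (t : R) : V := ev e (phi t *m z).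
have dga z t : is_derive t (1 : R) (ga z) (ga (A *m z) t) by exact: (isdc_ev e (oneparam_isdc KG t z op)).
have dn z i : (ga z)^`(i) = ga (iter i (mulmx A) z).
  elim: i => [//|i IH]; rewrite derive1nS IH; exact: derive1_isd.
exists (ga x); split.
- move=> m; split=> [i _ t|t].
    by rewrite dn; have [] := dga (iter i (mulmx A) x) t.
  rewrite dn; apply: cvg_ev => i; exact: (isdc_cont (oneparam_isdc KG t _ op)).
- by move=> t; rewrite /ga; case: op => /(_ t)[g ->] _ _; exists g => //; rewrite matE' frameK.
- by rewrite /ga (oneparam0 KG op) mul1mx.
- by rewrite (derive1_isd (dga x)) /ga (oneparam0 KG op) mul1mx.
Qed.

Theorem restriction_surjective (u : 'cV[R]_N -> R) : polyf u ->
  (forall v, u (co e (ev s (co s v))) = u (co e v)) ->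
  (forall g, g \in normalizer rho Sigma -> forall v, v \in Sigma -> u (co e (rho g v)) = u (co e v)) ->
  exists p, [/\ polyf p, forall g v, p (co e (rho g v)) = p (co e v) &
    forall v, v \in Sigma -> p (co e v) = u (co e v)].
Proof.
move=> pu uP uW; have KG := cgrp_matgrp.
have [x0 [Q [a [A rt]]]] := roots_exist KG proj_mxT proj_mxK matgrp_cover matgrp_polar.
have [|p [pp Kp pE]] := @chevalley_restriction R N matgrp proj_mx KG proj_mxT proj_mxK
    matgrp_cover matgrp_polar x0 Q a A rt u.
  split=> // [x|_ x [[g ->] gP]].
    by rewrite -(co_ev fe x) proj_mxE uP.
  have gN v : v \in Sigma -> rho g v \in Sigma.
    move=> vS; rewrite -(frameK (rho g v)) -matE; apply/proj_mxP; rewrite mulmxA -gP -mulmxA.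
    by congr (_ *m _); apply/proj_mxP; rewrite frameK.
  have nS : g \in normalizer rho Sigma.
    apply/eqP/eqP; rewrite eqEdim limg_dim_eq ?leqnn ?andbT; last first.
      apply/eqP; rewrite -subv0; apply/subvP => v; rewrite memv_cap memv_ker => /andP[_ /eqP gv].
      by rewrite memv0 -(repK rho g v) gv linear0.
    by apply/subvP => _ /memv_imgP[v vS ->]; exact: gN.
  have pr : proj_mx *m (mat g *m x) = co e (rho g (ev s (co s (ev e x)))).
    by rewrite mulmxA -gP -mulmxA -{1}(co_ev fe x) proj_mxE matE.
  have E1 z : u z = u (proj_mx *m z) by rewrite -{2}(co_ev fe z) proj_mxE uP (co_ev fe).
  rewrite E1 pr uW ?(ev_in fs) // [RHS]E1 -{2}(co_ev fe x) proj_mxE //.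
exists p; split=> // [g v|v vS]; first by rewrite -matE Kp //; exists g.
by apply: pE; apply/proj_mxP; rewrite frameK.
Qed.

End Representation.

Section Components.
Variables (R : realType) (n : nat).
Implicit Type c : R -> 'rV[R]_n.

Lemma isd_component c t i : derivable c t (1 : R) ->
  is_derive t (1 : R) (fun s => c s 0 i) (c^`() t 0 i).
Proof.
move=> dc; rewrite derive1E.
have cv : h^-1 *: (c (h *: (1 : R) + t) - c t) @[h --> (0 : R)^'] --> 'D_1 c t by exact: dc.
have cc : (h^-1 *: (c (h *: (1 : R) + t) - c t)) 0 i @[h --> (0 : R)^'] --> 'D_1 c t 0 i.
  exact: (cvg_comp _ _ cv (@coord_continuous R 1 n 0 i ('D_1 c t))).
apply: quot_isd; apply: cvg_trans cc; apply: near_eq_cvg; near=> h.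
by rewrite !mxE [h *: (1 : R)]mulr1 [h + t]addrC.
Unshelve. all: by end_near. Qed.

Lemma curve_Ck_component m c : curve_Ck m c -> forall i t, Ck m t (fun s => c s 0 i).
Proof.
elim: m c => [|m IH] c [dc cc] i t.
  apply/Ck0; near=> s; exact: (cvg_comp _ _ (cc s) (@coord_continuous R 1 n 0 i (c s))).
apply/CkS; exists (fun s => c^`() s 0 i); split.
  by near=> s; apply: isd_component; exact: (dc 0%N).
apply: IH; split; last by rewrite -derive1Sn.
by move=> j jm s; rewrite -derive1Sn; exact: (dc j.+1).
Unshelve. all: by end_near. Qed.

End Components.

(** * The generalized Weyl group as a list of matrices *)

Section WeylMatrices.
Variables (R : realType) (G : groupType) (V : innerVectType R) (rho : orthRep G V).
Variables (r : nat) (s : 'I_r -> V) (Sigma : {vspace V}).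
Hypothesis fs : frame Sigma s.
Implicit Types (g : G) (v : V) (x : 'cV[R]_r).

Notation nor := (normalizer rho Sigma).

Definition wmx g : 'M[R]_r := \matrix_(i, j) dot (rho g (s j)) (s i).

Lemma wmxE g v : v \in Sigma -> wmx g *m co s v = co s (rho g v).
Proof.
move=> vS; apply/colP => i; rewrite -[in RHS](ev_co fs vS) !mxE linear_sum dot_suml.
by apply: eq_bigr => j _; rewrite linearZ dotZl !mxE mulrC.
Qed.

Lemma ev_wmx g x : g \in nor -> ev s (wmx g *m x) = rho g (ev s x).
Proof.
move=> gn; rewrite -{1}(co_ev fs x) wmxE ?(ev_in fs) // (ev_co fs) //.
exact: (normalizer_mem gn) (ev_in fs x).
Qed.

Lemma wmx_ext (A B : 'M[R]_r) : (forall v, v \in Sigma -> A *m co s v = B *m co s v) -> A = B.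
Proof.
move=> h; apply/matrixP => i j.
have := h _ (ev_in fs (delta_mx j 0)); rewrite (co_ev fs) -!colE => /colP/(_ i).
by rewrite !mxE.
Qed.

Hypothesis fin : finite_set [set: weyl_group rho Sigma].

(** Elements of the normalizer in the same class act alike on [Sigma], so finitely many classes give
    finitely many matrices. *)
Lemma weyl_matrices : exists H : seq 'M[R]_r, uniq H /\
  forall A, A \in H <-> exists2 g, g \in nor & A = wmx g.
Proof.
have /finite_seqP[ws wsE] := fin.
exists (undup [seq wmx (val (weyl_repr w)) | w <- ws]); split; first exact: undup_uniq.
move=> A; rewrite mem_undup; split=> [/mapP[w _ ->]|[g gn ->]].
  by exists (val (weyl_repr w)) => //; exact: (valP (weyl_repr w)).
apply/mapP; exists (weyl_class (exist _ g gn : normalizer_type rho Sigma)).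
  have : [set: weyl_group rho Sigma] (weyl_class (exist _ g gn : normalizer_type rho Sigma)) by [].
  by rewrite wsE.
apply: wmx_ext => v vS; rewrite !wmxE //; congr (co s _).
by rewrite weyl_repr_class.
Qed.

Variable H : seq 'M[R]_r.
Hypothesis Hu : uniq H.
Hypothesis HP : forall A, A \in H <-> exists2 g, g \in nor & A = wmx g.

Lemma wmxV g : wmx g^-1%g = (wmx g)^T.
Proof. by apply/matrixP => i j; rewrite !mxE -[LHS](rep_dot rho g) repVK dotC. Qed.

Lemma weyl_isgrp : isgrp H.
Proof.
have [n1 nD] := normalizer_group_closed rho Sigma.
have nV g : g \in nor -> g^-1%g \in nor by move=> gn; rewrite -[g^-1%g]mul1g; exact: nD.
have nM g h : g \in nor -> h \in nor -> (g * h)%g \in nor.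
  by move=> gn /nV hn; rewrite -[h]invgK; exact: nD.
split.
- exact: Hu.
- apply/HP; exists 1%g => //.
  by apply: wmx_ext => v vS; rewrite wmxE // rep1 mul1mx.
- move=> _ _ /HP[g gn ->] /HP[h hn ->]; apply/HP; exists (g * h)%g; first exact: nM.
  apply: wmx_ext => v vS; rewrite -mulmxA !wmxE ?repM //; exact: normalizer_mem vS.
- move=> _ /HP[g gn ->]; apply/HP; exists g^-1%g; first exact: nV.
  by rewrite wmxV.
- move=> _ /HP[g gn ->]; rewrite /orth; apply: wmx_ext => v vS.
  rewrite -wmxV -mulmxA !wmxE ?mul1mx ?repK //; exact: normalizer_mem vS.
Qed.

Lemma weyl_gen d : is_d_number (weyl_rep rho Sigma) d -> gen d H.
Proof.
move=> [m [sg [deg [mg ->]]]] f pf fH.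
pose s' i := vsproj Sigma (s i).
have s'E i : vsval (s' i) = s i by rewrite vsprojK //; case: fs.
have coE (x : subvs_of Sigma) : co s' x = co s (vsval x).
  by apply/colP => i; rewrite !mxE -s'E.
have evE x : vsval (ev s' x) = ev s x.
  by rewrite linear_sum; apply: eq_bigr => i _; rewrite linearZ /= s'E.
have [P hP] : exists P : mpoly.mpoly m R, forall x : subvs_of Sigma, f (co s' x) = mpoly.meval (fun i => sg i x) P.
  apply: (mingen_generates mg); first exact: polyf_is_poly.
  move=> w x; rewrite !coE /= weyl_actE -wmxE ?subvsP // fH //.
  by apply/HP; exists (val (weyl_repr w)) => //; exact: (valP (weyl_repr w)).
apply: (@alg_ext _ _ _ (fun z => mpoly.meval (fun i => sg i (ev s' z)) P)).
  by move=> z; rewrite -hP coE evE (co_ev fs).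
apply: alg_meval => i; apply: alg_base; split.
- have [p _ pE] := mingen_homog mg i.
  by apply: polyf_ext (poly_eval_ev s' p) => z; rewrite pE.
- move=> _ z /HP[g gn ->].
  rewrite -(mingen_invariant mg i (weyl_class (exist _ g gn : normalizer_type rho Sigma)) (ev s' z)).
  congr (sg i _); apply: val_inj; rewrite /= weyl_act_class !evE.
  by rewrite ev_wmx.
- exists (deg i); split; first exact: (mingen_deg_gt0 mg).
    exact: (leq_bigmax (F := deg) i).
  exact: homog_ev (mingen_homog mg i).
Qed.

End WeylMatrices.

(** * Curves in the orbit space *)

Section OrbitCurves.
Variables (R : realType) (G : topologicalGroupType) (V : euclideanType R) (rho : orthRep G V).
Hypothesis G_compact : compact [set: G].
Hypothesis rho_continuous : continuous (fun p : G * V => rho p.1 p.2).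
Variables (n : nat) (sigma : 'I_n -> V -> R) (deg : 'I_n -> nat).
Hypothesis sigma_generators : minimal_generators rho sigma deg.
Variable Sigma : {vspace V}.
Hypothesis Sigma_section : is_section rho Sigma.
Variables (r : nat) (s : 'I_r -> V).
Hypothesis fs : frame Sigma s.
Variable H : seq 'M[R]_r.
Hypothesis HP : forall A, A \in H <-> exists2 g, g \in normalizer rho Sigma & A = wmx rho s g.
Variable c : R -> 'rV[R]_n.

Lemma section_curve : (forall t, range (orbit_map sigma) (c t)) ->
  exists v : R -> V, forall t, v t \in Sigma /\ orbit_map sigma (v t) = c t.
Proof.
move=> ct.
have /choice[v hv] (t : R) : exists v : V, v \in Sigma /\ orbit_map sigma v = c t; last by exists v.
have [w _ wE] := ct t; have [h _] := Sigma_section; have [y [g _ gE] yS] := h w.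
exists y; split=> //; rewrite -wE -gE; apply/rowP => i; rewrite !mxE.
exact: (mingen_invariant sigma_generators).
Qed.

Variable v : R -> V.
Hypothesis vP : forall t, v t \in Sigma /\ orbit_map sigma (v t) = c t.

(** An invariant of the finite group extends to a [G]-invariant polynomial, hence is a polynomial in
    the generators [sigma], whose values along [v] are the components of [c]. *)
Lemma section_gcurve m : curve_Ck m c -> forall t, gcurve m H (fun t => co s (v t)) t.
Proof.
move=> cm t f pf fH; have [N [e fe]] := @frame_exists R V fullv.
pose T : 'M[R]_(r, N) := \matrix_(i, j) dot (e j) (s i).
have TE z : T *m z = co s (ev e z).
  by apply/colP => i; rewrite !mxE dot_suml; apply: eq_bigr => j _; rewrite dotZl mxE mulrC.
pose u z := f (T *m z).
have uE w : u (co e w) = f (co s w) by rewrite /u TE (frameK fe).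
have [|w|g gn w wS|p [pp pK pE]] := @restriction_surjective R G V rho G_compact rho_continuous
    N e fe r s Sigma fs Sigma_section u.
- exact: polyf_comp_lin.
- by rewrite !uE (co_ev fs).
- by rewrite !uE -(wmxE rho fs) // fH //; apply/HP; exists g.
have [Q hQ] : exists Q : mpoly.mpoly n R, forall w, p (co e w) = mpoly.meval (fun i => sigma i w) Q.
  by apply: (mingen_generates sigma_generators); [exact: polyf_is_poly | move=> g w; exact: pK].
apply: (@Ck_eq _ m t (fun q => mpoly.meval (fun i => c q 0 i) Q)).
  near=> q; have [vS vE] := vP q; rewrite -uE -pE // hQ; apply: mpoly.meval_eq => i.
  by rewrite -vE mxE.
by apply: Ck_meval => i; exact: curve_Ck_component.
Unshelve. all: by end_near. Qed.

Variable y : R -> 'cV[R]_r.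
Hypothesis yP : forall t, exists2 g, g \in H & y t = g *m co s (v t).

Lemma section_lift : is_lift sigma c (fun t => ev s (y t)).
Proof.
move=> t; have [_ /HP[g gn ->] ->] := yP t; have [vS <-] := vP t.
rewrite (ev_wmx fs) // (ev_co fs) //; apply/rowP => i; rewrite !mxE.
exact: (mingen_invariant sigma_generators).
Qed.

Variable y' : R -> 'cV[R]_r.
Hypothesis dy : forall t, isdc y t (y' t).

Lemma section_derive1 : (fun t => ev s (y t) : V)^`() = fun t => ev s (y' t).
Proof. by apply: derive1_isd => t; exact: isdc_ev. Qed.

Lemma section_derivable t : derivable (fun t => ev s (y t) : V) t (1 : R).
Proof. by case: (isdc_ev s (dy t)). Qed.

Lemma section_orthogonal : is_orthogonal_curve rho (fun t => ev s (y t)).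
Proof.
move=> t w tw; rewrite section_derive1; have [_] := Sigma_section; apply; last exact: tw.
  exact: (ev_in fs).
exact: (ev_in fs).
Qed.

End OrbitCurves.

Theorem corollary3 (R : realType)
    (G : topologicalGroupType)
    (G_lie : is_lie_group R G) (G_compact : compact [set: G])
    (V : euclideanType R)
    (rho : orthRep G V)
    (rho_continuous : continuous (fun p : G * V => rho p.1 p.2))
    (n : nat) (sigma : 'I_n -> V -> R) (deg : 'I_n -> nat)
    (sigma_generators : minimal_generators rho sigma deg)
    (Sigma : {vspace V}) (Sigma_section : is_section rho Sigma)
    (d k : nat)
    (d_number : is_d_number (weyl_rep rho Sigma) d)
    (k_number : is_k_number (weyl_rep rho Sigma) k)
    (c : R -> 'rV[R]_n)
    (c_orbit_space : forall t, range (orbit_map sigma) (c t)) :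
  (curve_Ck k c ->
    exists cbar : R -> V,
      [/\ is_lift sigma c cbar, curve_Ck 1 cbar &
          is_orthogonal_curve rho cbar]) /\
  (curve_Ck (k + d) c ->
    exists cbar : R -> V,
      [/\ is_lift sigma c cbar, twice_differentiable cbar &
          is_orthogonal_curve rho cbar]).
Proof.
have [fin [d' [l [U [w [d'_number _ _ _ kE]]]]]] := k_number.
have d'k : (d' <= k)%N by rewrite kE leq_maxl.
have [r [s fs]] := frame_exists Sigma.
have [H [Hu HP]] := weyl_matrices fs fin; have HG := weyl_isgrp fs Hu HP.
have [v vP] := section_curve sigma_generators Sigma_section c_orbit_space.
have gc m : curve_Ck m c -> forall t, gcurve m H (fun t => co s (v t)) t.
  exact: (section_gcurve G_compact rho_continuous sigma_generators Sigma_section fs HP vP).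
have gc_le m1 m2 t : (m1 <= m2)%N -> gcurve m2 H (fun t => co s (v t)) t ->
    gcurve m1 H (fun t => co s (v t)) t.
  by move=> m12 g f pf fH; exact: (cl_le m12 (g f pf fH)).
split=> ck.
  have [|y [y' [yP dy cy]]] := finite_lift_C1 HG (weyl_gen fs HP d'_number) (x := fun t => co s (v t)).
    by move=> t; apply: gc_le d'k _; exact: gc.
  exists (fun t => ev s (y t)); split.
  - exact: (section_lift sigma_generators fs HP vP yP).
  - split=> [[|//] _ t|]; first exact: section_derivable.
    have -> : (fun t => ev s (y t) : V)^`(1) = fun t => ev s (y' t) by exact: section_derive1.
    by move=> t; apply: cvg_ev; exact: cy.
  - exact: (section_orthogonal Sigma_section fs dy).
(* [d'] is the degree bound contained in [k_number], and [d] and [d'] are not identified with each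
   other: twice the smaller one is at most [d' + d <= k + d]. *)
have [d2 gend dk] : exists2 d2, gen d2 H & (2 * d2 <= k + d)%N.
  have [dd'|dd'] := leqP d d'.
    by exists d; [exact: (weyl_gen fs HP d_number) | lia].
  by exists d'; [exact: (weyl_gen fs HP d'_number) | lia].
have [|y [y' [y'' [yP dy dy']]]] := finite_lift_D2 HG gend (x := fun t => co s (v t)).
  by move=> t; apply: gc_le dk _; exact: gc.
exists (fun t => ev s (y t)); split.
- exact: (section_lift sigma_generators fs HP vP yP).
- split=> t; first exact: section_derivable.
  by rewrite (section_derive1 s dy); exact: section_derivable.
- exact: (section_orthogonal Sigma_section fs dy).
Qed.
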